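(* Let $\bar\Sigma^2$ be a compact Riemann surface, let $p_1,\dots,p_n\in\bar\Sigma^2$ be distinct points, let $f\colon\bar\Sigma^2\setminus\{p_1,\dots,p_n\}\to\mathbb{I}^3$ be a weakly complete and finite-type ZMC-face, and let $(g,\omega)$ be the Weierstrass data of $f$. Let $k$ be the number of expanding ends of $f$, and suppose that $p_1,\dots,p_k$ are expanding ends and $p_{k+1},\dots,p_n$ are shrinking ends. Then $$-\sum_{j=1}^k\mathrm{ord}_{p_j}(\omega)+\sum_{j=k+1}^n\mathrm{ord}_{p_j}(\omega)\ge 2k.\qquad( * )$$ Equality in $( * )$ holds if and only if each end $p_j$ is embedded. In particular, any zero mean curvature surface represented as the entire graph of a harmonic polynomial attains equality in $( * )$.
   Context: Isotropic 3-space $\mathbb{I}^3$ is $\mathbb{R}^3$ with coordinates $(t,x,y)$ and the degenerate inner product $\langle(t_1,x_1,y_1),(t_2,x_2,y_2)\rangle=x_1x_2+y_1y_2$. Riemann surfaces are connected. ZMC-faces. Let $\Sigma^2$ be a Riemann surface with universal cover $\pi\colon\tilde\Sigma^2\to\Sigma^2$. A map $f=(f^0,f^1,f^2)\colon\Sigma^2\to\mathbb{I}^3$ is a ZMC-face if there is a holomorphic immersion $F=(F^0,F^1,F^2)\colon\tilde\Sigma^2\to\mathbb{C}^3$ with $(dF^1)^2+(dF^2)^2=0$, $F^1$ non-constant, and $f\circ\pi=\mathrm{Re}(F)$. Standing convention: the lift satisfies $dF^1-i\,dF^2=0$. The Weierstrass data of $f$ is $(g,\omega)$ with $\omega=\partial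 f^1+i\,\partial f^2=2\,\partial f^1$ (a holomorphic 1-form, not identically zero) and $g=2\,\partial f^0/\omega$ (a meromorphic function), so that $dF=(g,1,-i)\omega$. The lift-metric is $ds^2_\#=(2+|g|^2)|\omega|^2$, a Riemannian metric on $\Sigma^2$. $f$ is weakly complete if $ds^2_\#$ is complete, and finite-type if $ds^2_\#$ has finite absolute total Gaussian curvature. When $f$ is weakly complete and finite-type on $\bar\Sigma^2\setminus\{p_1,\dots,p_n\}$ with $\bar\Sigma^2$ compact, $g$ and $\omega$ extend meromorphically to $\bar\Sigma^2$; the $p_j$ are the ends. The first fundamental form is $ds^2=f^*\langle\cdot,\cdot\rangle=|\omega|^2$. An end $p$ is expanding if $ds^2$ is complete at $p$ (every path in the surface converging to $p$ has infinite length), and shrinking otherwise. An end $p$ is embedded if $f$ restricted to $U\setminus\{p\}$ is an embedding for some neighborhood $U$ of $p$. The entire graph of a harmonic polynomial $\phi(x,y)$ is the ZMC-face $f\colon\mathbb{C}\to\mathbb{I}^3$, $f(x+iy)=(\phi(x,y),x,y)$, with $\bar\Sigma^2=\mathbb{C}\cup\{\infty\}$ and single end $\infty$. *)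

(* Defs.v *)
From HB Require Import structures.
From mathcomp Require Import all_boot all_order all_algebra.
From mathcomp Require Import complex polyXY.
From mathcomp Require Import all_classical all_reals all_analysis.
From mathcomp Require Import ring lra.

Set Implicit Arguments.
Unset Strict Implicit.
Unset Printing Implicit Defensive.

Import Order.TTheory GRing.Theory Num.Theory numFieldNormedType.Exports.

Local Open Scope classical_set_scope.
Local Open Scope complex_scope.
Local Open Scope ring_scope.

(* [R[i]] with the topology of its modulus; [derivable f z 1] and ['D_1 f z]
   for [f : R[i] -> R[i]] are then complex differentiability and the complex
   derivative. *)
HB.instance Definition _ (R : realType) := NormedModule.copy R[i] R[i]^o.

(** * Riemann surfaces *)

(* The atlas is indexed by the points of the surface: [chart x] is a coordinate
   defined on the open neighbourhood [chart_dom x] of [x], with inverse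
   [chart_inv x]; both functions are unspecified outside of [chart_dom x],
   resp. of [chart x @` chart_dom x]. *)
Record riemann_surface (R : realType) := RiemannSurface {
  rs_sort :> topologicalType ;
  chart : rs_sort -> rs_sort -> R[i] ;
  chart_dom : rs_sort -> set rs_sort ;
  chart_inv : rs_sort -> R[i] -> rs_sort ;
  chart_dom_open : forall x, open (chart_dom x) ;
  chart_dom_center : forall x, chart_dom x x ;
  chart_img_open : forall x, open (chart x @` chart_dom x) ;
  chartK : forall x q, chart_dom x q -> chart_inv x (chart x q) = q ;
  chart_continuous : forall x q, chart_dom x q ->
    {for q, continuous (chart x)} ;
  chart_inv_continuous : forall x q, chart_dom x q ->
    {for chart x q, continuous (chart_inv x)} ;
  chart_holomorphic : forall x y q, chart_dom x q -> chart_dom y q ->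
    derivable (chart y \o chart_inv x) (chart x q) 1 ;
  rs_hausdorff : hausdorff_space rs_sort ;
  rs_connected : connected [set: rs_sort]
}.

Section HolomorphicMaps.
Context {R : realType}.
Implicit Types X S : riemann_surface R.

Definition holomorphic_fun X (F : X -> R[i]) : Prop :=
  forall x : X, derivable (F \o chart_inv x) (chart x x) 1.

(* The coefficient of [dF] at [x] in the coordinate [chart x]. *)
Definition dcoef X (F : X -> R[i]) (x : X) : R[i] :=
  'D_1 (F \o chart_inv x) (chart x x).

Definition holomorphic_map X S (pi : X -> S) : Prop :=
  continuous pi /\
  forall x : X, derivable (chart (pi x) \o pi \o chart_inv x) (chart x x) 1.

Definition path_connected (T : topologicalType) : Prop :=
  forall x y : T, exists c : R -> T,
    [/\ {within `[0, 1], continuous c}, c 0 = x & c 1 = y].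

Definition null_homotopic (T : topologicalType) (c : R -> T) : Prop :=
  exists H : R * R -> T,
    {within `[0, 1] `*` `[0, 1], continuous H} /\
    forall t, 0 <= t <= 1 ->
      [/\ H (0, t) = c t, H (1, t) = c 0, H (t, 0) = c 0 & H (t, 1) = c 0].

Definition simply_connected (T : topologicalType) : Prop :=
  path_connected T /\
  forall c : R -> T, {within `[0, 1], continuous c} -> c 0 = c 1 ->
    null_homotopic c.

(* [pi] is a covering map from [X] onto the subset [D] of [S]; [U] enumerates
   the sheets above [V] and [s] the inverse homeomorphisms. *)
Definition covering (X S : topologicalType) (D : set S) (pi : X -> S) : Prop :=
  [/\ continuous pi, pi @` setT = D &
    forall y, D y -> exists V : set S, [/\ open V, V y, V `<=` D &
      exists (I : Type) (U : I -> set X) (s : I -> S -> X),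
      [/\ forall i, open (U i), trivIset setT U, pi @^-1` V = \bigcup_i U i &
        forall i,
          [/\ forall x, U i x -> s i (pi x) = x,
              forall v, V v -> U i (s i v) /\ pi (s i v) = v &
              forall v, V v -> {for v, continuous (s i)}]]]].

Definition universal_cover X S (D : set S) (pi : X -> S) : Prop :=
  [/\ covering D pi, holomorphic_map pi & simply_connected X].

End HolomorphicMaps.

(** * Isotropic space and ZMC-faces *)

(* Surfaces are open subsets [D] of a Riemann surface [S]; a map on [D] is a
   function on [S] whose values outside of [D] are irrelevant. *)

Definition isotropic_space (R : realType) : Type := (R * R * R)%type.

Section ZMC.
Context {R : realType}.
Local Notation I3 := (isotropic_space R).

Definition crd0 {T : Type} (v : T * T * T) : T := v.1.1.
Definition crd1 {T : Type} (v : T * T * T) : T := v.1.2.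
Definition crd2 {T : Type} (v : T * T * T) : T := v.2.

Definition isotropic_dot (v w : I3) : R :=
  crd1 v * crd1 w + crd2 v * crd2 w.

Definition re3 (v : R[i] * R[i] * R[i]) : I3 :=
  (complex.Re (crd0 v), complex.Re (crd1 v), complex.Re (crd2 v)).

Record zmc_lift (S X : riemann_surface R) (D : set S) (f : S -> I3)
    (pi : X -> S) (F : X -> R[i] * R[i] * R[i]) : Prop := {
  lift_cover : universal_cover D pi ;
  lift_holomorphic : [/\ holomorphic_fun (crd0 \o F),
    holomorphic_fun (crd1 \o F) & holomorphic_fun (crd2 \o F)] ;
  lift_immersion : forall x,
    (dcoef (crd0 \o F) x, dcoef (crd1 \o F) x, dcoef (crd2 \o F) x)
      <> (0, 0, 0) ;
  lift_isotropic : forall x,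
    dcoef (crd1 \o F) x ^+ 2 + dcoef (crd2 \o F) x ^+ 2 = 0 ;
  lift_nonconstant : exists x y, crd1 (F x) <> crd1 (F y) ;
  lift_re : forall x, f (pi x) = re3 (F x)
}.

(* The last conjunct is the normalisation dF^1 - i dF^2 = 0 of the lift, which
   selects one of the two factors of (dF^1)^2 + (dF^2)^2 = 0. *)
Definition zmc_face (S : riemann_surface R) (D : set S) (f : S -> I3) : Prop :=
  exists (X : riemann_surface R) (pi : X -> S) (F : X -> R[i] * R[i] * R[i]),
    zmc_lift D f pi F /\
    forall x, dcoef (crd1 \o F) x - 'i%C * dcoef (crd2 \o F) x = 0.

(** * Weierstrass data *)

Definition partial_re (u : R[i] -> R) (z : R[i]) : R :=
  derive1 (fun t : R => u (z + t%:C)) 0.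

Definition partial_im (u : R[i] -> R) (z : R[i]) : R :=
  derive1 (fun t : R => u (z + 'i%C * t%:C)) 0.

Definition laplacian (u : R[i] -> R) (z : R[i]) : R :=
  partial_re (partial_re u) z + partial_im (partial_im u) z.

(* The coefficient, at the value [z] of the coordinate [chart x], of the
   (1,0)-form [\partial u]. *)
Definition del (S : riemann_surface R) (u : S -> R) (x : S) (z : R[i]) : R[i] :=
  ((partial_re (u \o chart_inv x) z)%:C
   - 'i%C * (partial_im (u \o chart_inv x) z)%:C) / 2.

Definition omega (S : riemann_surface R) (f : S -> I3) (x : S) (z : R[i])
    : R[i] :=
  del (crd1 \o f) x z + 'i%C * del (crd2 \o f) x z.

(* [g] read in [chart x]; at the zeros of [omega] this function takes the value
   0 instead of its limit. *)
Definition gmap (S : riemann_surface R) (f : S -> I3) (x : S) (z : R[i])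
    : R[i] :=
  2 * del (crd0 \o f) x z / omega f x z.

(* [h] is meromorphic at [z0], of order [m]. *)
Definition has_order (h : R[i] -> R[i]) (z0 : R[i]) (m : int) : Prop :=
  exists u : R[i] -> R[i],
    [/\ \forall z \near z0, derivable u z 1, u z0 != 0 &
        \forall z \near z0^', h z = (z - z0) ^ m * u z].

(* The order at [p] of the meromorphic extension of [omega] (0 by default if
   [omega] is not meromorphic at [p], or vanishes identically around [p]). *)
Definition ord_omega (S : riemann_surface R) (f : S -> I3) (p : S) : int :=
  xget 0 [set m | has_order (omega f p) (chart p p) m].

(** * Metrics *)

Definition normsq (z : R[i]) : R := complex.Re z ^+ 2 + complex.Im z ^+ 2.

(* The conformal factor of the lift-metric (2 + |g|^2)|omega|^2 in [chart x],
   written so as to be correct also at the poles of [g]. *)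
Definition lift_factor (S : riemann_surface R) (f : S -> I3) (x : S) (z : R[i])
    : R :=
  2 * normsq (omega f x z) + normsq (2 * del (crd0 \o f) x z).

Lemma normsqM (z w : R[i]) : normsq (z * w) = normsq z * normsq w.
Proof. by case: z => a b; case: w => c d; rewrite /normsq /=; ring. Qed.

Lemma lift_factorE (S : riemann_surface R) (f : S -> I3) (x : S) (z : R[i]) :
  omega f x z != 0 ->
  lift_factor f x z = (2 + normsq (gmap f x z)) * normsq (omega f x z).
Proof.
move=> w0; rewrite /lift_factor [RHS]mulrDl; congr (_ + _).
by rewrite -normsqM /gmap divfK.
Qed.

(* A (possibly degenerate) metric is given by a quadratic form on each tangent
   space, the tangent space at [x] being identified with [R[i]] by [chart x]. *)

Definition lift_metric (S : riemann_surface R) (f : S -> I3) (x : S) (v : R[i])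
    : R :=
  lift_factor f x (chart x x) * normsq v.

Definition differential (S : riemann_surface R) (f : S -> I3) (x : S) (v : R[i])
    : I3 :=
  let d (u : S -> R) : R :=
    derive1 (fun t : R => u (chart_inv x (chart x x + t%:C * v))) 0 in
  (d (crd0 \o f), d (crd1 \o f), d (crd2 \o f)).

Definition first_fundamental_form (S : riemann_surface R) (f : S -> I3)
    (x : S) (v : R[i]) : R :=
  isotropic_dot (differential f x v) (differential f x v).

(* [c] is continuously differentiable on [`[a, b]], up to the endpoints: in the
   chart at [c t] it agrees on [`[a, b]] near [t] with a C^1 map [d]. *)
Definition C1_path (S : riemann_surface R) (c : R -> S) (a b : R) : Prop :=
  {within `[a, b], continuous c} /\
  forall t, a <= t <= b -> exists d : R -> R[i],
    (\forall s \near t,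
      [/\ derivable (@complex.Re R \o d) s 1, derivable (@complex.Im R \o d) s 1,
          {for s, continuous (derive1 (@complex.Re R \o d))} &
          {for s, continuous (derive1 (@complex.Im R \o d))}]) /\
    (\forall s \near t, a <= s <= b ->
      chart_dom (c t) (c s) /\ chart (c t) (c s) = d s).

Inductive piecewise_C1 (S : riemann_surface R) (c : R -> S) : R -> R -> Prop :=
| piecewise_C1_one a b : a <= b -> C1_path c a b -> piecewise_C1 c a b
| piecewise_C1_cat a m b :
    piecewise_C1 c a m -> piecewise_C1 c m b -> piecewise_C1 c a b.

Definition velocity (S : riemann_surface R) (c : R -> S) (t : R) : R[i] :=
  derive1 (fun s => complex.Re (chart (c t) (c s))) t
    +i* derive1 (fun s => complex.Im (chart (c t) (c s))) t.

Definition path_length (S : riemann_surface R) (q : S -> R[i] -> R)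
    (c : R -> S) (J : set R) : \bar R :=
  (\int[lebesgue_measure]_(t in J) (Num.sqrt (q (c t) (velocity c t)))%:E)%E.

Definition riemannian_dist (S : riemann_surface R) (D : set S)
    (q : S -> R[i] -> R) (x y : S) : \bar R :=
  ereal_inf [set l | exists c : R -> S,
    [/\ piecewise_C1 c 0 1, c 0 = x, c 1 = y,
        forall t, 0 <= t <= 1 -> D (c t) & l = path_length q c `[0, 1]]].

Definition complete_metric (S : riemann_surface R) (D : set S)
    (q : S -> R[i] -> R) : Prop :=
  forall u : nat -> S, (forall n, D (u n)) ->
    (forall e : R, 0 < e -> exists N : nat, forall m n : nat,
      (N <= m)%N -> (N <= n)%N -> (riemannian_dist D q (u m) (u n) < e%:E)%E) ->
    exists2 x : S, D x & u @ \oo --> x.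

(* Every path in [D] converging to [p] has infinite length. *)
Definition complete_at (S : riemann_surface R) (D : set S)
    (q : S -> R[i] -> R) (p : S) : Prop :=
  forall c : R -> S,
    (forall t, 0 <= t < 1 -> D (c t)) ->
    (forall b, 0 < b < 1 -> piecewise_C1 c 0 b) ->
    c t @[t --> (1 : R)^'-] --> p ->
    path_length q c `[0, 1[ = +oo%E.

(* Gaussian curvature of the conformal metric E |dz|^2. *)
Definition gauss_curvature (E : R[i] -> R) (z : R[i]) : R :=
  - laplacian (fun w => ln (E w)) z / (2 * E z).

(* The integral of |K| dA for the lift-metric, as the supremum of its integrals
   over finite disjoint families of measurable sets [A i] that each lie in the
   domain of a chart [chart (x i)]; there dA = E dx dy. *)
Definition total_abs_curvature (S : riemann_surface R) (D : set S)
    (f : S -> I3) : \bar R :=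
  ereal_sup [set l | exists (N : nat) (x : 'I_N -> S) (A : 'I_N -> set S),
    let img i : set (R * R) :=
      [set ab | exists2 q, A i q & chart (x i) q = ab.1 +i* ab.2] in
    [/\ forall i, A i `<=` D `&` chart_dom (x i),
        trivIset setT A,
        forall i, measurable (img i) &
        l = (\sum_(i < N)
          \int[lebesgue_measure \x lebesgue_measure]_(ab in img i)
            (`|gauss_curvature (lift_factor f (x i)) (ab.1 +i* ab.2)|
               * lift_factor f (x i) (ab.1 +i* ab.2))%:E)%E]].

Definition weakly_complete (S : riemann_surface R) (D : set S) (f : S -> I3)
    : Prop :=
  complete_metric D (lift_metric f).

Definition finite_type (S : riemann_surface R) (D : set S) (f : S -> I3)
    : Prop :=
  (total_abs_curvature D f < +oo)%E.

(** * Ends *)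

Definition punctured (T : Type) (n : nat) (p : 'I_n -> T) : set T :=
  [set q | forall j, q <> p j].

Definition expanding_end (S : riemann_surface R) (D : set S) (f : S -> I3)
    (p : S) : Prop :=
  complete_at D (first_fundamental_form f) p.

Definition shrinking_end (S : riemann_surface R) (D : set S) (f : S -> I3)
    (p : S) : Prop :=
  ~ expanding_end D f p.

(* An embedding is an immersion that is a homeomorphism onto its image; I^3
   carries the usual topology of R^3. *)
Definition embedding_on (S : riemann_surface R) (f : S -> I3) (A : set S)
    : Prop :=
  [/\ forall x v, A x -> differential f x v = (0, 0, 0) -> v = 0,
      {within A, continuous (f : S -> R * R * R)},
      forall x y, A x -> A y -> f x = f y -> x = y &
      forall x (V : set S), A x -> nbhs x V ->
        exists2 W : set (R * R * R), nbhs (f x : R * R * R) W &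
          forall y, A y -> W (f y) -> V y].

Definition embedded_end (S : riemann_surface R) (D : set S) (f : S -> I3)
    (p : S) : Prop :=
  exists U : set S,
    [/\ open U, U p, U `\ p `<=` D & embedding_on f (U `\ p)].

(* The first [k] of the [n] ends of [f] are expanding, the others shrinking. *)
Record complete_finite_type_face (S : riemann_surface R) (n : nat)
    (p : 'I_n -> S) (k : nat) (f : S -> I3) : Prop := {
  cf_compact : compact [set: S] ;
  cf_distinct : injective p ;
  cf_zmc : zmc_face (punctured p) f ;
  cf_weakly_complete : weakly_complete (punctured p) f ;
  cf_finite_type : finite_type (punctured p) f ;
  cf_le : (k <= n)%N ;
  cf_expanding : forall j : 'I_n, (j < k)%N ->
    expanding_end (punctured p) f (p j) ;
  cf_shrinking : forall j : 'I_n, (k <= j)%N ->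
    shrinking_end (punctured p) f (p j)
}.

Definition end_order_sum (S : riemann_surface R) (n : nat) (p : 'I_n -> S)
    (k : nat) (f : S -> I3) : int :=
  - (\sum_(j < n | (j < k)%N) ord_omega f (p j))
  + \sum_(j < n | (k <= j)%N) ord_omega f (p j).

End ZMC.

(** * Entire graphs *)

Section ComplexTopology.
Context {R : realType}.

Local Notation normc := (@Normc.normc R).

Lemma normrcE (z : R[i]) : `|z| = (normc z)%:C.
Proof. by []. Qed.

Lemma nbhs_complexP (z : R[i]) (A : set R[i]) :
  nbhs z A <-> exists2 e : R, 0 < e & forall w, normc (z - w) < e -> A w.
Proof.
split.
  move=> /nbhs_ballP [[e e']]; rewrite /= ltcE /= => /andP[/eqP -> e0] zA.
  by exists e => // w zw; apply: zA; rewrite /ball /= normrcE ltcR.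
move=> [e e0 zA]; apply/nbhs_ballP; exists e%:C; first by rewrite /= ltcR.
by move=> w; rewrite /ball /= normrcE ltcR; exact: zA.
Qed.

Lemma normcB (z w : R[i]) : normc (z - w) = normc (w - z).
Proof. by apply: complexI; rewrite -!normrcE distrC. Qed.

Lemma normc_triangle (z w : R[i]) : normc (z + w) <= normc z + normc w.
Proof. by have := ler_normD z w; rewrite !normrcE -rmorphD lecR. Qed.

Lemma normc_ge0 (z : R[i]) : 0 <= normc z.
Proof. by have := normr_ge0 z; rewrite normrcE lecR. Qed.

Lemma near_complex_neq0 (z : R[i]) : z != 0 -> \forall w \near z, w != 0.
Proof.
move=> z0; apply/nbhs_complexP; exists (normc z).
  by rewrite -ltcR -normrcE normr_gt0.
by move=> w; apply: contraTneq => ->; rewrite subr0 ltxx.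
Qed.

Lemma normc_continuous : continuous normc.
Proof.
move=> z; apply/(@cvgrPdist_lt _ _ _ (nbhs z)) => e e0.
apply/nbhs_complexP; exists e => // w; apply: le_lt_trans.
have := normc_triangle (z - w) w; have := normc_triangle (w - z) z.
rewrite !subrK (normcB w z) ler_norml => *; apply/andP; split; lra.
Qed.

Lemma cplx_continuous : continuous (fun p : R * R => p.1 +i* p.2 : R[i]).
Proof.
move=> [x y] A /nbhs_complexP [e e0 eA].
have e20 : 0 < e / 2 by rewrite divr_gt0.
exists (ball x (e / 2), ball y (e / 2)); first by split; exact: nbhsx_ballx.
move=> [a b] [/= xa yb]; apply: eA.
have -> : (x +i* y) - (a +i* b) = (x - a)%:C + (y - b)%:C * 'i%C :> R[i].
  by apply/eqP; rewrite eq_complex /=; apply/andP; split; apply/eqP; ring.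
apply: (le_lt_trans (normc_triangle _ _)).
have nR (r : R) : normc r%:C = `|r|.
  by rewrite /= expr0n addr0 sqrtr_sqr.
have nI (r : R) : normc (r%:C * 'i%C) = `|r|.
  by rewrite /= !mul0r !mulr0 mulr1 !subr0 addr0 expr0n add0r sqrtr_sqr.
rewrite nR nI; move: xa yb; rewrite /ball /=; lra.
Qed.

Lemma compact_disc (r : R) : compact [set z : R[i] | normc z <= r].
Proof.
apply: (@subclosed_compact _ _
  ((fun p : R * R => p.1 +i* p.2 : R[i]) @` (`[- r, r] `*` `[- r, r]))).
- apply: (@closed_comp _ _ normc [set x | x <= r]) => //.
    by move=> z _; exact: normc_continuous.
- apply: continuous_compact.
    by apply: continuous_subspaceT => x; exact: cplx_continuous.
  by apply: compact_setX; exact: segment_compact.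
- move=> [x y] /= h; exists (x, y) => //=; rewrite !in_itv /= -!ler_norml.
  by split; apply: le_trans h; rewrite -sqrtr_sqr ler_wsqrtr //
     ?lerDl ?lerDr ?sqr_ge0.
Qed.

Lemma compact_normc (W : set R[i]) :
  compact W -> exists2 r : R, 0 < r & forall z, W z -> normc z <= r.
Proof.
move=> cW.
have /compact_bounded [M [_ /(_ (Num.max 1 (M + 1)))]] : compact (normc @` W).
  apply: continuous_compact => //; apply: continuous_subspaceT => z.
  exact: normc_continuous.
move=> h; exists (Num.max 1 (M + 1)); first by rewrite lt_max ltr01.
move=> z Wz; apply: (le_trans (ler_norm _)); apply: h; last by exists z.
by rewrite lt_max ltrDl ltr01 orbT.
Qed.

Lemma connected_complex : connected [set: R[i]].
Proof.
have -> : [set: R[i]] =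
    \bigcup_(z in [set: R[i]])
      ((fun t : R => t * complex.Re z +i* (t * complex.Im z) : R[i]) @` setT).
  apply/seteqP; split => // z _; exists z => //; exists 1 => //.
  by rewrite !mul1r; case: z.
apply: bigcup_connected.
  exists 0 => z _; exists 0 => //; by rewrite !mul0r.
move=> z _; apply: connected_continuous_connected.
  exact/connected_intervalP.
apply: continuous_subspaceT => t.
apply: (@continuous_comp _ _ _ (fun t : R => (t * complex.Re z, t * complex.Im z))
  (fun p : R * R => p.1 +i* p.2 : R[i])); last exact: cplx_continuous.
have mul_cont (a : R) : (fun s : R => s * a) @ t --> t * a.
  by apply: cvgM; [exact: cvg_id | exact: cvg_cst].
exact: (cvg_pair (mul_cont _) (mul_cont _)).
(*[exact: cvg_id | exact: cvg_cst
                              *)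
Qed.

End ComplexTopology.

Section RiemannSphere.
Context {R : realType}.
Local Notation normc := (@Normc.normc R).
Local Notation opc := (one_point_compactification R[i]).

Definition sphere_chart (x : opc) (q : opc) : R[i] :=
  if x is Some _ then odflt 0 q else odflt 0 (omap GRing.inv q).

Definition sphere_dom (x : opc) : set opc :=
  if x is Some _ then [set q | q <> None] else [set q | q <> Some 0].

Definition sphere_inv (x : opc) (z : R[i]) : opc :=
  if x is Some _ then Some z else if z == 0 then None else Some z^-1.

Lemma sphere_nbhs_infty (A : set opc) :
  nbhs (None : opc) A <->
  A None /\ exists r : R, forall z, r < normc z -> A (Some z).
Proof.
split.
  move=> [W [cW _] WA]; split; first by apply: WA; right.
  have [r r0 Wr] := compact_normc cW; exists r => z rz; apply: WA; left.
  by exists z => // /Wr; rewrite leNgt rz.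
move=> [A0 [r rA]]; exists [set z : R[i] | normc z <= r].
  split; first exact: compact_disc.
  by apply: compact_closed; [exact: norm_hausdorff|exact: compact_disc].
move=> q [[z /= /negP zr <-]|-> //]; apply: rA.
by rewrite ltNge.
Qed.

Lemma sphere_nbhs_some (z : R[i]) (A : set opc) :
  nbhs (Some z : opc) A <-> nbhs z (fun w => A (Some w)).
Proof. by []. Qed.

Lemma normc0_eq (z : R[i]) : (normc z <= 0) = (z == 0).
Proof.
by rewrite -normr_le0 normrcE (lecR (normc z) 0).
Qed.

Lemma normcV (z : R[i]) : normc z^-1 = (normc z)^-1.
Proof. by apply: complexI; rewrite -normrcE normfV fmorphV. Qed.

Lemma sphere_dom_open (x : opc) : open (sphere_dom x).
Proof.
rewrite openE; case: x => [x|] [z|] //= Hz; rewrite /interior /=.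
- by apply/sphere_nbhs_some; near=> w.
- apply/sphere_nbhs_some.
  have : \forall w \near z, w != 0.
    by apply: near_complex_neq0; apply/eqP => z0; apply: Hz; rewrite z0.
  by apply: filterS => w /eqP w0 [].
- apply/sphere_nbhs_infty; split => //; exists 0 => w w0 [wE].
  by move: w0; rewrite wE ltNge normc0_eq eqxx.
Unshelve. all: by end_near. Qed.

Lemma sphere_dom_center (x : opc) : sphere_dom x x.
Proof. by case: x. Qed.

Lemma sphere_chartK (x q : opc) :
  sphere_dom x q -> sphere_inv x (sphere_chart x q) = q.
Proof.
case: x => [x|]; case: q => [z|] //=; last by rewrite eqxx.
move=> z0; rewrite invr_eq0 invrK.
by case: eqP => // zE; case: z0; rewrite zE.
Qed.

Lemma sphere_img_open (x : opc) : open (sphere_chart x @` sphere_dom x).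
Proof.
suff -> : sphere_chart x @` sphere_dom x = setT by exact: openT.
apply/seteqP; split => // z _; exists (sphere_inv x z); case: x => //=.
- by case: ifP => // /eqP z0 [/eqP]; rewrite invr_eq0 => /eqP.
- by case: ifP => [/eqP ->//|] _ /=; rewrite invrK.
Qed.

Lemma sphere_chart_continuous (x q : opc) :
  sphere_dom x q -> {for q, continuous (sphere_chart x)}.
Proof.
case: x => [x|]; case: q => [z|] //= z0 A /=.
- by move=> zA; apply/sphere_nbhs_some.
- move=> zA; apply/sphere_nbhs_some => /=.
  have /inv_continuous/(_ A zA) // : z != 0 :> R[i].
  by apply/eqP => zE; apply: z0; rewrite zE.
- move=> /nbhs_complexP [e e0 eA]; apply/sphere_nbhs_infty; split => /=.
    by apply: eA; rewrite subrr -[normc 0]/(normc 0) /= !expr0n addr0 sqrtr0.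
  exists e^-1 => z ze; apply: eA; rewrite normcB subr0 normcV.
  have z0' : 0 < normc z by apply: lt_trans ze; rewrite invr_gt0.
  by rewrite -(invrK e) ltf_pV2 // posrE invr_gt0.
Qed.

Lemma sphere_inv_continuous (x q : opc) :
  sphere_dom x q -> {for sphere_chart x q, continuous (sphere_inv x)}.
Proof.
case: x => [x|] hq; first by move=> A.
move=> A; rewrite (sphere_chartK hq).
case: q hq => [z|] /= z0.
  have {}z0 : z != 0 by apply/eqP => zE; apply: z0; rewrite zE.
  move=> /sphere_nbhs_some zA.
  have zV0 : z^-1 != 0 by rewrite invr_eq0.
  have hA : \forall w \near z^-1, A (Some w^-1).
    have := @inv_continuous _ _ zV0 (fun w => A (Some w)).
    by rewrite /= invrK; exact.
  change (\forall w \near z^-1, A (sphere_inv None w)).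
  apply: filterS2 (near_complex_neq0 zV0) hA => w w0 /=.
  by rewrite (negPf w0).
move=> /sphere_nbhs_infty [A0 [r rA]]; apply/nbhs_complexP.
have r0 : 0 < Num.max 1 r by rewrite lt_max ltr01.
exists (Num.max 1 r)^-1; first by rewrite invr_gt0.
move=> w; rewrite normcB subr0 => wr /=; case: eqP => // /eqP w0; apply: rA.
have w0' : 0 < normc w by rewrite ltNge normc0_eq.
rewrite normcV; apply: (@le_lt_trans _ _ (Num.max 1 r)).
  by rewrite le_max lexx orbT.
by rewrite -(invrK (Num.max 1 r)) ltf_pV2 // posrE invr_gt0.
Qed.

Lemma sphere_holomorphic (x y q : opc) : sphere_dom x q -> sphere_dom y q ->
  derivable (sphere_chart y \o sphere_inv x) (sphere_chart x q) 1.
Proof.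
have dV (z : R[i]) : z != 0 -> derivable (fun w : R[i] => w^-1) z 1.
  by move=> z0; apply: derivableV => //; exact: derivable_id.
have dI (z : R[i]) : derivable (id : R[i] -> R[i]) z 1 by exact: derivable_id.
case: x => [x|]; case: y => [y|] xq yq.
- have -> : sphere_chart (Some y) \o sphere_inv (Some x) = id by [].
  exact: dI.
- have -> : sphere_chart None \o sphere_inv (Some x) = GRing.inv by [].
  case: q xq yq => [z|] // _ z0; apply: dV; change (z != 0).
  by apply/eqP => zE; apply: z0; rewrite zE.
- case: q xq yq => [z|] // z0 _; rewrite [sphere_chart _ _]/=.
  have {}z0 : z^-1 != 0.
    by rewrite invr_eq0; apply/eqP => zE; apply: z0; rewrite zE.
  apply: (near_eq_derivable _ (dV _ z0)).
  by apply: filterS (near_complex_neq0 z0) => w w0 /=; rewrite (negPf w0).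
- have -> : sphere_chart None \o sphere_inv None = id.
    by apply/funext => z /=; case: eqP => [->|_] /=; rewrite ?invrK.
  exact: dI.
Qed.

Lemma sphere_hausdorff : hausdorff_space opc.
Proof.
have sepinf (z : R[i]) : ~ cluster (nbhs (Some z : opc)) (None : opc).
  move=> /(_ (Some @` [set w | normc (z - w) < 1])
    ([set q | if q is Some w then normc z + 1 < normc w else True])).
  case.
  - apply: one_point_compactification_some_nbhs; apply/nbhs_complexP.
    by exists 1.
  - by apply/sphere_nbhs_infty; split => //; exists (normc z + 1).
  - move=> q [[w /= zw <-]].
    have := normc_triangle (w - z) z; rewrite subrK (normcB w z); lra.
move=> [z|] [w|] // zw.
- congr Some; apply: norm_hausdorff => A B zA wB.
  have := zw _ _ (one_point_compactification_some_nbhs _ _ zA)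
    (one_point_compactification_some_nbhs _ _ wB).
  by move=> [_ [[a Aa <-] [b Bb [ba]]]]; exists a; split => //; rewrite -ba.
- by case: (sepinf z).
- case: (sepinf w) => A B wA B0.
  by have [q []] := zw _ _ B0 wA; exists q; split.
Qed.

Lemma sphere_connected : connected [set: opc].
Proof.
have -> : [set: opc] = closure (Some @` [set: R[i]] : set opc).
  apply/seteqP; split => // -[z|] _; first by apply: subset_closure; exists z.
  move=> A /sphere_nbhs_infty [_ [r rA]].
  pose z : R[i] := (`|r| + 1)%:C; exists (Some z); split; first by exists z.
  apply: rA; rewrite /z /= expr0n addr0 sqrtr_sqr [ltRHS]ger0_norm ?addr_ge0 //.
  by apply: (le_lt_trans (ler_norm r)); rewrite ltrDl.
apply: connected_closure; apply: connected_continuous_connected.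
  exact: connected_complex.
apply: continuous_subspaceT; exact: one_point_compactification_some_continuous.
Qed.

(* C u {oo}, with the coordinates z at the finite points and 1/z at [None],
   the point at infinity. *)
Definition riemann_sphere : riemann_surface R :=
  @RiemannSurface R opc sphere_chart sphere_dom sphere_inv
    sphere_dom_open sphere_dom_center sphere_img_open sphere_chartK
    sphere_chart_continuous sphere_inv_continuous sphere_holomorphic
    sphere_hausdorff sphere_connected.

(* The graph of [phi(x, y)] over C = riemann_sphere \ {None}. *)
Definition entire_graph (phi : {poly {poly R}}) (q : riemann_sphere)
    : isotropic_space R :=
  if q is Some z
  then (phi.[complex.Re z, complex.Im z], complex.Re z, complex.Im z)
  else (0, 0, 0).

Definition infinity_end (j : 'I_1) : riemann_sphere := None.

Definition harmonic_poly (phi : {poly {poly R}}) : Prop :=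
  forall z : R[i],
    laplacian (fun w => phi.[complex.Re w, complex.Im w]) z = 0.

End RiemannSphere.

(* Main.v *)
(* Near an end p, in the chart at p with p at the point c, the planar part
   P = f^1 + i f^2 is holomorphic on a punctured disc with P' = omega, and
   h = 2 d(f^0)/dz = g omega is holomorphic there as well.

   Finite total curvature bounds the area, with multiplicity, covered by g on
   the punctured disc. Covering the disc by small dyadic squares whose images
   lie in squares of finite total area, one finds a set E of positive length
   on a vertical line that g avoids near the end. The transform
   k = \int_E dt / (g - (x + i t)) then has |Re k| <= pi, so 1 / (k - pi - 1)
   extends to c; hence g stays away from some b, and the form W = h - b omega
   has no zeros and is comparable with the lift-metric. Completeness makes the
   solutions of phi' = 1 / W(phi) exist on discs of a fixed size, so 1 / W is
   bounded by Cauchy's estimate and omega is meromorphic at c.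

   Thus P = k + (z - c)^a U with U(c) <> 0, a <> 0, and ord omega = a - 1. The
   end is expanding if and only if a < 0, that is, if P is unbounded. It is
   embedded if and only if |a| = 1: for |a| > 1 the height f^0 takes the same
   value at two of the |a| points of some fibre of P near c. An expanding end
   therefore contributes -ord omega = 1 - a >= 2 and a shrinking one
   ord omega = a - 1 >= 0, with equality exactly in the embedded case.

   For the graph of phi one has omega = dz and g = phi_x - i phi_y, an entire
   function of polynomial growth. The lift-metric dominates |dz|^2, and its
   curvature density 4 |g'|^2 / (2 + |g|^2)^2 is O((1 + |z|^2)^-2) in the
   coordinates z and 1/z alike. At infinity P = 1/z, so a = -1. *)
Require Import Defs.
From HB Require Import structures.
From mathcomp Require Import all_boot all_order all_algebra.
From mathcomp Require Import complex polyXY.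
From mathcomp Require Import all_classical all_reals all_analysis.
From mathcomp Require Import measurable_realfun.
From mathcomp Require Import ring lra zify.

Set Implicit Arguments.
Unset Strict Implicit.
Unset Printing Implicit Defensive.

Import Order.TTheory GRing.Theory Num.Theory numFieldNormedType.Exports.

Local Open Scope classical_set_scope.
Local Open Scope complex_scope.
Local Open Scope ring_scope.

(** * Complex and real derivatives *)

Section Norm.
Context {R : realType}.
Local Notation C := R[i].
Local Notation nc := (@Normc.normc R).

(** Nothing is given about [g] or [omega] at a puncture: [ord_omega] returns a default unless an
    order is exhibited, so the analytic part has to rule out essential singularities. Finitely many
    omitted values would call for Picard's theorem; an omitted set of positive length gives, through
    its Cauchy transform, an explicit bounded function of [g], for which removability suffices. An
    area bound leads to such a set because squares of small total area cannot cover almost all of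
    every vertical line. The curvature density vanishes where [g' = 0], so the image of a small
    square is compared with its curvature plus its own plane area, and both sums are finite. The
    form [W] replaces [omega] since [omega] may vanish where the lift-metric does not, whereas
    [|W||dz|] is flat, nondegenerate and bounds the lift-metric from above up to a constant, so that
    completeness can be tested along its straight lines. The orders are then read off from [P],
    whose derivative is [omega]; splitting off the constant [k] makes the exponent [a] nonzero, and
    hence the order of the derivative exactly [a - 1]. *)

Lemma ncM (z w : C) : nc (z * w) = nc z * nc w.
Proof. exact: Normc.normcM. Qed.

Lemma nc_eq0 (z : C) : (nc z == 0) = (z == 0).
Proof. by rewrite -normc0_eq eq_le normc_ge0 andbT. Qed.

Lemma nc_gt0 (z : C) : (0 < nc z) = (z != 0).
Proof. by rewrite lt_def normc_ge0 andbT nc_eq0. Qed.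

Lemma nc0 : nc 0 = 0. Proof. by apply/eqP; rewrite nc_eq0. Qed.

Lemma nc_real (r : R) : nc r%:C = `|r|.
Proof. by rewrite /= expr0n addr0 sqrtr_sqr. Qed.

Lemma nc1 : nc 1 = 1. Proof. exact: Normc.normc1. Qed.

Lemma nci : nc 'i%C = 1.
Proof. by rewrite /= expr0n /= add0r expr1n sqrtr1. Qed.

Lemma ncN (z : C) : nc (- z) = nc z.
Proof. by rewrite -[z in RHS]opprK -(sub0r (- z)) normcB subr0. Qed.

Lemma ncX (z : C) n : nc (z ^+ n) = nc z ^+ n.
Proof. by elim: n => [|n IH]; rewrite ?expr0 ?nc1 // !exprS ncM IH. Qed.

Lemma nc_div (z w : C) : nc (z / w) = nc z / nc w.
Proof. by rewrite ncM Defs.normcV. Qed.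

Lemma nc_leD (z w : C) : nc (z + w) <= nc z + nc w.
Proof. exact: normc_triangle. Qed.

Lemma nc_leB (z w : C) : nc (z - w) <= nc z + nc w.
Proof. by rewrite -(ncN w) normc_triangle. Qed.

Lemma nc_subl (z w : C) : nc z - nc w <= nc (z - w).
Proof. by rewrite lerBlDr; have := nc_leD (z - w) w; rewrite subrK. Qed.

Lemma nc_subr (z w : C) : nc w - nc z <= nc (z - w).
Proof. by rewrite normcB nc_subl. Qed.

Lemma nc_sqr (z : C) : nc z ^+ 2 = complex.Re z ^+ 2 + complex.Im z ^+ 2.
Proof. by case: z => a b /=; rewrite sqr_sqrtr // addr_ge0 ?sqr_ge0. Qed.

Lemma nc_Re (z : C) : `|complex.Re z| <= nc z.
Proof.
by case: z => a b /=; rewrite -sqrtr_sqr ler_wsqrtr // lerDl sqr_ge0.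
Qed.

Lemma nc_Im (z : C) : `|complex.Im z| <= nc z.
Proof.
by case: z => a b /=; rewrite -sqrtr_sqr ler_wsqrtr // lerDr sqr_ge0.
Qed.

Lemma nc_ReIm (z : C) : nc z <= `|complex.Re z| + `|complex.Im z|.
Proof.
rewrite {1}[z]complexE (le_trans (nc_leD _ _)) // ncM nci mul1r.
by rewrite !nc_real.
Qed.

Lemma ReD (z w : C) : complex.Re (z + w) = complex.Re z + complex.Re w.
Proof. by case: z; case: w. Qed.
Lemma ImD (z w : C) : complex.Im (z + w) = complex.Im z + complex.Im w.
Proof. by case: z; case: w. Qed.
Lemma ReN (z : C) : complex.Re (- z) = - complex.Re z.
Proof. by case: z. Qed.
Lemma ImN (z : C) : complex.Im (- z) = - complex.Im z.
Proof. by case: z. Qed.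
Lemma cReM (z w : C) : complex.Re (z * w) =
  complex.Re z * complex.Re w - complex.Im z * complex.Im w.
Proof. by case: z; case: w. Qed.
Lemma cImM (z w : C) : complex.Im (z * w) =
  complex.Re z * complex.Im w + complex.Im z * complex.Re w.
Proof. by case: z; case: w. Qed.

Lemma complex_eta (z : C) : z = complex.Re z +i* complex.Im z.
Proof. by case: z. Qed.

Lemma nbhs_cP (z : C) (A : set C) :
  nbhs z A <-> exists2 d : R, 0 < d & forall w, nc (w - z) < d -> A w.
Proof.
rewrite nbhs_complexP; split => -[d d0 h]; exists d => // w.
  by rewrite normcB; exact: h.
by rewrite normcB; exact: h.
Qed.

Lemma nbhs_rP (t : R) (A : set R) :
  nbhs t A <-> exists2 d : R, 0 < d & forall s, `|s - t| < d -> A s.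
Proof.
split.
  move=> /nbhs_ballP [d /= d0 h]; exists d => // s st; apply: h.
  by rewrite /ball /= distrC.
move=> [d d0 h]; apply/nbhs_ballP; exists d => // s; rewrite /ball /= distrC.
exact: h.
Qed.

Lemma ccontP (f : C -> C) (z : C) :
  {for z, continuous f} <-> forall e : R, 0 < e ->
    exists2 d, 0 < d & forall w, nc (w - z) < d -> nc (f w - f z) < e.
Proof.
split=> [h e e0|h A].
  have /h /nbhs_cP // : nbhs (f z) [set w | nc (w - f z) < e].
  by apply/nbhs_cP; exists e.
move=> /nbhs_cP [e e0 eA]; have [d d0 hd] := h e e0.
by apply/nbhs_cP; exists d => // w /hd; exact: eA.
Qed.

Lemma rcontP (f : R -> C) (t : R) :
  {for t, continuous f} <-> forall e : R, 0 < e ->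
    exists2 d, 0 < d & forall s, `|s - t| < d -> nc (f s - f t) < e.
Proof.
split=> [h e e0|h A].
  have /h /nbhs_rP // : nbhs (f t) [set w | nc (w - f t) < e].
  by apply/nbhs_cP; exists e.
move=> /nbhs_cP [e e0 eA]; have [d d0 hd] := h e e0.
by apply/nbhs_rP; exists d => // w /hd; exact: eA.
Qed.

Lemma crcontP (f : C -> R) (z : C) :
  {for z, continuous f} <-> forall e : R, 0 < e ->
    exists2 d, 0 < d & forall w, nc (w - z) < d -> `|f w - f z| < e.
Proof.
split=> [h e e0|h A].
  have /h /nbhs_cP // : nbhs (f z) [set w | `|w - f z| < e].
  by apply/nbhs_rP; exists e.
move=> /nbhs_rP [e e0 eA]; have [d d0 hd] := h e e0.
by apply/nbhs_cP; exists d => // w /hd; exact: eA.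
Qed.

Lemma Re_continuous : continuous (@complex.Re R).
Proof.
move=> z; apply/crcontP => e e0; exists e => // w; apply: le_lt_trans.
by rewrite -ReN -ReD nc_Re.
Qed.

Lemma Im_continuous : continuous (@complex.Im R).
Proof.
move=> z; apply/crcontP => e e0; exists e => // w; apply: le_lt_trans.
by rewrite -ImN -ImD nc_Im.
Qed.

End Norm.

(** * Complex and real derivatives as first-order expansions *)

Section Derivatives.
Context {R : realType}.
Local Notation C := R[i].
Local Notation nc := (@Normc.normc R).

Implicit Types (F G : C -> C) (z l m : C) (c b : R -> C) (t : R).

(** The remainder form of [is_derive] (see [cderP]). The non-strict bound includes [w = z], and the
    chain rule and the derivative of an inverse become plain norm estimates. *)
Definition cder (F : C -> C) (z l : C) : Prop :=
  forall e : R, 0 < e -> exists2 d : R, 0 < d & forall w, nc (w - z) < d ->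
    nc (F w - F z - l * (w - z)) <= e * nc (w - z).

Definition rder (c : R -> C) (t : R) (v : C) : Prop :=
  forall e : R, 0 < e -> exists2 d : R, 0 < d & forall s, `|s - t| < d ->
    nc (c s - c t - (s - t)%:C * v) <= e * `|s - t|.


Lemma cvg_cP (T : Type) (F : set_system T) (FF : Filter F) (g : T -> C) (l : C) :
  g @ F --> l <->
  forall e : R, 0 < e -> \forall x \near F, nc (g x - l) < e.
Proof.
split=> [h e e0|h A /nbhs_cP [e e0 eA]].
  have /h // : nbhs l [set w | nc (w - l) < e] by apply/nbhs_cP; exists e.
by apply: filterS (h e e0) => x; exact: eA.
Qed.

Lemma cderP (F : C -> C) (z l : C) : cder F z l <-> is_derive z 1 F l.
Proof.
have key : cder F z l <->
    (fun h : C => h^-1 *: (F (h *: 1 + z) - F z)) @ 0^' --> l.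
  rewrite cvg_cP; split=> h e e0.
    have [d d0 hd] := h _ (divr_gt0 e0 (ltr0n _ 2)).
    apply/nbhs_cP; exists d => // w; rewrite subr0 => wd w0.
    have := hd (w *: 1 + z); rewrite addrK [w *: 1]mulr1 => /(_ wd) {}hd.
    have w0' : 0 < nc w by rewrite nc_gt0.
    have -> : w^-1 *: (F (w + z) - F z) - l = w^-1 * (F (w + z) - F z - l * w).
      by rewrite -[_ *: _]/(w^-1 * _); field.
    rewrite ncM Defs.normcV mulrC ltr_pdivrMr // (le_lt_trans hd) //.
    by rewrite ltr_pM2r //; lra.
  have := h e e0 => /nbhs_cP [d d0 hd]; exists d => // w wd.
  have [->|wz] := eqVneq w z; first by rewrite !subrr mulr0 subr0 nc0 mulr0.
  have wz0 : w - z != 0 by rewrite subr_eq0.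
  have := hd (w - z); rewrite subr0 => /(_ wd wz0) /ltW.
  rewrite [(w - z) *: 1]mulr1 subrK.
  have -> : (w - z)^-1 *: (F w - F z) - l =
      (w - z)^-1 * (F w - F z - l * (w - z)).
    by rewrite -[_ *: _]/((w - z)^-1 * _); field.
  by rewrite ncM Defs.normcV mulrC ler_pdivrMr // nc_gt0.
rewrite key; split=> [h|[]].
  split; first by apply/cvg_ex; exists l.
  by apply: cvg_lim => //; exact: norm_hausdorff.
by move=> /cvg_ex [m hm] <-; rewrite /derive (cvg_lim _ hm).
Qed.

Lemma cder_derivable F z l : cder F z l -> derivable F z 1.
Proof. by move=> /cderP []. Qed.

Lemma derivable_cder F z : derivable F z 1 -> cder F z ('D_1 F z).
Proof. by move=> h; apply/cderP; exact: derivableP. Qed.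

Lemma cder_val F z l : cder F z l -> 'D_1 F z = l.
Proof. by move=> /cderP []. Qed.

Lemma cder_uniq F z l m : cder F z l -> cder F z m -> l = m.
Proof. by move=> /cder_val <- /cder_val <-. Qed.

Lemma cder_eq F z l m : cder F z l -> l = m -> cder F z m.
Proof. by move=> ? <-. Qed.

Lemma cder_near F G z l : (\forall w \near z, F w = G w) ->
  cder F z l -> cder G z l.
Proof. by move=> FG /cderP h; apply/cderP; exact: near_eq_is_derive h. Qed.

Lemma cder_cst (k z : C) : cder (fun=> k) z 0.
Proof. by apply/cderP; exact: is_derive_cst. Qed.

Lemma cder_id z : cder (fun w => w) z 1.
Proof. by apply/cderP; exact: is_derive_id. Qed.

Lemma cderD F G z l m : cder F z l -> cder G z m ->
  cder (fun w => F w + G w) z (l + m).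
Proof. by move=> /cderP h /cderP k; apply/cderP; exact: is_deriveD. Qed.

Lemma cderB F G z l m : cder F z l -> cder G z m ->
  cder (fun w => F w - G w) z (l - m).
Proof. by move=> /cderP h /cderP k; apply/cderP; exact: is_deriveB. Qed.

Lemma cderM F G z l m : cder F z l -> cder G z m ->
  cder (fun w => F w * G w) z (l * G z + F z * m).
Proof.
move=> /cderP h /cderP k; apply/cderP; apply: is_derive_eq.
by change (F z * m + G z * l = l * G z + F z * m); ring.
Qed.

Lemma cderZ F z l (k : C) : cder F z l -> cder (fun w => k * F w) z (k * l).
Proof.
move=> h; apply: cder_eq (cderM (cder_cst k z) h) _.
by rewrite mul0r add0r.
Qed.

Lemma cderX F z l n : cder F z l ->
  cder (fun w => F w ^+ n) z (n%:R * F z ^+ n.-1 * l).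
Proof.
move=> h; elim: n => [|n IH].
  by rewrite !mul0r; under [fun w => _]eq_fun do rewrite expr0; exact: cder_cst.
under [fun w => _]eq_fun do rewrite exprS.
apply: cder_eq (cderM h IH) _ => /=; case: n {IH} => [|n] /=.
  by rewrite expr0; ring.
by rewrite -[in RHS]natr1 exprS; ring.
Qed.

Lemma cder_cont F z l : cder F z l -> {for z, continuous F}.
Proof.
by move=> /cder_derivable /derivable1_diffP; exact: differentiable_continuous.
Qed.

Lemma cderV F z l : F z != 0 -> cder F z l ->
  cder (fun w => (F w)^-1) z (- l / F z ^+ 2).
Proof.
move=> F0 /cderP [dF <-]; apply/cderP; split; first exact: derivableV.
by rewrite deriveV // -[_ *: _]/(_ * _) mulNr mulNr mulrC; congr (- (_ * _)).
Qed.

Lemma cder_comp F G z l m : cder G z m -> cder F (G z) l ->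
  cder (fun w => F (G w)) z (l * m).
Proof.
move=> hG hF e e0; have /ccontP cG := cder_cont hG.
have k0 : 0 < nc m + 1 by rewrite ltr_wpDl ?normc_ge0.
have l0 : 0 < nc l + 1 by rewrite ltr_wpDl ?normc_ge0.
have [d1 d10 h1] := hF (e / 2 / (nc m + 1)) (divr_gt0 (divr_gt0 e0 (ltr0n _ 2)) k0).
have [d2 d20 h2] := cG _ d10.
(* The cap 1 yields [|G w - G z| <= (|m| + 1)|w - z|]; the other bound pays for the factor [l]. The
   summands [+ 1] keep the denominators positive. *)
have m0 : 0 < Num.min 1 (e / 2 / (nc l + 1)).
  by rewrite lt_min ltr01 /= !divr_gt0.
have [d3 d30 h3] := hG _ m0.
exists (Num.min d2 d3); first by rewrite lt_min d20.
move=> w; rewrite lt_min => /andP[wd2 wd3].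
have := h1 _ (h2 _ wd2); have := h3 _ wd3.
set a := Num.min _ _ => Ha Hb.
have a1 : a <= 1 by rewrite ge_min lexx.
have a2 : a <= e / 2 / (nc l + 1) by rewrite ge_min lexx orbT.
have -> : F (G w) - F (G z) - l * m * (w - z) =
  (F (G w) - F (G z) - l * (G w - G z)) + l * (G w - G z - m * (w - z)) by ring.
apply: (le_trans (nc_leD _ _)); rewrite ncM.
have w0 := normc_ge0 (w - z).
have H1 : nc (G w - G z) <= (nc m + 1) * nc (w - z).
  have -> : G w - G z = (G w - G z - m * (w - z)) + m * (w - z) by ring.
  apply: (le_trans (nc_leD _ _)); rewrite ncM mulrDl addrC lerD2l mul1r.
  by apply: (le_trans Ha); rewrite ler_piMl.
have H2 : nc (F (G w) - F (G z) - l * (G w - G z)) <= e / 2 * nc (w - z).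
  apply: (le_trans Hb); apply: (@le_trans _ _
    (e / 2 / (nc m + 1) * ((nc m + 1) * nc (w - z)))).
    by rewrite ler_pM2l // !divr_gt0.
  by rewrite mulrA divfK // gt_eqF.
have H3 : nc l * nc (G w - G z - m * (w - z)) <= e / 2 * nc (w - z).
  apply: (@le_trans _ _ ((nc l + 1) * (e / 2 / (nc l + 1) * nc (w - z)))).
    apply: ler_pM; rewrite ?normc_ge0 ?lerDl //.
    by apply: (le_trans Ha); rewrite ler_wpM2r.
  by rewrite mulrA [(nc l + 1) * _]mulrC divfK // gt_eqF.
by lra.
Qed.

Lemma is_derive_rP (f : R -> R) (t v : R) : is_derive t 1 f v <->
  forall e : R, 0 < e -> exists2 d : R, 0 < d & forall s, `|s - t| < d ->
    `|f s - f t - (s - t) * v| <= e * `|s - t|.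
Proof.
have key : (forall e : R, 0 < e -> exists2 d : R, 0 < d &
      forall s, `|s - t| < d -> `|f s - f t - (s - t) * v| <= e * `|s - t|) <->
    (fun h : R => h^-1 *: (f (h *: 1 + t) - f t)) @ 0^' --> v.
  split=> [h|/cvgrPdist_lt h e e0].
    apply/cvgrPdist_lt => e e0.
    have [d d0 hd] := h _ (divr_gt0 e0 (ltr0n _ 2)).
    apply/nbhs_rP; exists d => // w; rewrite subr0 => wd w0.
    have := hd (w *: 1 + t); rewrite addrK [w *: 1]mulr1 => /(_ wd) {}hd.
    have w0' : 0 < `|w| by rewrite normr_gt0.
    have -> : v - w^-1 *: (f (w + t) - f t) = - (w^-1 * (f (w + t) - f t - w * v)).
      by rewrite -[_ *: _]/(w^-1 * _); field.
    rewrite normrN normrM normfV mulrC ltr_pdivrMr // (le_lt_trans hd) //.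
    by rewrite ltr_pM2r //; lra.
  have := h e e0 => /nbhs_rP [d d0 hd]; exists d => // w wd.
  have [->|wz] := eqVneq w t; first by rewrite !subrr mul0r subr0 normr0 mulr0.
  have wz0 : w - t != 0 by rewrite subr_eq0.
  have := hd (w - t); rewrite subr0 => /(_ wd wz0) /ltW.
  rewrite [(w - t) *: 1]mulr1 subrK.
  have -> : v - (w - t)^-1 *: (f w - f t) =
      - ((w - t)^-1 * (f w - f t - (w - t) * v)).
    by rewrite -[_ *: _]/((w - t)^-1 * _); field.
  by rewrite normrN normrM normfV mulrC ler_pdivrMr // normr_gt0.
rewrite key; split=> [[]|h].
  by move=> /cvg_ex [m hm] <-; rewrite /derive (cvg_lim _ hm).
split; first by apply/cvg_ex; exists v.
by apply: cvg_lim => //; exact: norm_hausdorff.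
Qed.

Lemma Re_rdiff (c : R -> C) s t v :
  complex.Re (c s - c t - (s - t)%:C * v) =
  complex.Re (c s) - complex.Re (c t) - (s - t) * complex.Re v.
Proof. by rewrite !ReD !ReN cReM /= mul0r subr0. Qed.

Lemma Im_rdiff (c : R -> C) s t v :
  complex.Im (c s - c t - (s - t)%:C * v) =
  complex.Im (c s) - complex.Im (c t) - (s - t) * complex.Im v.
Proof. by rewrite !ImD !ImN cImM /= mul0r addr0. Qed.

Lemma rderP (c : R -> C) (t : R) (v : C) : rder c t v <->
  is_derive t 1 (@complex.Re R \o c) (complex.Re v) /\
  is_derive t 1 (@complex.Im R \o c) (complex.Im v).
Proof.
rewrite !is_derive_rP; split=> [h|[h1 h2] e e0].
  split=> e e0; have [d d0 hd] := h e e0; exists d => // s /hd; apply: le_trans.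
    by rewrite -Re_rdiff nc_Re.
  by rewrite -Im_rdiff nc_Im.
have [d1 d10 H1] := h1 _ (divr_gt0 e0 (ltr0n _ 2)).
have [d2 d20 H2] := h2 _ (divr_gt0 e0 (ltr0n _ 2)).
exists (Num.min d1 d2); first by rewrite lt_min d10.
move=> s; rewrite lt_min => /andP[/H1 sd1 /H2 sd2].
apply: (le_trans (nc_ReIm _)); rewrite Re_rdiff Im_rdiff; move: sd1 sd2 => /=.
lra.
Qed.

Lemma rder_eq c t v v' : rder c t v -> v = v' -> rder c t v'.
Proof. by move=> ? <-. Qed.

Lemma rder_near c c' t v : (\forall s \near t, c s = c' s) ->
  rder c t v -> rder c' t v.
Proof.
move=> h /rderP [h1 h2]; apply/rderP; split.
  by apply: near_eq_is_derive h1; apply: filterS h => s /= ->.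
by apply: near_eq_is_derive h2; apply: filterS h => s /= ->.
Qed.

Lemma rder_cst (k : C) t : rder (fun=> k) t 0.
Proof. by apply/rderP; split; apply: is_derive_cst. Qed.

Lemma rder_id t : rder (fun s => s%:C) t 1.
Proof. by apply/rderP; split; [exact: is_derive_id|exact: is_derive_cst]. Qed.

Lemma rder_comp F c t l v : rder c t v -> cder F (c t) l ->
  rder (fun s => F (c s)) t (l * v).
Proof.
move=> hG hF e e0.
have k0 : 0 < nc v + 1 by rewrite ltr_wpDl ?normc_ge0.
have l0 : 0 < nc l + 1 by rewrite ltr_wpDl ?normc_ge0.
have [d1 d10 h1] := hF (e / 2 / (nc v + 1)) (divr_gt0 (divr_gt0 e0 (ltr0n _ 2)) k0).
have m0 : 0 < Num.min 1 (e / 2 / (nc l + 1)).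
  by rewrite lt_min ltr01 /= !divr_gt0.
have [d3 d30 h3] := hG _ m0.
exists (Num.min (d1 / (nc v + 1)) d3); first by rewrite lt_min d30 divr_gt0.
move=> w; rewrite lt_min => /andP[wd2 wd3].
have := h3 _ wd3.
set a := Num.min _ _ => Ha.
have a1 : a <= 1 by rewrite ge_min lexx.
have a2 : a <= e / 2 / (nc l + 1) by rewrite ge_min lexx orbT.
have w0 := normr_ge0 (w - t).
have H1 : nc (c w - c t) <= (nc v + 1) * `|w - t|.
  have -> : c w - c t = (c w - c t - (w - t)%:C * v) + (w - t)%:C * v by ring.
  apply: (le_trans (nc_leD _ _)).
  rewrite ncM nc_real mulrDl addrC [nc v * _]mulrC lerD2l mul1r.
  by apply: (le_trans Ha); rewrite ler_piMl.
have Hb : nc (c w - c t) < d1.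
  by apply: (le_lt_trans H1); rewrite mulrC -ltr_pdivlMr.
have {}Hb := h1 _ Hb.
have -> : F (c w) - F (c t) - (w - t)%:C * (l * v) =
  (F (c w) - F (c t) - l * (c w - c t)) + l * (c w - c t - (w - t)%:C * v) by ring.
apply: (le_trans (nc_leD _ _)); rewrite ncM.
have H2 : nc (F (c w) - F (c t) - l * (c w - c t)) <= e / 2 * `|w - t|.
  apply: (le_trans Hb); apply: (@le_trans _ _
    (e / 2 / (nc v + 1) * ((nc v + 1) * `|w - t|))).
    by rewrite ler_pM2l // !divr_gt0.
  by rewrite mulrA divfK // gt_eqF.
have H3 : nc l * nc (c w - c t - (w - t)%:C * v) <= e / 2 * `|w - t|.
  apply: (@le_trans _ _ ((nc l + 1) * (e / 2 / (nc l + 1) * `|w - t|))).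
    apply: ler_pM; rewrite ?normc_ge0 ?lerDl //.
    by apply: (le_trans Ha); rewrite ler_wpM2r.
  by rewrite mulrA [(nc l + 1) * _]mulrC divfK // gt_eqF.
by lra.
Qed.

Lemma rderD b c t u v : rder b t u -> rder c t v ->
  rder (fun s => b s + c s) t (u + v).
Proof.
move=> /rderP[h1 h2] /rderP[k1 k2]; apply/rderP; rewrite ReD ImD; split.
  rewrite (_ : _ \o _ = (@complex.Re R \o b) + (@complex.Re R \o c)).
    exact: is_deriveD.
  by apply/funext => s /=; rewrite ReD.
rewrite (_ : _ \o _ = (@complex.Im R \o b) + (@complex.Im R \o c)).
  exact: is_deriveD.
by apply/funext => s /=; rewrite ImD.
Qed.

Lemma rderM b c t u v : rder b t u -> rder c t v ->
  rder (fun s => b s * c s) t (u * c t + b t * v).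
Proof.
move=> /rderP[h1 h2] /rderP[k1 k2]; apply/rderP; split.
  rewrite (_ : _ \o _ = (@complex.Re R \o b) * (@complex.Re R \o c)
    - (@complex.Im R \o b) * (@complex.Im R \o c)).
    by apply: is_derive_eq; rewrite ReD !cReM -![_ *: _]/(_ * _) /=; ring.
  by apply/funext => s /=; rewrite cReM.
rewrite (_ : _ \o _ = (@complex.Re R \o b) * (@complex.Im R \o c)
    + (@complex.Im R \o b) * (@complex.Re R \o c)).
  by apply: is_derive_eq; rewrite ImD !cImM -![_ *: _]/(_ * _) /=; ring.
by apply/funext => s /=; rewrite cImM.
Qed.

Lemma rderZ c t v (k : C) : rder c t v -> rder (fun s => k * c s) t (k * v).
Proof.
move=> h; apply: rder_eq (rderM (rder_cst k t) h) _.
by rewrite mul0r add0r.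
Qed.

Lemma rder_line (a v : C) t : rder (fun s => a + s%:C * v) t v.
Proof.
apply: rder_eq (rderD (rder_cst a t) (rderM (rder_id t) (rder_cst v t))) _.
by rewrite mul1r mulr0 addr0 add0r.
Qed.

Lemma rder_cont c t v : rder c t v -> {for t, continuous c}.
Proof.
move=> h; apply/rcontP => e e0; have [d d0 hd] := h 1 ltr01.
have k0 : 0 < nc v + 1 by rewrite ltr_wpDl ?normc_ge0.
exists (Num.min d (e / (nc v + 1))); first by rewrite lt_min d0 divr_gt0.
move=> s; rewrite lt_min => /andP[/hd sd se].
have -> : c s - c t = (c s - c t - (s - t)%:C * v) + (s - t)%:C * v by ring.
apply: (le_lt_trans (nc_leD _ _)); rewrite ncM nc_real.
by move: se; rewrite ltr_pdivlMr //; lra.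
Qed.

(* The factor 2 comes from treating the real and imaginary parts separately. *)
Lemma rder_mvi (c v : R -> C) (a b M : R) : a <= b ->
  (forall t, a <= t <= b -> rder c t (v t)) ->
  (forall t, a <= t <= b -> nc (v t) <= M) ->
  nc (c b - c a) <= 2 * M * (b - a).
Proof.
move=> ab dc vM.
have mvt (p : C -> R) : (forall t, a <= t <= b ->
      is_derive t 1 (p \o c) (p (v t)) /\ `|p (v t)| <= M) ->
    `|p (c b) - p (c a)| <= M * (b - a).
  move=> hp.
  have [t||t tab ->] := @MVT_segment R (p \o c) (p \o v) a b ab.
  - by rewrite in_itv /= => /andP[t1 t2]; case: (hp t) => //; rewrite !ltW.
  - apply: derivable_within_continuous => t; rewrite in_itv /= => tab.
    by case: (hp t tab) => -[].
  move: tab; rewrite in_itv /= => /hp [_ h].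
  by rewrite normrM [`|b - a|]ger0_norm ?subr_ge0 // ler_wpM2r // subr_ge0.
apply: (le_trans (nc_ReIm _)); rewrite ReD ReN ImD ImN.
have h1 := mvt (@complex.Re R); have h2 := mvt (@complex.Im R).
have := h1 _; have := h2 _; set x := `| _ - _ | ; set y := `| _ - _ |.
move=> H1 H2; have {}H1 : x <= M * (b - a).
  apply: H1 => t tab; have /rderP [_ ?] := dc t tab; split => //.
  exact: le_trans (nc_Im _) (vM t tab).
have {}H2 : y <= M * (b - a).
  apply: H2 => t tab; have /rderP [? _] := dc t tab; split => //.
  exact: le_trans (nc_Re _) (vM t tab).
lra.
Qed.

Lemma rder0_cst (c : R -> C) (a b : R) : a <= b ->
  (forall t, a <= t <= b -> rder c t 0) -> c b = c a.
Proof.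
move=> ab h; apply/eqP; rewrite -subr_eq0 -nc_eq0 eq_le normc_ge0 andbT.
have := @rder_mvi c (fun=> 0) a b 0 ab h; rewrite mulr0 mul0r; apply.
by move=> t _; rewrite nc0.
Qed.

End Derivatives.

(** * Integration and Cauchy's formula *)

Section Integral.
Context {R : realType}.
Local Notation C := R[i].
Local Notation nc := (@Normc.normc R).
Local Notation mu := (@lebesgue_measure R).

Implicit Types (F G : C -> C) (f g : R -> C) (z : C) (t : R).

Lemma exists_real_primitive (f : R -> R) : continuous f ->
  exists F : R -> R, forall x : R, is_derive x 1 F (f x).
Proof.
move=> cf.
have int (a b : R) : mu.-integrable `[a, b] (EFin \o f).
  apply: continuous_compact_integrable; first exact: segment_compact.
  exact: continuous_subspaceT.
pose I (a b : R) := (\int[mu]_(t in `[a, b]) f t)%R.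
have I0 (a b : R) : b <= a -> I a b = 0.
  rewrite le_eqVlt => /predU1P[->|ba]; rewrite /I.
    by rewrite set_itv1 Rintegral_set1.
  by rewrite set_itv_ge ?Rintegral_set0 // bnd_simp -ltNge.
have Icat (a m b : R) : a <= m -> m <= b -> I a b = I a m + I m b.
  move=> am mb.
  have := @Rintegral_itvB R f (BLeft a) (BRight b) m (int a b).
  rewrite !bnd_simp => /(_ am mb) h; rewrite /I -[LHS](subrK (I a m)) addrC.
  congr (_ + _); rewrite h Rintegral_itv_obnd_cbnd //.
  by apply: integrableS (int m b) => //; exact: subset_itv_oc_cc.
(* One of the two integrals is always over an empty or one-point interval, so this is the oriented
   integral from 0. Near [x] it differs by a constant from the integral from [- n], to which the
   fundamental theorem applies. *)
exists (fun x => I 0 x - I x 0) => x.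
pose n : R := `|x| + 1.
have hx : - n < x < n.
  rewrite -ltr_norml /n ltrDl //; exact: ltr01.
have /andP [hx1 hx2] := hx.
have [d1 d2] : derivable (I (- n)) x 1 /\ (I (- n))^`()%classic x = f x.
  by apply: (@continuous_FTC1_closed R f (- n) x n) => //; exact: cf.
have hd : is_derive x 1 (fun y => I (- n) y - I (- n) 0) (f x).
  rewrite -[f x]subr0; apply: is_deriveB.
  by split; [exact: d1|rewrite -derive1E; exact: d2].
apply: near_eq_is_derive hd.
have n0 : 0 <= n by rewrite addr_ge0.
near=> y.
have ny : - n <= y.
  by apply: ltW; near: y; exact: lt_nbhsr.
have [y0|y0] := leP 0 y.
  rewrite (I0 y 0) // (@Icat (- n) 0 y) ?oppr_le0 // subr0; ring.
by rewrite (I0 0 y) ?ltW // (@Icat (- n) y 0) // ?ltW //; ring.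
Unshelve. all: by end_near. Qed.

(* Inductive wrappers: conversion must not unfold the topology of [R[i]]. *)
Variant ccont (F : C -> C) (z : C) : Prop := CCont of {for z, continuous F}.
Variant rcont (f : R -> C) : Prop := RCont of forall t, {for t, continuous f}.

Lemma ccontE F z : ccont F z <-> {for z, continuous F}.
Proof. by split=> [[]|]. Qed.

Lemma ccont_epsP F z : ccont F z <-> forall e : R, 0 < e ->
  exists2 d, 0 < d & forall w, nc (w - z) < d -> nc (F w - F z) < e.
Proof. by rewrite ccontE ccontP. Qed.

Lemma ccont_cst (k z : C) : ccont (fun=> k) z.
Proof. by split; exact: cst_continuous. Qed.

Lemma ccont_id z : ccont (fun w => w) z.
Proof. by split=> A. Qed.

Lemma ccontM F G z : ccont F z -> ccont G z -> ccont (fun w => F w * G w) z.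
Proof. by move=> [cF] [cG]; split; exact: (@cvgM C C (nbhs z) _ F G (F z) (G z) cF cG). Qed.

Lemma ccontD F G z : ccont F z -> ccont G z -> ccont (fun w => F w + G w) z.
Proof. by move=> [cF] [cG]; split; exact: (@cvgD C C C (nbhs z) _ F G (F z) (G z) cF cG). Qed.

Lemma ccontB F G z : ccont F z -> ccont G z -> ccont (fun w => F w - G w) z.
Proof. by move=> [cF] [cG]; split; exact: (@cvgB C C C (nbhs z) _ F G (F z) (G z) cF cG). Qed.

Lemma ccontV F z : F z != 0 -> ccont F z -> ccont (fun w => (F w)^-1) z.
Proof. by move=> F0 [cF]; split; exact: (@cvgV C C (nbhs z) _ F (F z) F0 cF). Qed.

Lemma ccont_comp F G z : ccont G z -> ccont F (G z) -> ccont (fun w => F (G w)) z.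
Proof. by move=> [cG] [cF]; split; exact: (@continuous_comp _ _ _ G F z cG cF). Qed.

Lemma cder_ccont F z l : cder F z l -> ccont F z.
Proof. by move=> /cder_cont. Qed.

Lemma rcont_cst (k : C) : rcont (fun=> k).
Proof. by split=> t; exact: cst_continuous. Qed.

Lemma rcontM f g : rcont f -> rcont g -> rcont (fun t => f t * g t).
Proof.
by move=> [cf] [cg]; split=> t; exact: (@cvgM C R (nbhs t) _ f g (f t) (g t) (cf t) (cg t)).
Qed.

Lemma rcontD f g : rcont f -> rcont g -> rcont (fun t => f t + g t).
Proof.
by move=> [cf] [cg]; split=> t; exact: (@cvgD C C R (nbhs t) _ f g (f t) (g t) (cf t) (cg t)).
Qed.

Lemma rcontB f g : rcont f -> rcont g -> rcont (fun t => f t - g t).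
Proof.
by move=> [cf] [cg]; split=> t; exact: (@cvgB C C R (nbhs t) _ f g (f t) (g t) (cf t) (cg t)).
Qed.

Lemma rcontV f : (forall t, f t != 0) -> rcont f -> rcont (fun t => (f t)^-1).
Proof.
by move=> f0 [cf]; split=> t; exact: (@cvgV C R (nbhs t) _ f (f t) (f0 t) (cf t)).
Qed.

Lemma rcontX f n : rcont f -> rcont (fun t => f t ^+ n).
Proof.
move=> cf; elim: n => [|n IH]; first exact: rcont_cst.
rewrite (_ : (fun t => _) = (fun t => f t * f t ^+ n)); first exact: rcontM.
by apply/funext => t; rewrite exprS.
Qed.

Lemma rcont_comp f F : rcont f -> (forall t, ccont F (f t)) ->
  rcont (fun t => F (f t)).
Proof.
move=> [cf] cF; split=> t; have [{}cF] := cF t.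
exact: (@continuous_comp _ _ _ f F t (cf t) cF).
Qed.

Lemma rder_rcont f (v : R -> C) : (forall t, rder f t (v t)) -> rcont f.
Proof. by move=> h; split=> t; exact: rder_cont (h t). Qed.

Lemma rcont_proj (p : C -> R) f t : (forall z w, `|p z - p w| <= nc (z - w)) ->
  rcont f -> {for t, continuous (p \o f)}.
Proof.
move=> hp [/(_ t) /rcontP cf] A /nbhs_rP [e e0 eA].
have [d d0 hd] := cf e e0; apply/nbhs_rP; exists d => // s /hd h.
by apply: eA; exact: le_lt_trans (hp _ _) h.
Qed.

Lemma Re_lip z w : `|complex.Re z - complex.Re w| <= nc (z - w).
Proof. by rewrite -ReN -ReD nc_Re. Qed.

Lemma Im_lip z w : `|complex.Im z - complex.Im w| <= nc (z - w).
Proof. by rewrite -ImN -ImD nc_Im. Qed.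

Lemma exists_primitive (f : R -> C) : rcont f ->
  exists F : R -> C, forall t, rder F t (f t).
Proof.
move=> cf.
have [F hF] : exists F : R -> R, forall x : R, is_derive x 1 F (complex.Re (f x)).
  apply: (exists_real_primitive (f := @complex.Re R \o f)) => t.
  exact: rcont_proj Re_lip cf.
have [G hG] : exists F : R -> R, forall x : R, is_derive x 1 F (complex.Im (f x)).
  apply: (exists_real_primitive (f := @complex.Im R \o f)) => t.
  exact: rcont_proj Im_lip cf.
by exists (fun t => F t +i* G t) => t; apply/rderP.
Qed.

(** Fixing one primitive per integrand makes additivity of the integral in its bounds a telescoping
    identity, settled by [ring] wherever rectangles are cut. *)
Definition primitive (f : R -> C) : R -> C :=
  xget (fun=> 0) [set F | forall t, rder F t (f t)].

Lemma primitiveP (f : R -> C) t : rcont f -> rder (primitive f) t (f t).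
Proof.
move=> /exists_primitive [F hF]; rewrite /primitive; case: xgetP => [G _ hG|].
  exact: hG.
by move=> /(_ F).
Qed.

(* The integral of [f] over [a, b], oriented: [b < a] is allowed; [f] has to be
   continuous on the whole line. *)
Definition cint (f : R -> C) (a b : R) : C := primitive f b - primitive f a.

Lemma cintC f a b : cint f a b = - cint f b a.
Proof. by rewrite /cint opprB. Qed.

Lemma cint_FTC (F f : R -> C) (a b : R) : rcont f ->
  (forall t, rder F t (f t)) -> cint f a b = F b - F a.
Proof.
move=> cf hF; wlog ab : a b / a <= b.
  move=> h; have [/h//|/ltW/h] := leP a b.
  by move=> ba; rewrite cintC ba opprB.
have : primitive f b + (-1) * F b = primitive f a + (-1) * F a.
  apply: (@rder0_cst R (fun t => primitive f t + (-1) * F t) a b ab) => t _.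
  apply: rder_eq (rderD (primitiveP t cf) (rderZ (-1) (hF t))) _.
  by rewrite mulN1r subrr.
rewrite /cint => /(canRL (addrK _)) ->; ring.
Qed.

Lemma cint_le (f : R -> C) (a b M : R) : rcont f ->
  (forall t : R, Num.min a b <= t <= Num.max a b -> nc (f t) <= M) ->
  nc (cint f a b) <= 2 * M * `|b - a|.
Proof.
move=> cf; wlog ab : a b / a <= b.
  move=> h; case/orP: (le_total a b) => [/h//|ba].
  by rewrite cintC ncN distrC minC maxC; exact: h.
rewrite min_l // max_r // ger0_norm ?subr_ge0 // => h.
apply: (rder_mvi ab _ h) => t _; exact: primitiveP.
Qed.

Lemma cintD f g a b : rcont f -> rcont g ->
  cint (fun t => f t + g t) a b = cint f a b + cint g a b.
Proof.
move=> cf cg; rewrite (@cint_FTC (fun t => primitive f t + primitive g t)).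
- by rewrite /cint; ring.
- exact: rcontD.
- by move=> t; apply: rderD; exact: primitiveP.
Qed.

Lemma cintZ (k : C) f a b : rcont f ->
  cint (fun t => k * f t) a b = k * cint f a b.
Proof.
move=> cf; rewrite (@cint_FTC (fun t => k * primitive f t)).
- by rewrite /cint; ring.
- by apply: rcontM => //; exact: rcont_cst.
- by move=> t; apply: rderZ; exact: primitiveP.
Qed.

Lemma cintB f g a b : rcont f -> rcont g ->
  cint (fun t => f t - g t) a b = cint f a b - cint g a b.
Proof.
move=> cf cg; rewrite (_ : (fun t => _) = (fun t => f t + (-1) * g t)); last first.
  by apply/funext => t; rewrite mulN1r.
rewrite cintD ?cintZ // ?mulN1r //.
by apply: rcontM => //; exact: rcont_cst.
Qed.

End Integral.

(** * Goursat's theorem and primitives on squares *)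

Section Goursat.
Context {R : realType}.
Local Notation C := R[i].
Local Notation nc := (@Normc.normc R).
Implicit Types (f F : C -> C) (a b c d x y : R) (z p : C).

Definition hint f y a b : C := cint (fun t => f (t +i* y)) a b.
Definition vint f x c d : C := 'i%C * cint (fun s => f (x +i* s)) c d.
Definition rint f a b c d : C :=
  hint f c a b + vint f b c d - hint f d a b - vint f a c d.

Lemma rder_hline y t : rder (fun t => t +i* y) t 1.
Proof. by apply/rderP; split; [exact: is_derive_id|exact: is_derive_cst]. Qed.

Lemma rder_vline x t : rder (fun t => x +i* t) t 'i%C.
Proof. by apply/rderP; split; [exact: is_derive_cst|exact: is_derive_id]. Qed.

Lemma hline_cont f y : (forall z, ccont f z) -> rcont (fun t => f (t +i* y)).
Proof.
by move=> cf; apply: rcont_comp => [|t]; [exact: rder_rcont (rder_hline y)|exact: cf].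
Qed.

Lemma vline_cont f x : (forall z, ccont f z) -> rcont (fun s => f (x +i* s)).
Proof.
by move=> cf; apply: rcont_comp => [|t]; [exact: rder_rcont (rder_vline x)|exact: cf].
Qed.

Lemma rint_primitive f F a b c d : (forall z, ccont f z) ->
  (forall z, cder F z (f z)) -> rint f a b c d = 0.
Proof.
move=> cf hF.
have h y u v : hint f y u v = F (v +i* y) - F (u +i* y).
  apply: (@cint_FTC R (fun t => F (t +i* y))) => [|t].
    exact: hline_cont.
  by apply: rder_eq (rder_comp (rder_hline y t) (hF _)) _; rewrite mulr1.
have v x u w : vint f x u w = F (x +i* w) - F (x +i* u).
  rewrite /vint -cintZ; last exact: vline_cont.
  apply: (@cint_FTC R (fun t => F (x +i* t))) => [|t].
    by apply: rcontM; [exact: rcont_cst|exact: vline_cont].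
  by apply: rder_eq (rder_comp (rder_vline x t) (hF _)) _; rewrite mulrC.
by rewrite /rint !h !v; ring.
Qed.

Lemma rintB f g a b c d : (forall z, ccont f z) -> (forall z, ccont g z) ->
  rint (fun z => f z - g z) a b c d = rint f a b c d - rint g a b c d.
Proof.
move=> cf cg; rewrite /rint /hint /vint !cintB; try exact: hline_cont;
  try exact: vline_cont.
ring.
Qed.

(** The factor 4 is the 2 of [cint_le], once for each of two opposite sides. *)
Lemma rint_le f a b c d M : (forall z, ccont f z) -> a <= b -> c <= d ->
  (forall x y, a <= x <= b -> c <= y <= d -> nc (f (x +i* y)) <= M) ->
  nc (rint f a b c d) <= 4 * M * ((b - a) + (d - c)).
Proof.
move=> cf ab cd hM.
have h y : c <= y <= d -> nc (hint f y a b) <= 2 * M * (b - a).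
  move=> hy; rewrite -(@ger0_norm _ (b - a)) ?subr_ge0 //.
  apply: cint_le; first exact: hline_cont.
  by move=> t; rewrite min_l // max_r // => ?; exact: hM.
have v x : a <= x <= b -> nc (vint f x c d) <= 2 * M * (d - c).
  move=> hx; rewrite -(@ger0_norm _ (d - c)) ?subr_ge0 // ncM nci mul1r.
  apply: cint_le; first exact: vline_cont.
  by move=> t; rewrite min_l // max_r // => ?; exact: hM.
rewrite /rint; have := h c; have := h d; have := v a; have := v b.
rewrite !lexx ab cd => /(_ isT) vb /(_ isT) va /(_ isT) hd /(_ isT) hc.
apply: (le_trans (nc_leB _ _)); have := nc_leB (hint f c a b + vint f b c d) (hint f d a b).
have := nc_leD (hint f c a b) (vint f b c d); lra.
Qed.

Lemma rint_cut_x f a m b c d : rint f a b c d = rint f a m c d + rint f m b c d.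
Proof. by rewrite /rint /hint /cint; ring. Qed.

Lemma rint_cut_y f a b c m d : rint f a b c d = rint f a b c m + rint f a b m d.
Proof. by rewrite /rint /vint /cint; ring. Qed.

Lemma rint_xx f a c d : rint f a a c d = 0.
Proof. by rewrite /rint /hint /cint; ring. Qed.

Lemma rint_yy f a b c : rint f a b c c = 0.
Proof. by rewrite /rint /vint /cint; ring. Qed.

(** The supremum of the left endpoints lies in all the nested intervals. *)
Lemma nested_limit (u : nat -> R) (s : R) : 0 <= s ->
  (forall n, u n <= u n.+1 /\ u n.+1 + s / 2 ^+ n.+1 <= u n + s / 2 ^+ n) ->
  exists x, forall n, u n <= x <= u n + s / 2 ^+ n.
Proof.
move=> s0 h.
have u1 n m : u n <= u (n + m)%N.
  elim: m => [|m IH]; first by rewrite addn0.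
  by rewrite addnS (le_trans IH) //; case: (h (n + m)%N).
have u2 n m : u (n + m)%N + s / 2 ^+ (n + m) <= u n + s / 2 ^+ n.
  elim: m => [|m IH]; first by rewrite addn0.
  by rewrite addnS (le_trans _ IH) //; case: (h (n + m)%N).
have s0' n : 0 <= s / 2 ^+ n by rewrite divr_ge0 // exprn_ge0.
have ub n : ubound (range u) (u n + s / 2 ^+ n).
  move=> _ [m _ <-]; have [nm|mn] := leqP n m.
    by have := u2 n (m - n)%N; rewrite subnKC // => H; have := s0' m; lra.
  by have := u1 m (n - m)%N; rewrite subnKC ?(ltnW mn) // => H; have := s0' n; lra.
have sp : has_sup (range u) by split; [exists (u 0), 0 | exists (u 0 + s / 2 ^+ 0)].
exists (sup (range u)) => n; apply/andP; split.
  by apply: ub_le_sup; [case: sp|exists n].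
by apply: ge_sup => //; case: sp.
Qed.

(** The affine part of [f] at [z] has a primitive and integrates to 0. The remainder is at most
    [e / 4] times the half-perimeter, and [rint_le] multiplies it by 4 half-perimeters. *)
Lemma goursat_local f z l (e : R) : (forall z, ccont f z) -> cder f z l -> 0 < e ->
  exists2 r : R, 0 < r & forall a b c d,
    a <= complex.Re z <= b -> c <= complex.Im z <= d -> (b - a) + (d - c) < r ->
    nc (rint f a b c d) <= e * ((b - a) + (d - c)) ^+ 2.
Proof.
move=> cf hf e0; have [r r0 hr] := hf _ (divr_gt0 e0 (ltr0n _ 4)).
exists r => // a b c d /andP[az zb] /andP[cz zd] lt_r.
pose g w := f z + l * (w - z).
pose G w := f z * w + l * ((w - z) ^+ 2 / 2).
have dg w : cder g w l.
  apply: cder_eq (cderD (cder_cst _ _) (cderZ l (cderB (cder_id w) (cder_cst z w)))) _.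
  by ring.
have cg : (forall z, ccont g z) by move=> w; exact: cder_ccont (dg w).
have dG w : cder G w (g w).
  have h := cderM (cderX 2 (cderB (cder_id w) (cder_cst z w))) (cder_cst 2^-1 w).
  by apply: cder_eq (cderD (cderZ (f z) (cder_id w)) (cderZ l h)) _; rewrite /g /=; field.
have -> : rint f a b c d = rint (fun w => f w - g w) a b c d.
  by rewrite rintB // (rint_primitive a b c d cg dG) subr0.
set s := b - a + (d - c) in lt_r *.
have s0 : 0 <= s by rewrite /s; lra.
have -> : e * s ^+ 2 = 4 * (e / 4 * s) * s by field.
apply: rint_le; [|lra|lra|].
  by move=> w; apply: ccontB; [exact: cf|exact: cg].
move=> x y /andP[ax xb] /andP[cy yd].
have xyz : nc (x +i* y - z) <= s.
  apply: (le_trans (nc_ReIm _)); rewrite ReD ImD ReN ImN /=.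
  apply: lerD; rewrite ler_norml; apply/andP; split; lra.
have := hr _ (le_lt_trans xyz lt_r); rewrite /g opprD addrA => h.
by apply: (le_trans h); rewrite ler_wpM2l // divr_ge0 // ltW.
Qed.

(** Bisection: the bound [e] times the squared half-perimeter is additive over the four quarters, so
    if it fails for a rectangle it fails for a quarter. The quarters shrink to a point where
    [goursat_local] is contradicted. Continuity is asked on the whole plane because [cint]
    integrates functions continuous on the whole line. *)
Lemma goursat f a b c d : (forall z, ccont f z) -> a <= b -> c <= d ->
  (forall x y, a <= x <= b -> c <= y <= d -> derivable f (x +i* y) 1) ->
  rint f a b c d = 0.
Proof.
move=> cf ab cd df.
pose s := b - a; pose t := d - c.
have s0 : 0 <= s by rewrite subr_ge0.
have t0 : 0 <= t by rewrite subr_ge0.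
suff key (e : R) : 0 < e -> nc (rint f a b c d) <= e * (s + t) ^+ 2.
  apply/eqP; rewrite -nc_eq0 eq_le normc_ge0 andbT; apply/ler_addgt0Pl => e e0.
  have st : 0 < (s + t) ^+ 2 + 1 by rewrite ltr_wpDl ?sqr_ge0.
  rewrite addr0; apply: (le_trans (key _ (divr_gt0 e0 st))).
  rewrite -mulrA; apply: ler_piMr; first exact: ltW.
  by rewrite mulrC ler_pdivrMr // mul1r lerDl.
move=> e0; rewrite leNgt; apply/negP => bad0.
pose w n : R := s / 2 ^+ n; pose h n : R := t / 2 ^+ n.
have wS n : w n = w n.+1 + w n.+1.
  by rewrite /w exprS; field; rewrite expf_neq0.
have hS n : h n = h n.+1 + h n.+1.
  by rewrite /h exprS; field; rewrite expf_neq0.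
have w0 n : 0 <= w n by rewrite divr_ge0 // exprn_ge0.
have h0 n : 0 <= h n by rewrite divr_ge0 // exprn_ge0.
pose I (u : R * R) n := rint f u.1 (u.1 + w n) u.2 (u.2 + h n).
pose bad (u : R * R) n := e * (w n + h n) ^+ 2 < nc (I u n).
pose nxt (u : R * R) n (v : R * R) :=
  [/\ bad v n.+1, v.1 = u.1 \/ v.1 = u.1 + w n.+1 &
      v.2 = u.2 \/ v.2 = u.2 + h n.+1].
have step u n : bad u n -> exists v, nxt u n v.
  move=> bu; apply: contrapT => /forallNP no.
  have good (v : R * R) : v.1 = u.1 \/ v.1 = u.1 + w n.+1 ->
      v.2 = u.2 \/ v.2 = u.2 + h n.+1 -> nc (I v n.+1) <= e * (w n.+1 + h n.+1) ^+ 2.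
    by move=> v1 v2; rewrite leNgt; apply/negP => bv; apply: (no v); split.
  move: bu; rewrite /bad ltNge => /negP; apply.
  have -> : I u n = I (u.1, u.2) n.+1 + I (u.1, u.2 + h n.+1) n.+1 +
      (I (u.1 + w n.+1, u.2) n.+1 + I (u.1 + w n.+1, u.2 + h n.+1) n.+1).
    have e1 : u.1 + w n.+1 + w n.+1 = u.1 + w n by rewrite (wS n) addrA.
    have e2 : u.2 + h n.+1 + h n.+1 = u.2 + h n by rewrite (hS n) addrA.
    rewrite /I /= e1 e2 (rint_cut_x f u.1 (u.1 + w n.+1) (u.1 + w n)).
    rewrite (rint_cut_y f u.1 (u.1 + w n.+1) u.2 (u.2 + h n.+1) (u.2 + h n)).
    by rewrite (rint_cut_y f (u.1 + w n.+1) (u.1 + w n) u.2 (u.2 + h n.+1)).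
  have g1 := good (u.1, u.2) (or_introl erefl) (or_introl erefl).
  have g2 := good (u.1, u.2 + h n.+1) (or_introl erefl) (or_intror erefl).
  have g3 := good (u.1 + w n.+1, u.2) (or_intror erefl) (or_introl erefl).
  have g4 := good (u.1 + w n.+1, u.2 + h n.+1) (or_intror erefl) (or_intror erefl).
  apply: (le_trans (nc_leD _ _)).
  apply: (@le_trans _ _ (4 * (e * (w n.+1 + h n.+1) ^+ 2))); last first.
    by rewrite (wS n) (hS n) le_eqVlt; apply/orP; left; apply/eqP; ring.
  have := nc_leD (I (u.1, u.2) n.+1) (I (u.1, u.2 + h n.+1) n.+1).
  have := nc_leD (I (u.1 + w n.+1, u.2) n.+1) (I (u.1 + w n.+1, u.2 + h n.+1) n.+1).
  move: g1 g2 g3 g4; lra.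
pose u := fix u n : R * R :=
  if n is n'.+1 then xget (0, 0) (nxt (u n') n') else (a, c).
have badu n : bad (u n) n.
  elim: n => [|n IH].
    have e1 : a + w 0%N = b by rewrite /w expr0 divr1 /s; ring.
    have e2 : c + h 0%N = d by rewrite /h expr0 divr1 /t; ring.
    by rewrite /bad /I /= e1 e2 /w /h expr0 !divr1.
  by rewrite /=; case: xgetP => [v _ [] //|no]; have [v /no] := step _ _ IH.
have nxtu n : nxt (u n) n (u n.+1).
  by rewrite /=; case: xgetP => // no; have [v /no] := step _ _ (badu n).
have [x hx] : exists x, forall n, (u n).1 <= x <= (u n).1 + s / 2 ^+ n.
  apply: nested_limit => // n; have [_ + _] := nxtu n.
  by rewrite -/(w n) -/(w n.+1) (wS n); have := w0 n.+1 => ? [->|->]; split; lra.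
have [y hy] : exists y, forall n, (u n).2 <= y <= (u n).2 + t / 2 ^+ n.
  apply: nested_limit => // n; have [_ _] := nxtu n.
  by rewrite -/(h n) -/(h n.+1) (hS n); have := h0 n.+1 => ? [->|->]; split; lra.
have dxy : derivable f (x +i* y) 1.
  have := hx 0; have := hy 0; rewrite /= !expr0 !divr1 /s /t => ? ?.
  by apply: df; lra.
have [r r0 hr] := goursat_local cf (derivable_cder dxy) e0.
have [n hn] : exists n, w n + h n < r.
  have := @cvg_geometric R (s + t) 2^-1.
  rewrite ger0_norm ?invr_ge0 // invf_lt1 // ltr1n => /(_ isT).
  move=> /cvgrPdist_lt /(_ _ r0) [n _ /(_ n (leqnn n))] /=.
  rewrite sub0r normrN exprVn => hn; exists n; rewrite /w /h -mulrDl.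
  exact: le_lt_trans (ler_norm _) hn.
have := hr (u n).1 ((u n).1 + w n) (u n).2 ((u n).2 + h n) (hx n) (hy n).
have K (x' y' : R) : x' + y' - x' = y' by ring.
rewrite !K => /(_ hn); rewrite leNgt => /negP; apply.
exact: badu.
Qed.

Lemma rint_small f p (e : R) : (forall z, ccont f z) -> 0 < e ->
  exists2 r : R, 0 < r & forall a b c d, a <= b -> c <= d ->
    complex.Re p - r <= a -> b <= complex.Re p + r ->
    complex.Im p - r <= c -> d <= complex.Im p + r ->
    nc (rint f a b c d) <= e.
Proof.
move=> cf e0; have /ccont_epsP /(_ 1 ltr01) [r r0 hr] := cf p.
pose M := nc (f p) + 1.
have M0 : 0 < M by rewrite ltr_wpDl ?normc_ge0.
(* Half-perimeters are at most [4 r'], so [rint_le] gives [16 M r' <= e]; [r / 3] keeps the square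
   inside the disc on which [|f| <= M]. *)
pose r' := Num.min (r / 3) (e / (16 * M)).
have r'0 : 0 < r' by rewrite lt_min !divr_gt0 // mulr_gt0.
have r'r : r' <= r / 3 by rewrite ge_min lexx.
have r'e : r' <= e / (16 * M) by rewrite ge_min lexx orbT.
exists r' => // a b c d ab cd ra br rc dr.
apply: (@le_trans _ _ (4 * M * ((b - a) + (d - c)))); last first.
  move: r'e; rewrite ler_pdivlMr ?mulr_gt0 // => r'e.
  apply: le_trans r'e; rewrite [4 * M]mulrC -mulrA mulrA [r' * _]mulrC -!mulrA.
  rewrite [16 * _]mulrCA ler_pM2l //; lra.
apply: rint_le => // x y /andP[ax xb] /andP[cy yd].
have /ltW : nc (f (x +i* y) - f p) < 1.
  apply: hr; apply: (le_lt_trans (nc_ReIm _)); rewrite ReD ImD ReN ImN /=.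
  apply: (@le_lt_trans _ _ (r' + r')); last lra.
  by apply: lerD; rewrite ler_norml; apply/andP; split; lra.
by have := nc_subl (f (x +i* y)) (f p); rewrite /M; lra.
Qed.

(** Cutting along the sides of a small square around [p] leaves four outer rectangles with integral
    0 and an inner one that is small by continuity at [p]. *)
Lemma goursat_except f p a b c d : (forall z, ccont f z) -> a <= b -> c <= d ->
  (forall x y, a <= x <= b -> c <= y <= d -> x +i* y != p ->
    derivable f (x +i* y) 1) ->
  rint f a b c d = 0.
Proof.
move=> cf ab cd df; apply/eqP; rewrite -nc_eq0 eq_le normc_ge0 andbT.
apply/ler_addgt0Pl => e e0; rewrite addr0.
have [r r0 hr] := rint_small p cf e0.
(* The cuts are clamped to the sides of the rectangle: outer pieces may degenerate, which covers
   every position of [p], inside or outside. *)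
pose clip (u v q : R) := Num.min v (Num.max u q).
have clipP u v q : u <= v -> [/\ u <= clip u v q, clip u v q <= v,
    clip u v q <= q \/ clip u v q = u & q <= clip u v q \/ clip u v q = v].
  move=> uv; rewrite /clip; case: (leP u q) => uq.
    case: (leP v q) => vq; split => //;
      first [by left|by right|by left; lra|by right; lra|lra].
  case: (leP v u) => vq; split => //;
    first [by left|by right|by left; lra|by right; lra|lra].
have clip_mono u v q q' : q <= q' -> clip u v q <= clip u v q'.
  move=> qq; rewrite /clip le_min ge_min lexx /= ge_min; apply/orP; right.
  by rewrite ge_max !le_max lexx qq orbT.
set px := complex.Re p in hr; set py := complex.Im p in hr.
have [x1 x2 x3 x4] := clipP a b (px - r) ab.
have [y1 y2 y3 y4] := clipP a b (px + r) ab.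
have mx : clip a b (px - r) <= clip a b (px + r) by apply: clip_mono; lra.
move: (clip a b (px - r)) (clip a b (px + r)) x1 x2 x3 x4 y1 y2 y3 y4 mx.
move=> m1 m2 x1 x2 x3 x4 y1 y2 y3 y4 mx.
have [x1' x2' x3' x4'] := clipP c d (py - r) cd.
have [y1' y2' y3' y4'] := clipP c d (py + r) cd.
have my : clip c d (py - r) <= clip c d (py + r) by apply: clip_mono; lra.
move: (clip c d (py - r)) (clip c d (py + r)) x1' x2' x3' x4' y1' y2' y3' y4' my.
move=> n1 n2 x1' x2' x3' x4' y1' y2' y3' y4' my.
have neqx x y : x != px -> x +i* y != p.
  by move=> h; apply/eqP => E; move: h; rewrite /px -E eqxx.
have neqy x y : y != py -> x +i* y != p.
  by move=> h; apply/eqP => E; move: h; rewrite /py -E eqxx.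
rewrite (rint_cut_x _ _ m1) (rint_cut_x _ m1 m2).
have -> : rint f a m1 c d = 0.
  case: x3 => [x3|->]; last by rewrite rint_xx.
  apply: goursat => // x y hx hy; apply: df; [lra|lra|].
  by apply: neqx; lra.
have -> : rint f m2 b c d = 0.
  case: y4 => [y4|->]; last by rewrite rint_xx.
  apply: goursat => // x y hx hy; apply: df; [lra|lra|].
  by apply: neqx; lra.
rewrite add0r addr0 (rint_cut_y _ _ _ _ n1) (rint_cut_y _ _ _ n1 n2).
have -> : rint f m1 m2 c n1 = 0.
  case: x3' => [x3'|->]; last by rewrite rint_yy.
  apply: goursat => // x y hx hy; apply: df; [lra|lra|].
  by apply: neqy; lra.
have -> : rint f m1 m2 n2 d = 0.
  case: y4' => [y4'|->]; last by rewrite rint_yy.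
  apply: goursat => // x y hx hy; apply: df; [lra|lra|].
  by apply: neqy; lra.
rewrite add0r addr0.
have [->|nx] := eqVneq m1 m2; first by rewrite rint_xx nc0 ltW.
have [->|ny] := eqVneq n1 n2; first by rewrite rint_yy nc0 ltW.
have x5 : px - r <= m1.
  by case: x4 => // m1b; case/eqP: nx; apply/le_anti; rewrite mx m1b.
have y5 : m2 <= px + r.
  by case: y3 => // m2a; case/eqP: nx; apply/le_anti; rewrite mx m2a.
have x5' : py - r <= n1.
  by case: x4' => // n1b; case/eqP: ny; apply/le_anti; rewrite my n1b.
have y5' : n2 <= py + r.
  by case: y3' => // n2a; case/eqP: ny; apply/le_anti; rewrite my n2a.
exact: hr.
Qed.

Lemma between_dist (x x' t : R) :
  Num.min x x' <= t <= Num.max x x' -> `|t - x| <= `|x' - x|.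
Proof.
have [xx|xx] := leP x x'; rewrite ?min_l ?max_r // ?min_r ?max_l ?(ltW xx) // => h.
  by rewrite !ger0_norm; lra.
by rewrite !ler0_norm; lra.
Qed.

(** The primitive integrates horizontally, then vertically. Vanishing rectangle integrals turn its
    increment into an integral along an L-shaped path from [z] to [z'], where [f] is close to
    [f z]. *)
Lemma box_primitive f p z0 (r : R) : (forall z, ccont f z) ->
  (forall z, `|complex.Re (z - z0)| < r -> `|complex.Im (z - z0)| < r ->
    z != p -> derivable f z 1) ->
  exists F, forall z, `|complex.Re (z - z0)| < r ->
    `|complex.Im (z - z0)| < r -> cder F z (f z).
Proof.
move=> cf df.
pose x0 := complex.Re z0; pose y0 := complex.Im z0.
have box x y : `|complex.Re (x +i* y - z0)| < r ->
    `|complex.Im (x +i* y - z0)| < r -> `|x - x0| < r /\ `|y - y0| < r.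
  by rewrite ReD ImD ReN ImN.
have zero a b c d : `|a - x0| < r -> `|b - x0| < r -> `|c - y0| < r ->
    `|d - y0| < r -> rint f a b c d = 0.
  wlog ab : a b / a <= b.
    move=> H; have [/H//|/ltW/H h] := leP a b => *.
    suff -> : rint f a b c d = - rint f b a c d by rewrite h ?oppr0.
    by rewrite /rint /hint /cint; ring.
  wlog cd : c d / c <= d.
    move=> H; have [/H//|/ltW/H h] := leP c d => *.
    suff -> : rint f a b c d = - rint f a b d c by rewrite h ?oppr0.
    by rewrite /rint /vint /cint; ring.
  rewrite !ltr_norml => ha hb hc hd.
  apply: (@goursat_except _ p) => // x y hx hy; apply: df.
    by rewrite ReD ReN /= ltr_norml -/x0; lra.
  by rewrite ImD ImN /= ltr_norml -/y0; lra.
exists (fun z => hint f y0 x0 (complex.Re z) + vint f (complex.Re z) y0 (complex.Im z)).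
move=> [x y] /box H1 /H1 [{H1} hx hy] e e0.
have r0 : 0 < r by apply: le_lt_trans hx.
(* Each leg of the L contributes at most [2 * (e / 8)] times the distance. *)
have /ccont_epsP /(_ (e / 8)) := cf (x +i* y).
case=> [|d d0 hd]; first by rewrite divr_gt0.
pose d' := Num.min (d / 2) (Num.min (r - `|x - x0|) (r - `|y - y0|)).
have d'0 : 0 < d' by rewrite !lt_min !subr_gt0 hx hy divr_gt0.
exists d' => // -[x' y']; rewrite /d' !lt_min.
set w := nc _ => /and3P[wd wx wy].
have xw : `|x' - x| <= w by rewrite /w (le_trans _ (nc_Re _)) // ReD ReN.
have yw : `|y' - y| <= w by rewrite /w (le_trans _ (nc_Im _)) // ImD ImN.
have hx' : `|x' - x0| < r by have := ler_distD x x' x0; lra.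
have hy' : `|y' - y0| < r by have := ler_distD y y' y0; lra.
have hx0 : `|x0 - x0| < r by rewrite subrr normr0.
have hy0 : `|y0 - y0| < r by rewrite subrr normr0.
have z := zero x x' y0 y hx hx' hy0 hy.
pose g v := f v - f (x +i* y).
have cg : (forall z, ccont g z).
  by move=> v; apply: ccontB; [exact: cf|exact: ccont_cst].
have -> : hint f y0 x0 x' + vint f x' y0 y' - (hint f y0 x0 x + vint f x y0 y)
    - f (x +i* y) * ((x' +i* y') - (x +i* y)) = hint g y x x' + vint g x' y y'.
  have hg : hint g y x x' = hint f y x x' - f (x +i* y) * (x' - x)%:C.
    rewrite /hint cintB; last 2 first.
    - exact: hline_cont.
    - exact: rcont_cst.
    congr (_ - _); rewrite (@cint_FTC _ (fun t => f (x +i* y) * t%:C)).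
    - by rewrite -mulrBr rmorphB.
    - exact: rcont_cst.
    - by move=> t; apply: rder_eq (rderZ _ (rder_id t)) _; rewrite mulr1.
  have vg : vint g x' y y' = vint f x' y y' - 'i%C * f (x +i* y) * (y' - y)%:C.
    rewrite /vint cintB; last 2 first.
    - exact: vline_cont.
    - exact: rcont_cst.
    rewrite mulrBr; congr (_ - _); rewrite -mulrA; congr (_ * _).
    rewrite (@cint_FTC _ (fun t => f (x +i* y) * t%:C)).
    - by rewrite -mulrBr rmorphB.
    - exact: rcont_cst.
    - by move=> t; apply: rder_eq (rderZ _ (rder_id t)) _; rewrite mulr1.
  have -> : (x' +i* y') - (x +i* y) = (x' - x)%:C + 'i%C * (y' - y)%:C.
    by rewrite [LHS]complexE ReD ImD ReN ImN.
  rewrite hg vg -[LHS]subr0 -z /rint /vint /hint /cint; ring.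
have hM : nc (hint g y x x') <= 2 * (e / 8) * `|x' - x|.
  apply: cint_le; first exact: hline_cont.
  move=> t /between_dist tx; apply/ltW/hd.
  apply: (le_lt_trans (nc_ReIm _)); rewrite ReD ImD ReN ImN /= subrr normr0; lra.
have vM : nc (vint g x' y y') <= 2 * (e / 8) * `|y' - y|.
  rewrite ncM nci mul1r; apply: cint_le; first exact: vline_cont.
  move=> t /between_dist ty; apply/ltW/hd.
  apply: (le_lt_trans (nc_ReIm _)); rewrite ReD ImD ReN ImN /=; lra.
apply: (le_trans (nc_leD _ _)).
apply: (@le_trans _ _ (2 * (e / 8) * w + 2 * (e / 8) * w)); last first.
  have : 0 <= e * w by rewrite mulr_ge0 ?normc_ge0 // ltW.
  lra.
by apply: (le_trans (lerD hM vM)); apply: lerD; rewrite ler_wpM2l // mulr_ge0 // divr_ge0 // ltW.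
Qed.

End Goursat.

(** * The unit circle *)

Section Circle.
Context {R : realType}.
Local Notation C := R[i].
Local Notation nc := (@Normc.normc R).
Implicit Types (t : R) (a z : C).

Definition cis (t : R) : C := cos t +i* sin t.

Lemma rder_cis t : rder cis t ('i%C * cis t).
Proof.
apply/rderP; split.
  have -> : complex.Re ('i%C * cis t) = - sin t by rewrite cReM /= mul0r mul1r sub0r.
  exact: is_derive_cos.
have -> : complex.Im ('i%C * cis t) = cos t by rewrite cImM /= mul0r mul1r add0r.
exact: is_derive_sin.
Qed.

Lemma nc_cis t : nc (cis t) = 1.
Proof. by rewrite /= cos2Dsin2 sqrtr1. Qed.

Lemma cis_neq0 t : cis t != 0.
Proof. by rewrite -nc_gt0 nc_cis ltr01. Qed.

Lemma cis0 : cis 0 = 1.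
Proof. by rewrite /cis cos0 sin0. Qed.

Lemma cis2pi : cis (2 * pi) = 1.
Proof. by rewrite /cis mulr_natl cos2pi sin2pi. Qed.

Lemma rcont_cis : rcont cis.
Proof. exact: rder_rcont rder_cis. Qed.

Lemma pi2_gt0 : 0 < 2 * pi :> R.
Proof. by rewrite mulr_gt0 // pi_gt0. Qed.

End Circle.

(** * Cauchy integrals over a circle *)

Section CauchyIntegral.
Context {R : realType}.
Local Notation C := R[i].
Local Notation nc := (@Normc.normc R).
Variable r : R.
Hypothesis r0 : 0 < r.
Implicit Types (g : R -> C) (a b z : C) (N : nat) (t : R).

Let eta t : C := (r%:C * cis t)^-1.

Let rC0 : r%:C != 0 :> C.
Proof. by rewrite -nc_gt0 nc_real gtr0_norm. Qed.

Let eta_neq0 t : eta t != 0.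
Proof. by rewrite invr_eq0 mulf_neq0 // cis_neq0. Qed.

Let nc_eta t : nc (eta t) = r^-1.
Proof. by rewrite Defs.normcV ncM nc_cis mulr1 nc_real gtr0_norm. Qed.

Let rder_eta t : rder eta t (- 'i%C * eta t).
Proof.
have h := rderZ r%:C (rder_cis t).
have k : cder (fun z : C => z^-1) (r%:C * cis t) (- 1 / (r%:C * cis t) ^+ 2).
  by apply: cderV (cder_id _); rewrite mulf_neq0 // cis_neq0.
apply: rder_eq (rder_comp h k) _; rewrite /eta; have c0 := cis_neq0 t.
by field; rewrite rC0 c0.
Qed.

Let rcont_eta : rcont eta.
Proof. exact: rder_rcont rder_eta. Qed.

Let den_neq0 a t : nc a < r -> 1 - a * eta t != 0.
Proof.
move=> ar; rewrite subr_eq0; apply/negP => /eqP h.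
have := nc1 (R := R); rewrite h ncM nc_eta => /eqP.
by rewrite lt_eqF // ltr_pdivrMr // mul1r.
Qed.

Let nc_den a t : 1 - nc a / r <= nc (1 - a * eta t).
Proof. by have := nc_subl 1 (a * eta t); rewrite nc1 ncM nc_eta. Qed.

Let kern N a t : C := eta t ^+ N / (1 - a * eta t).

Let rcont_den a : rcont (fun t => 1 - a * eta t).
Proof.
apply: rcontB; first exact: rcont_cst.
by apply: rcontM => //; exact: rcont_cst.
Qed.

Let rcont_kern N a : nc a < r -> rcont (kern N a).
Proof.
move=> ar; apply: rcontM; first exact: rcontX.
by apply: rcontV; [move=> t; exact: den_neq0|exact: rcont_den].
Qed.

(* With [z = r e^(it)]: the integral over the circle of radius [r] of
   [g / (z^N (z - a))], normalised so that [g = f] and [N = 0] gives Cauchy's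
   formula. *)
Definition cauchy_integral g N a : C :=
  cint (fun t => g t * kern N a t) 0 (2 * pi) / (2 * pi)%:C.

Local Notation A := cauchy_integral.

Let tpi0 : (2 * pi)%:C != 0 :> C.
Proof. by rewrite -nc_gt0 nc_real normr_gt0 gt_eqF // pi2_gt0. Qed.

(** One step of the geometric series, [1 / (1 - q) = 1 + q / (1 - q)] with [q = a / z] under the
    integral. Iterating it produces Taylor coefficients and remainders without any infinite
    series. *)
Lemma cauchy_integral_rec g N a : rcont g -> nc a < r ->
  A g N a = A g N 0 + a * A g N.+1 a.
Proof.
move=> cg ar; have n0 : nc (0 : C) < r by rewrite nc0.
rewrite /A [a * _]mulrA -cintZ; last first.
  by apply: rcontM => //; exact: rcont_kern.
rewrite -mulrDl -cintD; last 2 first.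
- by apply: rcontM => //; exact: rcont_kern.
- apply: rcontM; first exact: rcont_cst.
  by apply: rcontM => //; exact: rcont_kern.
congr (_ / _); congr cint; apply/funext => t; rewrite /kern.
have d := den_neq0 t ar; rewrite exprS mul0r subr0; field.
exact: d.
Qed.

Lemma cauchy_integral_le g N a M : rcont g -> nc a < r ->
  (forall t, nc (g t) <= M) ->
  nc (A g N a) <= 2 * M * r^-1 ^+ N / (1 - nc a / r).
Proof.
move=> cg ar gM; have d0 : 0 < 1 - nc a / r.
  by rewrite subr_gt0 ltr_pdivrMr // mul1r.
have p0 := @pi2_gt0 R.
rewrite nc_div nc_real gtr0_norm // ler_pdivrMr //.
apply: (le_trans (cint_le (M := M * r^-1 ^+ N / (1 - nc a / r)) _ _)).
- by apply: rcontM => //; exact: rcont_kern.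
- move=> t _; rewrite ncM nc_div ncX nc_eta -mulrA.
  have M0 : 0 <= M by apply: le_trans (gM 0); exact: normc_ge0.
  apply: ler_pM => //; rewrite ?normc_ge0 ?divr_ge0 ?exprn_ge0 ?invr_ge0 ?normc_ge0 //.
    exact: ltW.
  apply: ler_wpM2l; first by rewrite exprn_ge0 // invr_ge0 ltW.
  by rewrite lef_pV2 ?posrE ?nc_den // (lt_le_trans d0) // nc_den.
by rewrite subr0 gtr0_norm // !mulrA.
Qed.

Lemma geometric_small (q K e : R) : 0 <= q < 1 -> 0 < e ->
  exists n, K * q ^+ n < e.
Proof.
move=> /andP[q0 q1] e0; have := @cvg_geometric R K q.
rewrite ger0_norm // => /(_ q1) /cvgrPdist_lt /(_ _ e0) [n _ /(_ n (leqnn n))] /=.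
rewrite sub0r normrN => hn; exists n; exact: le_lt_trans (ler_norm _) hn.
Qed.

Lemma cauchy_integral_factor g N n a : rcont g -> nc a < r ->
  (forall k, (k < n)%N -> A g (N + k) 0 = 0) -> A g N a = a ^+ n * A g (N + n) a.
Proof.
move=> cg ar; elim: n => [|n IH] z; first by rewrite addn0 expr0 mul1r.
rewrite IH => [|k kn]; last by apply: z; rewrite ltnS ltnW.
by rewrite cauchy_integral_rec // z // add0r mulrA -exprSr addnS.
Qed.

(** If all coefficients vanish, [n] steps of the recursion leave a factor [(|a| / r)^n] times a
    bounded integral. *)
Lemma cauchy_integral_zero g N a M : rcont g -> nc a < r ->
  (forall t, nc (g t) <= M) ->
  (forall k, A g (N + k) 0 = 0) -> A g N a = 0.
Proof.
move=> cg ar gM z.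
apply/eqP; rewrite -nc_eq0 eq_le normc_ge0 andbT; apply/ler_addgt0Pl => e e0.
have d0 : 0 < 1 - nc a / r by rewrite subr_gt0 ltr_pdivrMr // mul1r.
have q01 : 0 <= nc a / r < 1.
  by rewrite divr_ge0 ?normc_ge0 ?(ltW r0) // ltr_pdivrMr // mul1r.
have [n hn] := geometric_small (2 * M * r^-1 ^+ N / (1 - nc a / r)) q01 e0.
rewrite (@cauchy_integral_factor _ _ n) // ncM ncX addr0.
apply: le_trans (ltW hn).
apply: (le_trans (ler_wpM2l _ (cauchy_integral_le (N + n) cg ar gM))).
  by rewrite exprn_ge0 // normc_ge0.
by rewrite le_eqVlt; apply/orP; left; apply/eqP; rewrite exprD exprMn; ring.
Qed.

Lemma cint_eta_pow N : cint (fun t => eta t ^+ N.+1) 0 (2 * pi) = 0.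
Proof.
pose F t := ('i%C / N.+1%:R) * eta t ^+ N.+1.
have N0 : N.+1%:R != 0 :> C by rewrite pnatr_eq0.
rewrite (@cint_FTC R F).
- by rewrite /F /eta cis2pi cis0 subrr.
- exact: rcontX.
- move=> t; apply: rder_eq (rderZ _ (rder_comp (rder_eta t) (cderX N.+1 (cder_id _)))) _.
  rewrite /= exprS; field : (@sqr_i R).
  by [].
Qed.

Lemma cauchy_integral1 a : nc a < r -> A (fun=> 1) 0%N a = 1.
Proof.
move=> ar; have c1 := rcont_cst (1 : C).
rewrite cauchy_integral_rec // (@cauchy_integral_zero _ 1%N a 1) //.
- rewrite mulr0 addr0 /A (_ : (fun t => _) = (fun=> 1)); last first.
    by apply/funext => t; rewrite /kern expr0 mul0r subr0 divr1 mulr1.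
  rewrite (@cint_FTC R (fun t => t%:C)) //; first by rewrite subr0 divff.
  by move=> t; exact: rder_id.
- by move=> t; rewrite nc1.
- move=> k; rewrite /A (_ : (fun t => _) = (fun t => eta t ^+ k.+1)); last first.
    by apply/funext => t; rewrite /kern mul0r subr0 divr1 mul1r add1n.
  by rewrite cint_eta_pow mul0r.
Qed.

Let kern' N a t : C := eta t ^+ N.+1 / (1 - a * eta t) ^+ 2.

Let rcont_kern' N a : nc a < r -> rcont (kern' N a).
Proof.
move=> ar; apply: rcontM; first exact: rcontX.
apply: rcontV; first by move=> t; rewrite expf_neq0 // den_neq0.
by apply: rcontX; exact: rcont_den.
Qed.

(** Differentiation under the integral, made exact: subtracting the linear term from the difference
    of the kernels at [b] and [a] leaves [(b - a)^2] times a kernel bounded near [a]. *)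
Lemma cauchy_integral_cder g N a M : rcont g -> nc a < r ->
  (forall t, nc (g t) <= M) ->
  exists2 l, cder (A g N) a l &
    nc l <= 2 * M * (r^-1 ^+ N.+1 / (1 - nc a / r) ^+ 2).
Proof.
move=> cg ar gM; have d0 : 0 < 1 - nc a / r.
  by rewrite subr_gt0 ltr_pdivrMr // mul1r.
have p0 := @pi2_gt0 R.
have M0 : 0 <= M by apply: le_trans (gM 0); exact: normc_ge0.
have dt t : 1 - nc a / r <= nc (1 - a * eta t) by exact: nc_den.
set d := 1 - nc a / r in d0 dt *.
have bnd (x : R -> C) K : rcont x -> (forall t, nc (x t) <= K) ->
    nc (cint x 0 (2 * pi) / (2 * pi)%:C) <= 2 * K.
  move=> cx xK; rewrite nc_div nc_real gtr0_norm // ler_pdivrMr //.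
  have := @cint_le R x 0 (2 * pi) K cx; rewrite subr0 gtr0_norm //; apply.
  by move=> t _; exact: xK.
exists (cint (fun t => g t * kern' N a t) 0 (2 * pi) / (2 * pi)%:C); last first.
  rewrite -mulrA; apply: bnd; first by apply: rcontM => //; exact: rcont_kern'.
  move=> t; rewrite ncM nc_div !ncX nc_eta; apply: ler_pM => //.
  - exact: normc_ge0.
  - by rewrite divr_ge0 ?exprn_ge0 ?normc_ge0 // invr_ge0 ltW.
  - rewrite ler_wpM2l ?exprn_ge0 ?invr_ge0 ?(ltW r0) //.
    rewrite lef_pV2 ?posrE ?exprn_gt0 //; last exact: lt_le_trans (dt t).
    by rewrite ler_sqr ?nnegrE ?normc_ge0 // ltW.
move=> e e0.
pose K := 2 * (M * (r^-1 ^+ N.+2 / (d ^+ 2 * (d / 2)))).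
have K0 : 0 <= K.
  have d2 : 0 <= d / 2 by rewrite divr_ge0 // ltW.
  rewrite /K mulr_ge0 // mulr_ge0 // divr_ge0 //.
    by rewrite exprn_ge0 // invr_ge0 ltW.
  by rewrite mulr_ge0 // exprn_ge0 // ltW.
(* The first bound keeps [|1 - b eta|] above [d / 2], half of its lower bound at [a]; the second
   absorbs the bound [K] of the remainder kernel. *)
pose D := Num.min (d * r / 2) (e / (K + 1)).
have D0 : 0 < D by rewrite lt_min !divr_gt0 ?mulr_gt0 // ltr_wpDl.
exists D => // b; rewrite /D lt_min => /andP[bd be].
have ba : nc b <= nc a + nc (b - a) by rewrite addrC; have := nc_leD (b - a) a; rewrite subrK.
have dr : d * r = r - nc a by rewrite /d mulrBl mul1r divfK // gt_eqF.
have br : nc b < r by move: bd ba; rewrite dr; have := normc_ge0 a; lra.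
have db t : d / 2 <= nc (1 - b * eta t).
  apply: le_trans (nc_den b t).
  have -> : 1 - nc b / r = (r - nc b) / r by rewrite [RHS]mulrBl divff ?gt_eqF.
  rewrite ler_pdivlMr // mulrAC dr; move: bd ba; rewrite dr; lra.
have -> : A g N b - A g N a -
    cint (fun t => g t * kern' N a t) 0 (2 * pi) / (2 * pi)%:C * (b - a) =
    (b - a) ^+ 2 * (cint (fun t => g t * (eta t ^+ N.+2 /
      ((1 - a * eta t) ^+ 2 * (1 - b * eta t)))) 0 (2 * pi) / (2 * pi)%:C).
  rewrite [_ / _ * (b - a)]mulrAC [_ * (_ / _)]mulrA -mulrBl -mulrBl.
  congr (_ / _); rewrite [_ * (b - a)]mulrC -!cintZ; last 2 first.
  - apply: rcontM => //; apply: rcontM; first exact: rcontX.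
    apply: rcontV => [t|]; first by rewrite mulf_neq0 // ?expf_neq0 ?den_neq0.
    by apply: rcontM; [apply: rcontX|]; exact: rcont_den.
  - by apply: rcontM => //; exact: rcont_kern'.
  have c1 : rcont (fun t => g t * kern N a t) by apply: rcontM (rcont_kern _ ar).
  have c2 : rcont (fun t => g t * kern N b t) by apply: rcontM (rcont_kern _ br).
  have c3 : rcont (fun t => (b - a) * (g t * kern' N a t)).
    by apply: rcontM (rcont_cst _) _; apply: rcontM (rcont_kern' _ ar).
  rewrite -!cintB; try first [exact: c1|exact: c2|exact: c3|exact: rcontB c2 c1].
  congr cint; apply/funext => t; rewrite /kern /kern' !exprS.
  have := den_neq0 t ar; have := den_neq0 t br => h1 h2.
  by field; rewrite h1 h2.
rewrite ncM ncX.
have h : nc (cint (fun t => g t * (eta t ^+ N.+2 /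
      ((1 - a * eta t) ^+ 2 * (1 - b * eta t)))) 0 (2 * pi) / (2 * pi)%:C) <= K.
  apply: bnd => [|t].
    apply: rcontM => //; apply: rcontM; first exact: rcontX.
    apply: rcontV => [t|]; first by rewrite mulf_neq0 // ?expf_neq0 ?den_neq0.
    by apply: rcontM; [apply: rcontX|]; exact: rcont_den.
  rewrite ncM nc_div ncX [nc (_ * (1 - b * eta t))]ncM ncX nc_eta.
  have i0 : 0 <= r^-1 by rewrite invr_ge0 ltW.
  have d2 : 0 < d / 2 by rewrite divr_gt0.
  have u0 := lt_le_trans d0 (dt t); have v0 := lt_le_trans d2 (db t).
  apply: ler_pM; [exact: normc_ge0| |exact: gM|].
    by rewrite divr_ge0 ?exprn_ge0 ?mulr_ge0 ?exprn_ge0 ?normc_ge0.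
  apply: ler_wpM2l; first exact: exprn_ge0.
  rewrite lef_pV2 ?posrE ?mulr_gt0 ?exprn_gt0 //.
  apply: ler_pM; rewrite ?exprn_ge0 ?(ltW d2) ?(ltW d0) //.
  by rewrite ler_sqr ?nnegrE ?normc_ge0 // ltW.
apply: (le_trans (ler_wpM2l _ h)); first by rewrite exprn_ge0 ?normc_ge0.
have n0 := normc_ge0 (b - a).
rewrite expr2 -mulrA mulrC ler_wpM2r // mulrC.
apply: (@le_trans _ _ ((e / (K + 1)) * (K + 1))); last first.
  by rewrite divfK // gt_eqF // ltr_wpDl.
by rewrite mulrC; apply: ler_pM => //; [exact: ltW|rewrite lerDl].
Qed.

End CauchyIntegral.

(** * Cauchy's integral formula *)

Section Cauchy.
Context {R : realType}.
Local Notation C := R[i].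
Local Notation nc := (@Normc.normc R).
Implicit Types (f F : C -> C) (a b c z w : C) (r s x y : R).

(** Applied to both coordinates, this gives the continuous retraction [squeeze] of the plane onto a
    square. Composing with it makes a function continuous on the whole plane, as [box_primitive]
    asks, and leaves it unchanged on the square. *)
Let clamp (s x : R) : R := Num.max (- s) (Num.min s x).

Let clamp_id s x : `|x| <= s -> clamp s x = x.
Proof.
rewrite ler_norml => /andP[sx xs]; rewrite /clamp min_r // max_r //.
Qed.

Let clamp_le s x : 0 <= s -> `|clamp s x| <= s.
Proof.
move=> s0; rewrite /clamp ler_norml le_max lexx /= ge_max ge_min lexx andbT.
lra.
Qed.

Let clamp_lip s x y : `|clamp s x - clamp s y| <= `|x - y|.
Proof.
wlog xy : x y / x <= y.
  move=> h; case/orP: (le_total x y) => [/h//|/h].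
  by rewrite distrC [`|y - x|]distrC.
have -> : `|x - y| = y - x by rewrite distrC ger0_norm ?subr_ge0.
rewrite /clamp; have [?|?] := leP s x; have [?|?] := leP s y;
  have [?|?] := leP (- s) s; have [?|?] := leP (- s) x;
  have [?|?] := leP (- s) y; rewrite ler_norml; lra.
Qed.

Let squeeze (s : R) z : C := clamp s (complex.Re z) +i* clamp s (complex.Im z).

Let squeeze_ccont s z : ccont (squeeze s) z.
Proof.
apply/ccont_epsP => e e0; exists (e / 2); first by rewrite divr_gt0.
move=> w wz; apply: (le_lt_trans (nc_ReIm _)); rewrite ReD ImD ReN ImN /=.
apply: (@le_lt_trans _ _ (nc (w - z) + nc (w - z))); last by lra.
apply: lerD; apply: (le_trans (clamp_lip _ _ _)).
  by rewrite -ReN -ReD nc_Re.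
by rewrite -ImN -ImD nc_Im.
Qed.

Let squeeze_id s z : `|complex.Re z| <= s -> `|complex.Im z| <= s ->
  squeeze s z = z.
Proof. by move=> h k; rewrite /squeeze !clamp_id // -complex_eta. Qed.

Let squeeze_le s z : 0 <= s -> nc (squeeze s z) ^+ 2 <= 2 * s ^+ 2.
Proof.
move=> s0; rewrite nc_sqr /= mulr_natl mulr2n.
by apply: lerD; rewrite -[leLHS]real_normK ?num_real // ler_sqr ?nnegrE // clamp_le.
Qed.

Lemma ccont_bounded f c r : (forall z, nc (z - c) <= r -> ccont f z) ->
  exists M, forall z, nc (z - c) <= r -> nc (f z) <= M.
Proof.
move=> cf.
have /compact_normc [M _ hM] : compact ((fun z => f (c + z)) @` [set z : C | nc z <= r]).
  apply: continuous_compact; last exact: compact_disc.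
  apply: continuous_in_subspaceT => z; rewrite inE /= => zr.
  have : ccont (fun z => f (c + z)) z.
    apply: (ccont_comp (F := f)).
      by apply: ccontD; [exact: ccont_cst|exact: ccont_id].
    by apply: cf; rewrite addrC addrA addNr add0r.
  by case.
exists M => z zr; apply: hM; exists (z - c) => //=.
by rewrite addrC subrK.
Qed.

Lemma diff_quotient_ccont f a : (forall l, cder f a l ->
  ccont (fun z => if z == a then l else (f z - f a) / (z - a)) a).
Proof.
move=> l h; apply/ccont_epsP => e e0.
have [d d0 hd] := h (e / 2) (divr_gt0 e0 (ltr0n _ 2)).
exists d => // w /hd {}hd; rewrite eqxx; case: eqVneq => [_|wa].
  by rewrite subrr nc0.
have wa0 : w - a != 0 by rewrite subr_eq0.
have -> : (f w - f a) / (w - a) - l = (f w - f a - l * (w - a)) / (w - a).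
  by field.
rewrite nc_div ltr_pdivrMr ?nc_gt0 //; apply: (le_lt_trans hd).
by rewrite ltr_pM2r ?nc_gt0 //; lra.
Qed.

(** The quotient [(f z - f a) / (z - a)], completed at [a], is continuous and differentiable
    elsewhere, so the exceptional point allowed in [box_primitive] yields a primitive and its circle
    integral is 0. What remains is [f a] times [cauchy_integral1]. *)
Lemma cauchy_formula f r a : 0 < r ->
  (forall z, nc z < 2 * r -> derivable f z 1) -> nc a < r ->
  f a = cauchy_integral r (fun t => f (r%:C * cis t)) 0%N a.
Proof.
move=> r0 df ar.
pose q z := if z == a then 'D_1 f a else (f z - f a) / (z - a).
have dfa : cder f a ('D_1 f a).
  by apply/derivable_cder/df; move: ar r0; lra.
have dq z : nc z < 2 * r -> z != a -> derivable q z 1.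
  move=> zr za; have za0 : z - a != 0 by rewrite subr_eq0.
  have h : cder (fun z => (f z - f a) / (z - a)) z _ :=
    cderM (cderB (derivable_cder (df _ zr)) (cder_cst (f a) z))
      (cderV (F := fun w => w - a) za0 (cderB (cder_id z) (cder_cst a z))).
  apply: cder_derivable (cder_near _ h).
  have := near_complex_neq0 za0 => /nbhs_cP [d d0 hd].
  apply/nbhs_cP; exists (nc (z - a)); first by rewrite nc_gt0.
  move=> w; rewrite /q; case: eqVneq => // ->; rewrite normcB.
  by rewrite ltxx.
have cq z : nc z < 2 * r -> ccont q z.
  move=> zr; have [->|za] := eqVneq z a; first exact: diff_quotient_ccont.
  by apply: cder_ccont (derivable_cder (dq _ zr za)).
(* The square of half-side [5 r / 4] contains the circle of radius [r] and lies in the disc of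
   radius [2 r], since [2 * (5 / 4)^2 < 4]. *)
pose s : R := 5 / 4 * r.
have s0 : 0 <= s by rewrite /s; lra.
have sq z : nc (squeeze s z) < 2 * r.
  rewrite -ltr_sqr ?nnegrE ?normc_ge0 ?mulr_ge0 ?(ltW r0) //.
  apply: (le_lt_trans (squeeze_le z s0)); rewrite /s !exprMn.
  have : 0 < r ^+ 2 by rewrite exprn_gt0.
  lra.
have [||F hF] := @box_primitive R (fun z => q (squeeze s z)) a 0 s.
- by move=> z; apply: ccont_comp; [exact: squeeze_ccont|exact: cq].
- move=> z; rewrite subr0 => zs1 zs2 za.
  have zr : nc z < 2 * r by rewrite -(@squeeze_id s z) ?ltW.
  apply: cder_derivable (cder_near _ (derivable_cder (dq z zr za))).
  apply/nbhs_cP; exists (Num.min (s - `|complex.Re z|) (s - `|complex.Im z|)).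
    by rewrite lt_min !subr_gt0 zs1.
  move=> w; rewrite lt_min => /andP[w1 w2]; rewrite squeeze_id //.
    have /= := ler_normD (complex.Re (w - z)) (complex.Re z).
    rewrite -ReD subrK; have := nc_Re (w - z); lra.
  have /= := ler_normD (complex.Im (w - z)) (complex.Im z).
  rewrite -ImD subrK; have := nc_Im (w - z); lra.
have zr t : nc (r%:C * cis t) = r by rewrite ncM nc_cis mulr1 nc_real gtr0_norm.
have rs : r < s by rewrite /s; lra.
have in1 t : `|complex.Re (r%:C * cis t)| < s.
  by apply: le_lt_trans rs; rewrite -{2}(zr t) nc_Re.
have in2 t : `|complex.Im (r%:C * cis t)| < s.
  by apply: le_lt_trans rs; rewrite -{2}(zr t) nc_Im.
have rc : rcont (fun t => r%:C * cis t).
  by apply: rcontM rcont_cis; exact: rcont_cst.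
have r2 t : nc (r%:C * cis t) < 2 * r by rewrite zr; lra.
have cf : rcont (fun t => f (r%:C * cis t)).
  apply: rcont_comp rc _ => t.
  exact: cder_ccont (derivable_cder (df _ (r2 t))).
have rcis0 t : r%:C * cis t != 0 by rewrite -nc_gt0 zr.
have neq t : r%:C * cis t != a.
  by apply/eqP => E; move: ar; rewrite -E zr ltxx.
have neq0 t : 1 - a * (r%:C * cis t)^-1 != 0.
  by rewrite -(divff (rcis0 t)) -mulrBl mulf_neq0 ?invr_eq0 // subr_eq0.
have ck : rcont (fun t => 1 / (1 - a * (r%:C * cis t)^-1)).
  apply: rcontM; first exact: rcont_cst.
  apply: rcontV => //; apply: rcontB; first exact: rcont_cst.
  by apply: rcontM; [exact: rcont_cst|exact: rcontV].
have zero : cint (fun t => (f (r%:C * cis t) - f a) *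
    (1 / (1 - a * (r%:C * cis t)^-1))) 0 (2 * pi) = 0.
  (* With [z = r e^(it)] the integrand is [z q(z)], the [t]-derivative of [- i F(z)], and the curve
     is closed. *)
  rewrite (@cint_FTC R (fun t => - 'i%C * F (r%:C * cis t))).
  - by rewrite cis2pi cis0 subrr.
  - by apply: rcontM ck; apply: rcontB cf _; exact: rcont_cst.
  - move=> t; have := rder_comp (rderZ r%:C (rder_cis t)) (hF (r%:C * cis t) _ _).
    rewrite !subr0 => /(_ (in1 t) (in2 t)) h.
    apply: rder_eq (rderZ (- 'i%C) h) _.
    rewrite squeeze_id ?ltW // /q (negPf (neq t)).
    have n1 := neq0 t; have n2 := rcis0 t.
    have n3 : r%:C * cis t - a != 0 by rewrite subr_eq0.
    have n4 : r%:C != 0 :> C by rewrite -nc_gt0 nc_real normr_gt0 gt_eqF.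
    have n5 := cis_neq0 t.
    by field : (@sqr_i R); rewrite n4 n5 n3.
have one := cauchy_integral1 r0 ar.
rewrite -[LHS]mulr1 -one /cauchy_integral mulrA; congr (_ / _).
rewrite -cintZ; last by under eq_fun do rewrite mul1r.
apply/eqP; rewrite eq_sym -subr_eq0 -cintB; last 2 first.
- exact: rcontM.
- apply: rcontM; first exact: rcont_cst.
  by under eq_fun do rewrite mul1r.
apply/eqP; rewrite -[RHS]zero; congr cint; apply/funext => t.
by rewrite expr0; ring.
Qed.

End Cauchy.

(** * Holomorphic functions *)

Section Holomorphic.
Context {R : realType}.
Local Notation C := R[i].
Local Notation nc := (@Normc.normc R).
Implicit Types (f F u : C -> C) (a b c z w : C) (r s x y : R).

Definition holo f z : Prop := \forall w \near z, derivable f w 1.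

Lemma holoP f z : holo f z <->
  exists2 r : R, 0 < r & forall w, nc (w - z) < r -> derivable f w 1.
Proof. exact: nbhs_cP. Qed.

Lemma holo_derivable f z : holo f z -> derivable f z 1.
Proof. exact: nbhs_singleton. Qed.

Lemma holo_cder f z : holo f z -> cder f z ('D_1 f z).
Proof. by move=> /holo_derivable/derivable_cder. Qed.

Lemma holo_ccont f z : holo f z -> ccont f z.
Proof. by move=> /holo_cder/cder_ccont. Qed.

Lemma holo_near f z : holo f z -> \forall w \near z, holo f w.
Proof. exact: near_join. Qed.

Lemma near_eq_holo f F z : (\forall w \near z, f w = F w) -> holo f z -> holo F z.
Proof.
move=> /near_join h; apply: filterS2 h => w fF dw.
by apply: near_eq_derivable dw; apply: filterS fF => y ->.
Qed.

(** [F N] is the N-th Taylor remainder divided by [z ^+ N], and [F k 0] is the k-th coefficient. The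
    derivative bound on the half disc is what [holo_deriv] uses. *)
Lemma holo_taylor f c : holo f c ->
  exists r (F : nat -> C -> C), [/\ 0 < r,
    forall z, nc z < r -> F 0%N z = f (c + z),
    forall N z, nc z < r -> F N z = F N 0 + z * F N.+1 z,
    forall N z, nc z < r -> derivable (F N) z 1 &
    (forall k, F k 0 = 0) -> forall z, nc z < r -> f (c + z) = 0] /\
    forall N, exists K, forall z, nc z < r / 2 -> nc ('D_1 (F N) z) <= K.
Proof.
move=> /holoP [s s0 hs]; pose r := s / 3.
have r0 : 0 < r by rewrite divr_gt0.
have r3 : 3 * r = s by rewrite /r; field.
pose h z := f (c + z).
have dh z : nc z < s -> derivable h z 1.
  move=> zs; have /derivable_cder k : derivable f (c + z) 1.
    by apply: hs; rewrite addrC addrA addNr add0r.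
  exact: cder_derivable (cder_comp (F := f) (cderD (cder_cst c z) (cder_id z)) k).
have dh2 z : nc z < 2 * r -> derivable h z 1 by move=> zr; apply: dh; lra.
pose g t := h (r%:C * cis t).
have rt t : nc (r%:C * cis t) = r by rewrite ncM nc_cis mulr1 nc_real gtr0_norm.
have cg : rcont g.
  apply: rcont_comp => [|t]; first by apply: rcontM rcont_cis; exact: rcont_cst.
  by apply: cder_ccont (derivable_cder (dh _ _)); rewrite rt; lra.
have [M hM] : exists M, forall t, nc (g t) <= M.
  have [|M hM] := @ccont_bounded R h 0 r.
    by move=> z; rewrite subr0 => zr; apply: cder_ccont (derivable_cder (dh _ _)); lra.
  by exists M => t; apply: hM; rewrite subr0 rt.
exists r, (cauchy_integral r g); split.
  split => //.
  - by move=> z zr; rewrite -cauchy_formula.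
  - by move=> N z zr; exact: cauchy_integral_rec.
  - move=> N z zr; have [l hl _] := cauchy_integral_cder r0 N cg zr hM.
    exact: cder_derivable hl.
  - move=> zero z zr; rewrite -[f _]/(h z) (cauchy_formula r0 dh2 zr).
    by apply: (cauchy_integral_zero r0 cg zr hM).
move=> N; exists (2 * M * (r^-1 ^+ N.+1 / (1 - 1 / 2) ^+ 2)) => z zr.
have zr' : nc z < r by lra.
have [l /cder_val -> hl] := cauchy_integral_cder r0 N cg zr' hM.
apply: (le_trans hl); have M0 : 0 <= M by apply: le_trans (hM 0); exact: normc_ge0.
have q : nc z / r <= 1 / 2 by rewrite ler_pdivrMr //; lra.
rewrite ler_wpM2l ?mulr_ge0 // ler_wpM2l ?exprn_ge0 ?invr_ge0 ?(ltW r0) //.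
have n0 := normc_ge0 z.
rewrite lef_pV2 ?posrE ?exprn_gt0 //; try lra.
by rewrite ler_sqr ?nnegrE; lra.
Qed.

Lemma holo_expand1 f c : holo f c -> exists2 F, holo F c &
  \forall z \near c, f z = f c + (z - c) * F z.
Proof.
move=> /holo_taylor [r [F [[r0 F0 Frec dF _] _]]].
exists (fun z => F 1%N (z - c)).
  apply/holoP; exists r => // w wr.
  have h := cder_comp (F := F 1%N) (cderB (cder_id w) (cder_cst c w))
    (derivable_cder (dF 1%N _ wr)).
  exact: cder_derivable h.
apply/nbhs_cP; exists r => // w wr.
have := Frec 0%N _ wr; rewrite !F0 ?nc0 // addr0 addrC subrK.
by [].
Qed.

(** Differentiating the second-order expansion gives [f' = F1(0) + 2 z F2 + z^2 F2'] in the shifted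
    variable [z]. This is differentiable at the centre because [F2] is continuous and [F2'] is
    bounded. *)
Lemma holo_deriv f c : holo f c -> holo (fun z => 'D_1 f z) c.
Proof.
have pt c' : holo f c' -> derivable (fun z => 'D_1 f z) c' 1.
  move=> {c} /holo_taylor [r [F [[r0 F0 Frec dF _] bF]]].
  have [K hK] := bF 2%N.
  have near_ w : nc (w - c') < r -> f w =
      F 0%N 0 + (w - c') * (F 1%N 0 + (w - c') * F 2%N (w - c')).
    by move=> wr; rewrite -!Frec // F0 // addrC subrK.
  have der w : nc (w - c') < r -> 'D_1 f w = F 1%N 0 +
     2%:R * (w - c') * F 2%N (w - c') + (w - c') ^+ 2 * 'D_1 (F 2%N) (w - c').
    move=> wr; apply: cder_val.
    have hw := cderB (cder_id w) (cder_cst c' w).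
    have h2 := cder_comp (F := F 2%N) hw (derivable_cder (dF 2%N _ wr)).
    have := cderD (cder_cst (F 0%N 0) w)
      (cderM hw (cderD (cder_cst (F 1%N 0) w) (cderM hw h2))).
    move=> h; apply: cder_eq (cder_near _ h) _; last by ring.
    apply/nbhs_cP; exists (r - nc (w - c')); first by rewrite subr_gt0.
    move=> v vr; rewrite [RHS]near_ //.
    have -> : v - c' = (v - w) + (w - c') by ring.
    by apply: (le_lt_trans (nc_leD _ _)); lra.
  have nr : nc (0 : C) < r by rewrite nc0.
  have /ccont_epsP cF : ccont (F 2%N) 0 := cder_ccont (derivable_cder (dF 2%N _ nr)).
  apply: (@cder_derivable _ _ _ (2%:R * F 2%N 0)) => e e0.
  have [d d0 hd] := cF (e / 4) (divr_gt0 e0 (ltr0n _ 4)).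
  have K0 : 0 <= K.
    by apply: le_trans (hK 0 _); [exact: normc_ge0|rewrite nc0 divr_gt0].
  pose D := Num.min (Num.min d (r / 2)) (e / (2 * (K + 1))).
  exists D; first by rewrite !lt_min d0 !divr_gt0 // mulr_gt0 // ltr_wpDl.
  move=> w; rewrite !lt_min => /andP[/andP[wd wr] we].
  have wr' : nc (w - c') < r by have := normc_ge0 (w - c'); lra.
  have w0 := normc_ge0 (w - c').
  have e2 : 'D_1 f c' = F 1%N 0.
    have := der c'; rewrite subrr nc0 => /(_ r0) ->; ring.
  rewrite e2 (der _ wr').
  have -> : F 1%N 0 + 2%:R * (w - c') * F 2%N (w - c') +
      (w - c') ^+ 2 * 'D_1 (F 2%N) (w - c') - F 1%N 0 - 2%:R * F 2%N 0 * (w - c') =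
      (w - c') * (2%:R * (F 2%N (w - c') - F 2%N 0) + (w - c') * 'D_1 (F 2%N) (w - c')).
    by ring.
  rewrite ncM mulrC ler_wpM2r //; apply: (le_trans (nc_leD _ _)).
  rewrite !ncM; have -> : nc 2%:R = 2.
    by rewrite -(rmorph_nat (real_complex R)) nc_real ger0_norm.
  have h1 : nc (F 2%N (w - c') - F 2%N 0) <= e / 4 by apply/ltW/hd; rewrite subr0.
  have h2 : nc (w - c') * nc ('D_1 (F 2%N) (w - c')) <= e / 2.
    apply: (@le_trans _ _ (e / (2 * (K + 1)) * (K + 1))).
      apply: ler_pM; rewrite ?normc_ge0 // ?(ltW we) //.
      by apply: (le_trans (hK _ wr)); rewrite lerDl.
    have k1 : K + 1 != 0 by rewrite gt_eqF // ltr_wpDl.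
    by rewrite le_eqVlt; apply/orP; left; apply/eqP; field.
  lra.
by move=> /holo_near; apply: filterS => w; exact: pt.
Qed.

(** The order is the least index of a nonzero Taylor coefficient, and [u] is the corresponding
    remainder. *)
Lemma holo_zero_order f c : holo f c ->
  (\forall z \near c, f z = 0) \/
  exists m u, [/\ holo u c, u c != 0 & \forall z \near c, f z = (z - c) ^+ m * u z].
Proof.
move=> /holo_taylor [r [F [[r0 F0 Frec dF Fz] _]]].
have [z|/existsNP [n hn]] := pselect (forall k, F k 0 = 0).
  left; apply/nbhs_cP; exists r => // w wr; rewrite -(Fz z _ wr).
  by rewrite addrC subrK.
right.
have ex : exists n, F n 0 != 0 by exists n; apply/eqP.
case: (ex_minnP ex) => m Fm min_m.
have eq w : nc (w - c) < r -> f w = (w - c) ^+ m * F m (w - c).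
  move=> wr; have -> : f w = F 0%N (w - c) by rewrite F0 // addrC subrK.
  elim: m {Fm} min_m => [|m IH] min_m; first by rewrite expr0 mul1r.
  rewrite IH => [|k /min_m]; last exact: ltnW.
  rewrite Frec // (_ : F m 0 = 0) ?add0r ?exprSr ?mulrA //.
  by apply/eqP/negPn/negP => /min_m; rewrite ltnn.
exists m, (fun z => F m (z - c)); split; last by apply/nbhs_cP; exists r.
  apply/holoP; exists r => // w wr.
  exact: cder_derivable (cder_comp (F := F m) (cderB (cder_id w) (cder_cst c w))
    (derivable_cder (dF m _ wr))).
by rewrite subrr.
Qed.

Lemma nbhs_puncP z (A : set C) : (\forall w \near z^', A w) <->
  exists2 d : R, 0 < d & forall w, nc (w - z) < d -> w != z -> A w.
Proof. exact: nbhs_cP. Qed.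

(** Riemann's trick: [(z - c)^2 f] is differentiable at [c] with value and derivative 0, so the
    square can be divided out again by two first-order expansions. *)
Lemma holo_removable f c M : (\forall z \near c^', derivable f z 1) ->
  (\forall z \near c^', nc (f z) <= M) ->
  exists2 g, holo g c & \forall z \near c^', f z = g z.
Proof.
move=> /nbhs_puncP [d1 d10 h1] /nbhs_puncP [d2 d20 h2].
pose k z := (z - c) ^+ 2 * f z.
have kc : cder k c 0.
  move=> e e0; have M1 : 0 < `|M| + 1 by rewrite ltr_wpDl.
  exists (Num.min d2 (e / (`|M| + 1))); first by rewrite lt_min d20 divr_gt0.
  move=> w; rewrite lt_min => /andP[wd we]; rewrite /k subrr expr0n mul0r.
  rewrite mul0r !subr0 ncM; have [->|wc] := eqVneq w c.
    by rewrite subrr expr0n nc0 mul0r mulr0.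
  rewrite ncX expr2 -mulrA mulrC ler_wpM2r ?normc_ge0 //.
  move: we; rewrite ltr_pdivlMr // => /ltW; apply: le_trans.
  rewrite ler_wpM2l ?normc_ge0 // (le_trans (h2 _ wd wc)) //.
  by have := ler_norm M; lra.
have hk : holo k c.
  apply/holoP; exists d1 => // w wd; have [->|wc] := eqVneq w c.
    exact: cder_derivable kc.
  exact: cder_derivable (cderM (cderX 2 (cderB (cder_id w) (cder_cst c w)))
    (derivable_cder (h1 _ wd wc))).
have [F hF eqF] := holo_expand1 hk.
have k0 : k c = 0 by rewrite /k subrr expr0n mul0r.
have [G hG eqG] := holo_expand1 hF.
have Fc : F c = 0.
  have h : cder k c (1 * F c + (c - c) * 'D_1 F c).
    have := cderM (cderB (cder_id c) (cder_cst c c)) (holo_cder hF).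
    rewrite subr0; apply: cder_near; apply: filterS eqF => w ->.
    by rewrite k0 add0r.
  by have := cder_uniq h kc; rewrite subrr mul0r addr0 mul1r.
exists G => //; apply: filterS2 eqF eqG => z; rewrite k0 Fc !add0r /k => e1 e2 zc.
have zc0 : z - c != 0 by rewrite subr_eq0.
apply: (mulfI (expf_neq0 2 zc0)); rewrite e1 e2; ring.
Qed.

(** Cauchy's formula on the circle of radius [r / 3], with the factor 2 of [cint_le], gives
    [6 M / r]; the constant 8 is merely sufficient. *)
Lemma cauchy_estimate f c r M : 0 < r ->
  (forall w, nc (w - c) < r -> derivable f w 1) ->
  (forall w, nc (w - c) < r -> nc (f w) <= M) ->
  nc ('D_1 f c) <= 8 * M / r.
Proof.
move=> r0 df fM; pose s := r / 3; have s0 : 0 < s by rewrite divr_gt0.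
have s3 : 3 * s = r by rewrite /s; field.
pose h z := f (c + z).
have addK z : c + z - c = z by rewrite addrC addrA addNr add0r.
have dh z : nc z < 2 * s -> cder h z ('D_1 f (c + z)).
  move=> zs; have /derivable_cder k : derivable f (c + z) 1 by apply: df; rewrite addK; lra.
  apply: cder_eq (cder_comp (F := f) (cderD (cder_cst c z) (cder_id z)) k) _.
  by rewrite add0r mulr1.
have st t : nc (s%:C * cis t) = s by rewrite ncM nc_cis mulr1 nc_real gtr0_norm.
pose g t := h (s%:C * cis t).
have cg : rcont g.
  apply: rcont_comp => [|t]; first by apply: rcontM rcont_cis; exact: rcont_cst.
  by apply: cder_ccont (dh _ _); rewrite st; lra.
have gM t : nc (g t) <= M by apply: fM; rewrite addK st; lra.
have n0 : nc (0 : C) < s by rewrite nc0.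
have [l hl lM] := cauchy_integral_cder s0 0%N cg n0 gM.
have -> : 'D_1 f c = l.
  rewrite -[c]addr0; apply: cder_uniq (dh _ _) _; first by rewrite nc0 mulr_gt0.
  apply: cder_near hl; apply/nbhs_cP; exists s => // w; rewrite subr0 => ws.
  by rewrite -cauchy_formula // => z /dh/cder_derivable.
apply: (le_trans lM); rewrite nc0 mul0r subr0 expr1n divr1 expr1.
have M0 : 0 <= M by apply: le_trans (gM 0); exact: normc_ge0.
have h0 : 0 <= M / s by rewrite divr_ge0 // ltW.
rewrite -s3 -mulrA -[8 * M / _]mulrA.
have -> : M / (3 * s) = M / s / 3 by field; rewrite gt_eqF.
lra.
Qed.

End Holomorphic.

(** * A clopen criterion on connected sets *)

Section Connected.
Variable T : topologicalType.
Implicit Types A Z : set T.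

(** Inside [A] the complement of [Z] coincides with its own interior, so the trace of [Z] is
    clopen. *)
Lemma connected_dichotomy A Z : connected A -> open Z ->
  (forall x, A x -> Z x \/ \forall y \near x, ~ Z y) ->
  A `&` Z !=set0 -> A `<=` Z.
Proof.
move=> cA oZ dich ne.
suff -> : A = A `&` Z by move=> x [].
apply/esym/cA => //; first by exists Z.
exists (~` (~` Z)^°); first by apply: open_closedC; exact: open_interior.
apply/seteqP; split=> x [Ax].
  by move=> Zx; split => // /interior_subset.
by move=> nZ; split => //; case: (dich x Ax).
Qed.

End Connected.

(** * Identity principle, local inverses and local coordinates *)

Section Identity.
Context {R : realType}.
Local Notation C := R[i].
Local Notation nc := (@Normc.normc R).
Implicit Types (f F g u : C -> C) (a b c z w : C) (r s : R) (D : set C).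

Definition convex_set D : Prop := forall a b (t : R), D a -> D b ->
  0 <= t <= 1 -> D (a + t%:C * (b - a)).

Lemma convex_disc c r : convex_set [set z | nc (z - c) < r].
Proof.
move=> a b t /= ar br /andP[t0 t1].
have -> : a + t%:C * (b - a) - c = (1 - t)%:C * (a - c) + t%:C * (b - c).
  by rewrite rmorphB rmorph1; ring.
apply: (le_lt_trans (nc_leD _ _)); rewrite !ncM !nc_real.
rewrite ger0_norm ?subr_ge0 // ger0_norm //.
have [->|tn0] := eqVneq t 0; first by rewrite mul0r addr0 subr0 mul1r.
have : t * nc (b - c) < t * r by rewrite ltr_pM2l // lt_def tn0.
have : (1 - t) * nc (a - c) <= (1 - t) * r.
  by apply: ler_wpM2l; [rewrite subr_ge0|exact: ltW].
lra.
Qed.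

Lemma convex_setI D D' : convex_set D -> convex_set D' -> convex_set (D `&` D').
Proof. by move=> h h' a b t [? ?] [? ?] t01; split; [exact: h|exact: h']. Qed.

Lemma seg_rder F a b t l : cder F (a + t%:C * (b - a)) l ->
  rder (fun t => F (a + t%:C * (b - a))) t (l * (b - a)).
Proof. by move=> h; exact: (rder_comp (rder_line a (b - a) t) h). Qed.

Lemma convex_mvi D F (M : R) : convex_set D ->
  (forall z, D z -> derivable F z 1) ->
  (forall z, D z -> nc ('D_1 F z) <= M) ->
  forall a b, D a -> D b -> nc (F b - F a) <= 2 * M * nc (b - a).
Proof.
move=> cD dF bF a b Da Db.
have := @rder_mvi R (fun t => F (a + t%:C * (b - a)))
  (fun t => 'D_1 F (a + t%:C * (b - a)) * (b - a)) 0 1 (M * nc (b - a)) ler01.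
rewrite mul1r mul0r addr0 subr0 mulr1 [a + _]addrC subrK mulrA.
apply=> t t01; have Dt := cD a b t Da Db t01.
  by apply: seg_rder; exact: derivable_cder (dF _ Dt).
by rewrite ncM ler_wpM2r ?normc_ge0 // bF.
Qed.

Lemma convex_deriv0 D F : convex_set D ->
  (forall z, D z -> cder F z 0) -> forall a b, D a -> D b -> F a = F b.
Proof.
move=> cD dF a b Da Db; apply/esym/eqP.
rewrite -subr_eq0 -nc_eq0 eq_le normc_ge0 andbT.
have := @convex_mvi D F 0 cD _ _ a b Da Db; rewrite mulr0 mul0r; apply => z Dz.
  exact: cder_derivable (dF z Dz).
by rewrite (cder_val (dF z Dz)) nc0.
Qed.

(** Zeros are isolated unless [f] vanishes near [z]. The second alternative is phrased for
    [connected_dichotomy], applied to the open set of points near which [f] vanishes. *)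
Lemma near_zero_dichotomy f z : holo f z ->
  (\forall w \near z, f w = 0) \/
  (\forall w \near z, ~ \forall v \near w, f v = 0).
Proof.
case/holo_zero_order => [|[m [u [hu uz eqf]]]]; [by left|right].
have u0 : \forall w \near z, u w != 0.
  have /ccont_epsP /(_ (nc (u z))) := holo_ccont hu.
  rewrite nc_gt0 => /(_ uz) [d d0 hd]; apply/nbhs_cP; exists d => // w /hd h.
  by apply/eqP => uw; move: h; rewrite uw sub0r ncN ltxx.
have : \forall w \near z, w != z -> f w != 0.
  apply: filterS2 eqf u0 => w -> uw wz.
  by rewrite mulf_neq0 // expf_neq0 // subr_eq0.
move=> /nbhs_cP [d d0 hd]; apply/nbhs_cP; exists d => // w wd.
move=> /nbhs_cP [e e0 he].
(* If [f] vanished near [w], then [w] and the different point [v] would both be zeros in a disc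
   whose only possible zero is [z]. *)
pose v := w + (Num.min e (d - nc (w - z)) / 2)%:C.
have m0 : 0 < Num.min e (d - nc (w - z)) / 2.
  by rewrite divr_gt0 // lt_min e0 subr_gt0.
have vw : nc (v - w) = Num.min e (d - nc (w - z)) / 2.
  by rewrite /v addrC addrA addNr add0r nc_real gtr0_norm.
have vE (x : C) : nc (x - w) < e -> nc (x - z) < d -> x = z.
  by move=> xe xd; apply/eqP/negPn/negP => xz; have /eqP := hd _ xd xz; rewrite he.
have v1 : v = z.
  apply: vE.
    rewrite vw; have : Num.min e (d - nc (w - z)) <= e by rewrite ge_min lexx.
    lra.
  have -> : v - z = (v - w) + (w - z) by ring.
  apply: (le_lt_trans (nc_leD _ _)); rewrite vw.
  have : Num.min e (d - nc (w - z)) <= d - nc (w - z) by rewrite ge_min lexx orbT.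
  lra.
have w1 : w = z by apply: vE => //; rewrite subrr nc0.
by move: m0; rewrite -vw v1 w1 subrr nc0 ltxx.
Qed.

Lemma convex_identity D f a b : convex_set D ->
  (forall z, D z -> holo f z) -> D a -> D b ->
  (\forall z \near a, f z = 0) -> f b = 0.
Proof.
move=> cD hf Da Db fa.
pose c (t : R) := a + t%:C * (b - a).
pose Z := [set z : C | \forall w \near z, f w = 0].
have oZ : open Z by rewrite openE => z; exact: near_join.
have sD z : (c @` `[0, 1]) z -> D z.
  by move=> [t /=]; rewrite in_itv /= => t01 <-; exact: cD.
have h : (c @` `[0, 1]) `<=` Z.
  apply: connected_dichotomy => //.
  - apply: connected_continuous_connected; first exact: segment_connected.
    apply: continuous_subspaceT => t; exact: rder_cont (rder_line a (b - a) t).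
  - by move=> z /sD/hf/near_zero_dichotomy.
  - exists a; split => //; exists 0; rewrite ?/c ?mul0r ?addr0 //=.
    by rewrite in_itv /= lexx ler01.
have /h : (c @` `[0, 1]) b.
  exists 1; first by rewrite /= in_itv /= lexx ler01.
  by rewrite /c mul1r addrC subrK.
exact: nbhs_singleton.
Qed.

Lemma ccont_near g z (P : C -> Prop) : ccont g z ->
  (\forall y \near g z, P y) -> \forall w \near z, P (g w).
Proof.
move=> /ccont_epsP cg /nbhs_cP [e e0 he]; have [d d0 hd] := cg e e0.
by apply/nbhs_cP; exists d => // w /hd; exact: he.
Qed.

Lemma near_neq0 f z : ccont f z -> f z != 0 -> \forall w \near z, f w != 0.
Proof.
move=> /ccont_epsP /(_ (nc (f z))); rewrite nc_gt0 => h fz; have [d d0 hd] := h fz.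
apply/nbhs_cP; exists d => // w /hd k; apply/eqP => fw.
by move: k; rewrite fw sub0r ncN ltxx.
Qed.

Lemma cder_inverse f g b m : cder f (g b) m -> m != 0 ->
  (\forall y \near b, f (g y) = y) -> ccont g b -> cder g b m^-1.
Proof.
move=> hf m0 fg /ccont_epsP cg e e0.
have m0' : 0 < nc m by rewrite nc_gt0.
pose e1 := Num.min (nc m / 2) (e * nc m ^+ 2 / 2).
have e10 : 0 < e1 by rewrite lt_min !divr_gt0 // mulr_gt0 // exprn_gt0.
have e1m : e1 <= nc m / 2 by rewrite ge_min lexx.
have e1e : e1 <= e * nc m ^+ 2 / 2 by rewrite ge_min lexx orbT.
have [d1 d10 h1] := hf _ e10; have [d2 d20 h2] := cg _ d10.
have /nbhs_cP [d3 d30 h3] := fg.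
exists (Num.min d2 d3); first by rewrite lt_min d20.
move=> y; rewrite lt_min => /andP[/h2/h1 + /h3 fy].
rewrite (nbhs_singleton fg) fy; set w := g y; set z := g b => h.
have n0 := normc_ge0 (w - z); have n1 := normc_ge0 (y - b).
have k1 : nc m * nc (w - z) <= 2 * nc (y - b).
  have : nc (m * (w - z)) <= nc (y - b) + nc (y - b - m * (w - z)).
    have := nc_leB (y - b) (y - b - m * (w - z)).
    by rewrite opprB addrCA subrr addr0.
  have : e1 * nc (w - z) <= nc m / 2 * nc (w - z) by rewrite ler_wpM2r.
  rewrite ncM; lra.
have -> : w - z - m^-1 * (y - b) = - (m^-1 * (y - b - m * (w - z))).
  by field.
rewrite ncN ncM Defs.normcV mulrC ler_pdivrMr //; apply: (le_trans h).
apply: (@le_trans _ _ (e * nc m / 2 * (nc m * nc (w - z)))).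
  have -> : e * nc m / 2 * (nc m * nc (w - z)) = e * nc m ^+ 2 / 2 * nc (w - z).
    by rewrite expr2; ring.
  by rewrite ler_wpM2r.
have -> : e * nc (y - b) * nc m = e * nc m / 2 * (2 * nc (y - b)) by field.
by rewrite ler_wpM2l // divr_ge0 // mulr_ge0 // ltW.
Qed.

(** Near [c] the derivative of [f z - l z] is at most [|l| / 4], so by [convex_mvi] its increments
    are at most half of those of [l z]. *)
Lemma holo_bilipschitz f c : holo f c -> 'D_1 f c != 0 ->
  exists2 r : R, 0 < r & [/\
    forall z, nc (z - c) < r -> derivable f z 1,
    forall z, nc (z - c) < r -> 'D_1 f z != 0 &
    forall z w, nc (z - c) < r -> nc (w - c) < r ->
      nc ('D_1 f c) * nc (z - w) <= 2 * nc (f z - f w)].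
Proof.
move=> hf l0; set l := 'D_1 f c in l0 *.
have l0' : 0 < nc l by rewrite nc_gt0.
have /ccont_epsP /(_ (nc l / 4)) := holo_ccont (holo_deriv hf).
rewrite divr_gt0 // => /(_ isT) [d d0 hd].
have /holoP [r r0 hr] := hf.
pose D := [set z : C | nc (z - c) < Num.min r d].
have dD z : D z -> derivable f z 1.
  by rewrite /D /= lt_min => /andP[/hr].
have DD z : D z -> nc ('D_1 f z - l) < nc l / 4.
  by rewrite /D /= lt_min => /andP[_ /hd].
exists (Num.min r d); first by rewrite lt_min r0.
split; first exact: dD.
  move=> z /DD h.
  by apply/eqP => dz; move: h; rewrite dz sub0r ncN -/l; lra.
move=> z w zD wD; have := @convex_mvi D (fun z => f z - l * z) (nc l / 4) (@convex_disc _ _) _ _ w z wD zD.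
have der y : D y -> cder (fun z => f z - l * z) y ('D_1 f y - l).
  move=> /dD/derivable_cder h.
  by apply: cder_eq (cderB h (cderZ l (cder_id y))) _; rewrite mulr1.
have H1 y : D y -> derivable (fun z => f z - l * z) y 1.
  by move=> /der/cder_derivable.
have H2 y : D y -> nc ('D_1 (fun z => f z - l * z) y) <= nc l / 4.
  by move=> Dy; rewrite (cder_val (der y Dy)) ltW // DD.
move=> /(_ H1 H2).
have := nc_subr (f z - f w) (l * (z - w)); rewrite ncM.
have -> : f z - l * z - (f w - l * w) = (f z - f w) - l * (z - w) by ring.
lra.
Qed.

(** For surjectivity, [|f - b|] is minimised over a closed disc. The lower Lipschitz bound keeps the
    minimum off the boundary; a nonzero interior minimum would decrease along the Newton direction
    [(b - f) / f']. The same Lipschitz bound makes the inverse continuous and single-valued. *)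
Lemma holo_local_inverse f c : holo f c -> 'D_1 f c != 0 ->
  exists2 g, [/\ holo g (f c), g (f c) = c, 'D_1 g (f c) != 0 &
    \forall y \near f c, f (g y) = y] & \forall z \near c, g (f z) = z.
Proof.
move=> hf l0; have [r r0 [df dn0 lip]] := holo_bilipschitz hf l0.
set l := 'D_1 f c in l0 lip; have l0' : 0 < nc l by rewrite nc_gt0.
pose s := r / 2; have s0 : 0 < s by rewrite divr_gt0.
have sr : s < r by rewrite /s; lra.
(* A minimum on the boundary would have [|l| s <= 2 |f z - f c| < 4 eta], as
   [|f z - b| <= |f c - b| < eta] there. *)
pose eta := nc l * s / 4.
have eta0 : 0 < eta by rewrite divr_gt0 // mulr_gt0.
have cc : nc (c - c) < r by rewrite subrr nc0.
have surj b : nc (b - f c) < eta -> exists2 z, nc (z - c) < s & f z = b.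
  move=> be.
  have [|||z] := @compact_EVT_min C R (fun z => nc (f (c + z) - b)) [set z | nc z <= s].
  - by exists 0; rewrite /mkset nc0 ltW.
  - exact: compact_disc.
  - apply: continuous_in_subspaceT => z; rewrite inE /= => zs.
    have cz : nc (c + z - c) < r by rewrite addrC addrA addNr add0r; lra.
    have : ccont (fun z => f (c + z) - b) z.
      apply: ccontB; last exact: ccont_cst.
      apply: (ccont_comp (F := f)).
        by apply: ccontD; [exact: ccont_cst|exact: ccont_id].
      exact: cder_ccont (derivable_cder (df _ cz)).
    move=> /ccont_epsP h; apply/crcontP => e e0; have [d d0 hd] := h e e0.
    exists d => // w /hd; apply: le_lt_trans.
    have := nc_subl (f (c + w) - b) (f (c + z) - b).
    have := nc_subr (f (c + w) - b) (f (c + z) - b).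
    by rewrite ler_norml => *; apply/andP; split; lra.
  rewrite inE /= => zs zmin.
  have zE : c + z - c = z by rewrite addrC addrA addNr add0r.
  have zlt : nc z < s.
    rewrite lt_neqAle zs andbT; apply/eqP => sz.
    have := zmin 0; rewrite inE /mkset nc0 addr0 => /(_ (ltW s0)).
    have := lip (c + z) c; rewrite zE sz subrr nc0 => /(_ sr r0).
    have -> : f (c + z) - f c = (f (c + z) - b) + (b - f c) by ring.
    have := nc_leD (f (c + z) - b) (b - f c).
    by have := normcB (f c) b; move: be; rewrite /eta; lra.
  exists (c + z); first by rewrite zE.
  apply/eqP; rewrite -subr_eq0; apply/negPn/negP => fb.
  have fb0 : 0 < nc (f (c + z) - b) by rewrite nc_gt0.
  have cz : nc (c + z - c) < r by rewrite zE; lra.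
  have m0 : 'D_1 f (c + z) != 0 by exact: dn0.
  have := derivable_cder (df _ cz); set m := 'D_1 f (c + z) in m0 *.
  have m0' : 0 < nc m by rewrite nc_gt0.
  move=> /(_ (nc m / 2)); rewrite divr_gt0 // => /(_ isT) [d d0 hd].
  pose v := (b - f (c + z)) / m.
  have v0 : 0 < nc v by rewrite /v nc_div divr_gt0 // normcB.
  have vm : nc m * nc v = nc (f (c + z) - b).
    by rewrite /v nc_div mulrC divfK ?gt_eqF // normcB.
  (* Step length along the Newton direction [v]: at most 1/2 so that [1 - t] is nonnegative, short
     enough for the first-order estimate, and short enough to stay in the disc of radius [s]. *)
  pose t : R := Num.min (1 / 2) (Num.min (d / (2 * nc v)) ((s - nc z) / nc v)).
  have t0 : 0 < t by rewrite !lt_min !divr_gt0 ?mulr_gt0 // subr_gt0.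
  have t1 : t <= 1 / 2 by rewrite ge_min lexx.
  have t2 : t * (2 * nc v) <= d.
    by rewrite -ler_pdivlMr ?mulr_gt0 // !ge_min lexx ?orbT.
  have t3 : t * nc v <= s - nc z by rewrite -ler_pdivlMr // !ge_min lexx ?orbT.
  have mv : m * v = b - f (c + z) by rewrite /v mulrC divfK.
  clearbody t v.
  have tv0 : 0 < t * nc v by rewrite mulr_gt0.
  have ntv : nc (t%:C * v) = t * nc v by rewrite ncM nc_real gtr0_norm.
  have := zmin (z + t%:C * v); rewrite inE /= => /(_ _).
  have -> : nc (z + t%:C * v) <= s.
    have h := nc_leD z (t%:C * v); rewrite ntv in h.
    by apply: (le_trans h); rewrite -lerBrDl.
  move=> /(_ isT); rewrite leNgt => /negP; apply.
  have /hd : nc (c + (z + t%:C * v) - (c + z)) < d.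
    have -> : c + (z + t%:C * v) - (c + z) = t%:C * v by ring.
    by rewrite ntv; move: t2 tv0; clear; lra.
  have -> : c + (z + t%:C * v) - (c + z) = t%:C * v by ring.
  rewrite ntv => hb.
  have -> : f (c + (z + t%:C * v)) - b =
      (f (c + (z + t%:C * v)) - f (c + z) - m * (t%:C * v)) +
      (1 - t)%:C * (f (c + z) - b).
    by rewrite mulrCA mv rmorphB rmorph1; ring.
  apply: (le_lt_trans (nc_leD _ _)); rewrite ncM nc_real ger0_norm.
    apply: (le_lt_trans (lerD hb (lexx _))); rewrite -vm.
    have : 0 < t * (nc m * nc v) by rewrite !mulr_gt0.
    by clear; lra.
  by move: t1; clear; lra.
pose g b := xget c [set z | nc (z - c) < s /\ f z = b].
have gP b : nc (b - f c) < eta -> nc (g b - c) < s /\ f (g b) = b.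
  move=> /surj [z zs zb]; rewrite /g; case: xgetP => [w _ //|no].
  by case: (no z).
have gr b : nc (b - f c) < eta -> nc (g b - c) < r by move=> /gP [h _]; lra.
have near_fg b : nc (b - f c) < eta -> \forall y \near b, nc (y - f c) < eta.
  move=> be; apply/nbhs_cP; exists (eta - nc (b - f c)); first by rewrite subr_gt0.
  move=> y yb; have -> : y - f c = (y - b) + (b - f c) by ring.
  by apply: (le_lt_trans (nc_leD _ _)); lra.
have glip b b' : nc (b - f c) < eta -> nc (b' - f c) < eta ->
    nc l * nc (g b - g b') <= 2 * nc (b - b').
  move=> h h'; have := lip _ _ (gr _ h) (gr _ h').
  by have [_ ->] := gP _ h; have [_ ->] := gP _ h'.
have gcont b : nc (b - f c) < eta -> ccont g b.
  move=> h; apply/ccont_epsP => e e0; have /nbhs_cP [d d0 hd] := near_fg _ h.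
  exists (Num.min d (e * nc l / 2)).
    by rewrite lt_min d0 divr_gt0 // mulr_gt0.
  move=> y; rewrite lt_min => /andP[/hd h' ye]; have := glip _ _ h' h.
  by rewrite -(ltr_pM2l l0'); lra.
have gder b : nc (b - f c) < eta -> cder g b ('D_1 f (g b))^-1.
  move=> h; apply: cder_inverse (gcont _ h).
  - exact: derivable_cder (df _ (gr _ h)).
  - exact: dn0 (gr _ h).
  - by apply: filterS (near_fg _ h) => y /gP [].
have fc : nc (f c - f c) < eta by rewrite subrr nc0.
have gfc : g (f c) = c.
  have [_ h] := gP _ fc; have := lip _ _ (gr _ fc) cc; rewrite h subrr nc0 mulr0.
  move=> k; apply/eqP; rewrite -subr_eq0 -nc_eq0 eq_le normc_ge0 andbT.
  by rewrite -(ler_pM2l l0') mulr0.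
exists g.
  split; [|exact: gfc| |].
  - by apply: filterS (near_fg _ fc) => b /gder/cder_derivable.
  - by rewrite (cder_val (gder _ fc)) invr_eq0 gfc.
  - by apply: filterS (near_fg _ fc) => b /gP [].
have /ccont_epsP /(_ _ eta0) [d d0 hd] := holo_ccont hf.
apply/nbhs_cP; exists (Num.min d r); first by rewrite lt_min d0.
move=> z; rewrite lt_min => /andP[/hd zd zr].
have [_ h] := gP _ zd; have := lip _ _ (gr _ zd) zr; rewrite h subrr nc0 mulr0.
move=> k; apply/eqP; rewrite -subr_eq0 -nc_eq0 eq_le normc_ge0 andbT.
by rewrite -(ler_pM2l l0') mulr0.
Qed.

Lemma holo_comp f g z : holo g z -> holo f (g z) -> holo (fun w => f (g w)) z.
Proof.
move=> hg hf; have h := ccont_near (holo_ccont hg) hf.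
apply: filterS2 hg h => w dg df.
exact: cder_derivable (cder_comp (derivable_cder dg) (derivable_cder df)).
Qed.

Lemma holoM f g z : holo f z -> holo g z -> holo (fun w => f w * g w) z.
Proof.
apply: filterS2 => w df dg.
exact: cder_derivable (cderM (derivable_cder df) (derivable_cder dg)).
Qed.

Lemma holoD f g z : holo f z -> holo g z -> holo (fun w => f w + g w) z.
Proof.
apply: filterS2 => w df dg.
exact: cder_derivable (cderD (derivable_cder df) (derivable_cder dg)).
Qed.

Lemma holoB f g z : holo f z -> holo g z -> holo (fun w => f w - g w) z.
Proof.
apply: filterS2 => w df dg.
exact: cder_derivable (cderB (derivable_cder df) (derivable_cder dg)).
Qed.

Lemma holo_cst (k z : C) : holo (fun=> k) z.
Proof. by apply: filterE => w; exact: cder_derivable (cder_cst k w). Qed.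

Lemma holo_id z : holo (fun w => w) z.
Proof. by apply: filterE => w; exact: cder_derivable (cder_id w). Qed.

Lemma holoX f z n : holo f z -> holo (fun w => f w ^+ n) z.
Proof.
apply: filterS => w df; exact: cder_derivable (cderX n (derivable_cder df)).
Qed.

Lemma holoV f z : f z != 0 -> holo f z -> holo (fun w => (f w)^-1) z.
Proof.
move=> f0 hf; have := near_neq0 (holo_ccont hf) f0; move: hf.
apply: filterS2 => w df fw; exact: cder_derivable (cderV fw (derivable_cder df)).
Qed.

(** Any root [y0] of [u c] is nonzero, so [y ^+ n] has a holomorphic inverse near it, and this
    inverse is composed with [u]. *)
Lemma holo_root u c n : holo u c -> u c != 0 -> (0 < n)%N ->
  exists2 v, holo v c & \forall z \near c, v z ^+ n = u z.
Proof.
move=> hu uc n0; pose y0 : C := n.-root (u c).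
have y0n : y0 ^+ n = u c by exact: rootCK.
have y00 : y0 != 0.
  by apply: contraNneq uc => y0z; rewrite -y0n y0z expr0n gtn_eqF.
have hp : holo (fun y : C => y ^+ n) y0 by apply: holoX; exact: holo_id.
have dp : 'D_1 (fun y : C => y ^+ n) y0 != 0.
  rewrite (cder_val (cderX n (cder_id y0))) mulr1 mulf_neq0 ?expf_neq0 //.
  by rewrite pnatr_eq0 -lt0n.
have [g [hg gy _ fg] _] := holo_local_inverse hp dp.
rewrite y0n in hg gy fg.
exists (fun z => g (u z)); first exact: holo_comp.
exact: ccont_near (holo_ccont hu) fg.
Qed.

Lemma cisD (s t : R) : cis (s + t) = cis s * cis t.
Proof.
by rewrite /cis cosD sinD; apply/eqP; rewrite eq_complex /= eqxx addrC eqxx.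
Qed.

Lemma cisX (t : R) n : cis t ^+ n = cis (n%:R * t).
Proof.
elim: n => [|n IH]; first by rewrite expr0 mul0r cis0.
by rewrite exprS IH -cisD -natr1 mulrDl mul1r addrC.
Qed.

(** [(z - c) v(z)] with [v ^+ m = u] has nonzero derivative at [c]; [Z] is its inverse. In the new
    coordinate, multiplication by an m-th root of unity permutes the fibres of
    [(z - c) ^+ m * u]. *)
Lemma power_coordinate u c m : holo u c -> u c != 0 -> (0 < m)%N ->
  exists Z : C -> C, [/\ holo Z 0, Z 0 = c,
    exists2 r : R, 0 < r & forall y y', nc y < r -> nc y' < r -> Z y = Z y' -> y = y' &
    \forall y \near 0, (Z y - c) ^+ m * u (Z y) = y ^+ m].
Proof.
move=> hu uc m0; have [v hv vm] := holo_root hu uc m0.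
pose h z := (z - c) * v z.
have hh : holo h c.
  by apply: holoM hv; apply: holoB; [exact: holo_id|exact: holo_cst].
have h0 : h c = 0 by rewrite /h subrr mul0r.
have dh : 'D_1 h c != 0.
  rewrite (cder_val (cderM (cderB (cder_id c) (cder_cst c c)) (holo_cder hv))).
  rewrite subr0 mul1r subrr mul0r addr0; apply: contraNneq uc => v0.
  by rewrite -(nbhs_singleton vm) v0 expr0n gtn_eqF.
have [Z [hZ Z0 _ hZK] _] := holo_local_inverse hh dh.
rewrite h0 in hZ Z0 hZK.
exists Z; split; [exact: hZ|exact: Z0| |].
  have /nbhs_cP [r r0 hr] := hZK; exists r => // y y' yr y'r E.
  by rewrite -(hr y) ?subr0 // E hr // subr0.
have vm' : \forall y \near 0, v (Z y) ^+ m = u (Z y).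
  apply: (ccont_near (P := fun z => v z ^+ m = u z) (holo_ccont hZ)).
  by rewrite Z0.
by apply: filterS2 hZK vm' => y e1 <-; rewrite -exprMn -/(h _) e1.
Qed.

End Identity.

(** * Injective holomorphic functions *)

Section Injective.
Context {R : realType}.
Local Notation C := R[i].
Local Notation nc := (@Normc.normc R).
Implicit Types (f g u : C -> C) (c z w : C).

Lemma cis_root_neq1 m : (1 < m)%N -> cis (2 * pi / m%:R : R) != 1.
Proof.
move=> m1; have m0 : 0 < m%:R :> R by rewrite ltr0n ltnW.
have p0 := pi_gt0 R.
set t := 2 * pi / m%:R; have t0 : 0 < t by rewrite divr_gt0 // mulr_gt0.
have tpi : t <= pi.
  rewrite /t ler_pdivrMr // mulrC; apply: ler_wpM2l; first exact: ltW.
  by rewrite (ler_nat _ 2).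
apply/eqP => /(congr1 (@complex.Re R)) /=; apply/eqP; rewrite lt_eqF //.
rewrite -[ltRHS]cos0 ltr_cos // in_itv /= ?lexx ?(ltW p0) //.
by rewrite (ltW t0).
Qed.

Lemma cis_root_pow m : (0 < m)%N -> cis (2 * pi / m%:R : R) ^+ m = 1.
Proof.
move=> m0; rewrite cisX mulrC divfK ?cis2pi //.
by rewrite pnatr_eq0 -lt0n.
Qed.

(** If [f - f c] had order [m > 1], it would be [y ^+ m] in a power coordinate and take equal values
    at [y] and at [y] times an m-th root of unity. *)
Lemma holo_injective_deriv f c : holo f c ->
  (exists2 r : R, 0 < r & forall z w, nc (z - c) < r -> nc (w - c) < r ->
    f z = f w -> z = w) ->
  'D_1 f c != 0.
Proof.
move=> hf [r r0 inj].
have hg : holo (fun z => f z - f c) c by apply: holoB hf _; exact: holo_cst.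
case: (holo_zero_order hg) => [|[m [u [hu uc E]]]].
  move=> /nbhs_cP [d d0 hd].
  pose x : R := Num.min d r / 2.
  have mdr : 0 < Num.min d r by rewrite lt_min d0.
  have x0 : 0 < x by rewrite divr_gt0.
  have xm : x < Num.min d r by rewrite /x; move: mdr; clear; lra.
  have nx : nc (c + x%:C - c) = x.
    by rewrite addrC addrA addNr add0r nc_real gtr0_norm.
  have := inj (c + x%:C) c; rewrite nx subrr nc0.
  move: xm; rewrite lt_min => /andP[xd xr] /(_ xr r0) h.
  have : c + x%:C = c.
    apply: h; apply/eqP; rewrite -subr_eq0; apply/eqP; apply: hd.
    by rewrite nx.
  move=> /(canRL (addKr _)); rewrite addNr => /complexI x00.
  by move: x0; rewrite x00 ltxx.
have m0 : (0 < m)%N.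
  case: m E => // E; have := nbhs_singleton E; rewrite !subrr expr0 mul1r.
  by move=> /esym/eqP; rewrite (negPf uc).
have [m1|m1] := leqP m 1.
  have mE : m = 1%N by apply/eqP; rewrite eqn_leq m1.
  have h : cder (fun z => f z - f c) c (u c).
    have := cderM (cderB (cder_id c) (cder_cst c c)) (holo_cder hu).
    rewrite subr0 mul1r subrr mul0r addr0; apply: cder_near.
    by apply: filterS E => z ->; rewrite mE expr1.
  have k := cderB (holo_cder hf) (cder_cst (f c) c).
  by rewrite -['D_1 f c]subr0 -(cder_uniq h k).
have [Z [hZ Z0 [s s0 injZ] pw]] := power_coordinate hu uc m0.
have cZ := holo_ccont hZ.
have E' : \forall y \near 0, f (Z y) - f c = (Z y - c) ^+ m * u (Z y).
  by apply: (ccont_near (P := fun z => f z - f c = (z - c) ^+ m * u z) cZ); rewrite Z0.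
have Zr : \forall y \near 0, nc (Z y - c) < r.
  apply: (ccont_near (P := fun z => nc (z - c) < r) cZ); rewrite Z0.
  by apply/nbhs_cP; exists r.
have : \forall y \near 0, f (Z y) - f c = y ^+ m /\ nc (Z y - c) < r.
  by apply: filterS3 E' Zr pw => y -> h ->.
move=> /nbhs_cP [d d0 hd].
pose x : R := Num.min d s / 2.
have mds : 0 < Num.min d s by rewrite lt_min d0.
have x0 : 0 < x by rewrite divr_gt0.
have : x < Num.min d s by rewrite /x; move: mds; clear; lra.
rewrite lt_min => /andP[xd xs].
pose y := x%:C * cis (2 * pi / m%:R).
have ny : nc y = x by rewrite ncM nc_cis mulr1 nc_real gtr0_norm.
have nx : nc x%:C = x by rewrite nc_real gtr0_norm.
have := hd x%:C; have := hd y; rewrite !subr0 ny nx => /(_ xd) [e1 r1] /(_ xd) [e2 r2].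
have yx : y = x%:C.
  apply: injZ; rewrite ?ny ?nx //; apply: (inj _ _ r1 r2).
  by apply: (addIr (- f c)); rewrite e1 e2 /y exprMn cis_root_pow // mulr1.
have x0' : x%:C != 0 :> C by rewrite -nc_gt0 nx.
have := cis_root_neq1 m1; suff -> : cis (2 * pi / m%:R) = 1 :> C by rewrite eqxx.
by apply: (mulfI x0'); rewrite -/y yx mulr1.
Qed.

End Injective.

(** * Local Weierstrass data *)

Section Charts.
Context {R : realType}.
Local Notation C := R[i].
Local Notation nc := (@Normc.normc R).
Variable S : riemann_surface R.
Implicit Types (x y q : S) (h : S -> C).

Lemma chart_inv_near x q (V : set S) : chart_dom x q -> nbhs q V ->
  \forall z \near chart x q, V (chart_inv x z).
Proof.
move=> xq qV; have := chart_inv_continuous xq.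
by move=> k; apply: k; rewrite (chartK xq).
Qed.

Lemma chart_near x q (V : set C) : chart_dom x q -> nbhs (chart x q) V ->
  \forall q' \near q, V (chart x q').
Proof. by move=> xq; exact: (chart_continuous xq). Qed.

Lemma chart_dom_near x q : chart_dom x q -> \forall q' \near q, chart_dom x q'.
Proof. by move=> xq; apply: open_nbhs_nbhs; split=> //; exact: chart_dom_open. Qed.

Lemma chart_invK_near x q : chart_dom x q -> \forall z \near chart x q,
  chart_dom x (chart_inv x z) /\ chart x (chart_inv x z) = z.
Proof.
move=> xq; have : nbhs (chart x q) (chart x @` chart_dom x).
  by apply: open_nbhs_nbhs; split; [exact: chart_img_open|exists q].
by apply: filterS => _ [q' xq' <-]; rewrite (chartK xq').
Qed.

Lemma chart_transition x y q : chart_dom x q -> chart_dom y q ->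
  \forall z \near chart x q, chart_inv y (chart y (chart_inv x z)) = chart_inv x z.
Proof.
move=> xq yq; apply: filterS (chart_inv_near xq (chart_dom_near yq)) => z.
exact: chartK.
Qed.

Lemma cder_chart h x y q l : chart_dom x q -> chart_dom y q ->
  cder (h \o chart_inv y) (chart y q) l ->
  cder (h \o chart_inv x) (chart x q)
    (l * 'D_1 (chart y \o chart_inv x) (chart x q)).
Proof.
move=> xq yq hl.
have hm := derivable_cder (chart_holomorphic xq yq).
have hl' : cder (h \o chart_inv y) ((chart y \o chart_inv x) (chart x q)) l.
  by rewrite /= (chartK xq).
have := cder_comp hm hl'; apply: cder_near.
by apply: filterS (chart_transition xq yq) => z /= ->.
Qed.

Lemma holomorphic_fun_chart h x q : holomorphic_fun h -> chart_dom x q ->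
  derivable (h \o chart_inv x) (chart x q) 1.
Proof.
move=> hh xq; have := derivable_cder (hh q).
by move=> /(cder_chart xq (chart_dom_center q))/cder_derivable.
Qed.

Lemma holomorphic_fun_holo h x q : holomorphic_fun h -> chart_dom x q ->
  holo (h \o chart_inv x) (chart x q).
Proof.
move=> hh xq; have := chart_inv_near xq (chart_dom_near xq).
apply: filterS2 (chart_invK_near xq) => z [d zK] _.
by rewrite -zK; exact: holomorphic_fun_chart.
Qed.

Lemma dcoef_chart h x q : holomorphic_fun h -> chart_dom x q ->
  'D_1 (h \o chart_inv x) (chart x q) =
  dcoef h q * 'D_1 (chart q \o chart_inv x) (chart x q).
Proof.
move=> hh xq; have := derivable_cder (hh q).
by move=> /(cder_chart xq (chart_dom_center q))/cder_val.
Qed.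

End Charts.

Section HolomorphicMap.
Context {R : realType}.
Local Notation C := R[i].
Variables X S : riemann_surface R.
Variable pi_ : X -> S.

Lemma holomorphic_map_chart (y : X) (x : S) (y' : X) : holomorphic_map pi_ ->
  chart_dom y y' -> chart_dom x (pi_ y') ->
  derivable (chart x \o pi_ \o chart_inv y) (chart y y') 1.
Proof.
move=> [cpi hpi] yy' xpy.
have cd' := chart_dom_center y'; have cdp := chart_dom_center (pi_ y').
have h1 := derivable_cder (hpi y').
have h2 : cder (chart x \o chart_inv (pi_ y'))
    ((chart (pi_ y') \o pi_ \o chart_inv y') (chart y' y'))
    ('D_1 (chart x \o chart_inv (pi_ y')) (chart (pi_ y') (pi_ y'))).
  rewrite /= (chartK cd'); apply: derivable_cder.
  exact: chart_holomorphic.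
have [l h4] : exists l, cder (chart x \o pi_ \o chart_inv y') (chart y' y') l.
  eexists; apply: cder_near (cder_comp h1 h2).
  have : \forall z \near chart y' y', chart_dom (pi_ y') (pi_ (chart_inv y' z)).
    apply: (chart_inv_near cd' (V := fun v => chart_dom (pi_ y') (pi_ v))).
    exact: (cpi y' _ (chart_dom_near cdp)).
  by apply: filterS => z /= /chartK ->.
exact: (cder_derivable (cder_chart yy' cd' h4)).
Qed.

End HolomorphicMap.

(** * Local potentials of a ZMC-face *)

Section LocalData.
Context {R : realType}.
Local Notation C := R[i].
Local Notation nc := (@Normc.normc R).
Local Notation I3 := (isotropic_space R).

(* [f] is [(Re G, Re P, Im P)] near the point [z] of the coordinate [chart x];
   [P' dz] is the form omega of the Weierstrass data and [G' dz = g omega]. *)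
Record local_data (S : riemann_surface R) (f : S -> I3) (x : S) (z : C)
    (G P : C -> C) : Prop := {
  ld_G : holo G z;
  ld_P : holo P z;
  ld_immersion : 'D_1 P z != 0 \/ 'D_1 G z != 0;
  ld_nonconstant : ~ \forall w \near z, 'D_1 P w = 0;
  ld_eq : \forall w \near z, f (chart_inv x w) =
    (complex.Re (G w), complex.Re (P w), complex.Im (P w)) }.

(** Unique continuation on a connected surface: by [near_zero_dichotomy] in the charts, the set of
    points near which [F] is constant is clopen. It turns the global condition that [F^1] is
    non-constant into the local clause [ld_nonconstant]. *)
Lemma holomorphic_fun_locally_cst (X : riemann_surface R) (F : X -> C) (y : X) :
  holomorphic_fun F ->
  (\forall z \near chart y y, 'D_1 (F \o chart_inv y) z = 0) ->
  forall x x', F x = F x'.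
Proof.
move=> hF D0.
pose L := [set x : X | \forall x' \near x, F x' = F x].
have oL : open L.
  rewrite openE => x; rewrite /L /interior /= => h.
  apply: filterS (near_join h) => x' h'.
  by have e := nbhs_singleton h'; apply: filterS h' => x'' ->.
have key (x : X) : (\forall z \near chart x x, 'D_1 (F \o chart_inv x) z = 0) ->
    L x.
  move=> h; have hx := chart_dom_center x.
  have /nbhs_cP [r r0 hr] : \forall z \near chart x x,
      cder (F \o chart_inv x) z 0.
    apply: filterS2 (holomorphic_fun_holo hF hx) h => z dF <-.
    exact: derivable_cder dF.
  have : \forall z \near chart x x, F (chart_inv x z) = F x.
    apply/nbhs_cP; exists r => // z zr.
    have := @convex_deriv0 R [set z | nc (z - chart x x) < r] (F \o chart_inv x) (@convex_disc R _ _) hr z (chart x x) zr.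
    rewrite /= (chartK hx); apply; by rewrite /mkset subrr nc0.
  move=> /(chart_near hx) h'; apply: filterS2 (chart_dom_near hx) h' => x' d.
  by rewrite (chartK d).
have all x : L x.
  suff : [set: X] `<=` L by apply.
  apply: connected_dichotomy => //; first exact: rs_connected.
  - move=> {}x _; have hx := chart_dom_center x.
    case: (near_zero_dichotomy (holo_deriv (holomorphic_fun_holo hF hx))).
      by move=> /key; left.
    move=> h; right; apply: filterS2 (chart_dom_near hx) (chart_near hx h).
    move=> x' d nz Lx'; apply: nz.
    apply: filterS (near_join (chart_inv_near d Lx')) => z zx'.
    apply: cder_val; apply: cder_near (cder_cst (F x') z).
    by apply: filterS zx' => w /= ->.
  - by exists y; split => //; exact: key.
move=> x x'; suff : [set: X] `<=` [set x | F x = F x'] by move=> /(_ x); apply.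
apply: connected_dichotomy.
- exact: rs_connected.
- rewrite openE => z; rewrite /interior /= => <-; exact: all.
- move=> z _; case: (pselect (F z = F x')) => h; [by left|right].
  by apply: filterS (all z) => z' /= ->.
- by exists x'.
Qed.


Lemma cmul_eq0l (a b : C) : b != 0 -> a * b = 0 -> a = 0.
Proof. by move=> b0 /eqP; rewrite mulf_eq0 (negPf b0) orbF => /eqP. Qed.

(** Over an evenly covered neighbourhood the projection, read in charts, is injective, so it has a
    holomorphic inverse [g], and the lift descends as [F o g]. The normalisation [dF^1 = i dF^2]
    expresses [Re F^2] by [Im F^1] up to a constant. *)
Lemma zmc_local_data (S : riemann_surface R) (D : set S) (f : S -> I3) (x q : S) :
  zmc_face D f -> D q -> chart_dom x q ->
  exists G P, local_data f x (chart x q) G P.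
Proof.
move=> [X [pi_ [F [[[cov hpi _] [hF0 hF1 hF2] imm _ ncst fre] lift]]]] Dq xq.
have [_ piD covD] := cov.
have [V [oV Vq VD [I [U [s [oU _ piV sheets]]]]]] := covD q Dq.
have [y _ pyq] : (pi_ @` setT) q by rewrite piD.
have [i _ Uy] : (\bigcup_i U i) y by rewrite -piV /preimage /mkset pyq.
have [sK sU scont] := sheets i.
have yy := chart_dom_center y; have [cpi _] := hpi.
have nV : nbhs q V by exact: open_nbhs_nbhs.
have nU : nbhs y (U i) by apply: open_nbhs_nbhs; split.
have xpy : chart_dom x (pi_ y) by rewrite pyq.
set zx := chart x q; set zy := chart y y.
pose p := chart x \o pi_ \o chart_inv y.
have pzy : p zy = zx by rewrite /p /= /zy (chartK yy) pyq.
have hp : holo p zy.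
  have n1 : \forall z \near zy, chart_dom x (pi_ (chart_inv y z)).
    apply: (chart_inv_near yy (V := fun v => chart_dom x (pi_ v))).
    exact: (cpi y _ (chart_dom_near xpy)).
  apply: filterS2 (chart_invK_near yy) n1 => z [d zK] d'.
  by rewrite -zK; exact: holomorphic_map_chart.
(* The sheet section [s i] is a left inverse of the projection, which makes [p] injective. *)
have ginj : 'D_1 p zy != 0.
  apply: holo_injective_deriv => //.
  have n1 : \forall z \near zy, chart_dom x (pi_ (chart_inv y z)).
    apply: (chart_inv_near yy (V := fun v => chart_dom x (pi_ v))).
    exact: (cpi y _ (chart_dom_near xpy)).
  have : \forall z \near zy, [/\ U i (chart_inv y z),
      chart y (chart_inv y z) = z & chart_dom x (pi_ (chart_inv y z))].
    by apply: filterS3 (chart_inv_near yy nU) (chart_invK_near yy) n1 => z ? [].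
  move=> /nbhs_cP [r r0 hr]; exists r => // z w /hr [u1 k1 d1] /hr [u2 k2 d2] e.
  rewrite -k1 -k2; congr chart; rewrite -(sK _ u1) -(sK _ u2); congr s.
  by rewrite -(chartK d1) -(chartK d2); congr chart_inv.
have [g [hg gz dg pg] gp] := holo_local_inverse hp ginj.
rewrite pzy in hg gz dg pg.
have sq : s i q = y by rewrite -pyq sK.
have cs : {for q, continuous (s i)} by exact: scont.
have snear (W : set X) : nbhs y W -> \forall z \near zx, W (s i (chart_inv x z)).
  move=> yW; apply: (chart_inv_near xq (V := fun v => W (s i v))).
  by apply: cs; rewrite sq.
(* The continuous section of the covering and the holomorphic inverse [g] are the same map: [g o p]
   is the identity and the section inverts [pi_]. *)
have sg : \forall z \near zx, s i (chart_inv x z) = chart_inv y (g z).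
  have n1 := snear _ (chart_near yy gp).
  have n2 := snear _ (chart_dom_near yy).
  have n3 : \forall z \near zx, g (p (chart y (s i (chart_inv x z)))) =
      chart y (s i (chart_inv x z)) /\ chart_dom y (s i (chart_inv x z)).
    by apply: filterS2 n1 n2.
  apply: filterS3 n3 (chart_inv_near xq nV) (chart_invK_near xq) => z [+ d] Vz [_ zK].
  rewrite /p /= (chartK d); have [_ ->] := sU _ Vz; rewrite zK => ->.
  by rewrite (chartK d).
have hH0 : holo (crd0 \o F \o chart_inv y) zy by exact: holomorphic_fun_holo.
have hH1 : holo (crd1 \o F \o chart_inv y) zy by exact: holomorphic_fun_holo.
have hH2 : holo (crd2 \o F \o chart_inv y) zy by exact: holomorphic_fun_holo.
move: hH0 hH1 hH2; set H0 := _ \o chart_inv y; set H1 := _ \o chart_inv y.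
set H2 := _ \o chart_inv y => hH0 hH1 hH2.
have iso : \forall z \near zy, 'D_1 H1 z - 'i%C * 'D_1 H2 z = 0.
  apply: filterS (chart_invK_near yy) => z [d zK].
  have e1 := dcoef_chart hF1 d; have e2 := dcoef_chart hF2 d.
  rewrite zK in e1 e2; rewrite e1 e2 mulrA -mulrBl.
  by have -> := lift (chart_inv y z); rewrite mul0r.
have [k hk] : exists k, \forall z \near zy, H1 z - 'i%C * H2 z = k.
  exists (H1 zy - 'i%C * H2 zy).
  have /nbhs_cP [r r0 hr] : \forall z \near zy,
      cder (fun z => H1 z - 'i%C * H2 z) z 0.
    apply: filterS3 hH1 hH2 iso => z d1 d2 <-.
    exact: cderB (derivable_cder d1) (cderZ _ (derivable_cder d2)).
  apply/nbhs_cP; exists r => // z zr.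
  apply: (@convex_deriv0 R [set z | nc (z - zy) < r] (fun z => H1 z - 'i%C * H2 z)
    (@convex_disc R _ _) hr z zy zr).
  by rewrite /mkset subrr nc0.
have gn (W : C -> Prop) : (\forall z \near zy, W z) -> \forall z \near zx, W (g z).
  by move=> h; apply: (ccont_near (holo_ccont hg)); rewrite gz.
have hG0 : holo (fun z => H0 (g z)) zx by apply: holo_comp hg _; rewrite gz.
have hG1 : holo (fun z => H1 (g z)) zx by apply: holo_comp hg _; rewrite gz.
pose G z := H0 (g z).
(* From [H1 - i H2 = k], [Re H2 = Im H1 - Im k]; the shift by [i Im k] makes [Im P] equal to [Re H2]
   and leaves [Re P] equal to [Re H1]. *)
pose P z := H1 (g z) - 'i%C * (complex.Im k)%:C.
have dP : \forall z \near zx, 'D_1 P z = 'D_1 H1 (g z) * 'D_1 g z.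
  apply: filterS2 hg (gn _ hH1) => z dgz dh; apply: cder_val.
  have := cderB (cder_comp (derivable_cder dgz) (derivable_cder dh)) (cder_cst _ z).
  by rewrite subr0; exact.
have hP : holo P zx by apply: holoB hG1 _; exact: holo_cst.
have dG : 'D_1 G zx = 'D_1 H0 zy * 'D_1 g zx.
  apply: cder_val; rewrite -{1}gz.
  by apply: cder_comp; [exact: holo_cder|rewrite gz; exact: holo_cder].
have dg0 : \forall z \near zx, 'D_1 g z != 0.
  exact: near_neq0 (holo_ccont (holo_deriv hg)) dg.
have dH (F' : X -> C) : holomorphic_fun F' -> 'D_1 (F' \o chart_inv y) zy = dcoef F' y.
  by [].
exists G, P; split; [exact: hG0|exact: hP| | |].
- apply: contrapT => /not_orP [/negP/negPn/eqP P0 /negP/negPn/eqP G0].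
  move: P0 G0; rewrite dG (nbhs_singleton dP) gz.
  move=> /(cmul_eq0l dg) h1 /(cmul_eq0l dg) h0.
  apply: (imm y); have := lift y; rewrite /dcoef -/H0 -/H1 -/H2 -/zy h0 h1.
  move=> h; suff -> : 'D_1 H2 zy = 0 by [].
  have i0 : 'i%C != 0 :> C by rewrite -nc_gt0 nci.
  apply: (cmul_eq0l i0); rewrite mulrC; apply/eqP.
  by rewrite -oppr_eq0 -sub0r; apply/eqP.
- move=> P0.
  have Hg : \forall z \near zx, 'D_1 H1 (g z) = 0.
    apply: filterS3 P0 dP dg0 => z -> /esym e g0.
    exact: cmul_eq0l g0 e.
  have : \forall w \near zy, 'D_1 H1 w = 0.
    have Hpg : \forall w \near zy, 'D_1 H1 (g (p w)) = 0.
      apply: (ccont_near (P := fun z => 'D_1 H1 (g z) = 0) (holo_ccont hp)).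
      by rewrite pzy.
    by apply: filterS2 Hpg gp => w + e; rewrite e.
  move=> /(holomorphic_fun_locally_cst hF1) all.
  by have [a [b ab]] := ncst; apply: ab; exact: (all a b).
- have n1 := chart_inv_near xq nV.
  apply: filterS3 n1 sg (gn _ hk) => z Vz sz kz.
  have [_ ps] := sU _ Vz.
  rewrite -{1}ps fre /re3 sz -/(H0 (g z)).
  congr (_, _, _).
    rewrite /P ReD ReN cReM /= !mul0r mul1r subr0 oppr0 addr0.
    by [].
  rewrite /P ImD ImN cImM /= mul0r mul1r add0r.
  have := congr1 (@complex.Im R) kz; rewrite ImD ImN cImM /= mul0r mul1r add0r.
  move=> <-; rewrite opprB addrCA subrr addr0.
  by [].
Qed.

End LocalData.

(** * Weierstrass data and curvature of the lift-metric *)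

Section Weierstrass.
Context {R : realType}.
Local Notation C := R[i].
Local Notation nc := (@Normc.normc R).
Local Notation I3 := (isotropic_space R).
Implicit Types (u : C -> R) (z w v : C) (G P p h : C -> C).

Definition dir_deriv (v : C) u z : R := derive1 (fun t : R => u (z + t%:C * v)) 0.

Lemma partial_reE u z : partial_re u z = dir_deriv 1 u z.
Proof. by rewrite /dir_deriv; under eq_fun do rewrite mulr1. Qed.

Lemma partial_imE u z : partial_im u z = dir_deriv 'i%C u z.
Proof. by rewrite /dir_deriv; under eq_fun do rewrite mulrC. Qed.

Lemma near_line z v (A : C -> Prop) : (\forall w \near z, A w) ->
  \forall t \near (0 : R), A (z + t%:C * v).
Proof.
have := rder_cont (rder_line z v 0) => c zA; apply: c.
by rewrite mul0r addr0.
Qed.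

Lemma near_dir_deriv v u1 u2 z : (\forall w \near z, u1 w = u2 w) ->
  dir_deriv v u1 z = dir_deriv v u2 z.
Proof.
move=> h; rewrite /dir_deriv !derive1E; apply: near_eq_derive.
exact: near_line h.
Qed.

Lemma dir_deriv_val v u z d : is_derive (0 : R) 1 (fun t : R => u (z + t%:C * v)) d ->
  dir_deriv v u z = d.
Proof. by move=> [_ <-]; rewrite /dir_deriv derive1E. Qed.

Lemma line_rder v G z l : cder G z l ->
  rder (fun t => G (z + t%:C * v)) 0 (l * v).
Proof.
move=> h; apply: rder_comp (rder_line z v 0) _.
by rewrite mul0r addr0.
Qed.

Lemma dir_deriv_Re v G z l : cder G z l ->
  dir_deriv v (fun w => complex.Re (G w)) z = complex.Re (l * v).
Proof. by move=> h; apply: dir_deriv_val; have /rderP [] := line_rder v h. Qed.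

Lemma del_Re (S : riemann_surface R) (u : S -> R) (x : S) G z l :
  (\forall w \near z, u (chart_inv x w) = complex.Re (G w)) -> cder G z l ->
  del u x z = l / 2.
Proof.
move=> uG hG; rewrite /del partial_reE partial_imE.
rewrite !(near_dir_deriv _ (u2 := fun w => complex.Re (G w)) uG).
rewrite !(dir_deriv_Re _ hG) mulr1 ReiNIm; congr (_ / _).
by rewrite rmorphN mulrN opprK -complexE.
Qed.

Lemma potential_forms (S : riemann_surface R) (f : S -> I3) (x : S) z G P :
  holo G z -> holo P z ->
  (\forall w \near z, f (chart_inv x w) =
    (complex.Re (G w), complex.Re (P w), complex.Im (P w))) ->
  \forall w \near z,
    omega f x w = 'D_1 P w /\ 2 * del (crd0 \o f) x w = 'D_1 G w.
Proof.
move=> hG hP eqf.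
apply: filterS3 hG hP (near_join eqf) => w dG dP e.
have two : (2 : C) != 0 by rewrite pnatr_eq0.
split; last first.
  rewrite (del_Re (G := G) (l := 'D_1 G w)).
  - by rewrite mulrC divfK.
  - by apply: filterS e => w' /= ->.
  - exact: derivable_cder.
rewrite /omega (del_Re (u := crd1 \o f) (G := P) (l := 'D_1 P w)); last 2 first.
- by apply: filterS e => w' /= ->.
- exact: derivable_cder.
(* [Im P = Re (- i P)], so the two planar coordinates contribute [P' / 2] each to [omega]. *)
rewrite (del_Re (u := crd2 \o f) (G := fun w => - 'i%C * P w) (l := - 'i%C * 'D_1 P w)).
- by field : (@sqr_i R).
- by apply: filterS e => w' /= ->; rewrite mulNr ReN cReM /= mul0r mul1r sub0r opprK.
- exact: cderZ (derivable_cder dP).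
Qed.

Lemma ld_forms (S : riemann_surface R) (f : S -> I3) (x : S) z G P :
  local_data f x z G P -> \forall w \near z,
    omega f x w = 'D_1 P w /\ 2 * del (crd0 \o f) x w = 'D_1 G w.
Proof. by move=> [hG hP _ _]; exact: potential_forms. Qed.

Definition lam p h w : R := 2 * normsq (p w) + normsq (h w).

Lemma normsqE z : normsq z = nc z ^+ 2.
Proof. by rewrite nc_sqr. Qed.

Lemma lam_gt0 p h z : p z != 0 \/ h z != 0 -> 0 < lam p h z.
Proof.
rewrite /lam !normsqE; have a := sqr_ge0 (nc (p z)); have b := sqr_ge0 (nc (h z)).
case=> k; have : 0 < nc (p z) ^+ 2 \/ 0 < nc (h z) ^+ 2.
- by left; rewrite exprn_gt0 // nc_gt0.
- by case=> ?; lra.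
- by right; rewrite exprn_gt0 // nc_gt0.
- by case=> ?; lra.
Qed.

Lemma ld_lift_factor (S : riemann_surface R) (f : S -> I3) (x : S) z G P :
  local_data f x z G P -> \forall w \near z,
    lift_factor f x w = lam (fun w => 'D_1 P w) (fun w => 'D_1 G w) w.
Proof.
move=> /ld_forms; apply: filterS => w [e1 e2].
by rewrite /lift_factor e1 e2.
Qed.

Lemma isdM (f g : R -> R) (t a b : R) : is_derive t 1 f a -> is_derive t 1 g b ->
  is_derive t 1 (fun s => f s * g s) (a * g t + f t * b).
Proof.
move=> h k; apply: is_derive_eq.
by change (f t * b + g t * a = a * g t + f t * b); ring.
Qed.

Lemma isdD (f g : R -> R) (t a b : R) : is_derive t 1 f a -> is_derive t 1 g b ->
  is_derive t 1 (fun s => f s + g s) (a + b).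
Proof. by move=> h k; exact: is_deriveD. Qed.

Lemma isdZ (f : R -> R) (k t a : R) : is_derive t 1 f a ->
  is_derive t 1 (fun s => k * f s) (k * a).
Proof. by move=> h; exact: is_deriveZ. Qed.

Lemma isdV (f : R -> R) (t a : R) : f t != 0 -> is_derive t 1 f a ->
  is_derive t 1 (fun s => (f s)^-1) (- a / f t ^+ 2).
Proof.
move=> f0 [df <-]; split; first exact: derivableV.
by rewrite deriveV // -[_ *: _]/(_ * _) !mulNr mulrC.
Qed.

Lemma isd_eq (f g : R -> R) (t a b : R) : is_derive t 1 f a ->
  (forall s, f s = g s) -> a = b -> is_derive t 1 g b.
Proof. by move=> + /funext <- <-. Qed.

(** Derivative of [lam] in the direction [v], as a function of the values [p], [h] and of the
    derivatives [p'], [h']. *)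
Let N (p' p h' h : C) (v : C) : R :=
  4 * (complex.Re (p' * v) * complex.Re p + complex.Im (p' * v) * complex.Im p) +
  2 * (complex.Re (h' * v) * complex.Re h + complex.Im (h' * v) * complex.Im h).

Let lam_line p h z v (p' h' : C) : cder p z p' -> cder h z h' ->
  is_derive (0 : R) 1 (fun t : R => lam p h (z + t%:C * v)) (N p' (p z) h' (h z) v).
Proof.
move=> hp hh.
have /rderP [a1 a2] := line_rder v hp; have /rderP [b1 b2] := line_rder v hh.
apply: (isd_eq (isdD (isdZ 2 (isdD (isdM a1 a1) (isdM a2 a2)))
  (isdD (isdM b1 b1) (isdM b2 b2)))) => [s|] /=.
  by rewrite /lam /normsq; ring.
by rewrite !mul0r !addr0 /N; ring.
Qed.

Let N_line p h p1 h1 z v (p2 h2 : C) : cder p z (p1 z) -> cder h z (h1 z) ->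
  cder p1 z p2 -> cder h1 z h2 ->
  is_derive (0 : R) 1 (fun t : R => N (p1 (z + t%:C * v)) (p (z + t%:C * v))
      (h1 (z + t%:C * v)) (h (z + t%:C * v)) v)
    (N (p2 * v) (p z) (h2 * v) (h z) v + 4 * normsq (p1 z * v) + 2 * normsq (h1 z * v)).
Proof.
move=> hp hh hp1 hh1.
have /rderP [a1 a2] := line_rder v hp; have /rderP [b1 b2] := line_rder v hh.
have hp1' := cderM hp1 (cder_cst v z); have hh1' := cderM hh1 (cder_cst v z).
have /rderP [c1 c2] := line_rder v hp1'; have /rderP [d1 d2] := line_rder v hh1'.
apply: (isd_eq (isdD (isdZ 4 (isdD (isdM c1 a1) (isdM c2 a2)))
  (isdZ 2 (isdD (isdM d1 b1) (isdM d2 b2))))) => [s|] //=.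
by rewrite !mul0r !mulr0 !addr0 /N /normsq; ring.
Qed.

Lemma dir_deriv_ln v p h z (p' h' : C) : cder p z p' -> cder h z h' -> 0 < lam p h z ->
  dir_deriv v (fun w => ln (lam p h w)) z = N p' (p z) h' (h z) v / lam p h z.
Proof.
move=> hp hh l0; apply: dir_deriv_val.
have h1 := lam_line v hp hh.
have h2 : is_derive (lam p h (z + (0 : R)%:C * v)) 1 (@ln R) (lam p h z)^-1.
  by rewrite mul0r addr0; exact: is_derive1_ln.
apply: (isd_eq (@is_derive1_comp _ (@ln R)
  (fun t : R => lam p h (z + t%:C * v)) 0 _ _ h2 h1)) => // .
exact: mulrC.
Qed.

(** The second derivatives [p2], [h2] enter through [v ^+ 2] and cancel between [v = 1] and [v = i];
    the rest is a Lagrange identity. *)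
Let laplacian_alg (p2 h2 q k a b : C) (l : R) :
  l = 2 * normsq a + normsq b -> l != 0 ->
  (N (p2 * 1) a (h2 * 1) b 1 + 4 * normsq (q * 1) + 2 * normsq (k * 1)) / l - N q a k b 1 ^+ 2 / l ^+ 2 +
  ((N (p2 * 'i%C) a (h2 * 'i%C) b 'i%C + 4 * normsq (q * 'i%C)
    + 2 * normsq (k * 'i%C)) / l - N q a k b 'i%C ^+ 2 / l ^+ 2) =
  8 * normsq (a * k - q * b) / l ^+ 2.
Proof.
move=> -> ln0.
case: a b p2 h2 q k ln0 => [a1 a2] [b1 b2] [c1 c2] [d1 d2] [e1 e2] [g1 g2].
by rewrite /N /normsq /= => ln0; field.
Qed.

Lemma laplacianE u z : laplacian u z =
  dir_deriv 1 (dir_deriv 1 u) z + dir_deriv 'i%C (dir_deriv 'i%C u) z.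
Proof.
have e1 : partial_re u = dir_deriv 1 u by apply/funext => w; rewrite partial_reE.
have e2 : partial_im u = dir_deriv 'i%C u by apply/funext => w; rewrite partial_imE.
by rewrite /laplacian e1 e2 partial_reE partial_imE.
Qed.

(** [lam] is the squared norm of the holomorphic curve [(sqrt 2 p, h)], and this is the usual
    formula for the Laplacian of the logarithm of such a norm, with the Wronskian in the
    numerator. *)
Lemma laplacian_ln p h z : holo p z -> holo h z -> 0 < lam p h z ->
  laplacian (fun w => ln (lam p h w)) z =
  8 * normsq (p z * 'D_1 h z - 'D_1 p z * h z) / lam p h z ^+ 2.
Proof.
move=> hp hh l0.
pose p1 w := 'D_1 p w; pose h1 w := 'D_1 h w.
have near_pos : \forall w \near z, 0 < lam p h w.
  have [k|k] : p z != 0 \/ h z != 0.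
    case: (eqVneq (p z) 0) => pz; last by left.
    case: (eqVneq (h z) 0) => hz; last by right.
    by move: l0; rewrite /lam pz hz /normsq /= !expr0n /= !addr0 mulr0 ltxx.
  - by apply: filterS (near_neq0 (holo_ccont hp) k) => w pw; apply: lam_gt0; left.
  - by apply: filterS (near_neq0 (holo_ccont hh) k) => w pw; apply: lam_gt0; right.
have first v : \forall w \near z, dir_deriv v (fun w => ln (lam p h w)) w =
    N (p1 w) (p w) (h1 w) (h w) v / lam p h w.
  apply: filterS3 near_pos hp hh => w lw dp dh.
  by apply: dir_deriv_ln => //; exact: derivable_cder.
have second v : dir_deriv v (dir_deriv v (fun w => ln (lam p h w))) z =
    (N ('D_1 p1 z * v) (p z) ('D_1 h1 z * v) (h z) v + 4 * normsq (p1 z * v) +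
     2 * normsq (h1 z * v)) / lam p h z
    - (N (p1 z) (p z) (h1 z) (h z) v) ^+ 2 / lam p h z ^+ 2.
  rewrite (near_dir_deriv _ (first v)); apply: dir_deriv_val.
  have cp := holo_cder hp; have ch := holo_cder hh.
  have cp1 := holo_cder (holo_deriv hp); have ch1 := holo_cder (holo_deriv hh).
  have l0' : lam p h (z + (0 : R)%:C * v) != 0 by rewrite mul0r addr0 gt_eqF.
  apply: (isd_eq (isdM (@N_line p h p1 h1 z v _ _ cp ch cp1 ch1)
    (@isdV (fun t : R => lam p h (z + t%:C * v)) 0 _ l0' (lam_line v cp ch)))) => [//|] /=.
  rewrite !mul0r !addr0.
  by rewrite /p1 /h1 mulNr mulrN mulrA -expr2.
rewrite laplacianE.
rewrite !second -/(p1 z) -/(h1 z).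
by apply: laplacian_alg; rewrite // gt_eqF.
Qed.

Lemma near_laplacian u1 u2 z : (\forall w \near z, u1 w = u2 w) ->
  laplacian u1 z = laplacian u2 z.
Proof.
move=> h; rewrite (laplacianE u1) (laplacianE u2).
have k v : \forall w \near z, dir_deriv v u1 w = dir_deriv v u2 w.
  by apply: filterS (near_join h) => w; exact: near_dir_deriv.
by rewrite (near_dir_deriv 1 (k 1)) (near_dir_deriv 'i%C (k 'i%C)).
Qed.

(* The density of |K| dA in a coordinate in which [dP = p dz], [dG = h dz]. *)
Definition curv_density p h z : R :=
  4 * normsq (p z * 'D_1 h z - 'D_1 p z * h z) / lam p h z ^+ 2.

Lemma abs_curvature (E : C -> R) p h z : holo p z -> holo h z ->
  p z != 0 \/ h z != 0 -> (\forall w \near z, E w = lam p h w) ->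
  `|gauss_curvature E z| * E z = curv_density p h z.
Proof.
move=> hp hh im lE; have l0 : 0 < lam p h z by exact: lam_gt0.
rewrite /gauss_curvature (nbhs_singleton lE).
have -> : laplacian (fun w => ln (E w)) z = laplacian (fun w => ln (lam p h w)) z.
  by apply: near_laplacian; apply: filterS lE => w ->.
rewrite (laplacian_ln hp hh l0).
rewrite /curv_density; set n := normsq _; set l := lam p h z in l0 *.
have n0 : 0 <= n by rewrite /n normsqE sqr_ge0.
have l1 : l != 0 by rewrite gt_eqF.
rewrite mulNr normrN ger0_norm; first by field.
by rewrite !divr_ge0 ?mulr_ge0 ?sqr_ge0 // ltW.
Qed.

Lemma ld_curvature (S : riemann_surface R) (f : S -> I3) (x : S) z G P :
  local_data f x z G P ->
  `|gauss_curvature (lift_factor f x) z| * lift_factor f x z =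
  curv_density (fun w => 'D_1 P w) (fun w => 'D_1 G w) z.
Proof.
move=> ld; have [hG hP im _ _] := ld.
exact: (abs_curvature (holo_deriv hP) (holo_deriv hG) im (ld_lift_factor ld)).
Qed.

End Weierstrass.

(** * The values of g near an end *)

Section Dyadic.
Context {R : realType}.
Local Notation C := R[i].
Local Notation nc := (@Normc.normc R).
Implicit Types (z w : C) (n m : nat) (x y : R).

(* [(n, (i, j))] stands for the half-open dyadic square of side [2^-n] with
   lower left corner [(i + j 'i) / 2^n]. *)
Definition dyadic : Type := nat * (int * int).

Definition dyadic_at n z : int * int :=
  (Num.floor (2 ^+ n * complex.Re z), Num.floor (2 ^+ n * complex.Im z)).

Definition dbox (k : dyadic) : set C := [set z | dyadic_at k.1 z = k.2].

Definition darea (k : dyadic) : R := 4^-1 ^+ k.1.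

Definition parent (ij : int * int) : int * int := ((ij.1 %/ 2)%Z, (ij.2 %/ 2)%Z).

Lemma floor_half x : Num.floor (x / 2) = (Num.floor x %/ 2)%Z.
Proof.
set i := Num.floor x; have := floor_itv x; rewrite -/i => /andP[ix xi].
have := divz_eq i 2; set q := (i %/ 2)%Z; set r := (i %% 2)%Z => iE.
have r0 : 0 <= r by rewrite modz_ge0.
have r1 : r < 2 by rewrite ltz_pmod.
apply: floor_def; apply/andP; split.
  rewrite ler_pdivlMr //; apply: le_trans ix.
  by rewrite -(intrM R q 2) ler_int iE lerDl.
rewrite ltr_pdivrMr //; apply: (lt_le_trans xi).
rewrite -(intrM R (q + 1) 2) ler_int iE mulrDl mul1r -addrA lerD2l.
by rewrite lezD1.
Qed.

Lemma dyadic_at_parent n z : dyadic_at n z = parent (dyadic_at n.+1 z).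
Proof.
rewrite /dyadic_at /parent /= -!floor_half.
have e x : 2 ^+ n.+1 * x / 2 = 2 ^+ n * x by rewrite exprS; field.
by rewrite !e.
Qed.

Lemma dyadic_at_iter n m z : dyadic_at n z = iter m parent (dyadic_at (n + m) z).
Proof.
elim: m n => [|m IH] n; first by rewrite addn0.
by rewrite iterSr addnS -dyadic_at_parent.
Qed.

Lemma floor_eq_dist x y : Num.floor x = Num.floor y -> `|x - y| < 1.
Proof.
move=> e; have /andP[a b] := floor_itv x; have /andP[c d] := floor_itv y.
rewrite e in a b; move: a b c d; rewrite intrD ltr_norml => *.
by apply/andP; split; lra.
Qed.

Lemma dyadic_dist n z w : dyadic_at n w = dyadic_at n z ->
  nc (w - z) <= 2 * 2^-1 ^+ n.
Proof.
move=> [/floor_eq_dist e1 /floor_eq_dist e2].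
have p0 : 0 < 2 ^+ n :> R by rewrite exprn_gt0.
apply: (le_trans (nc_ReIm _)); rewrite ReD ImD ReN ImN.
rewrite -(ler_pM2l p0) mulrDr mulrCA exprVn divff ?gt_eqF // mulr1.
move: e1 e2; rewrite -!mulrBr !normrM (ger0_norm (ltW p0)).
lra.
Qed.

Lemma dyadic_small z (d : R) : 0 < d ->
  exists n, 2 * 2^-1 ^+ n < d.
Proof.
move=> d0; apply: geometric_small => //.
by rewrite invr_ge0 ler0n invf_lt1 // ltr1n.
Qed.

Lemma darea_side (k : dyadic) : darea k = (2^-1 ^+ k.1) ^+ 2.
Proof. by rewrite /darea -exprM mulnC exprM; congr (_ ^+ _); field. Qed.

Lemma darea_ge0 k : 0 <= darea k.
Proof. by rewrite /darea exprn_ge0 // invr_ge0. Qed.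

Definition dmaximal (P : dyadic -> Prop) (k : dyadic) : Prop :=
  P k /\ forall m, (m < k.1)%N -> ~ P (m, iter (k.1 - m) parent k.2).

(** Two dyadic squares that meet are nested, and a maximal one has no ancestor satisfying [P]. *)
Lemma dmaximal_disjoint P k k' z : dmaximal P k -> dmaximal P k' ->
  dbox k z -> dbox k' z -> k = k'.
Proof.
wlog kk : k k' / (k.1 <= k'.1)%N.
  move=> H; have [/H//|/ltnW/H h] := leqP k.1 k'.1 => p p' b b'.
  by apply/esym/h.
case: k k' kk => [n ij] [n' ij'] /= nn [Pk _] [_ mx]; rewrite /dbox /= => e e'.
have [nE|nn'] := eqVneq n n'; first by rewrite -e -e' nE.
have lt : (n < n')%N by rewrite ltn_neqAle nn'.
case: (mx n lt) => /=; have := dyadic_at_iter n (n' - n) z.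
by rewrite subnKC // e e' => <-.
Qed.

Lemma dmaximal_cover P z : (exists n, P (n, dyadic_at n z)) ->
  exists2 k, dmaximal P k & dbox k z.
Proof.
move=> ex; have ex' : exists n, `[< P (n, dyadic_at n z) >].
  by have [n Pn] := ex; exists n; apply/asboolP.
case: (ex_minnP ex') => n /asboolP Pn mn.
exists (n, dyadic_at n z) => //; split => //= m mln.
rewrite -{2}(subnKC (ltnW mln)) -dyadic_at_iter => Pm.
by have := mn m; rewrite leqNgt mln => H; have := H (asboolT Pm).
Qed.

Let square_bound (x : R) : 0 <= x -> x <= 4 ^+ 2 -> (2 + x) ^+ 2 <= 18 ^+ 2.
Proof. by rewrite !expr2 => x0 x16; nra. Qed.

(** For [x <= 4] the weight [(2 + x^2)^2] is at most [18^2 = 4 * 81], which is where 81 comes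
    from. *)
Lemma density_bound (x a b : R) : 0 <= x <= 4 -> 0 <= a <= b ->
  a ^+ 2 / 81 * (2 + x ^+ 2) ^+ 2 <= 4 * b ^+ 2.
Proof.
move=> /andP[x0 x4] /andP[a0 ab].
have x2 : (2 + x ^+ 2) ^+ 2 <= 18 ^+ 2.
  by apply: square_bound; [exact: sqr_ge0|rewrite ler_sqr ?nnegrE].
apply: (@le_trans _ _ (a ^+ 2 / 81 * 18 ^+ 2)).
  by apply: ler_wpM2l x2; rewrite divr_ge0 // sqr_ge0.
have -> : a ^+ 2 / 81 * 18 ^+ 2 = 4 * a ^+ 2 by field.
apply: ler_wpM2l; first exact: ler0n.
by rewrite ler_sqr ?nnegrE // (le_trans a0).
Qed.

End Dyadic.

(** * Covering the values of g by squares of finite total area *)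

Section SquareCover.
Context {R : realType}.
Local Notation C := R[i].
Local Notation nc := (@Normc.normc R).
Implicit Types (z y : C) (n m : nat).

Definition punc (c : C) (r : R) : set C := [set z | 0 < nc (z - c) < r].

(* Stands for [\int_A e <= T] and does not require [e] to be measurable. *)
Definition lower_sums_le (A : set C) (e : C -> R) (T : R) : Prop :=
  forall (s : seq dyadic) (kap : dyadic -> R), uniq s ->
    (forall k k' z, k \in s -> k' \in s -> dbox k z -> dbox k' z -> k = k') ->
    (forall k z, k \in s -> dbox k z -> A z /\ 0 <= kap k <= e z) ->
    \sum_(k <- s) kap k * darea k <= T.

Variables (w h : C -> C) (c : C) (r : R).
Hypothesis hw : forall z, punc c r z -> holo w z.
Hypothesis hh : forall z, punc c r z -> holo h z.
Hypothesis im : forall z, punc c r z -> w z != 0 \/ h z != 0.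

Definition unit_square (z : C) : Prop :=
  0 <= complex.Re z <= 1 /\ 0 <= complex.Im z <= 1.

(** The values of [g = h / w] on the square [k] that fall into the unit square lie in the square of
    centre [a] and half-side [s]. Here [kap] is a lower bound for the curvature density, so [s ^+ 2]
    is paid for by curvature and plane area. The distance to [c] lets a smaller disc avoid any
    finite number of squares. *)
Let good (k : dyadic) (a : C) (s kap : R) : Prop :=
  [/\ 0 <= kap, 0 <= s, s ^+ 2 <= (1458 * kap + 1) * darea k,
      exists2 d : R, 0 < d & forall z, dbox k z -> d <= nc (z - c) &
      forall z, dbox k z -> [/\ punc c r z, kap <= curv_density w h z &
        w z != 0 -> unit_square (h z / w z) ->
        `|complex.Re (h z / w z) - complex.Re a| < s /\
        `|complex.Im (h z / w z) - complex.Im a| < s]].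

Lemma unit_square_nc z : unit_square z -> nc z <= 2.
Proof.
move=> [/andP[a b] /andP[d e]]; apply: (le_trans (nc_ReIm z)).
by rewrite !ger0_norm //; lra.
Qed.

Lemma curv_density_ge0 (p g : C -> C) z : 0 <= curv_density p g z.
Proof.
rewrite /curv_density normsqE; apply: divr_ge0; last exact: sqr_ge0.
by apply: mulr_ge0; [exact: ler0n|exact: sqr_ge0].
Qed.

(** By the quotient rule, the curvature form is the pull-back by [g] of a multiple of spherical
    area. *)
Lemma curv_density_quotient z : punc c r z -> w z != 0 ->
  curv_density w h z =
  4 * nc ('D_1 (fun y => h y / w y) z) ^+ 2 / (2 + nc (h z / w z) ^+ 2) ^+ 2.
Proof.
move=> pz wz; have cw := holo_cder (hw pz); have ch := holo_cder (hh pz).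
rewrite (cder_val (cderM ch (cderV wz cw))).
rewrite /curv_density /lam !normsqE.
set h' := 'D_1 h z; set w' := 'D_1 w z.
have -> : h' / w z + h z * (- w' / w z ^+ 2) = (w z * h' - w' * h z) / w z ^+ 2.
  by field.
rewrite !nc_div ncX; set N := nc (_ - _).
have w0 : 0 < nc (w z) by rewrite nc_gt0.
have l0 : 2 * nc (w z) ^+ 2 + nc (h z) ^+ 2 != 0.
  rewrite gt_eqF // ltr_pwDl ?sqr_ge0 //.
  by rewrite mulr_gt0 // exprn_gt0.
by field; rewrite l0 gt_eqF.
Qed.

Let punc_open z : punc c r z -> \forall y \near z, punc c r y.
Proof.
move=> /andP[z0 zr]; apply/nbhs_cP.
exists (Num.min (nc (z - c)) (r - nc (z - c))).
  by rewrite lt_min z0 subr_gt0.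
move=> y; rewrite lt_min => /andP[y1 y2]; apply/andP; split.
  have := nc_subl (z - c) (z - y); rewrite (normcB z y).
  have -> : z - c - (z - y) = y - c by ring.
  lra.
have -> : y - c = (y - z) + (z - c) by ring.
by apply: (le_lt_trans (nc_leD _ _)); lra.
Qed.

(** Near [z] either [g] avoids the unit square, and zero data do, or [g] is bounded and nearly
    affine, so a small square has an image of size about [|g'|] times its side. *)
Let exists_good z : punc c r z -> exists n a s kap, good (n, dyadic_at n z) a s kap.
Proof.
move=> pz.
have vac : (\forall y \near z, w y != 0 -> ~ unit_square (h y / w y)) ->
    exists n a s kap, good (n, dyadic_at n z) a s kap.
  move=> nv; have /andP[z0 zr] := pz.
  have nz : \forall y \near z, nc (z - c) / 2 <= nc (y - c).
    apply/nbhs_cP; exists (nc (z - c) / 2); first by rewrite divr_gt0.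
    move=> y yz; have := nc_subl (z - c) (z - y); rewrite (normcB z y).
    have -> : z - c - (z - y) = y - c by ring.
    lra.
  have /nbhs_cP [d d0 hd] : \forall y \near z, [/\ punc c r y,
      nc (z - c) / 2 <= nc (y - c) & w y != 0 -> ~ unit_square (h y / w y)].
    by apply: filterS3 (punc_open pz) nz nv.
  have [n hn] := dyadic_small z d0.
  have hb y : dbox (n, dyadic_at n z) y -> nc (y - z) < d.
    by move=> /dyadic_dist /le_lt_trans; apply.
  exists n, 0, 0, 0; split => //.
  - by rewrite expr0n mulr0 add0r mul1r darea_ge0.
  - exists (nc (z - c) / 2); first by rewrite divr_gt0.
    by move=> y /hb/hd [].
  - move=> y /hb/hd [py _ nsq]; split => //.
    exact: curv_density_ge0.
    by move=> wy /(nsq wy).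
have [wz|wz] := eqVneq (w z) 0.
  apply: vac; have hz : h z != 0 by case: (im pz) => //; rewrite wz eqxx.
  have hz0 : 0 < nc (h z) by rewrite nc_gt0.
  have cw := holo_ccont (hw pz); have ch := holo_ccont (hh pz).
  have nw : \forall y \near z, nc (w y) < nc (h z) / 8.
    apply: (ccont_near (P := fun v => nc v < nc (h z) / 8) cw); rewrite wz.
    by apply/nbhs_cP; exists (nc (h z) / 8); rewrite ?divr_gt0 // => v; rewrite subr0.
  have nh : \forall y \near z, nc (h z) / 2 < nc (h y).
    apply: (ccont_near (P := fun v => nc (h z) / 2 < nc v) ch).
    apply/nbhs_cP; exists (nc (h z) / 2); rewrite ?divr_gt0 // => v vh.
    by have := nc_subr v (h z); lra.
  apply: filterS2 nw nh => y wy hy wy0 /unit_square_nc.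
  rewrite nc_div ler_pdivrMr ?nc_gt0 //; lra.
(* Points of the unit square have modulus at most 2: from [|g z| >= 3] nearby values avoid it, and
   from [|g z| < 3] nearby values stay within 4, the range of [density_bound]. *)
have [g3|g3] := leP 3 (nc (h z / w z)).
  apply: vac.
  have cg : ccont (fun y => h y / w y) z.
    by apply: ccontM; [exact: holo_ccont (hh pz)|apply: ccontV wz _; exact: holo_ccont (hw pz)].
  have ng : \forall y \near z, 2 < nc (h y / w y).
    apply: (ccont_near (P := fun v => 2 < nc v) cg).
    apply/nbhs_cP; exists 1; rewrite ?ltr01 // => v vh.
    by have := nc_subr v (h z / w z); lra.
  by apply: filterS ng => y hy _ /unit_square_nc; lra.
pose g y := h y / w y.
have hg : holo g z by apply: holoM (hh pz) _; apply: holoV wz (hw pz).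
(* Tolerance for the derivative; small enough that [9 * (mm + 2 eta)^2 <= 18 mm^2 + 1], and
   [18 * 81 = 1458]. *)
pose eta : R := 1 / 20.
pose l := 'D_1 g z.
have /andP[z0 zr] := pz.
have nz : \forall y \near z, nc (z - c) / 2 <= nc (y - c).
  apply/nbhs_cP; exists (nc (z - c) / 2); first by rewrite divr_gt0.
  move=> y yz; have := nc_subl (z - c) (z - y); rewrite (normcB z y).
  have -> : z - c - (z - y) = y - c by ring.
  lra.
have n1 : \forall y \near z, nc l - eta <= nc ('D_1 g y).
  apply: (ccont_near (P := fun v => nc l - eta <= nc v) (holo_ccont (holo_deriv hg))).
  apply/nbhs_cP; exists eta; rewrite /eta // ?divr_gt0 // => v vh.
  by have := nc_subr v l; rewrite -/l in vh *; lra.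
have n2 : \forall y \near z, nc (g y) <= 4.
  apply: (ccont_near (P := fun v => nc v <= 4) (holo_ccont hg)).
  apply/nbhs_cP; exists 1; rewrite ?ltr01 // => v vh.
  by have := nc_subl v (g z); rewrite -/(g z) in g3; lra.
have n3 : \forall y \near z, nc (g y - g z) <= (nc l + eta) * nc (y - z).
  have eta0 : 0 < eta by rewrite divr_gt0.
  have [d d0 hd] := holo_cder hg eta0; apply/nbhs_cP; exists d => // y /hd h1.
  have -> : g y - g z = (g y - g z - l * (y - z)) + l * (y - z) by ring.
  by apply: (le_trans (nc_leD _ _)); rewrite ncM mulrDl addrC lerD2l.
have nw := near_neq0 (holo_ccont (hw pz)) wz.
have /nbhs_cP [d d0 hd] : \forall y \near z, ([/\ punc c r y,
    nc (z - c) / 2 <= nc (y - c) & w y != 0] /\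
    [/\ nc l - eta <= nc ('D_1 g y), nc (g y) <= 4 &
    nc (g y - g z) <= (nc l + eta) * nc (y - z)]).
  have a1 : \forall y \near z, [/\ punc c r y,
    nc (z - c) / 2 <= nc (y - c) & w y != 0] by apply: filterS3 (punc_open pz) nz nw.
  have a2 : \forall y \near z, [/\ nc l - eta <= nc ('D_1 g y), nc (g y) <= 4 &
    nc (g y - g z) <= (nc l + eta) * nc (y - z)] by apply: filterS3 n1 n2 n3.
  by apply: filterS2 a1 a2.
have [n hn] := dyadic_small z d0.
have hb y : dbox (n, dyadic_at n z) y -> nc (y - z) <= 2 * 2^-1 ^+ n by move=> /dyadic_dist.
pose mm : R := Num.max 0 (nc l - eta).
have m0 : 0 <= mm by rewrite le_max lexx.
have m1 : nc l - eta <= mm by rewrite le_max lexx orbT.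
pose side : R := 2^-1 ^+ n.
have side0 : 0 < side by rewrite exprn_gt0 // invr_gt0.
have l0 := normc_ge0 l.
(* Points of the square are within [2 * side] of [z], and 3 makes the inclusion strict. [kap] is the
   output of [density_bound] for the lower bound [mm] of [|g'|]. *)
exists n, (g z), (3 * (nc l + eta) * side), (mm ^+ 2 / 81).
have e0 : 0 < eta by rewrite divr_gt0.
split.
- by rewrite divr_ge0 // sqr_ge0.
- by rewrite !mulr_ge0 // ?(ltW side0) // addr_ge0 // ltW.
- rewrite darea_side /= -/side exprMn ler_wpM2r ?sqr_ge0 //.
  apply: (@le_trans _ _ ((3 * (mm + 2 * eta)) ^+ 2)).
    rewrite ler_sqr ?nnegrE ?mulr_ge0 ?addr_ge0 ?mulr_ge0 ?(ltW e0) //.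
    by rewrite ler_wpM2l //; lra.
  rewrite /eta; have := sqr_ge0 (mm - 1 / 10); rewrite !expr2; lra.
- exists (nc (z - c) / 2); first by rewrite divr_gt0.
  by move=> y /hb/le_lt_trans/(_ hn)/hd [[]].
- move=> y yb; have := hb y yb; rewrite -/side => ys.
  have [[py _ wy] [d1 d2 d3]] := hd _ (le_lt_trans ys hn).
  split => //.
    rewrite (curv_density_quotient py wy) -/g -/(g y).
    have D0 := normc_ge0 ('D_1 g y).
    have mD : mm <= nc ('D_1 g y) by rewrite ge_max D0.
    have G0 : 0 < (2 + nc (g y) ^+ 2) ^+ 2.
      by rewrite exprn_gt0 // ltr_pwDl // sqr_ge0.
    rewrite ler_pdivlMr //.
    by apply: density_bound; [rewrite normc_ge0|rewrite m0].
  move=> _ _; rewrite -/(g y).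
  have lt : nc (g y - g z) < 3 * (nc l + eta) * side.
    apply: (le_lt_trans d3).
    have le0 : 0 < nc l + eta := ltr_wpDl l0 e0.
    rewrite [3 * _]mulrC -mulrA (ltr_pM2l le0); apply: (le_lt_trans ys).
    by rewrite (ltr_pM2r side0) ltr_nat.
  rewrite -!ReN -!ImN -ReD -ImD.
  by split; apply: le_lt_trans lt; [exact: nc_Re|exact: nc_Im].
Qed.

(** Every point lies in some square carrying good data; the maximal such squares are disjoint, so
    their lower sums are bounded by [T] and [T']. *)
Lemma square_cover T T' : lower_sums_le (punc c r) (curv_density w h) T ->
  lower_sums_le (punc c r) (fun=> 1) T' ->
  exists (a : dyadic -> C) (s : dyadic -> R) (sel : dyadic -> Prop),
    [/\ forall k, 0 <= s k,
        forall k, sel k -> exists2 d : R, 0 < d & forall z, dbox k z -> d <= nc (z - c),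
        forall z, punc c r z -> w z != 0 -> unit_square (h z / w z) ->
          exists2 k, sel k & dbox k z /\
            (`|complex.Re (h z / w z) - complex.Re (a k)| < s k /\
            `|complex.Im (h z / w z) - complex.Im (a k)| < s k) &
        forall l : seq dyadic, uniq l -> (forall k, k \in l -> sel k) ->
          \sum_(k <- l) s k ^+ 2 <= 1458 * T + T'].
Proof.
move=> hT hT'.
pose P k := exists a s kap, good k a s kap.
have /choice [F hF] k : exists F : C * R * R, P k -> good k F.1.1 F.1.2 F.2.
  case: (pselect (P k)) => [[a [s [kap g]]]|nP]; last by exists (0, 0, 0).
  by exists (a, s, kap).
pose sel := dmaximal P.
exists (fun k => (F k).1.1), (fun k => if pselect (P k) then (F k).1.2 else 0), sel.
have hs k (Pk : P k) : (if pselect (P k) then (F k).1.2 else 0) = (F k).1.2.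
  by case: pselect.
split.
- by move=> k; case: pselect => // Pk; have [] := hF k Pk.
- by move=> k [Pk _]; have [] := hF k Pk.
- move=> z pz wz uz; have [|k kmax kz] := @dmaximal_cover R P z.
    by have [n hn] := exists_good pz; exists n.
  exists k => //; split => //; have [Pk _] := kmax; rewrite (hs k Pk).
  by have [_ _ _ _ /(_ z kz) [_ _]] := hF k Pk; apply.
- move=> l ul lsel.
  have gk k : k \in l -> good k (F k).1.1 (F k).1.2 (F k).2.
    by move=> /lsel [Pk _]; exact: hF.
  have dis k k' z : k \in l -> k' \in l -> dbox k z -> dbox k' z -> k = k'.
    by move=> /lsel m /lsel m'; exact: (dmaximal_disjoint m m').
  have h1 := hT l (fun k => (F k).2) ul dis _.
  have h2 := hT' l (fun=> 1) ul dis _.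
  have {}h1 : \sum_(k <- l) (F k).2 * darea k <= T.
    apply: h1 => k z kl kz; have [k0 _ _ _ /(_ z kz) [pz kc _]] := gk k kl.
    by rewrite k0.
  have {}h2 : \sum_(k <- l) 1 * darea k <= T'.
    apply: h2 => k z kl kz; have [_ _ _ _ /(_ z kz) [pz _ _]] := gk k kl.
    by rewrite ler01 lexx.
  apply: (@le_trans _ _ (\sum_(k <- l) (1458 * ((F k).2 * darea k) + 1 * darea k))).
    rewrite big_seq [leRHS]big_seq; apply: ler_sum => k kl.
    have [Pk _] := lsel k kl; rewrite (hs k Pk) mulrA -mulrDl.
    by have [] := gk k kl.
  rewrite big_split /= -mulr_sumr; apply: lerD h2.
  by apply: ler_wpM2l h1; exact: ler0n.
Qed.

End SquareCover.

(** * A vertical line not covered by small squares *)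

Section Slice.
Context {R : realType}.
Local Notation mu := (@lebesgue_measure R).
Implicit Types (a b s : nat -> R).

Lemma series_tail (u : nat -> R) (B e : R) : (forall n, 0 <= u n) ->
  (forall n, \sum_(0 <= k < n) u k <= B) -> 0 < e ->
  exists N, forall n, \sum_(N <= k < n) u k <= e.
Proof.
move=> u0 uB e0; pose U n := \sum_(0 <= k < n) u k.
have ndU : {homo U : n m / (n <= m)%N >-> n <= m}.
  move=> n m nm; rewrite /U [leRHS](@big_cat_nat _ _ _ n) //=.
  by rewrite lerDl sumr_ge0.
have hs : has_sup (range U).
  by split; [exists (U 0%N), 0%N|exists B => _ [n _ <-]; exact: uB].
have [_ [N _ <-] hN] := sup_adherent e0 hs.
exists N => n; have [nN|Nn] := leqP n N.
  by rewrite big_geq // ltW.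
have : U n <= sup (range U) by apply: ub_le_sup; [case: hs|exists n].
have -> : U n = U N + \sum_(N <= k < n) u k.
  by rewrite /U (big_cat_nat (n := N)) ?(ltnW Nn).
by move: hN; clear; lra.
Qed.

Lemma nneseries_le (u : nat -> R) (B : R) : (forall n, 0 <= u n) ->
  (forall n, \sum_(0 <= k < n) u k <= B) ->
  (\sum_(0 <= k <oo) (u k)%:E <= B%:E)%E.
Proof.
move=> u0 uB; apply: lime_le.
  by apply: is_cvg_nneseries => n _ _; rewrite lee_fin.
by apply: nearW => n; rewrite sumEFin lee_fin.
Qed.

Lemma lebesgue_measure01 : mu `[0, 1] = 1%E.
Proof. by rewrite lebesgue_measure_itv /= lte01 oppr0 adde0. Qed.

(** Fubini: if the squares covered almost all of every vertical segment, the lengths of their slices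
    would sum to at least 1 for each [x]. Integrating over [x] gives [1 <= sum of 4 s^2], while the
    hypothesis bounds this sum by 1/2. *)
Lemma exists_slice a b s : (forall k, 0 <= s k) ->
  (forall n, \sum_(0 <= k < n) s k ^+ 2 <= 1 / 8) ->
  exists2 x : R, 0 <= x <= 1 &
    (0 < mu (`[0, 1] `\`
      \bigcup_(k : nat) [set t : R | `|x - a k| < s k /\ `|t - b k| < s k])%R)%E.
Proof.
move=> s0 sB; apply: contrapT => no.
(* The length of the slice of the k-th square at abscissa [x]. *)
pose phi (k : nat) (x : measurableTypeR R) : \bar R := ((2 * s k) * \1_(ball (a k) (s k)) x)%:E.
have phi0 k x : (0 <= phi k x)%E.
  by rewrite lee_fin mulr_ge0 ?mulr_ge0.
have mb k : measurable (ball (a k) (s k) : set (measurableTypeR R)) by exact: (measurable_realfun.open_measurable (ball_open _ _)).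
have m01 : measurable (`[0%R, 1%R]%classic : set (measurableTypeR R)) by exact: measurable_itv.
have mphi k : @measurable_fun _ _ (measurableTypeR R) (\bar R) `[0%R, 1%R]%classic (phi k).
  apply/measurable_EFinP; apply: measurable_funM => //.
have big (x : R) : 0 <= x <= 1 -> (1 <= \sum_(0 <= k <oo) phi k x)%E.
  move=> x01; pose J (k : nat) := [set t : R | `|x - a k| < s k /\ `|t - b k| < s k].
  have JE k : J k = if `|x - a k| < s k then ball (b k) (s k) else set0.
    apply/seteqP; rewrite /J; split=> t /=; case: ifP => _ //.
    - by move=> [_]; rewrite /ball /= distrC.
    - by case.
    - by rewrite /ball /= distrC.
  have mb' k : measurable (ball (b k) (s k) : set (measurableTypeR R)) by exact: (measurable_realfun.open_measurable (ball_open _ _)).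
  have mJ k : measurable (J k : set (measurableTypeR R)) by rewrite JE; case: ifP => _; [exact: mb'|exact: measurable0].
  have muJ k : (mu (J k) <= phi k x)%E.
    rewrite JE; case: ifP => h; last by rewrite measure0; exact: phi0.
    rewrite /phi indicE lebesgue_measure_ball // mem_set ?mulr1 ?mulr_natl //.
    by rewrite /ball /= distrC.
  set U := \bigcup_k J k.
  have mU : measurable (U : set (measurableTypeR R)) by exact: bigcup_measurable.
  have U1 : (1 <= mu U)%E.
    have E0 : mu (`[0%R, 1%R] `\` U) = 0%E.
      apply/eqP; rewrite eq_le measure_ge0 andbT leNgt; apply/negP => E0.
      by apply: no; exists x.
    have := le_measure mu (mem_set m01)
      (mem_set (measurableU _ _ (measurableD m01 mU) mU)) _.
    move=> h; have mE1 : mu `[0, 1] = 1%E := lebesgue_measure01.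
    rewrite -mE1; apply: (le_trans (h _)).
      by move=> t t01; case: (pselect (U t)) => tU; [right|left].
    apply: (le_trans (measureU2 _ _ _)) => //; first exact: measurableD.
    by rewrite [X in (X + _)%E](_ : _ = 0%E) ?add0e //; exact: E0.
  apply: (le_trans U1); apply: (le_trans (measure_sigma_subadditive _ mJ mU _)) => //.
  by apply: lee_nneseries => [k _ _|k _]; [exact: measure_ge0|exact: muJ].
have : (\int[mu]_(x in `[0%R, 1%R]) (cst 1%E x) <=
    \int[mu]_(x in `[0%R, 1%R]) \sum_(0 <= k <oo) phi k x)%E.
  apply: ge0_le_integral => //.
  - by apply: ge0_emeasurable_sum => // k x _ _; exact: phi0.
rewrite integral_cst //= lebesgue_measure01 mul1e.
rewrite integral_nneseries //.
apply/negP; rewrite -ltNge.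
have le4 k : (\int[mu]_(x in `[0%R, 1%R]) phi k x <= (4 * s k ^+ 2)%:E)%E.
  under eq_integral do rewrite /phi EFinM.
  have m1 : measurable_fun (`[0%R, 1%R]%classic : set (measurableTypeR R))
      (fun x : measurableTypeR R => (\1_(ball (a k) (s k)) x)%:E : \bar R).
    by apply/measurable_EFinP.
  rewrite (ge0_integralZl _ m01 m1) //.
  - rewrite integral_indic //.
    apply: (@le_trans _ _ ((2 * s k)%:E * (2 * s k)%:E)%E).
      apply: lee_wpmul2l; first by rewrite lee_fin mulr_ge0.
      apply: (@le_trans _ _ (mu (ball (a k) (s k)))).
        by apply: le_measure; rewrite ?inE //; exact: measurableI.
      by rewrite lebesgue_measure_ball // mulr_natl.
    by rewrite -EFinM lee_fin expr2; lra.
  by rewrite lee_fin mulr_ge0.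
apply: (@le_lt_trans _ _ (\sum_(0 <= k <oo) (4 * s k ^+ 2)%:E)%E).
  apply: lee_nneseries => [k _ _|k _]; last exact: le4.
  by apply: integral_ge0 => x _; exact: phi0.
apply: (@le_lt_trans _ _ (1 / 2)%:E); last by rewrite lte_fin; lra.
apply: nneseries_le => [n|n]; first by rewrite mulr_ge0 ?sqr_ge0.
by rewrite -mulr_sumr; have := sB n; lra.
Qed.

End Slice.

(** * The Poisson kernel of a half-plane *)

Section Poisson.
Context {R : realType}.
Local Notation mu := (@lebesgue_measure R).

Lemma poisson_derive (x b t : R) : 0 < x ->
  is_derive t 1 (fun s : R => atan ((s - b) / x)) (x / (x ^+ 2 + (t - b) ^+ 2)).
Proof.
move=> x0.
have h1 : is_derive t 1 (fun s : R => (s - b) / x) (x^-1).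
  by apply: is_derive_eq; rewrite scaler0 add0r subr0 -[_ *: _]/(_ * _) mulr1.
have h2 := is_derive1_atan ((t - b) / x).
have h3 := @is_derive1_comp R (@atan R) (fun s : R => (s - b) / x) t _ _ h2 h1; apply: (is_derive_eq h3).
have d0 : 0 < x ^+ 2 + (t - b) ^+ 2 by rewrite ltr_pwDl ?exprn_gt0 // sqr_ge0.
have -> : 1 + ((t - b) / x) ^+ 2 = (x ^+ 2 + (t - b) ^+ 2) / x ^+ 2.
  by rewrite expr_div_n mulrDl divff // expf_neq0 // gt_eqF.
by field; rewrite !gt_eqF.
Qed.

Lemma poisson_continuous (x b : R) : 0 < x ->
  continuous (fun t : R => x / (x ^+ 2 + (t - b) ^+ 2)).
Proof.
move=> x0 t; apply: differentiable_continuous; apply/derivable1_diffP.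
have d0 : x ^+ 2 + (t - b) ^+ 2 != 0.
  by rewrite gt_eqF // ltr_pwDl ?exprn_gt0 // sqr_ge0.
by apply: derivableM; [|apply: derivableV => //].
Qed.

Lemma poisson_integral_le (x b a c : R) : 0 < x -> a <= c ->
  (\int[mu]_(t in `[a, c]) (x / (x ^+ 2 + (t - b) ^+ 2)))%R <= pi.
Proof.
move=> x0; rewrite le_eqVlt => /predU1P[<-|ac].
  by rewrite set_itv1 Rintegral_set1 pi_ge0.
pose F (s : R) : R := atan ((s - b) / x).
have dF (t : R) : derivable F t 1 by have [] := poisson_derive b t x0.
have cF (t : R) : {for t, continuous F}.
  by apply: differentiable_continuous; apply/derivable1_diffP.
rewrite /Rintegral (@continuous_FTC2 _ _ F) //=.
- rewrite /F; have := atan_gtNpi2 ((a - b) / x); have := atan_ltpi2 ((c - b) / x).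
  by clear; lra.
- by apply: continuous_subspaceT => t; exact: poisson_continuous.
- split; first by move=> t _; exact: dF.
  + by apply: cvg_at_right_filter; exact: cF.
  + by apply: cvg_at_left_filter; exact: cF.
- by move=> t _; rewrite derive1E; have [_ h] := poisson_derive b t x0; exact: h.
Qed.

End Poisson.

(** * Complex integrals over a compact part of the unit interval *)

Section EInt.
Context {R : realType}.
Local Notation C := R[i].
Local Notation nc := (@Normc.normc R).
Local Notation mu := (@lebesgue_measure R).
Variable E : set R.
Hypothesis cE : compact E.
Hypothesis E01 : E `<=` `[0, 1].
Implicit Types f g : R -> C.

Definition eint f : C :=
  (\int[mu]_(t in E) complex.Re (f t))%R +i* (\int[mu]_(t in E) complex.Im (f t))%R.

Definition cont_on f : Prop := forall t, E t -> {for t, continuous f}.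

Let mE : measurable (E : set (measurableTypeR R)).
Proof. exact: measurable_realfun.compact_measurable. Qed.

Let proj_int (p : C -> R) f : (forall z w, `|p z - p w| <= nc (z - w)) ->
  cont_on f -> mu.-integrable E (EFin \o (p \o f)).
Proof.
move=> hp cf; apply: continuous_compact_integrable => //.
apply: continuous_in_subspaceT => t; rewrite inE => Et A /nbhs_rP [e e0 eA].
have /rcontP /(_ e e0) [d d0 hd] := cf t Et; apply/nbhs_rP; exists d => // s /hd h.
by apply: eA; exact: le_lt_trans (hp _ _) h.
Qed.

Let Re_int f : cont_on f -> mu.-integrable E (EFin \o (fun t => complex.Re (f t))).
Proof. exact: (proj_int (@Re_lip R)). Qed.

Let Im_int f : cont_on f -> mu.-integrable E (EFin \o (fun t => complex.Im (f t))).
Proof. exact: (proj_int (@Im_lip R)). Qed.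

Lemma eintB f g : cont_on f -> cont_on g ->
  eint (fun t => f t - g t) = eint f - eint g.
Proof.
move=> cf cg; apply/eqP; rewrite eq_complex /= /eint.
under eq_Rintegral do rewrite ReD ReN.
rewrite RintegralB //; try exact: Re_int.
under [X in _ && (X == _)]eq_Rintegral do rewrite ImD ImN.
by rewrite RintegralB ?eqxx //; exact: Im_int.
Qed.

Lemma eintZ (k : C) f : cont_on f -> eint (fun t => k * f t) = k * eint f.
Proof.
move=> cf; have iR := Re_int cf; have iI := Im_int cf.
have sR (r : R) := integrableZl mE r iR; have sI (r : R) := integrableZl mE r iI.
case: k => x y; apply/eqP; rewrite eq_complex /= /eint; apply/andP; split; apply/eqP.
  under eq_Rintegral do rewrite cReM /=.
  rewrite RintegralB //; [|exact: sR|exact: sI].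
  by rewrite !RintegralZl.
under eq_Rintegral do rewrite cImM /=.
rewrite RintegralD //; [|exact: sI|exact: sR].
by rewrite !RintegralZl.
Qed.

Lemma mu_E_le1 : (mu E <= 1)%E.
Proof.
have := le_measure mu (mem_set mE) (mem_set (measurable_itv `[0%R, 1%R])) E01.
by move=> h; apply: (le_trans h); rewrite [leLHS](_ : _ = 1%E) //; exact: lebesgue_measure01.
Qed.

Let proj_le (q : R -> R) M : 0 <= M -> mu.-integrable E (EFin \o q) ->
  (forall t, E t -> `|q t| <= M) -> `|\int[mu]_(t in E) q t|%R <= M.
Proof.
move=> M0 iq qM.
apply: (le_trans (le_normr_Rintegral mE iq)).
have iM : mu.-integrable E (EFin \o (fun=> M)).
  apply: continuous_compact_integrable => //.
  by apply: continuous_subspaceT => t; exact: cst_continuous.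
apply: (@le_trans _ _ (\int[mu]_(t in E) M)%R).
  apply: le_Rintegral => //.
  exact: (integrable_norm iq).
rewrite Rintegral_cst // ler_piMr //.
rewrite (_ : 1 = fine (1%E : \bar R)) //; apply: fine_le => //;
  [rewrite ge0_fin_numE ?measure_ge0 //; exact: le_lt_trans mu_E_le1 (ltry _)|exact: mu_E_le1].
Qed.

Lemma eint_le f M : 0 <= M -> cont_on f -> (forall t, E t -> nc (f t) <= M) ->
  nc (eint f) <= 2 * M.
Proof.
move=> M0 cf fM; apply: (le_trans (nc_ReIm _)); rewrite /eint /= mulr_natl mulr2n.
apply: lerD; apply: proj_le => //; try exact: Re_int; try exact: Im_int.
  by move=> t Et; exact: le_trans (nc_Re _) (fM t Et).
by move=> t Et; exact: le_trans (nc_Im _) (fM t Et).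
Qed.

Lemma Re_eint_gt0 f : cont_on f -> (0 < mu E)%E ->
  (exists2 m, 0 < m & forall t, E t -> m <= complex.Re (f t)) -> 0 < complex.Re (eint f).
Proof.
move=> cf mu0 [m m0 fm].
have iM : mu.-integrable E (EFin \o (fun=> m)).
  apply: continuous_compact_integrable => //.
  by apply: continuous_subspaceT => t; exact: cst_continuous.
apply: (@lt_le_trans _ _ (\int[mu]_(t in E) m)%R).
  rewrite Rintegral_cst // mulr_gt0 // fine_gt0 // mu0 /=.
  exact: le_lt_trans mu_E_le1 (ltry _).
by apply: le_Rintegral => //; exact: Re_int.
Qed.

(* The angle under which the interval is seen is less than [pi]. *)
Lemma Re_eint_le_pi f (x b : R) : cont_on f ->
  (forall t : R, E t -> `|complex.Re (f t)| <= `|x| / (x ^+ 2 + (t - b) ^+ 2)) ->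
  `|complex.Re (eint f)| <= pi.
Proof.
move=> cf fb; have iR := Re_int cf.
apply: (le_trans (le_normr_Rintegral mE iR)).
have iN := integrable_norm iR.
have [x0|x0] := eqVneq x 0.
  apply: (@le_trans _ _ (\int[mu]_(t in E) 0)%R); last first.
    by rewrite Rintegral_cst // mul0r pi_ge0.
  have i0 : mu.-integrable E (EFin \o (fun=> 0 : R)).
    apply: continuous_compact_integrable => //.
    by apply: continuous_subspaceT => t; exact: cst_continuous.
  apply: le_Rintegral => //.
  by move=> t /fb; rewrite x0 normr0 mul0r.
have nx : 0 < `|x| by rewrite normr_gt0.
have cq : continuous (fun t : R => `|x| / (`|x| ^+ 2 + (t - b) ^+ 2)).
  by move=> t; exact: (poisson_continuous nx).
apply: le_trans (poisson_integral_le b nx ler01).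
have i1 : mu.-integrable `[0, 1] (EFin \o (fun t : R => `|x| / (`|x| ^+ 2 + (t - b) ^+ 2))).
  apply: continuous_compact_integrable; first exact: segment_compact.
  exact: continuous_subspaceT.
apply: (@le_trans _ _ (\int[mu]_(t in E) (`|x| / (`|x| ^+ 2 + (t - b) ^+ 2)))%R).
  apply: le_Rintegral => //.
  - by apply: integrableS i1 => //; exact: measurable_itv.
  - by move=> t /fb; rewrite real_normK ?num_real.
rewrite /Rintegral; apply: fine_le.
- by apply: integrable_fin_num => //; apply: integrableS i1 => //; exact: measurable_itv.
- by apply: integrable_fin_num => //; exact: measurable_itv.
- have m01 : measurable (`[0%R, 1%R]%classic : set (measurableTypeR R)) by exact: measurable_itv.
  apply: (@ge0_subset_integral _ _ _ mu _ _ mE m01).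
  - by case/integrableP : i1.
  - by move=> t _; rewrite lee_fin divr_ge0 // addr_ge0 // sqr_ge0.
  - exact: E01.
Qed.

End EInt.

(** * Values omitted by g near an end *)

Section Selection.
Context {R : realType}.
Local Notation C := R[i].
Local Notation nc := (@Normc.normc R).
Local Notation mu := (@lebesgue_measure R).

Definition slope (x t : R) : C := x +i* t.

(** After enumerating the selected squares, a tail has total [s^2] at most 1/8 and [exists_slice]
    applies to it. The finitely many squares before the tail keep away from [c], so on a smaller
    disc every value of [g] in the unit square is covered by the tail. The equation
    [h = (x + i t) w] also excludes zeros of [w], where [h] is nonzero. *)
Lemma exists_avoided_slopes (w h : C -> C) (c : C) (r T T' : R) : 0 < r ->
  (forall z, punc c r z -> holo w z) -> (forall z, punc c r z -> holo h z) ->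
  (forall z, punc c r z -> w z != 0 \/ h z != 0) ->
  lower_sums_le (punc c r) (curv_density w h) T ->
  lower_sums_le (punc c r) (fun=> 1) T' ->
  exists (x : R) (E : set R), [/\ 0 <= x <= 1 /\ compact E, E `<=` `[0, 1]%classic, (0 < mu E)%E &
    exists2 rho, 0 < rho <= r & forall z t, punc c rho z -> E t ->
      h z - slope x t * w z != 0].
Proof.
move=> r0 hw hh im lT lT'.
have [a [s [sel [s0 far cov sums]]]] := square_cover hw hh im lT lT'.
(* Integers that code no square, and squares that are not selected, get half-side 0: they cover
   nothing and add nothing to the sums. *)
pose at_ (T : Type) (d : T) (F : dyadic -> T) (n : nat) : T :=
  if @pickle_inv dyadic n is Some k then F k else d.
pose sn n : R := at_ R 0 (fun k => if `[< sel k >] then s k else 0) n.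
pose re_ n : R := at_ R 0 (fun k => complex.Re (a k)) n.
pose im_ n : R := at_ R 0 (fun k => complex.Im (a k)) n.
have sn0 n : 0 <= sn n.
  by rewrite /sn /at_; case: pickle_inv => // k; case: ifP.
have snB n : \sum_(0 <= k < n) sn k ^+ 2 <= 1458 * T + T'.
  pose l := [seq k <- pmap (@pickle_inv dyadic) (index_iota 0 n) | `[< sel k >]].
  have -> : \sum_(0 <= k < n) sn k ^+ 2 = \sum_(k <- l) s k ^+ 2.
    rewrite big_filter [RHS]big_mkcond [RHS]big_pmap; apply: eq_bigr => k _.
    rewrite /sn /at_; case: pickle_inv => [k'|] /=; last by rewrite expr0n.
    by case: ifP => _ //; rewrite expr0n.
  apply: sums.
    apply: filter_uniq; apply: (pmap_uniq (g := @pickle dyadic)); last exact: iota_uniq.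
    exact: pickle_invK.
  by move=> k; rewrite mem_filter => /andP[/asboolP].
have e8 : 0 < 1 / 8 :> R by rewrite divr_gt0 // ltr0n.
have [N hN] := series_tail (fun n => sqr_ge0 (sn n)) snB e8.
have hN' n : \sum_(0 <= k < n) sn (k + N)%N ^+ 2 <= 1 / 8.
  have := hN (n + N)%N; rewrite -{1}(add0n N) big_addn addnK; exact.
have [x x01 hx] := exists_slice (fun k => re_ (k + N)%N)
  (fun k => im_ (k + N)%N) (fun k => sn0 (k + N)%N) hN'.
set U := \bigcup_k _ in hx.
exists x, (`[0, 1]%classic `\` U).
have oU : open U.
  apply: bigcup_open => k _.
  set J := mkset _; suff -> : J = (if `|x - re_ (k + N)%N| < sn (k + N)%N
    then ball (im_ (k + N)%N) (sn (k + N)%N) else set0).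
    by case: ifP => _; [exact: ball_open|exact: open0].
  apply/seteqP; rewrite /J; split=> t /=; case: ifP => _ //.
  - by move=> [_]; rewrite /ball /= distrC.
  - by case.
  - by rewrite /ball /= distrC.
split => //.
- split => //; apply: (subclosed_compact _ (@segment_compact R 0 1)); last by move=> t [].
  rewrite setDE; apply: closedI; last exact: open_closedC.
  exact: (compact_closed (@Rhausdorff R) (@segment_compact R 0 1)).
(* The minimum of the distances to [c] over the finitely many selected squares before the tail. *)
have [rho1 rho10 far1] : exists2 rho, 0 < rho & forall n k, (n < N)%N ->
    @pickle_inv dyadic n = Some k -> sel k -> forall z, dbox k z -> rho <= nc (z - c).
  elim: (N) => [|m [rho rho0 IH]]; first by exists 1.
  case E : (@pickle_inv dyadic m) => [k|]; last first.
    exists rho => // n k; rewrite ltnS leq_eqVlt => /predU1P[->|/IH]; last exact.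
    by rewrite E.
  have [sk|sk] := pselect (sel k); last first.
    exists rho => // n k'; rewrite ltnS leq_eqVlt => /predU1P[->|/IH]; last exact.
    by rewrite E => -[<-].
  have [d d0 hd] := far k sk; exists (Num.min rho d); first by rewrite lt_min rho0.
  move=> n k'; rewrite ltnS leq_eqVlt => /predU1P[->|nm].
    by rewrite E => -[<-] _ z /hd; apply: le_trans; rewrite ge_min lexx orbT.
  move=> e1 e2 z e3; apply: le_trans (IH n k' nm e1 e2 z e3).
  by rewrite ge_min lexx.
exists (Num.min rho1 r); first by rewrite lt_min rho10 r0 ge_min lexx orbT.
move=> z t [/andP[z0]]; rewrite lt_min => /andP[z1 zr] [t01 nU].
have pz : punc c r z by apply/andP.
have [w0|w0] := eqVneq (w z) 0.
  by rewrite w0 mulr0 subr0; have := im z pz; rewrite w0 eqxx => -[].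
apply/negP => /eqP /subr0_eq hE.
have qE : h z / w z = slope x t by rewrite hE mulfK.
have us : unit_square (h z / w z).
  by rewrite qE /unit_square /=; split => //; move: t01; rewrite in_itv.
have [k sk [bk]] := cov z pz w0 us; rewrite qE /= => -[h1 h2].
pose n := pickle k.
have pn : @pickle_inv dyadic n = Some k by rewrite pickleK_inv.
have [nN|Nn] := ltnP n N.
  by have := far1 n k nN pn sk z bk; rewrite leNgt z1.
apply: nU; exists (n - N)%N => //=; rewrite subnK //.
by rewrite /re_ /im_ /sn /at_ pn asboolT.
Qed.


Lemma compact_away (E : set R) (f : R -> C) : compact E -> cont_on E f ->
  (forall t, E t -> f t != 0) -> exists2 m : R, 0 < m & forall t, E t -> m <= nc (f t).
Proof.
move=> cE cf f0.
have cK : closed (f @` E).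
  apply: compact_closed; first exact: norm_hausdorff.
  apply: continuous_compact => //.
  by apply: continuous_in_subspaceT => t; rewrite inE => /cf.
have : nbhs (0 : C) (~` (f @` E)).
  apply: open_nbhs_nbhs; split; first exact: closed_openC.
  by move=> [t /f0]; move=> /eqP.
move=> /nbhs_cP [m m0 hm]; exists m => // t Et; rewrite leNgt; apply/negP => ft.
by apply: (hm (f t)); [rewrite subr0|exists t].
Qed.

Lemma rder_cont_on (E : set R) (f : R -> C) :
  (forall t, E t -> exists v, rder f t v) -> cont_on E f.
Proof. by move=> h t /h [v hv]; exact: rder_cont hv. Qed.

(** A product rule in which the first factor vanishes at [z], so mere continuity of the second is
    enough. It serves to differentiate the transform without differentiating an integral. *)
Lemma cder_mul_cont (A B : C -> C) (z l : C) : cder A z l -> A z = 0 -> ccont B z ->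
  cder (fun y => A y * B y) z (l * B z).
Proof.
move=> dA A0 cB e e0.
have k0 : 0 < nc l + 2 by rewrite ltr_wpDl ?normc_ge0.
have b0 : 0 < nc (B z) + 1 by rewrite ltr_wpDl ?normc_ge0.
have e1 : 0 < Num.min 1 (e / 2 / (nc (B z) + 1)).
  by rewrite lt_min ltr01 divr_gt0 // divr_gt0.
have [d1 d10 h1] := dA _ e1.
have [d2 d20 h2] := (ccont_epsP _ _).1 cB (e / 2 / (nc l + 2)) (divr_gt0 (divr_gt0 e0 (ltr0n _ 2)) k0).
exists (Num.min d1 d2); first by rewrite lt_min d10.
move=> y; rewrite lt_min => /andP[/h1 q1 /h2 q2].
rewrite A0 mul0r subr0; rewrite A0 subr0 in q1.
have -> : A y * B y - l * B z * (y - z) =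
    A y * (B y - B z) + B z * (A y - l * (y - z)) by ring.
apply: (le_trans (nc_leD _ _)); rewrite !ncM.
have n0 := normc_ge0 (y - z).
have q3 : nc (A y - l * (y - z)) <= nc (y - z).
  by apply: (le_trans q1); rewrite ler_piMl // ge_min lexx.
have q4 : nc (A y - l * (y - z)) <= e / 2 / (nc (B z) + 1) * nc (y - z).
  by apply: (le_trans q1); rewrite ler_wpM2r // ge_min lexx orbT.
have q5 : nc (A y) <= (nc l + 2) * nc (y - z).
  have := nc_leD (A y - l * (y - z)) (l * (y - z)); rewrite subrK ncM.
  by move: q3 n0; clear; lra.
have q6 : nc (A y) * nc (B y - B z) <= e / 2 * nc (y - z).
  apply: (@le_trans _ _ ((nc l + 2) * nc (y - z) * (e / 2 / (nc l + 2)))).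
    by apply: ler_pM => //; [exact: normc_ge0|exact: normc_ge0|exact: ltW].
  by move: k0; move: (nc l + 2) (nc (y - z)) => u v u0; rewrite mulrAC [u * _]mulrC divfK ?gt_eqF.
have q7 : nc (B z) * nc (A y - l * (y - z)) <= e / 2 * nc (y - z).
  apply: (@le_trans _ _ ((nc (B z) + 1) * (e / 2 / (nc (B z) + 1) * nc (y - z)))).
    apply: ler_pM => //; [exact: normc_ge0|exact: normc_ge0|].
    by rewrite lerDl ler01.
  by move: b0; move: (nc (B z) + 1) (nc (y - z)) => u v u0; rewrite mulrA [u * _]mulrC divfK ?gt_eqF.
by rewrite (splitr e) mulrDl; exact: lerD.
Qed.

End Selection.

Lemma Re_inv (R : realType) (z : R[i]) :
  complex.Re z^-1 = complex.Re z / (complex.Re z ^+ 2 + complex.Im z ^+ 2).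
Proof. by case: z. Qed.

(** * The Cauchy transform of the omitted set *)

Section Slope.
Context {R : realType}.
Local Notation C := R[i].
Local Notation nc := (@Normc.normc R).
Local Notation mu := (@lebesgue_measure R).
Variables (E : set R) (x : R).
Hypothesis cE : compact E.
Hypothesis E01 : E `<=` `[0, 1]%classic.
Hypothesis x01 : 0 <= x <= 1.

Lemma eq_eint (f g : R -> C) : (forall t, E t -> f t = g t) -> eint E f = eint E g.
Proof.
by move=> fg; rewrite /eint; congr (_ +i* _); apply: eq_Rintegral => t; rewrite inE => /fg ->.
Qed.

Let E_ge0 t : E t -> 0 <= t <= 1.
Proof.
by move=> /E01 h; have : t \in `[0, 1]%R := h; rewrite in_itv.
Qed.

Lemma nc_slope t : E t -> nc (slope x t) <= 2.
Proof. by move=> /E_ge0 h; exact: unit_square_nc. Qed.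

Lemma slopeE t : slope x t = x%:C + t%:C * 'i%C.
Proof.
by apply/eqP; rewrite eq_complex /= !mul0r !mulr0 mulr1 subr0 !addr0 add0r !eqxx.
Qed.

Lemma rder_slope (p q : C) t : exists v, rder (fun s : R => p - slope x s * q) t v.
Proof.
exists ('i%C * - q).
apply: rder_near (rder_line (p - x%:C * q) ('i%C * - q) t).
apply/nbhs_rP; exists 1; first exact: ltr01.
by move=> s _; rewrite slopeE; ring.
Qed.

Lemma cont_on_div (a p q p' q' : C) : (forall t, E t -> p - slope x t * q != 0) ->
  (forall t, E t -> p' - slope x t * q' != 0) ->
  cont_on E (fun t => a / ((p - slope x t * q) * (p' - slope x t * q'))).
Proof.
move=> h1 h2; apply: rder_cont_on => t Et.
have [v hv] := rder_slope p q t; have [v' hv'] := rder_slope p' q' t.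
eexists; apply: (rder_comp (F := fun u => a / u) (rderM hv hv')).
apply: (cderZ a (cderV _ (cder_id _))).
by rewrite mulf_neq0 ?h1 ?h2.
Qed.

Lemma cont_on_inv (a p q : C) : (forall t, E t -> p - slope x t * q != 0) ->
  cont_on E (fun t => a / (p - slope x t * q)).
Proof.
move=> h1; apply: rder_cont_on => t Et.
have [v hv] := rder_slope p q t.
eexists; apply: (rder_comp (F := fun u => a / u) hv).
by apply: (cderZ a (cderV _ (cder_id _))); exact: h1.
Qed.

(** With [g = p / q] this is the integral of [1 / (g - (x + i t))] over [E]. The homogeneous form
    remains correct at poles of [g], where [q = 0] and the value is 0. *)
Definition cauchy_tr (p q : C) : C := eint E (fun t => q / (p - slope x t * q)).

(** The real part of the integrand is, up to sign, the Poisson kernel of the line at [g], whose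
    total mass is [pi]. *)
Lemma Re_cauchy_tr p q : (forall t, E t -> p - slope x t * q != 0) ->
  `|complex.Re (cauchy_tr p q)| <= pi.
Proof.
move=> h1; have [q0|q0] := eqVneq q 0.
  apply: (Re_eint_le_pi cE E01 (x := 0) (b := 0)); first exact: cont_on_inv.
  by move=> t Et; rewrite q0 mul0r /= !normr0 mul0r.
apply: (Re_eint_le_pi cE E01 (x := complex.Re (p / q) - x) (b := complex.Im (p / q))).
  exact: cont_on_inv.
move=> t Et.
have -> : q / (p - slope x t * q) = (p / q - slope x t)^-1.
  by rewrite -[in RHS](mulfK q0 (slope x t)) -mulrBl invf_div.
rewrite Re_inv ReD ImD ReN ImN /= normrM normfV.
set d := (X in _ / `|X|); have d0 : 0 <= d by rewrite addr_ge0 // sqr_ge0.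
by rewrite (ger0_norm d0) /d -(sqrrN (t - _)) opprB.
Qed.

Lemma compact_slope (p q : C) : (forall t, E t -> p - slope x t * q != 0) ->
  exists2 m : R, 0 < m & forall t, E t -> m <= nc (p - slope x t * q).
Proof.
move=> h; apply: compact_away => //; apply: rder_cont_on => t _; exact: rder_slope.
Qed.

(** Resolvent identity: the difference of the transforms at [z] and [z0] is [A z * B z], where [A]
    is holomorphic with [A z0 = 0] and [B] is an integral that only has to be continuous. *)
Lemma cder_cauchy_tr (w h : C -> C) z0 :
  holo w z0 -> holo h z0 ->
  (\forall z \near z0, forall t, E t -> h z - slope x t * w z != 0) ->
  exists l, cder (fun z => cauchy_tr (h z) (w z)) z0 l.
Proof.
move=> hw hh /nbhs_cP [d0 d00 hd0].
have nz t : E t -> h z0 - slope x t * w z0 != 0.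
  by apply: hd0; rewrite subrr nc0.
have [m m0 hm] := compact_slope nz.
pose D z t := h z - slope x t * w z.
pose A z := w z * h z0 - w z0 * h z.
pose B z := eint E (fun t => 1 / (D z t * D z0 t)).
have cB : ccont B z0.
  apply/ccont_epsP => e e0.
  (* [m / 2] keeps the moving denominator above half of its minimum at [z0]; [e * m^3 / 8] then
     bounds the change of the integrand by [e / 4]. *)
  pose eta := Num.min (m / 2) (e * m ^+ 3 / 8).
  have eta0 : 0 < eta.
    by rewrite lt_min !divr_gt0 // ?ltr0n // mulr_gt0 // exprn_gt0.
  have [d1 d10 h1] := (ccont_epsP _ _).1 (holo_ccont hh) (eta / 2) (divr_gt0 eta0 (ltr0n _ 2)).
  have [d2 d20 h2] := (ccont_epsP _ _).1 (holo_ccont hw) (eta / 4) (divr_gt0 eta0 (ltr0n _ 4)).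
  exists (Num.min d0 (Num.min d1 d2)); first by rewrite !lt_min d00 d10.
  move=> z; rewrite !lt_min => /and3P[/hd0 nzz /h1 q1 /h2 q2].
  have dD t : E t -> nc (D z0 t - D z t) <= eta.
    move=> Et; rewrite /D.
    have -> : h z0 - slope x t * w z0 - (h z - slope x t * w z) =
      - (h z - h z0) + slope x t * (w z - w z0) by ring.
    apply: (le_trans (nc_leD _ _)); rewrite ncN ncM.
    have := ler_wpM2r (normc_ge0 (w z - w z0)) (nc_slope Et).
    by move: q1 q2; clear -cE E01 x01; lra.
  have lD t : E t -> m / 2 <= nc (D z t).
    move=> Et; have := nc_subl (D z0 t) (D z t); have := dD t Et; have := hm t Et.
    have : eta <= m / 2 by rewrite ge_min lexx.
    by rewrite /D; clear -cE E01 x01; lra.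
  rewrite /B -(eintB cE); try (by apply: cont_on_div).
  apply: (@le_lt_trans _ _ (2 * (e / 4))); last by move: e0; clear -cE E01 x01; lra.
  apply: (eint_le cE E01); first by rewrite divr_ge0 // ltW.
    have c1 := cont_on_div (a := 1) nzz nz; have c2 := cont_on_div (a := 1) nz nz.
    by move=> t Et; apply: cvgB; [exact: c1|exact: c2].
  move=> t Et.
  have -> : 1 / (D z t * D z0 t) - 1 / (D z0 t * D z0 t) =
      (D z0 t - D z t) / (D z t * D z0 t ^+ 2).
    have e1 := nzz t Et; have e2 := nz t Et; rewrite -/(D z t) in e1; rewrite -/(D z0 t) in e2.
    by field; rewrite e1 e2.
  rewrite nc_div ncM ncX ler_pdivrMr; last first.
    apply: mulr_gt0; last by rewrite exprn_gt0 // nc_gt0; exact: nz.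
    by rewrite nc_gt0; exact: nzz.
  apply: (le_trans (dD t Et)).
  apply: (@le_trans _ _ (e / 4 * (m / 2 * m ^+ 2))).
    have : eta <= e * m ^+ 3 / 8 by rewrite ge_min lexx orbT.
    by rewrite exprS; clear -cE E01 x01; lra.
  rewrite ler_wpM2l ?divr_ge0 // ?(ltW e0) //.
  apply: ler_pM; [by rewrite divr_ge0 // ltW|by rewrite sqr_ge0|exact: lD|].
  by rewrite lerXn2r // ?nnegrE ?normc_ge0 ?(ltW m0) //; exact: hm.
have dA : cder A z0 ('D_1 w z0 * h z0 - w z0 * 'D_1 h z0).
  apply: cder_eq (cderB (cderM (holo_cder hw) (cder_cst (h z0) z0)) (cderZ (w z0) (holo_cder hh))) _.
  by rewrite mulr0 addr0.
have A0 : A z0 = 0 by rewrite /A; ring.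
exists (('D_1 w z0 * h z0 - w z0 * 'D_1 h z0) * B z0 + 0).
apply: cder_near (cderD (cder_mul_cont dA A0 cB) (cder_cst (cauchy_tr (h z0) (w z0)) z0)).
apply/nbhs_cP; exists d0 => // z /hd0 nzz.
apply/esym/subr0_eq; rewrite opprD addrA addrAC.
rewrite /cauchy_tr -(eintB cE); [|exact: cont_on_inv|exact: cont_on_inv].
rewrite /B -(eintZ cE); last exact: cont_on_div.
apply/eqP; rewrite subr_eq0; apply/eqP; apply: eq_eint => t Et.
have e1 := nzz t Et; have e2 := nz t Et.
rewrite /A /D; field; first by rewrite e1 e2.
Qed.

(** The resolvent identity again, with denominators at least 1/2 and 1; the remaining factor 2 is
    that of [eint_le]. *)
Lemma nc_sub_cauchy_tr p q (b : C) (d : R) : q != 0 -> d <= 1 / 2 ->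
  (forall t, E t -> p - slope x t * q != 0) ->
  (forall t, E t -> 1 <= nc (b - slope x t)) -> nc (p - b * q) <= d * nc q ->
  nc (cauchy_tr p q - cauchy_tr b 1) <= 4 * d.
Proof.
move=> q0 d2 nz b1 hb.
have b0 t : E t -> b - slope x t * 1 != 0.
  by move=> Et; rewrite mulr1 -nc_gt0 (lt_le_trans ltr01) // b1.
have qE t : q / (p - slope x t * q) = (p / q - slope x t)^-1.
  by rewrite -[in RHS](mulfK q0 (slope x t)) -mulrBl invf_div.
have pb : nc (p / q - b) <= d.
  have -> : p / q - b = (p - b * q) / q by rewrite mulrBl mulfK.
  by rewrite nc_div ler_pdivrMr // nc_gt0.
have d0 : 0 <= d by exact: le_trans (normc_ge0 _) pb.
rewrite /cauchy_tr -(eintB cE); [|exact: cont_on_inv|exact: cont_on_inv].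
have -> : 4 * d = 2 * (2 * d) by rewrite mulrA -natrM.
apply: (eint_le cE E01); first by rewrite mulr_ge0.
  have c1 := cont_on_inv (a := q) nz; have c2 := cont_on_inv (a := 1) b0.
  by move=> t Et; apply: cvgB; [exact: c1|exact: c2].
move=> t Et; rewrite qE mulr1 div1r.
have n1 := b1 t Et.
have n2 : 1 / 2 <= nc (p / q - slope x t).
  have := nc_subl (b - slope x t) (b - p / q).
  have -> : b - slope x t - (b - p / q) = p / q - slope x t by ring.
  have e1 := normcB b (p / q); move: e1 n1 pb d2; clear -cE E01 x01; lra.
have z1 : p / q - slope x t != 0.
  by rewrite -nc_gt0 (lt_le_trans _ n2) // divr_gt0 // ltr0n.
have z2 : b - slope x t != 0 by rewrite -nc_gt0 (lt_le_trans ltr01).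
have -> : (p / q - slope x t)^-1 - (b - slope x t)^-1 =
    - (p / q - b) / ((p / q - slope x t) * (b - slope x t)).
  by move: z1 z2; move: (p / q) (slope x t) => u v z1 z2; field; rewrite z1 z2.
rewrite nc_div ncN ncM ler_pdivrMr ?mulr_gt0 ?nc_gt0 //.
apply: (le_trans pb).
have -> : 2 * d * (nc (p / q - slope x t) * nc (b - slope x t)) =
   d * ((2 * nc (p / q - slope x t)) * nc (b - slope x t)) by ring.
rewrite ler_peMr // -[1]mulr1 ler_pM //.
by move: n2; clear -cE E01 x01; lra.
Qed.

(** [Re (1 / (1 - i t)) = 1 / (1 + t^2) >= 1/2] on [E]. At [x - 1] the sign is opposite, which
    separates the two candidate limits. *)
Lemma Re_cauchy_tr_right : (0 < mu E)%E -> 0 < complex.Re (cauchy_tr (x + 1)%:C 1).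
Proof.
move=> muE; apply: (Re_eint_gt0 cE E01) => //.
  apply: cont_on_inv => t Et; rewrite mulr1 eq_complex /= negb_and.
  by apply/orP; left; rewrite addrAC subrr add0r oner_eq0.
exists (1 / 2); first by rewrite divr_gt0 // ltr0n.
move=> t Et; rewrite mulr1 !div1r Re_inv /=.
have -> : x + 1 - x = 1 by ring.
have /andP[t0 t1] := E_ge0 Et.
have t2 : t ^+ 2 <= 1 by rewrite expr_le1.
rewrite sub0r sqrrN expr1n ler_pdivlMr; first by move: t2; clear -cE E01 x01; lra.
by rewrite ltr_pwDl // sqr_ge0.
Qed.

Lemma Re_cauchy_tr_left : (0 < mu E)%E -> complex.Re (cauchy_tr (x - 1)%:C 1) < 0.
Proof.
move=> muE.
have nz t : E t -> (x - 1)%:C - slope x t * 1 != 0 :> C.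
  move=> Et; rewrite mulr1 eq_complex /= negb_and.
  by apply/orP; left; rewrite addrAC subrr add0r oppr_eq0 oner_eq0.
have := @Re_eint_gt0 _ _ cE E01 (fun t => -1 / ((x - 1)%:C - slope x t * 1)).
have -> : eint E (fun t => -1 / ((x - 1)%:C - slope x t * 1)) =
    -1 * cauchy_tr (x - 1)%:C 1.
  rewrite /cauchy_tr -(eintZ cE); last exact: cont_on_inv.
  by apply: eq_eint => t _; rewrite [X in _ = _ * X]div1r.
rewrite mulN1r ReN oppr_gt0; apply => //; first exact: cont_on_inv.
exists (1 / 2); first by rewrite divr_gt0 // ltr0n.
move=> t Et; rewrite mulr1 mulN1r ReN Re_inv /=.
have -> : x - 1 - x = - 1 by ring.
have /andP[t0 t1] := E_ge0 Et.
have t2 : t ^+ 2 <= 1 by rewrite expr_le1.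
rewrite sub0r !sqrrN expr1n mulNr opprK ler_pdivlMr; first by move: t2; clear -cE E01 x01; lra.
by rewrite ltr_pwDl // sqr_ge0.
Qed.

End Slope.

(** * A value from which g stays away *)

Section GoodSlope.
Context {R : realType}.
Local Notation C := R[i].
Local Notation nc := (@Normc.normc R).
Local Notation mu := (@lebesgue_measure R).
Variables (w h : C -> C) (c : C) (r T T' : R).
Hypothesis r0 : 0 < r.
Hypothesis hw : forall z, punc c r z -> holo w z.
Hypothesis hh : forall z, punc c r z -> holo h z.
Hypothesis im : forall z, punc c r z -> w z != 0 \/ h z != 0.

(* If [h/w] came close to both [x + 1] and [x - 1] on every punctured disc, the
   bounded function [1 / (k - (pi + 1))], where [k] is the transform [cauchy_tr]
   of [h] and [w], would extend to [c] with two different limits. *)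
Lemma exists_good_slope : lower_sums_le (punc c r) (curv_density w h) T ->
  lower_sums_le (punc c r) (fun=> 1) T' ->
  exists (b : C) (d rho : R), [/\ 0 < d, 0 < rho <= r &
    forall z, punc c rho z -> d * nc (w z) <= nc (h z - b * w z)].
Proof.
move=> lT lT'.
have [x [E [[x01 cE] E01 muE [rho /andP[rho0 rhor] nz]]]] :=
  exists_avoided_slopes r0 hw hh im lT lT'.
have sub z : punc c rho z -> punc c r z.
  by move=> /andP[a b]; apply/andP; split => //; exact: lt_le_trans b rhor.
pose k z := cauchy_tr E x (h z) (w z).
(* A point at distance at least 1 from the strip [|Re| <= pi] that contains all values of the
   transform. *)
pose Q : C := (pi + 1)%:C.
have farQ (u : C) : `|complex.Re u| <= pi -> 1 <= nc (u - Q).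
  move=> /ler_normlP [_ hu]; apply: le_trans (nc_Re _).
  rewrite ReD ReN /= ler0_norm; first by move: hu; clear -r0 hw hh im T T'; lra.
  by move: hu; clear -r0 hw hh im T T'; lra.
have neQ (u : C) : `|complex.Re u| <= pi -> u - Q != 0.
  by move=> /farQ; rewrite -nc_gt0; exact: lt_le_trans ltr01.
have puncn z : punc c rho z -> \forall y \near z, punc c rho y.
  move=> /andP[z1 z2]; apply/nbhs_cP.
  exists (Num.min (nc (z - c)) (rho - nc (z - c))); first by rewrite lt_min z1 subr_gt0.
  move=> y; rewrite lt_min => /andP[y1 y2]; apply/andP; split.
    rewrite nc_gt0; apply: contraTneq y1 => /subr0_eq ->.
    by rewrite normcB ltxx.
  have := nc_leD (y - z) (z - c); rewrite addrA subrK => y3.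
  by move: y2 y3; clear -r0 hw hh im T T'; lra.
have dk z : punc c rho z -> derivable (fun z => (k z - Q)^-1) z 1.
  move=> pz; have [l hl] := cder_cauchy_tr cE E01 x01 (hw (sub z pz)) (hh (sub z pz)) (filterS (fun y py t => nz y t py) (puncn z pz)).
  apply: cder_derivable (cderV _ (cderB hl (cder_cst Q z))).
  by apply: neQ; apply: Re_cauchy_tr => // t; exact: nz.
have near_punc : \forall z \near c^', punc c rho z.
  by apply/nbhs_puncP; exists rho => // z z1 z2; apply/andP; rewrite nc_gt0 subr_eq0.
have [g hg gE] : exists2 g, holo g c & \forall z \near c^', (k z - Q)^-1 = g z.
  apply: (@holo_removable R (fun z => (k z - Q)^-1) c 1).
    by apply: filterS near_punc; exact: dk.
  apply: filterS near_punc => z pz; have k1 : 1 <= nc (k z - Q).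
    by apply: farQ; apply: Re_cauchy_tr => // t; exact: nz.
  by rewrite -[_^-1]div1r nc_div nc1 div1r invf_le1 // (lt_le_trans ltr01).
pose good (b : C) := exists d rho1 : R, [/\ 0 < d, 0 < rho1 <= r &
  forall z, punc c rho1 z -> d * nc (w z) <= nc (h z - b * w z)].
(* If [b] is not good, [h / w] comes arbitrarily close to [b] on every punctured disc, and the
   extended function must have the corresponding value at [c]. *)
have key b : (forall t, E t -> 1 <= nc (b - slope x t)) -> ~ good b ->
    g c = (cauchy_tr E x b 1 - Q)^-1.
  move=> b1 nb; apply/eqP; rewrite -subr_eq0; apply: contrapT => /negP ne.
  set e := nc (g c - (cauchy_tr E x b 1 - Q)^-1).
  have e0 : 0 < e by rewrite nc_gt0.
  have b0 t : E t -> b - slope x t * 1 != 0.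
    by move=> Et; rewrite mulr1 -nc_gt0 (lt_le_trans ltr01) // b1.
  have [d1 d10 hd1] := (ccont_epsP _ _).1 (holo_ccont hg) (e / 2) (divr_gt0 e0 (ltr0n _ 2)).
  have [d2 d20 hd2] := (nbhs_puncP _ _).1 gE.
  (* By [nc_sub_cauchy_tr] an error [d] in [g] costs [4 d <= e / 4], which together with the [e / 2]
     from continuity of [g] stays below [e]. *)
  pose d := Num.min (1 / 2) (e / 16).
  have d0 : 0 < d by rewrite lt_min !divr_gt0 // ltr0n.
  pose rho1 := Num.min rho (Num.min d1 d2).
  apply: nb; exists d, rho1; split => //.
    by rewrite !lt_min rho0 d10 d20 /= ge_min rhor.
  move=> z /andP[z0]; rewrite !lt_min => /and3P[z1 z2 z3].
  rewrite leNgt; apply/negP => zb.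
  have pz : punc c rho z by apply/andP.
  have w0 : w z != 0.
    rewrite -nc_gt0 lt0r normc_ge0 andbT; apply: contraTneq zb => ->.
    by rewrite mulr0 -leNgt normc_ge0.
  have nzt t : E t -> h z - slope x t * w z != 0 by exact: nz.
  have d12 : d <= 1 / 2 by rewrite ge_min lexx.
  have := nc_sub_cauchy_tr cE E01 w0 d12 nzt b1 (ltW zb); rewrite -/(k z) => kb.
  have gz : (k z - Q)^-1 = g z by apply: hd2 => //; rewrite -subr_eq0 -nc_gt0.
  have k1 : `|complex.Re (k z)| <= pi by exact: Re_cauchy_tr.
  have k2 : `|complex.Re (cauchy_tr E x b 1)| <= pi by exact: Re_cauchy_tr.
  have q1 : nc (g z - (cauchy_tr E x b 1 - Q)^-1) <= 4 * d.
    rewrite -gz; move: (neQ _ k1) (neQ _ k2) (farQ _ k1) (farQ _ k2).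
    move: kb; move: (k z) (cauchy_tr E x b 1) (Q) => u v y uv n1 n2 f1 f2.
    have -> : (u - y)^-1 - (v - y)^-1 = - (u - v) / ((u - y) * (v - y)).
      by field; rewrite n1 n2.
    rewrite nc_div ncN ncM ler_pdivrMr ?mulr_gt0 ?nc_gt0 //.
    apply: (le_trans uv); rewrite ler_peMr ?mulr_ge0 ?(ltW d0) //.
    by rewrite -[1]mulr1 ler_pM.
  have := nc_leD (g c - g z) (g z - (cauchy_tr E x b 1 - Q)^-1).
  rewrite addrA subrK -/e (normcB (g c)) => q2.
  have := hd1 z z2; have : d <= e / 16 by rewrite ge_min lexx orbT.
  by move: q1 q2 e0; clear -r0 hw hh im T T'; lra.
have far1 (s : R) (t : R) : `|s| = 1 -> 1 <= nc ((x + s)%:C - slope x t).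
  move=> s1; apply: le_trans (nc_Re _); rewrite ReD ReN /=.
  by rewrite addrAC subrr add0r s1.
have [g1|n1] := pselect (good (x + 1)%:C).
  by have [d [rho1 hd]] := g1; exists (x + 1)%:C, d, rho1.
have [g1|n2] := pselect (good (x - 1)%:C).
  by have [d [rho1 hd]] := g1; exists (x - 1)%:C, d, rho1.
exfalso.
have k1 := key _ (fun t _ => far1 1 t (normr1 _)) n1.
have k2 := key _ (fun t _ => far1 (-1) t (normrN1 _)) n2.
have eqk : cauchy_tr E x (x + 1)%:C 1 = cauchy_tr E x (x - 1)%:C 1.
  by move: k1; rewrite k2 => /invr_inj /addIr ->.
have : 0 < complex.Re (cauchy_tr E x (x + 1)%:C 1) by apply: Re_cauchy_tr_right.
have : complex.Re (cauchy_tr E x (x - 1)%:C 1) < 0 by apply: Re_cauchy_tr_left.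
by rewrite eqk => /lt_trans h1 /h1; rewrite ltxx.
Qed.

End GoodSlope.

(** The integral of a nonnegative function is a supremum over simple functions below it, so
    monotonicity is immediate. Densities and speeds on arbitrary charts and paths can thus be
    compared before anything is known about their measurability. *)
Lemma ge0_le_integral_nomeas d (T : measurableType d) (R : realType)
    (mu : {measure set T -> \bar R}) (D : set T) (f1 f2 : T -> \bar R) :
  (forall x, D x -> 0 <= f1 x)%E -> (forall x, D x -> f1 x <= f2 x)%E ->
  (\int[mu]_(x in D) f1 x <= \int[mu]_(x in D) f2 x)%E.
Proof.
move=> f10 f12; have f20 x : D x -> (0 <= f2 x)%E.
  by move=> Dx; exact: le_trans (f10 x Dx) (f12 x Dx).
rewrite !ge0_integralE //; apply: ge_ereal_sup => _ [h /= hh <-].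
apply: ereal_sup_ubound; exists h => //= x; apply: (le_trans (hh x)).
by rewrite /patch; case: ifPn => //; rewrite inE => /f12.
Qed.

(** * Dyadic squares and plane measure *)

Section PlaneMeasure.
Context {R : realType}.
Local Notation C := R[i].
Local Notation nc := (@Normc.normc R).
Local Notation mu := (@lebesgue_measure R).
Local Notation R1 := (measurableTypeR R).
Local Notation mu2 := (mu \x mu)%E.

Definition dside (n : nat) (i : int) : set R1 :=
  `[i%:~R / 2 ^+ n, (i + 1)%:~R / 2 ^+ n[%classic.

Definition drect (k : dyadic) : set (R1 * R1) :=
  [set ab | dbox k ((ab.1 : R) +i* (ab.2 : R))].

Lemma floor_dside n i (x : R) : Num.floor (2 ^+ n * x) = i <-> dside n i x.
Proof.
have p0 : 0 < 2 ^+ n :> R by rewrite exprn_gt0.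
rewrite /dside /= in_itv /= ler_pdivrMr // ltr_pdivlMr // mulrC; split.
  by move=> <-; exact: floor_itv.
by exact: floor_def.
Qed.

Lemma drectE k : drect k = dside k.1 k.2.1 `*` dside k.1 k.2.2.
Proof.
case: k => n [i j]; apply/seteqP; split=> -[a b] /=; rewrite /drect /dbox /dyadic_at /=.
  by move=> [/floor_dside h1 /floor_dside h2].
by move=> [/floor_dside -> /floor_dside ->].
Qed.

Lemma measurable_dside n i : measurable (dside n i).
Proof. exact: measurable_itv. Qed.

Lemma measurable_drect k : measurable (drect k).
Proof. by rewrite drectE; apply: measurableX; exact: measurable_dside. Qed.

Lemma lebesgue_measure_dside n i : mu (dside n i) = (2^-1 ^+ n)%:E.
Proof.
have p0 : 0 < 2 ^+ n :> R by rewrite exprn_gt0.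
rewrite /dside lebesgue_measure_itv /= lte_fin ltr_pM2r ?invr_gt0 // ltr_int.
rewrite ltrDl /= -EFinB -mulrBl intrD addrAC subrr add0r mul1r.
by rewrite exprVn.
Qed.

Lemma measure_drect k : mu2 (drect k) = (darea k : R)%:E.
Proof.
rewrite drectE product_measure1E; [|exact: measurable_dside|exact: measurable_dside].
have e i : lebesgue_measure_lebesgue_measure__canonical__measure_function_SigmaFiniteMeasure R (dside k.1 i) = (2^-1 ^+ k.1)%:E.
  exact: lebesgue_measure_dside.
by rewrite [X in (X * _)%E]e [X in (_ * X)%E]e -EFinM darea_side expr2.
Qed.

Lemma integral_drect_ge (k : dyadic) (g : R1 * R1 -> \bar R) (kap : R) : 0 <= kap ->
  (forall x, drect k x -> kap%:E <= g x)%E ->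
  ((kap * darea k)%:E <= \int[mu2]_(x in drect k) g x)%E.
Proof.
move=> k0 hg; rewrite EFinM -measure_drect -integral_cst; last exact: measurable_drect.
by apply: ge0_le_integral_nomeas => x hx; [rewrite lee_fin|exact: hg].
Qed.

Lemma dbox_nonempty (k : dyadic) : exists z : C, dbox k z.
Proof.
exists ((k.2.1%:~R / 2 ^+ k.1) +i* (k.2.2%:~R / 2 ^+ k.1)).
have p0 : 2 ^+ k.1 != 0 :> R by rewrite expf_neq0 // pnatr_eq0.
rewrite /dbox /dyadic_at /= [RHS]surjective_pairing.
by congr pair; rewrite mulrC divfK // intrKfloor.
Qed.

Lemma area_lower_sums (c : C) (r : R) : 0 < r ->
  lower_sums_le (punc c r) (fun=> 1) (4 * r ^+ 2).
Proof.
move=> r0 s kap us dis inA.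
pose N := size s; pose k (i : 'I_N) := nth (0%N, (0, 0)) s i.
have ks i : k i \in s by rewrite mem_nth.
pose a := complex.Re c; pose b := complex.Im c.
pose B : set (R1 * R1) := `[a - r, a + r]%classic `*` `[b - r, b + r]%classic.
have mB : measurable B by apply: measurableX; exact: measurable_itv.
have muI (x : R) : mu `[x - r, x + r] = (2 * r)%:E.
  rewrite lebesgue_measure_itv /= lte_fin ltrBlDr -addrA ltrDl addr_gt0 //.
  by rewrite -EFinB; congr EFin; ring.
have muB : mu2 B = (4 * r ^+ 2)%:E.
  rewrite /B product_measure1E; [|exact: measurable_itv|exact: measurable_itv].
  rewrite [X in (X * _)%E](_ : _ = (2 * r)%:E); last exact: muI.
  rewrite [X in (_ * X)%E](_ : _ = (2 * r)%:E); last exact: muI.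
  by rewrite -EFinM; congr EFin; ring.
have tI : trivIset setT (fun i => drect (k i)).
  apply/trivIsetP => i j _ _ ij; apply/seteqP; split=> // -[x y] [/= h1 h2].
  have := dis _ _ _ (ks i) (ks j) h1 h2; rewrite /k => /eqP.
  by rewrite nth_uniq // => /eqP /val_inj ji; rewrite ji eqxx in ij.
have mk i : measurable (drect (k i)) by exact: measurable_drect.
rewrite -lee_fin -muB.
apply: (@le_trans _ _ (mu2 (\big[setU/set0]_(i < N) drect (k i)))).
  rewrite measure_bigsetU_ord // (big_nth (0%N, (0, 0))) big_mkord -sumEFin.
  apply: lee_sum => i _; rewrite [leRHS]measure_drect lee_fin ler_piMl ?darea_ge0 //.
  have [z hz] := dbox_nonempty (k i).
  by have [_ /andP[_]] := inA _ _ (ks i) hz.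
apply: le_measure; rewrite ?inE //; first exact: bigsetU_measurable.
rewrite -bigcup_seq => -[x y] [i _ hxy].
have [/andP[_ hr] _] := inA _ _ (ks i) hxy.
have := le_lt_trans (nc_Re _) hr; have := le_lt_trans (nc_Im _) hr.
rewrite ReD ImD ReN ImN /= => /ltr_normlP [h1 h2] /ltr_normlP [h3 h4].
rewrite /B; split; rewrite /= in_itv /= -/a -/b; apply/andP; split;
  move: h1 h2 h3 h4; rewrite -/a -/b; clear; lra.
Qed.

End PlaneMeasure.

(** * The forms omega and g omega at an end *)

Section EndForms.
Context {R : realType}.
Local Notation C := R[i].
Local Notation nc := (@Normc.normc R).
Local Notation mu := (@lebesgue_measure R).
Local Notation mu2 := (mu \x mu)%E.
Variables (S : riemann_surface R) (D : set S) (f : S -> isotropic_space R).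

Definition end_disc (p : S) (r : R) : Prop :=
  0 < r /\ forall z, nc (z - chart p p) < r ->
    [/\ chart_dom p (chart_inv p z), chart p (chart_inv p z) = z &
        z != chart p p -> D (chart_inv p z)].

Definition height_form (p : S) (z : C) : C := 2 * del (crd0 \o f) p z.

Lemma end_local_data p r z : zmc_face D f -> end_disc p r ->
  punc (chart p p) r z -> exists G P, local_data f p z G P.
Proof.
move=> zf [r0 er] /andP[z0 zr]; have [d1 d2 d3] := er z zr.
have Dz : D (chart_inv p z) by apply: d3; rewrite -subr_eq0 -nc_gt0.
by have := zmc_local_data zf Dz d1; rewrite d2.
Qed.

Lemma local_data_forms p z G P : local_data f p z G P ->
  [/\ holo (omega f p) z, holo (height_form p) z &
      omega f p z != 0 \/ height_form p z != 0].
Proof.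
move=> ld; have [hG hP im _ _] := ld; have h := ld_forms ld.
have [e1 e2] := nbhs_singleton h; split.
- by apply: near_eq_holo (holo_deriv hP); apply: filterS h => w [].
- by apply: near_eq_holo (holo_deriv hG); apply: filterS h => w [].
- by rewrite /height_form e1 e2.
Qed.

Lemma local_data_curvature p z G P : local_data f p z G P ->
  `|gauss_curvature (lift_factor f p) z| * lift_factor f p z =
  curv_density (omega f p) (height_form p) z.
Proof.
move=> ld; have [h1 h2 im] := local_data_forms ld.
apply: (abs_curvature h1 h2 im); apply/nbhs_cP; exists 1; first exact: ltr01.
by [].
Qed.

Lemma end_forms p r z : zmc_face D f -> end_disc p r ->
  punc (chart p p) r z ->
  [/\ holo (omega f p) z, holo (height_form p) z &
      omega f p z != 0 \/ height_form p z != 0].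
Proof.
by move=> zf er pz; have [G [P /local_data_forms]] := end_local_data zf er pz.
Qed.

(** Disjoint dyadic squares, carried to the surface by the single chart at [p], form one of the
    families in the supremum that defines the total curvature. *)
Lemma end_lower_sums p r : zmc_face D f -> finite_type D f -> end_disc p r ->
  lower_sums_le (punc (chart p p) r) (curv_density (omega f p) (height_form p))
    (fine (total_abs_curvature D f)).
Proof.
move=> zf ft er s kap us dis inA; have [r0 er'] := er.
pose N := size s; pose k (i : 'I_N) := nth (0%N, (0, 0)) s i.
have ks i : k i \in s by rewrite mem_nth.
have inA' i z : dbox (k i) z -> [/\ chart_dom p (chart_inv p z), chart p (chart_inv p z) = z & D (chart_inv p z)].
  move=> /(inA _ _ (ks i)) [/andP[z0 zr] _]; have [d1 d2 d3] := er' z zr.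
  by split => //; apply: d3; rewrite -subr_eq0 -nc_gt0.
pose A (i : 'I_N) : set S := chart_inv p @` dbox (k i).
have imgE i : [set ab : R * R | exists2 q, A i q & chart p q = ab.1 +i* ab.2] = drect (k i).
  apply/seteqP; split=> -[x y] /=.
    by move=> [_ [z hz <-]] e; have [_ e2 _] := inA' i z hz; move: hz; rewrite -e2 e.
  move=> hz; exists (chart_inv p (x +i* y)); first by exists (x +i* y).
  by have [_ -> _] := inA' i _ hz.
have le_tot : ((\sum_(k <- s) kap k * darea k)%:E <= total_abs_curvature D f)%E.
  apply: (@le_trans _ _ (\sum_(i < N) \int[mu2]_(ab in drect (k i))
      (`|gauss_curvature (lift_factor f p) (ab.1 +i* ab.2)|
               * lift_factor f p (ab.1 +i* ab.2))%:E)%E).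
    rewrite (big_nth (0%N, (0, 0))) big_mkord -sumEFin.
    apply: lee_sum => i _.
    have [z hz] := @dbox_nonempty R (k i).
    have [_ /andP[k0 _]] := inA _ _ (ks i) hz.
    apply: integral_drect_ge => // -[x y] /= hxy.
    have [pz /andP[_ kz]] := inA _ _ (ks i) hxy.
    have [G [P ld]] := end_local_data zf er pz.
    by rewrite (local_data_curvature ld) lee_fin.
  apply: ereal_sup_ubound; exists N, (fun=> p), A => img; split.
  - by move=> i _ [z hz <-]; have [d1 d2 d3] := inA' i z hz.
  - apply/trivIsetP => i j _ _ ij; apply/seteqP; split=> // q [[z hz zq] [z' hz' zq']].
    have [_ e1 _] := inA' i z hz; have [_ e2 _] := inA' j z' hz'.
    have zz : z = z' by rewrite -e1 -e2 zq zq'.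
    rewrite -zz in hz'; have := dis _ _ _ (ks i) (ks j) hz hz'; rewrite /k => /eqP.
    by rewrite nth_uniq // => /eqP /val_inj ji; rewrite ji eqxx in ij.
  - by move=> i; rewrite /img imgE; exact: measurable_drect.
  - by apply: eq_bigr => i _; rewrite /img imgE.
have tot0 : (0 <= total_abs_curvature D f)%E.
  apply: ereal_sup_ubound; exists 0%N, (fun=> p), (fun=> set0) => img; split.
  - by case.
  - by apply/trivIsetP => -[].
  - by case.
  - by rewrite big_ord0.
by rewrite -lee_fin fineK // ge0_fin_numE.
Qed.

Lemma end_good_slope p r : zmc_face D f -> finite_type D f -> end_disc p r ->
  exists (b : C) (d rho : R), [/\ 0 < d, 0 < rho <= r &
    forall z, punc (chart p p) rho z ->
      d * nc (omega f p z) <= nc (height_form p z - b * omega f p z)].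
Proof.
move=> zf ft er; have [r0 _] := er.
have h z := end_forms zf er (z := z).
have hw z : punc (chart p p) r z -> holo (omega f p) z by move=> /h [].
have hh z : punc (chart p p) r z -> holo (height_form p) z by move=> /h [].
have im z : punc (chart p p) r z -> omega f p z != 0 \/ height_form p z != 0 by move=> /h [].
have lT := end_lower_sums zf ft er; have lT' := @area_lower_sums R (chart p p) r r0.
exact: (exists_good_slope r0 hw hh im lT lT').
Qed.

End EndForms.

Lemma exists_end_disc (R : realType) (S : riemann_surface R) n (p : 'I_n -> S) j :
  exists r, end_disc (punctured p) (p j) r.
Proof.
have h1 : \forall q \near p j, forall i, q <> p j -> q <> p i.
  apply: filter_forall => i; have [ij|/eqP ij] := pselect (p i = p j).
    by apply: nearW => q; rewrite ij.
  have cl : closed [set p i].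
    by apply: accessible_closed_set1; apply: hausdorff_accessible; exact: rs_hausdorff.
  have : nbhs (p j) (~` [set p i]).
    apply: open_nbhs_nbhs; split; first exact: closed_openC.
    by move=> /= e; rewrite e eqxx in ij.
  by apply: filterS => q qi _.
have cd := chart_dom_center (p j).
have : \forall z \near chart (p j) (p j),
    [/\ chart_dom (p j) (chart_inv (p j) z), chart (p j) (chart_inv (p j) z) = z &
      forall i, chart_inv (p j) z <> p j -> chart_inv (p j) z <> p i].
  by apply: filterS2 (chart_invK_near cd) (chart_inv_near cd h1) => z [].
move=> /nbhs_cP [r r0 hr]; exists r; split => // z zr.
have [//|a b e] := hr z; split => // zc i; apply: e => ec.
by move: zc; rewrite -b ec eqxx.
Qed.

(** * Uniformity on discs and crossing times *)

Section Compactness.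
Context {R : realType}.
Local Notation C := R[i].
Local Notation nc := (@Normc.normc R).

(** Compactness for a property that passes to smaller [e]: local constants give a single one. It
    provides uniform existence times, lower bounds and, with [e^-1], upper bounds. *)
Lemma disc_uniform (c : C) (s : R) (P : C -> R -> Prop) :
  (forall z e e', P z e -> 0 < e' <= e -> P z e') ->
  (forall z, nc (z - c) <= s -> exists2 e, 0 < e & \forall z' \near z, P z' e) ->
  exists2 e, 0 < e & forall z, nc (z - c) <= s -> P z e.
Proof.
move=> mono loc.
have /compact_near_coveringP cov := @compact_disc R s.
have := cov R (0 : R)^'+ (fun e z => 0 < e -> P (c + z) e) _.
case=> [z zs|d /= d0 hd].
  have [|e e0 he] := loc (c + z); first by rewrite addrC addKr.
  exists ([set z' | P (c + z') e], [set e' | e' <= e]); last first.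
    by move=> [z' e'] /= [h1 h2] e'0; apply: mono h1 _; rewrite e'0.
  split => /=; last exact: nbhs_right_le.
  have /nbhs_cP [d d0 hd] := he; apply/nbhs_cP; exists d => // z' zz'.
  by apply: hd; rewrite opprD addrACA subrr add0r.
exists (d / 2); first by rewrite divr_gt0.
move=> z zs; rewrite -(subrKC c z).
apply: (hd (d / 2)) => //=; last by rewrite divr_gt0.
- by rewrite sub0r normrN gtr0_norm ?divr_gt0 //; move: d0; clear; lra.
- by rewrite divr_gt0.
Qed.

Lemma last_point (P : R -> Prop) : P 0 -> (forall t, P t -> 0 <= t <= 1) ->
  (forall t, 0 <= t <= 1 -> ~ P t -> exists2 d, 0 < d & forall s, `|s - t| < d -> ~ P s) ->
  exists2 t, P t & forall s, P s -> s <= t.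
Proof.
move=> P0 P01 cl.
have hs : has_sup [set t | P t] by split; [exists 0|exists 1 => t /P01 /andP[]].
have ub s : P s -> s <= sup [set t | P t] by move=> Ps; apply: ub_le_sup => //; case: hs.
exists (sup [set t | P t]) => //; apply: contrapT => nP.
have [|d d0 hd] := cl (sup [set t | P t]) _ nP.
  rewrite ub //=; apply: ge_sup; first by case: hs.
  by move=> t /P01 /andP[].
have [t Pt ht] := sup_adherent d0 hs.
apply: (hd t) => //; rewrite ler0_norm; last by rewrite subr_le0 ub.
by move: ht; clear; lra.
Qed.

(** [t0] is the last time at level at most [a], and [t1] the first later time at level at least [b],
    found as a last point after reversing time. *)
Lemma crossing (u : R -> R) (a b : R) :
  (forall t, 0 <= t <= 1 -> {for t, continuous u}) -> u 0 <= a -> a < b -> b <= u 1 ->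
  exists t0 t1, [/\ 0 <= t0, t0 <= t1, t1 <= 1, u t0 <= a & b <= u t1 /\
    forall t, t0 <= t <= t1 -> a <= u t <= b].
Proof.
move=> cu u0 ab u1.
have nearu (t : R) (V : set R) : 0 <= t <= 1 -> nbhs (u t) V ->
    exists2 d, 0 < d & forall s, `|s - t| < d -> V (u s).
  by move=> t01 /(cu t t01) /nbhs_rP.
have [|||t0 [/andP[t00 t01] ut0] last0] := @last_point (fun t => 0 <= t <= 1 /\ u t <= a).
- by split; [rewrite lexx ler01|].
- by move=> t [].
- move=> t t01 nP; have ut : a < u t by rewrite ltNge; apply/negP => h; apply: nP.
  have [d d0 hd] := nearu t [set x : R | a < x] t01 (lt_nbhsr ut).
  by exists d => // s /hd /= h [_]; rewrite leNgt h.
have [|||t1' [/andP[t10 t11] ut1] last1] :=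
    @last_point (fun t => 0 <= t <= 1 - t0 /\ b <= u (1 - t)).
- by split; [rewrite lexx subr_ge0|rewrite subr0].
- by move=> t [/andP[h1 h2] _]; rewrite h1 (le_trans h2) // gerBl.
- move=> t /andP[ta tb] nP.
  have [tt|tt] := leP t (1 - t0); last first.
    exists (t - (1 - t0)); first by rewrite subr_gt0.
    move=> s /ltr_normlP [h1 h2] [/andP[_ h3] _]; move: h1 h3; clear; lra.
  have ut : u (1 - t) < b by rewrite ltNge; apply/negP => h; apply: nP; rewrite ta tt.
  have [|d d0 hd] := nearu (1 - t) [set x : R | x < b] _ (lt_nbhsl ut).
    by rewrite subr_ge0 tb gerBl.
  exists d => // s hs [_]; rewrite leNgt (hd (1 - s)) //.
  by rewrite opprB addrC subrKA distrC.
exists t0, (1 - t1'); split => //; [by rewrite lerBrDl -lerBrDr|by rewrite gerBl|].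
split => // t /andP[h1 h2]; apply/andP; split.
- have [<-|tt0] := eqVneq t0 t; last first.
    rewrite leNgt; apply/negP => ut; have : t <= t0.
      by apply: last0; split; [apply/andP; split; [exact: le_trans h1|move: h2 t10; clear; lra]|exact: ltW].
    by move=> h3; case/eqP: tt0; apply/eqP; rewrite eq_le h1 h3.
  rewrite leNgt; apply/negP => ut.
  have [d d0 hd] := nearu t0 [set x : R | x < a] (introT andP (conj t00 t01)) (lt_nbhsl ut).
  have t0lt : t0 < 1.
    rewrite lt_neqAle t01 andbT; apply: contraTneq ut0 => ->.
    by rewrite -ltNge (lt_le_trans ab).
  pose s := Num.min (t0 + d / 2) 1.
  have st : t0 < s by rewrite lt_min t0lt andbT ltrDl divr_gt0.
  have : s <= t0.
    apply: last0; split.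
      by rewrite (le_trans t00 (ltW st)) ge_min lexx orbT.
    apply/ltW/hd; rewrite gtr0_norm ?subr_gt0 //.
    have : s <= t0 + d / 2 by rewrite ge_min lexx.
    by move: d0; clear; lra.
  by rewrite leNgt st.
- have [->|tt1] := eqVneq t (1 - t1'); last first.
    rewrite leNgt; apply/negP => ut; have : 1 - t <= t1'.
      apply: last1; rewrite subKr; split; last exact: ltW.
      by apply/andP; split; move: h1 h2 t10; clear; lra.
    move=> h3; case/eqP: tt1; apply/eqP; rewrite eq_le h2; move: h3; clear; lra.
  rewrite leNgt; apply/negP => ut.
  have t1lt : t1' < 1 - t0.
    rewrite lt_neqAle t11 andbT; apply: contraTneq ut => ->.
    by rewrite subKr -leNgt (le_trans ut0 (ltW ab)).
  have [|d d0 hd] := nearu (1 - t1') [set x : R | b < x] _ (lt_nbhsr ut).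
    by apply/andP; split; move: t10 t11 t00; clear; lra.
  pose s := Num.min (t1' + d / 2) (1 - t0).
  have st : t1' < s by rewrite lt_min t1lt andbT ltrDl divr_gt0.
  have : s <= t1'.
    apply: last1; split.
      by rewrite (le_trans t10 (ltW st)) ge_min lexx orbT.
    apply/ltW/hd; rewrite ltr0_norm; last by move: st; clear; lra.
    have : s <= t1' + d / 2 by rewrite ge_min lexx.
    by move: d0; clear; lra.
  by rewrite leNgt st.
Qed.

End Compactness.

(** * Completeness and growth at an end *)

Section Flow.
Context {R : realType}.
Local Notation C := R[i].
Local Notation nc := (@Normc.normc R).
Variables (W : C -> C) (c : C) (rho : R).
Implicit Types (z y : C) (phi : C -> C) (D : set C).

Hypothesis W0 : forall z, punc c rho z -> W z != 0.
Hypothesis WQ : forall z, punc c rho z -> exists2 Q, holo Q z &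
  \forall y \near z, 'D_1 Q y = W y.

(* Solutions of [phi' = 1 / W(phi)]: the local isometries from the plane to the
   punctured disc with the flat metric [|W||dz|]. *)
Definition flow_sol D phi : Prop :=
  forall y, D y -> punc c rho (phi y) /\ cder phi y (W (phi y))^-1.

Definition flows z (r : R) : Prop :=
  exists2 phi, phi 0 = z & flow_sol [set y | nc y < r] phi.

Lemma flow_solS D D' phi : D `<=` D' -> flow_sol D' phi -> flow_sol D phi.
Proof. by move=> DD' h y /DD'; exact: h. Qed.

Lemma punc_near z : punc c rho z -> \forall y \near z, punc c rho y.
Proof.
move=> /andP[z1 z2]; apply/nbhs_cP.
exists (Num.min (nc (z - c)) (rho - nc (z - c))); first by rewrite lt_min z1 subr_gt0.
move=> y; rewrite lt_min => /andP[y1 y2]; apply/andP; split.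
  rewrite nc_gt0; apply: contraTneq y1 => /subr0_eq ->.
  by rewrite normcB ltxx.
have := nc_leD (y - z) (z - c); rewrite addrA subrK => y3.
by apply: (le_lt_trans y3); rewrite -ltrBrDr.
Qed.

(** With [Q' = W], the function [Q(phi y) - y] is locally constant for every solution, and [Q] is
    injective near [phi a]. *)
Lemma flow_locally_unique phi psi D a : (\forall y \near a, D y) ->
  flow_sol D phi -> flow_sol D psi -> phi a = psi a ->
  \forall y \near a, phi y = psi y.
Proof.
move=> Da hphi hpsi e; have Da' := nbhs_singleton Da.
have [pa dpa] := hphi a Da'; have [_ dqa] := hpsi a Da'.
have [Q hQ QW] := WQ pa.
have Q'0 : 'D_1 Q (phi a) != 0 by rewrite (nbhs_singleton QW) W0.
have [r r0 [_ _ inj]] := holo_bilipschitz hQ Q'0.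
have nearQ : \forall y \near phi a, nc (y - phi a) < r /\ cder Q y (W y).
  have nr : \forall y \near phi a, nc (y - phi a) < r.
    by apply/nbhs_cP; exists r.
  by apply: filterS3 nr QW (holo_near hQ) => y h1 <- /holo_cder.
have h1 := ccont_near (cder_ccont dpa) nearQ.
have h2 : \forall y \near a, nc (psi y - phi a) < r /\ cder Q (psi y) (W (psi y)).
  by rewrite e in nearQ; rewrite e; exact: (ccont_near (cder_ccont dqa) nearQ).
have /nbhs_cP [d d0 hd] : \forall y \near a, [/\ D y,
    nc (phi y - phi a) < r /\ cder Q (phi y) (W (phi y)) &
    nc (psi y - phi a) < r /\ cder Q (psi y) (W (psi y))].
  by apply: filterS3 Da h1 h2 => y.
apply/nbhs_cP; exists d => // y yd.
have [Dy [y1 q1] [y2 q2]] := hd y yd.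
have : Q (phi y) - Q (psi y) = Q (phi a) - Q (psi a).
  apply: (convex_deriv0 (D := [set y | nc (y - a) < d]) (F := fun y => Q (phi y) - Q (psi y))) => //.
  - exact: convex_disc.
  - move=> v /hd [Dv [_ k1] [_ k2]]; have [p1 g1] := hphi v Dv; have [p2 g2] := hpsi v Dv.
    apply: cder_eq (cderB (cder_comp g1 k1) (cder_comp g2 k2)) _.
    by rewrite !mulfV ?subrr ?W0.
  - by rewrite /= subrr nc0.
rewrite e subrr => QE.
have := inj _ _ y1 y2; rewrite QE nc0 mulr0 => h.
apply/subr0_eq/eqP; rewrite -nc_eq0 eq_le normc_ge0 andbT.
by move: h; rewrite pmulr_rle0 // nc_gt0.
Qed.

Lemma flow_holo D phi a : (\forall y \near a, D y) -> flow_sol D phi -> holo phi a.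
Proof.
by move=> Da h; apply: filterS Da => y /h [_]; exact: cder_derivable.
Qed.

Lemma flow_unique D phi psi a b : convex_set D -> (forall y, D y -> \forall y' \near y, D y') ->
  flow_sol D phi -> flow_sol D psi -> D a -> D b -> phi a = psi a -> phi b = psi b.
Proof.
move=> cD oD h1 h2 Da Db e; apply: subr0_eq.
apply: (convex_identity (D := D) (f := fun y => phi y - psi y) (a := a)) => //.
- by move=> y Dy; apply: holoB; [exact: flow_holo (oD y Dy) h1|exact: flow_holo (oD y Dy) h2].
- by apply: filterS (flow_locally_unique (oD a Da) h1 h2 e) => y ->; rewrite subrr.
Qed.

(** Solutions are [y -> Q^-1(Q z' + y)]; one inverse serves all nearby starting points, hence the
    uniform radius. *)
Lemma flow_local z : punc c rho z ->
  exists2 e : R, 0 < e & \forall z' \near z, flows z' e.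
Proof.
move=> pz; have [Q hQ QW] := WQ pz.
have Q'0 : 'D_1 Q z != 0 by rewrite (nbhs_singleton QW) W0.
have [g [hg gz _ Qg] gQ] := holo_local_inverse hQ Q'0.
have near1 : \forall y \near g (Q z), [/\ punc c rho y, holo Q y & 'D_1 Q y = W y].
  by rewrite gz; apply: filterS3 (punc_near pz) (holo_near hQ) QW => y.
have near2 := ccont_near (holo_ccont hg) near1.
have /nbhs_cP [s s0 hs] : \forall y \near Q z, [/\ punc c rho (g y) & cder g y (W (g y))^-1].
  apply: filterS3 near2 (holo_near hg) (near_join Qg) => y [p1 p2 p3] hgy Qgy.
  split => //; apply: (cder_inverse (f := Q)) => //.
  - by rewrite -p3; exact: holo_cder.
  - by rewrite W0.
  - exact: holo_ccont.
exists (s / 2); first by rewrite divr_gt0.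
have near3 : \forall z' \near z, nc (Q z' - Q z) < s / 2.
  apply: (ccont_near (holo_ccont hQ) (P := fun y => nc (y - Q z) < s / 2)).
  by apply/nbhs_cP; exists (s / 2); [rewrite divr_gt0|].
apply: filterS2 near3 gQ => z' z1 z2.
exists (fun y => g (Q z' + y)); first by rewrite addr0.
move=> y ys; have [|p1 p2] := hs (Q z' + y).
  rewrite addrAC; apply: le_lt_trans (nc_leD _ _) _.
  by rewrite (splitr s) ltrD.
split => //; apply: cder_eq (cder_comp (cderD (cder_cst (Q z') y) (cder_id y)) p2) _.
by rewrite add0r mulr1.
Qed.

Lemma disc_near (a y : C) (r : R) : nc (y - a) < r -> \forall y' \near y, nc (y' - a) < r.
Proof.
move=> ya; apply/nbhs_cP; exists (r - nc (y - a)); first by rewrite subr_gt0.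
move=> y' h; have := nc_leD (y' - y) (y - a); rewrite addrA subrK => /le_lt_trans; apply.
by rewrite -ltrBrDr.
Qed.

(** At [y] the value is taken from the local solution started at the shrunken point [base y].
    Uniqueness on intersections of discs, which are convex, shows that neighbouring choices agree,
    so the diagonal [star y y] is a solution. *)
Lemma flow_extend z r e phi : 0 < r -> 0 < e -> phi 0 = z ->
  flow_sol [set y | nc y < r] phi ->
  (forall y, nc y < r -> flows (phi y) e) -> flows z (r + e / 2).
Proof.
move=> r0 e0 phi0 hphi loc.
have /choice [Phi hPhi] : forall y, exists psi : C -> C, nc y < r ->
    psi 0 = phi y /\ flow_sol [set v | nc v < e] psi.
  move=> y; have [yr|yr] := pselect (nc y < r).
    by have [psi] := loc y yr; exists psi.
  by exists (fun=> 0).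
(* Scaling by [t] maps the larger disc into the disc of radius [r] and moves its points by less than
   [e / 2]. *)
pose t := r / (r + e / 2).
have re0 : 0 < r + e / 2 by rewrite addr_gt0 // divr_gt0.
have t0 : 0 < t by rewrite divr_gt0.
have t1 : t < 1 by rewrite ltr_pdivrMr // mul1r ltrDl divr_gt0.
pose base (y : C) := t%:C * y.
have baser y : nc y < r + e / 2 -> nc (base y) < r.
  move=> h; rewrite /base ncM nc_real gtr0_norm // /t mulrAC ltr_pdivrMr //.
  by rewrite ltr_pM2l.
have basee y : nc y < r + e / 2 -> nc (y - base y) < e.
  move=> h; have -> : y - base y = (1 - t)%:C * y by rewrite /base rmorphB /=; ring.
  rewrite ncM nc_real ger0_norm ?subr_ge0 ?(ltW t1) //.
  have -> : 1 - t = (e / 2) / (r + e / 2).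
    apply: (mulIf (lt0r_neq0 re0)).
    by rewrite mulrBl mul1r /t !divfK ?lt0r_neq0 // addrC addKr.
  rewrite mulrAC ltr_pdivrMr //; apply: (@lt_le_trans _ _ (e / 2 * (r + e / 2))).
    by rewrite ltr_pM2l // divr_gt0.
  by rewrite ler_wpM2r ?(ltW re0) // ler_pdivrMr // ler_peMr ?(ltW e0) // ler1n.
pose star (y v : C) := Phi (base y) (v - base y).
have star_sol y : nc y < r + e / 2 -> flow_sol [set v | nc (v - base y) < e] (star y).
  move=> yr v ve; have [_ h] := hPhi _ (baser y yr).
  have [p1 p2] := h _ ve; split => //.
  apply: cder_eq (cder_comp (cderB (cder_id v) (cder_cst (base y) v)) p2) _.
  by rewrite subr0 mulr1.
have star_base y : nc y < r + e / 2 -> star y (base y) = phi (base y).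
  by move=> yr; rewrite /star subrr; have [] := hPhi _ (baser y yr).
have dopen a s y : [set v | nc (v - a) < s] y -> \forall y' \near y, [set v | nc (v - a) < s] y'.
  exact: disc_near.
have d0open s y : [set v | nc v < s] y -> \forall y' \near y, [set v | nc v < s] y'.
  by move=> /= ys; have := @disc_near 0 y s; rewrite subr0 => /(_ ys); apply: filterS => y' /=; rewrite subr0.
have conv0 s : convex_set [set v : C | nc v < s].
  move=> a b u /= ha hb hu; have := @convex_disc R 0 s a b u.
  by rewrite /= !subr0; apply.
have starE y : nc y < r + e / 2 -> \forall v \near y, star v v = star y v.
  move=> yr.
  have cb : ccont base y by apply: (cder_ccont (cderZ t%:C (cder_id y))).
  have n1 : \forall v \near y, nc v < r + e / 2 by exact: d0open.
  have n2 : \forall v \near y, nc (base v - base y) < e.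
    apply: (ccont_near cb (P := fun v => nc (v - base y) < e)).
    by apply: disc_near; rewrite subrr nc0.
  have n3 : \forall v \near y, nc (v - base y) < e by apply: disc_near; exact: basee.
  apply: filterS3 n1 n2 n3 => v v1 v2 v3.
  have e1 : phi (base v) = star y (base v).
    apply: (flow_unique (D := [set v | nc v < r] `&` [set v | nc (v - base y) < e]) (a := base y)).
    - by apply: convex_setI; [exact: conv0|exact: convex_disc].
    - by move=> x [x1 x2]; apply: filterS2 (d0open _ _ x1) (dopen _ _ _ x2) => x'.
    - by apply: flow_solS hphi => x [].
    - by apply: flow_solS (star_sol y yr) => x [].
    - by split; [exact: baser|rewrite /= subrr nc0].
    - by split; [exact: baser|].
    - by rewrite star_base.
  apply: (flow_unique (D := [set x | nc (x - base v) < e] `&` [set x | nc (x - base y) < e]) (a := base v)).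
  - by apply: convex_setI; exact: convex_disc.
  - by move=> x [x1 x2]; apply: filterS2 (dopen _ _ _ x1) (dopen _ _ _ x2) => x'.
  - by apply: flow_solS (star_sol v v1) => x [].
  - by apply: flow_solS (star_sol y yr) => x [].
  - by split => //=; rewrite subrr nc0.
  - by split => //=; exact: basee.
  - by rewrite star_base.
exists (fun y => star y y).
  have z0 : nc (0 : C) < r + e / 2 by rewrite nc0.
  by have := star_base 0 z0; rewrite /base mulr0 phi0.
move=> y /= yr; have [p1 p2] := star_sol y yr y (basee y yr); split => //.
by apply: cder_near p2; apply: filterS (starE y yr) => v ->.
Qed.

Lemma flows_le z r r' : flows z r -> r' <= r -> flows z r'.
Proof.
move=> [phi p0 h] rr; exists phi => //; apply: flow_solS h => y /= yr.
exact: lt_le_trans rr.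
Qed.

Lemma flow_exists z (T eta s : R) : 0 < T -> 0 < eta -> s < rho ->
  punc c rho z ->
  (forall r phi y, r <= T -> phi 0 = z -> flow_sol [set y | nc y < r] phi -> nc y < r ->
    eta <= nc (phi y - c) <= s) ->
  flows z T.
Proof.
move=> T0 eta0 srho pz stay.
have [e e0 he] : exists2 e, 0 < e & forall z, nc (z - c) <= s ->
    eta <= nc (z - c) -> flows z e.
  apply: (disc_uniform (P := fun z e => eta <= nc (z - c) -> flows z e)).
    by move=> y e e' h /andP[_ ee'] /h /flows_le; apply.
  move=> y ys; have [h|h] := leP eta (nc (y - c)).
    have [|e e0 he] := @flow_local y.
      by apply/andP; split; [exact: lt_le_trans h|exact: le_lt_trans srho].
    by exists e => //; apply: filterS he.
  exists 1; first exact: ltr01.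
  by apply: filterS (disc_near h) => y' hy' h'; move: hy'; rewrite ltNge h'.
have [e1 e10 /nbhs_singleton he1] := flow_local pz.
have key n : flows z (Num.min T (e1 + n%:R * (e / 2))).
  elim: n => [|n IH].
    by rewrite mul0r addr0; apply: flows_le he1 _; rewrite ge_min lexx orbT.
  set r := Num.min _ _ in IH; have r0 : 0 < r.
    by rewrite lt_min T0 (lt_le_trans e10) // lerDl mulr_ge0 // divr_ge0 // ltW.
  have [phi p0 hphi] := IH.
  apply: (flows_le (flow_extend r0 e0 p0 hphi _)).
    move=> y yr; have rT : r <= T by rewrite ge_min lexx.
    by have /andP[h1 h2] := stay r phi y rT p0 hphi yr; exact: he.
  rewrite -natr1 mulrDl mul1r addrA ge_min.
  have [h|h] := leP T (e1 + n%:R * (e / 2)).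
    by rewrite /r (min_idPl h) lerDl divr_ge0 // ltW.
  by rewrite /r (min_idPr (ltW h)) lexx orbT.
have [n hn] : exists n : nat, T <= e1 + n%:R * (e / 2).
  have e20 : 0 < e / 2 by rewrite divr_gt0.
  exists (Num.truncn (T / (e / 2))).+1.
  have := truncnS_gt (T / (e / 2)); rewrite ltr_pdivrMr // => /ltW h.
  by apply: (le_trans h); rewrite lerDr ltW.
by have := key n; rewrite (min_idPl hn).
Qed.

(* [z'] is reached from [z] along a path of [|W|]-length at most [L]. *)
Definition flow_joined z z' (L : R) : Prop :=
  exists (D : set C) phi a b, [/\ convex_set D, forall y, D y -> \forall y' \near y, D y',
    flow_sol D phi, D a /\ D b & [/\ phi a = z, phi b = z' & nc (b - a) <= L]].

Hypothesis complete : forall u : nat -> C, (forall n, punc c rho (u n)) ->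
  (forall e : R, 0 < e -> exists N : nat, forall m n, (N <= m)%N -> (N <= n)%N ->
    flow_joined (u m) (u n) e) ->
  ~ (forall e : R, 0 < e -> exists N : nat, forall n, (N <= n)%N -> nc (u n - c) < e).

(** Solutions from [z] on concentric discs restrict one another. If their values approached [c],
    parameters accumulating at a point would give a sequence that is Cauchy for the flat metric and
    tends to [c], against completeness. *)
Lemma flow_away z T : 0 < T -> exists2 eta, 0 < eta & forall r phi y, r <= T ->
  phi 0 = z -> flow_sol [set y | nc y < r] phi -> nc y < r -> eta <= nc (phi y - c).
Proof.
move=> T0.
have [|y' yT|eta eta0 h] := @disc_uniform R 0 T (fun y e => forall r phi, r <= T -> phi 0 = z ->
    flow_sol [set y | nc y < r] phi -> nc y < r -> e <= nc (phi y - c)).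
- by move=> y e e' h /andP[_ ee'] r phi r1 r2 r3 r4; exact: le_trans ee' (h r phi r1 r2 r3 r4).
- apply: contrapT => no.
  have bad (n : nat) : exists q : C * C, nc (q.1 - y') < n.+1%:R^-1 /\
      exists (r : R) phi, [/\ r <= T, phi 0 = z, flow_sol [set y | nc y < r] phi,
        nc q.1 < r & phi q.1 = q.2] /\ nc (q.2 - c) < n.+1%:R^-1.
    apply: contrapT => nex; apply: no; exists (n.+1%:R^-1); first by rewrite invr_gt0 ltr0n.
    apply/nbhs_cP; exists (n.+1%:R^-1); first by rewrite invr_gt0 ltr0n.
    move=> y yy r phi r1 r2 r3 r4; rewrite leNgt; apply/negP => hlt; apply: nex.
    exists (y, phi y); split; first by [].
    by exists r, phi; split.
  have [q hq] := choice bad.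
  have small (e : R) : 0 < e -> exists N : nat, forall n, (N <= n)%N -> (n.+1%:R^-1 : R) < e.
    move=> e0; exists (Num.truncn e^-1) => n Nn.
    rewrite invf_plt ?posrE ?ltr0n //; apply: (lt_le_trans (truncnS_gt _)).
    by rewrite ler_nat ltnS.
  apply: (complete (u := fun n => (q n).2)).
  + move=> n; have [_ [r [phi [[_ _ h3 h4 <-] _]]]] := hq n.
    by have [] := h3 _ h4.
  + move=> e e0; have [N hN] := small (e / 2) (divr_gt0 e0 (ltr0n _ 2)).
    have d0open s (y : C) : [set v | nc v < s] y -> \forall y' \near y, [set v | nc v < s] y'.
      by move=> /= ys; have := @disc_near 0 y s; rewrite subr0 => /(_ ys); apply: filterS => x /=; rewrite subr0.
    have conv0 s : convex_set [set v : C | nc v < s].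
      by move=> a b u /= ha hb hu; have := @convex_disc R 0 s a b u; rewrite /= !subr0; apply.
    exists N => m n Nm Nn.
    have [m1 [rm [pm [[_ mz ms mr mq] _]]]] := hq m.
    have [n1 [rn [pn [[_ nz ns nr nq] _]]]] := hq n.
    have dist : nc ((q n).1 - (q m).1) <= e /\ nc ((q m).1 - (q n).1) <= e.
      rewrite (normcB (q m).1); suff h : nc ((q n).1 - (q m).1) <= e by [].
      have -> : (q n).1 - (q m).1 = ((q n).1 - y') - ((q m).1 - y') by ring.
      apply: (le_trans (nc_leB _ _)); rewrite (splitr e) lerD //.
        by rewrite ltW // (lt_trans n1) // hN.
      by rewrite ltW // (lt_trans m1) // hN.
    have pos (x : C) (r : R) : nc x < r -> nc (0 : C) < r.
      by move=> h; rewrite nc0; exact: le_lt_trans (normc_ge0 _) h.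
    have [rr|/ltW rr] := leP rm rn.
      exists [set y | nc y < rn], pn, (q m).1, (q n).1; split => //.
      - by move=> y; exact: d0open.
      - by split => //=; exact: lt_le_trans rr.
      - split => //; last by case: dist.
        rewrite -mq; apply: (flow_unique (D := [set y | nc y < rm]) (a := 0)) => //.
        + by move=> y; exact: d0open.
        + by apply: flow_solS ns => y /= h; exact: lt_le_trans rr.
        + exact: pos mr.
        + by rewrite nz mz.
    exists [set y | nc y < rm], pm, (q m).1, (q n).1; split => //.
    - by move=> y; exact: d0open.
    - by split => //=; exact: lt_le_trans rr.
    - split => //; last by case: dist.
      rewrite -nq; apply: (flow_unique (D := [set y | nc y < rn]) (a := 0)) => //.
      + by move=> y; exact: d0open.
      + by apply: flow_solS ms => y /= h; exact: lt_le_trans rr.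
      + exact: pos nr.
      + by rewrite nz mz.
  + move=> e e0; have [N hN] := small e e0; exists N => n /hN h.
    have [_ [r [phi [_ hlt]]]] := hq n; exact: lt_trans hlt h.
- exists eta => // r phi y r1 r2 r3 r4; apply: (h y _ r phi) => //.
  by rewrite subr0 ltW // (lt_le_trans r4).
Qed.

(** From a point of the half disc the solution lives on the disc of radius [T]: completeness keeps
    it from [c], and a short parameter interval does not suffice to cross the outer annulus. Being
    bounded by [rho], it obeys Cauchy's estimate at 0, where its derivative is [1 / W z]. *)
Lemma flow_bounded : 0 < rho -> exists2 M, 0 <= M &
  forall z, punc c (rho / 2) z -> nc (W z)^-1 <= M.
Proof.
move=> rho0.
have hW z : punc c rho z -> holo W z.
  by move=> pz; have [Q hQ QW] := WQ pz; apply: near_eq_holo (holo_deriv hQ).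
pose s := 3 * rho / 4.
have [h1 h2] : rho / 2 < s /\ s < rho by rewrite /s; split; lra.
have [m m0 hm] : exists2 m, 0 < m & forall z, nc (z - c) <= s -> rho / 2 <= nc (z - c) -> m <= nc (W z).
  apply: (disc_uniform (P := fun z e => rho / 2 <= nc (z - c) -> e <= nc (W z))).
    by move=> y e e' h /andP[_ ee'] /h; exact: le_trans.
  move=> y ys; have [h|h] := leP (rho / 2) (nc (y - c)); last first.
    exists 1; first exact: ltr01.
    by apply: filterS (disc_near h) => y' hy' h'; move: hy'; rewrite ltNge h'.
  have py : punc c rho y.
    by apply/andP; split; [apply: lt_le_trans h; rewrite divr_gt0|exact: le_lt_trans h2].
  exists (nc (W y) / 2); first by rewrite divr_gt0 // nc_gt0 W0.
  have : \forall y' \near y, nc (W y' - W y) < nc (W y) / 2.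
    apply: (ccont_near (holo_ccont (hW y py)) (P := fun v => nc (v - W y) < nc (W y) / 2)).
    by apply: disc_near; rewrite subrr nc0 divr_gt0 // nc_gt0 W0.
  apply: filterS => y' h' _; have := nc_subl (W y) (W y'); rewrite (normcB (W y)).
  by move: h'; lra.
(* On the annulus the speed is at most [T / m = rho / 16], so with the factor 2 of [rder_mvi] a
   solution moves at most [rho / 8], less than the width [rho / 4]. *)
pose T := rho * m / 16.
have T0 : 0 < T by rewrite divr_gt0 ?ltr0n // mulr_gt0.
exists (8 * rho / T); first by apply: divr_ge0; [apply: mulr_ge0 => //; exact: ltW|exact: ltW].
move=> z /andP[z1 z2].
have pz : punc c rho z by apply/andP; split => //; apply: (lt_trans z2); lra.
have [eta eta0 away] := flow_away z T0.
have [phi p0 hphi] : flows z T.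
  apply: (flow_exists T0 eta0 h2 pz) => r phi y rT p0 hphi yr.
  rewrite (away r phi y rT p0 hphi yr) /= leNgt; apply/negP => out.
  have inD (t : R) : 0 <= t <= 1 -> nc (0 + t%:C * (y - 0)) < r.
    move=> /andP[t0 t1]; rewrite add0r subr0 ncM nc_real ger0_norm //.
    by apply: le_lt_trans yr; rewrite ler_piMl ?normc_ge0.
  pose u (t : R) := nc (phi (0 + t%:C * (y - 0)) - c).
  have dphi (t : R) : 0 <= t <= 1 -> rder (fun t => phi (0 + t%:C * (y - 0))) t ((W (phi (0 + t%:C * (y - 0))))^-1 * (y - 0)).
    by move=> /inD t01; apply: seg_rder; have [] := hphi _ t01.
  (* A solution that leaves the disc of radius [s] has crossed the annulus [rho / 2 <= |z - c| <= s]
     along the segment from 0 to [y]. *)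
  have [||//||t0 [t1 [t00 t01 t11 u0 [u1 ub]]]] := @crossing R u (rho / 2) s.
  - move=> t t01 A /nbhs_rP [e e0 eA]; apply/nbhs_rP.
    have /rcontP /(_ e e0) [d d0 hd] := rder_cont (dphi t t01).
    exists d => // x xt; apply: eA; rewrite /u.
    rewrite (le_lt_trans _ (hd x xt)) //.
    rewrite ler_norml; apply/andP; split.
      have := nc_subr (phi (0 + x%:C * (y - 0)) - c) (phi (0 + t%:C * (y - 0)) - c).
      by rewrite opprB addrA subrK; lra.
    have := nc_subl (phi (0 + x%:C * (y - 0)) - c) (phi (0 + t%:C * (y - 0)) - c).
    by rewrite opprB addrA subrK.
  - by rewrite /u mul0r addr0 p0 ltW.
  - by rewrite /u mul1r subr0 add0r ltW.
  have sub01 t : t0 <= t <= t1 -> 0 <= t <= 1.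
    by move=> /andP[a b]; rewrite (le_trans t00 a) (le_trans b t11).
  have M0 : 0 <= m^-1 * r by rewrite mulr_ge0 ?invr_ge0 ?(ltW m0) // (le_trans (normc_ge0 _) (ltW yr)).
  have bnd t : t0 <= t <= t1 ->
      nc ((W (phi (0 + t%:C * (y - 0))))^-1 * (y - 0)) <= m^-1 * r.
    move=> ht; rewrite ncM; have /andP[b1 b2] := ub t ht.
    apply: ler_pM; [exact: normc_ge0|exact: normc_ge0| |by rewrite subr0 ltW].
    rewrite -div1r nc_div nc1 div1r lef_pV2 ?posrE //; last first.
      by rewrite nc_gt0 W0 //; have [] := hphi _ (inD t (sub01 t ht)).
    by apply: hm; [exact: b2|exact: b1].
  have := rder_mvi t01 (fun t ht => dphi t (sub01 t ht)) bnd.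
  have : s - rho / 2 <= nc (phi (0 + t1%:C * (y - 0)) - phi (0 + t0%:C * (y - 0))).
    have := nc_subl (phi (0 + t1%:C * (y - 0)) - c) (phi (0 + t0%:C * (y - 0)) - c).
    rewrite opprB addrA subrK -/(u t1) -/(u t0) => h; apply: le_trans h.
    by rewrite lerD // lerN2.
  have q1 : 2 * (m^-1 * r) * (t1 - t0) <= rho / 8.
    have q2 : m^-1 * r <= rho / 16.
      rewrite mulrC ler_pdivrMr //; apply: (le_trans rT).
      by rewrite /T mulrAC.
    have q3 : t1 - t0 <= 1 by move: t11 t00; lra.
    apply: (@le_trans _ _ (2 * (m^-1 * r))); last by move: q2; lra.
    by rewrite ler_piMr // mulr_ge0.
  by move=> q2 q3; move: (le_trans q2 (le_trans q3 q1)) rho0; rewrite /s; clear -W0 WQ complete; lra.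
have -> : (W z)^-1 = 'D_1 (fun y => phi y - c) 0.
  have h0 : nc (0 : C) < T by rewrite nc0.
  have [_ h] := hphi 0 h0.
  by rewrite (cder_val (cderB h (cder_cst c 0))) subr0 p0.
apply: cauchy_estimate => //.
- move=> w; rewrite subr0 => /hphi [_ h].
  exact: cder_derivable (cderB h (cder_cst c w)).
- by move=> w; rewrite subr0 => /hphi [/andP[_ /ltW]].
Qed.

End Flow.

(** * Change of chart and curves in a chart *)

Section Transition.
Context {R : realType}.
Local Notation C := R[i].
Local Notation nc := (@Normc.normc R).
Local Notation I3 := (isotropic_space R).
Variables (S : riemann_surface R) (D : set S) (f : S -> I3).
Implicit Types (p q : S) (z v : C) (gam : R -> C).

Lemma transition_holo p q q' : chart_dom p q' -> chart_dom q q' ->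
  holo (chart q \o chart_inv p) (chart p q').
Proof.
move=> pq qq; have := chart_inv_near pq (chart_dom_near qq).
apply: filterS2 (chart_invK_near pq) => z [d zK] dq.
by rewrite -zK; exact: chart_holomorphic.
Qed.

Lemma rder_near_point gam t v (A : C -> Prop) : rder gam t v ->
  (\forall z \near gam t, A z) -> \forall s \near t, A (gam s).
Proof. by move=> h hA; have c := rder_cont h; exact: (c A hA). Qed.

Lemma dir_deriv_potential (u : C -> R) v z G l :
  (\forall w \near z, u w = complex.Re (G w)) -> cder G z l ->
  dir_deriv v u z = complex.Re (l * v).
Proof. by move=> uG hG; rewrite (near_dir_deriv v uG) (dir_deriv_Re v hG). Qed.

Section Forms.
Variables (p q : S).
Hypothesis zf : zmc_face D f.
Hypothesis Dq : D q.
Hypothesis pq : chart_dom p q.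
Local Notation T := (chart q \o chart_inv p).

(** Potentials in the chart at [q], composed with the transition map, are potentials in the chart at
    [p]; the chain rule gives the transformation law of the forms. *)
Lemma forms_chart :
  omega f p (chart p q) = omega f q (chart q q) * 'D_1 T (chart p q) /\
  height_form f p (chart p q) = height_form f q (chart q q) * 'D_1 T (chart p q).
Proof.
have cd := chart_dom_center q.
have [G [P [hG hP im nc eqf]]] := zmc_local_data zf Dq cd.
have [e1 e2] := nbhs_singleton (potential_forms hG hP eqf).
have hT := transition_holo pq cd.
have Tz : T (chart p q) = chart q q by rewrite /= chartK.
have hG' : holo G (T (chart p q)) by rewrite Tz.
have hP' : holo P (T (chart p q)) by rewrite Tz.
have eqf' : \forall w \near chart p q, f (chart_inv p w) =
    (complex.Re (G (T w)), complex.Re (P (T w)), complex.Im (P (T w))).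
  rewrite -Tz in eqf.
  apply: filterS2 (chart_transition pq cd) (ccont_near (holo_ccont hT) eqf) => w.
  by move=> <- ->.
have [k1 k2] := nbhs_singleton (potential_forms (holo_comp hT hG') (holo_comp hT hP') eqf').
rewrite /height_form k1 k2 e1 e2 -Tz.
by split; apply: cder_val; apply: cder_comp (holo_cder hT) (holo_cder _).
Qed.

Lemma lift_factor_chart : lift_factor f p (chart p q) =
  lift_factor f q (chart q q) * normsq ('D_1 T (chart p q)).
Proof.
have [e1 e2] := forms_chart.
rewrite /lift_factor -!/(height_form _ _ _) e1 e2 !normsqM.
by ring.
Qed.

Lemma first_fundamental_formE v :
  first_fundamental_form f q v = normsq (omega f q (chart q q)) * normsq v.
Proof.
have cd := chart_dom_center q.
have [G [P [hG hP im nc eqf]]] := zmc_local_data zf Dq cd.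
have [e1 _] := nbhs_singleton (potential_forms hG hP eqf).
rewrite -normsqM e1 /first_fundamental_form /isotropic_dot /differential /crd1 /crd2 /=.
have u1 : \forall w \near chart q q, (f (chart_inv q w)).1.2 = complex.Re (P w).
  by apply: filterS eqf => w ->.
have u2 : \forall w \near chart q q, (f (chart_inv q w)).2 = complex.Re (- 'i%C * P w).
  by apply: filterS eqf => w ->; rewrite /= mulNr ReN cReM /= mul0r mul1r sub0r opprK.
have := dir_deriv_potential v u1 (holo_cder hP); rewrite {1}/dir_deriv => ->.
have := dir_deriv_potential v u2 (cderZ (- 'i%C) (holo_cder hP)); rewrite {1}/dir_deriv => ->.
rewrite /normsq !expr2; congr (_ + _).
suff -> : complex.Re (- 'i%C * 'D_1 P (chart q q) * v) = complex.Im ('D_1 P (chart q q) * v) by [].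
by rewrite -mulrA mulNr ReN cReM /= mul0r mul1r sub0r opprK.
Qed.

End Forms.

Lemma chart_path_derivative p gam v q t : chart_dom p q -> gam t = chart p q ->
  rder gam t v ->
  rder (fun s => chart q (chart_inv p (gam s))) t ('D_1 (chart q \o chart_inv p) (gam t) * v).
Proof.
move=> pq e h; apply: (rder_comp (F := chart q \o chart_inv p) h).
by apply: holo_cder; rewrite e; apply: transition_holo => //; exact: chart_dom_center.
Qed.

(** [C1_path] reads a path in the chart at each of its own points, so a curve given in the chart at
    [p] has to be pushed through the transition maps. *)
Lemma chart_path_C1 p gam gam' (a b : R) :
  (forall t, a <= t <= b -> chart_dom p (chart_inv p (gam t)) /\
    chart p (chart_inv p (gam t)) = gam t) ->
  (forall t, a <= t <= b -> \forall s \near t, rder gam s (gam' s) /\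
    {for s, continuous gam'}) ->
  C1_path (chart_inv p \o gam) a b.
Proof.
move=> dom dgam; split.
  apply: continuous_in_subspaceT => t; rewrite inE /= in_itv /= => tab.
  have [d e] := dom t tab; have [h _] := nbhs_singleton (dgam t tab).
  apply: continuous_comp; first exact: rder_cont h.
  by rewrite -e; exact: chart_inv_continuous.
move=> t tab; have [d e] := dom t tab; set q := chart_inv p (gam t) in d e *.
have cd := chart_dom_center q.
have hT := transition_holo d cd; rewrite e in hT.
pose T := chart q \o chart_inv p.
have dg := dgam t tab; have [h _] := nbhs_singleton dg.
have nearT : \forall s \near t, holo T (gam s).
  exact: (rder_near_point h (holo_near hT)).
exists (T \o gam); split; last first.
  have : \forall s \near t, chart_dom q (chart_inv p (gam s)).
    apply: (rder_near_point (A := fun z => chart_dom q (chart_inv p z)) h).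
    by rewrite -e; apply: chart_inv_near => //; exact: chart_dom_near.
  by apply: filterS.
pose v s := 'D_1 T (gam s) * gam' s.
have dT : \forall s \near t, rder (T \o gam) s (v s) /\ {for s, continuous v}.
  apply: filterS2 nearT dg => s hs [h1 h2].
  split; first exact: (rder_comp (F := T) h1 (holo_cder hs)).
  apply/rcontP => e' e'0.
  have c1 := rder_cont (rder_comp (F := fun z => 'D_1 T z) h1 (holo_cder (holo_deriv hs))).
  have h3 : {for s, continuous v} by exact: cvgM c1 h2.
  exact: ((rcontP _ _).1 h3).
apply: filterS2 (near_join dT) dT => s nearv [/rderP [[d1 _] [d2 _]] cv].
have e1 : \forall y \near s, derive1 (@complex.Re R \o (T \o gam)) y = complex.Re (v y).
  by apply: filterS nearv => y [/rderP [[_ h1] _] _]; rewrite derive1E.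
have e2 : \forall y \near s, derive1 (@complex.Im R \o (T \o gam)) y = complex.Im (v y).
  by apply: filterS nearv => y [/rderP [_ [_ h1]] _]; rewrite derive1E.
have near_cont (u1 u2 : R -> R) : (\forall y \near s, u1 y = u2 y) ->
    {for s, continuous u2} -> {for s, continuous u1}.
  move=> ee; rewrite /prop_for /continuous_at (nbhs_singleton ee); apply: cvg_trans.
  by apply: near_eq_cvg; apply: filterS ee => y ->.
split; [exact: d1|exact: d2| |].
- apply: (near_cont _ _ e1); apply: (continuous_comp cv); exact: Re_continuous.
- apply: (near_cont _ _ e2); apply: (continuous_comp cv); exact: Im_continuous.
Qed.

Lemma velocity_chart p gam v t : chart_dom p (chart_inv p (gam t)) ->
  chart p (chart_inv p (gam t)) = gam t -> rder gam t v ->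
  velocity (chart_inv p \o gam) t =
  'D_1 (chart (chart_inv p (gam t)) \o chart_inv p) (gam t) * v.
Proof.
move=> d e h; have := chart_path_derivative d (esym e) h.
move=> /rderP [[_ h1] [_ h2]].
by rewrite /velocity /= !derive1E [RHS]complex_eta; congr (_ +i* _).
Qed.

Lemma lift_metric_velocity p gam v t : zmc_face D f -> D (chart_inv p (gam t)) ->
  chart_dom p (chart_inv p (gam t)) ->
  chart p (chart_inv p (gam t)) = gam t -> rder gam t v ->
  lift_metric f (chart_inv p (gam t)) (velocity (chart_inv p \o gam) t) =
  lift_factor f p (gam t) * normsq v.
Proof.
move=> zf Dt d e h; rewrite (velocity_chart d e h) /lift_metric.
by rewrite -[in lift_factor f p _]e (lift_factor_chart zf Dt d) e normsqM mulrA.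
Qed.

Lemma first_fundamental_form_velocity p gam v t : zmc_face D f -> D (chart_inv p (gam t)) ->
  chart_dom p (chart_inv p (gam t)) ->
  chart p (chart_inv p (gam t)) = gam t -> rder gam t v ->
  first_fundamental_form f (chart_inv p (gam t)) (velocity (chart_inv p \o gam) t) =
  normsq (omega f p (gam t)) * normsq v.
Proof.
move=> zf Dt d e h; rewrite (velocity_chart d e h) (first_fundamental_formE zf Dt).
have [e1 _] := forms_chart zf Dt d.
by rewrite -[in omega f p _]e e1 e !normsqM mulrA.
Qed.

End Transition.

(** * Completeness bounds the growth of omega *)

Section Completeness.
Context {R : realType}.
Local Notation C := R[i].
Local Notation nc := (@Normc.normc R).
Local Notation mu := (@lebesgue_measure R).
Local Notation I3 := (isotropic_space R).
Variables (S : riemann_surface R) (D : set S) (f : S -> I3) (p : S) (r : R).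
Hypothesis zf : zmc_face D f.
Hypothesis er : end_disc D p r.
Local Notation c := (chart p p).

Lemma end_disc_punc z : punc c r z ->
  [/\ chart_dom p (chart_inv p z), chart p (chart_inv p z) = z & D (chart_inv p z)].
Proof.
move=> /andP[z0 zr]; have [r0 /(_ z zr) [h1 h2 h3]] := er; split => //.
by apply: h3; rewrite -subr_eq0 -nc_gt0.
Qed.

Lemma path_length_le (q : S -> C -> R) (cc : R -> S) (J : set R) (M : R) :
  (forall t : R, J t -> Num.sqrt (q (cc t) (velocity cc t)) <= M) ->
  (path_length q cc J <= \int[mu]_(t in J) M%:E)%E.
Proof.
move=> h; apply: ge0_le_integral_nomeas => t Jt; first by rewrite lee_fin sqrtr_ge0.
by rewrite lee_fin; exact: h.
Qed.

Lemma path_length01_le (q : S -> C -> R) (cc : R -> S) (M : R) :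
  (forall t : R, 0 <= t <= 1 -> Num.sqrt (q (cc t) (velocity cc t)) <= M) ->
  (path_length q cc `[0%R, 1%R] <= M%:E)%E.
Proof.
move=> h; have h' (t : R) : `[0, 1]%classic t -> Num.sqrt (q (cc t) (velocity cc t)) <= M.
  by move=> t01; apply: h; have : t \in `[0, 1]%R := t01; rewrite in_itv.
apply: (le_trans (path_length_le h')).
rewrite integral_cst; last exact: measurable_itv.
by rewrite [X in (_ * X)%E](_ : _ = 1%E) ?mule1 //; exact: lebesgue_measure01.
Qed.

Section Slope.
Variables (b : C) (rho K : R).
Hypothesis rhor : 0 < rho <= r.
Hypothesis K0 : 0 <= K.
Local Notation W := (fun z => height_form f p z - b * omega f p z).
Hypothesis W0 : forall z, punc c rho z -> W z != 0.
Hypothesis lamK : forall z, punc c rho z -> lift_factor f p z <= (K * nc (W z)) ^+ 2.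

Let punc_le z : punc c rho z -> punc c r z.
Proof.
move=> /andP[h1 h2]; apply/andP; split => //; apply: lt_le_trans h2 _.
by case/andP: rhor.
Qed.

Lemma slope_potential z : punc c rho z -> exists2 Q, holo Q z &
  \forall y \near z, 'D_1 Q y = W y.
Proof.
move=> /punc_le pz; have [G [P [hG hP im ncst eqf]]] := end_local_data zf er pz.
exists (fun y => G y - b * P y); first exact: holoB hG (holoM (holo_cst b z) hP).
have := potential_forms hG hP eqf.
apply: filterS3 (holo_near hG) (holo_near hP) => y hGy hPy [e1 e2].
rewrite /height_form e1 e2; apply: cder_val.
by apply: cderB; [exact: holo_cder|apply: cderZ; exact: holo_cder].
Qed.

Lemma slope_holo z : punc c rho z -> holo W z.
Proof.
by move=> /slope_potential [Q hQ QW]; apply: near_eq_holo (holo_deriv hQ).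
Qed.

(** The image of the segment from [a] to [b] under a solution has constant speed [|b - a|] for
    [|W||dz|], which bounds the lift-metric up to the factor [K]. *)
Lemma flow_joined_dist z z' L : flow_joined W c rho z z' L ->
  (riemannian_dist D (lift_metric f) (chart_inv p z) (chart_inv p z') <= (K * L)%:E)%E.
Proof.
move=> [E [phi [u [v [cE oE hphi [Eu Ev] [<- <- uvL]]]]]].
pose gam (t : R) := phi (u + t%:C * (v - u)).
pose gam' (t : R) := (W (gam t))^-1 * (v - u).
have inE' (t : R) : 0 <= t <= 1 -> E (u + t%:C * (v - u)) by exact: cE.
have nearE (t : R) : 0 <= t <= 1 -> \forall s \near t, E (u + s%:C * (v - u)).
  move=> t01; apply: (rder_near_point (gam := fun s => u + s%:C * (v - u)) (rder_line u (v - u) t)).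
  exact: oE (inE' t t01).
have dgam (s : R) : E (u + s%:C * (v - u)) -> rder gam s (gam' s).
  by move=> Es; have [_ h] := hphi _ Es; exact: seg_rder h.
have pgam (t : R) : 0 <= t <= 1 -> punc c rho (gam t).
  by move=> t01; have [] := hphi _ (inE' t t01).
have cgam (s : R) : E (u + s%:C * (v - u)) -> {for s, continuous gam'}.
  move=> Es; have [ps _] := hphi _ Es.
  have hW := holo_cder (slope_holo ps).
  have dW := rder_comp (dgam s Es) (cderV (W0 ps) hW).
  by exact: rder_cont (rderM dW (rder_cst (v - u) s)).
apply: (@le_trans _ _ (path_length (lift_metric f) (chart_inv p \o gam) `[0, 1])).
  apply: ereal_inf_lbound; exists (chart_inv p \o gam); split => //.
  - apply: piecewise_C1_one; first exact: ler01.
    apply: (chart_path_C1 (gam' := gam')).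
      by move=> t /pgam /punc_le /end_disc_punc [].
    move=> t t01; apply: filterS (nearE t t01) => s Es.
    by split; [exact: dgam|exact: cgam].
  - by rewrite /= /gam mul0r addr0.
  - by rewrite /= /gam mul1r addrC subrK.
  - by move=> t /pgam /punc_le /end_disc_punc [].
apply: (@le_trans _ _ (K * nc (v - u))%:E); last first.
  by rewrite lee_fin ler_wpM2l.
apply: path_length01_le => t t01.
have pt := pgam t t01; have [d e Dt] := end_disc_punc (punc_le pt).
rewrite (lift_metric_velocity zf Dt d e (dgam t (inE' t t01))) normsqE.
have := lamK pt; have Wt := W0 pt; rewrite -nc_gt0 in Wt => hK.
have n0 := normc_ge0 (v - u).
have -> : K * nc (v - u) = Num.sqrt ((K * nc (W (gam t))) ^+ 2 * nc (gam' t) ^+ 2).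
  rewrite -exprMn sqrtr_sqr ger0_norm.
    rewrite /gam' ncM -div1r nc_div nc1 div1r -mulrA; congr (_ * _).
    by rewrite mulrA mulfV ?mul1r // gt_eqF.
  by rewrite !mulr_ge0 ?normc_ge0.
by rewrite ler_wsqrtr // ler_wpM2r // sqr_ge0.
Qed.

(** Such a sequence would be Cauchy for the lift-metric and have a limit in [D], but in the surface
    it converges to [p], which is outside of [D]. *)
Lemma slope_complete : weakly_complete D f -> ~ D p ->
  forall u : nat -> C, (forall n, punc c rho (u n)) ->
  (forall e : R, 0 < e -> exists N : nat, forall m n, (N <= m)%N -> (N <= n)%N ->
    flow_joined W c rho (u m) (u n) e) ->
  ~ (forall e : R, 0 < e -> exists N : nat, forall n, (N <= n)%N -> nc (u n - c) < e).
Proof.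
move=> wc nDp u pu cau conv.
have K1 : 0 < K + 1 by rewrite ltr_wpDl.
have [||x Dx hx] := wc (fun n => chart_inv p (u n)).
- by move=> n; have [] := end_disc_punc (punc_le (pu n)).
- move=> e e0; have [N hN] := cau (e / (K + 1)) (divr_gt0 e0 K1).
  exists N => m n Nm Nn; apply: (le_lt_trans (flow_joined_dist (hN m n Nm Nn))).
  by rewrite lte_fin mulrCA gtr_pMr // ltr_pdivrMr // mul1r ltrDl.
have hp : chart_inv p (u n) @[n --> \oo] --> p.
  move=> A pA; have := chart_inv_near (chart_dom_center p) pA.
  move=> /nbhs_cP [e e0 he]; have [N hN] := conv e e0.
  by exists N => // n /= Nn; apply: he; exact: hN.
have xp : x = p by apply: (cvg_unique (@rs_hausdorff R S) hx hp).
by apply: nDp; rewrite -xp.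
Qed.

End Slope.

(** [1 / W] is bounded and extends to [c] with a zero of finite order [j]; hence [W], and with it
    [omega], is at most of size [|z - c|^-j]. *)
Lemma end_omega_growth : weakly_complete D f -> finite_type D f -> ~ D p ->
  exists (j : nat) (M rho : R), [/\ 0 < rho <= r, 0 <= M &
    forall z, punc c rho z -> nc (omega f p z) * nc (z - c) ^+ j <= M].
Proof.
move=> wc ft nDp; have [b [d [rho [d0 rhor hd]]]] := end_good_slope zf ft er.
have /andP[rho0 rhor'] := rhor.
have sub z : punc c rho z -> punc c r z.
  by move=> /andP[h1 h2]; apply/andP; split => //; exact: lt_le_trans rhor'.
pose W z := height_form f p z - b * omega f p z.
have w_le z : punc c rho z -> nc (omega f p z) <= d^-1 * nc (W z).
  by move=> /hd; rewrite ler_pdivlMl.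
have W0 z : punc c rho z -> W z != 0.
  move=> pz; apply/eqP => We; have := w_le z pz; rewrite We nc0 mulr0 => h.
  have w0 : omega f p z = 0.
    by apply/eqP; rewrite -nc_eq0 eq_le h normc_ge0.
  have h0 : height_form f p z = 0 by move: We; rewrite /W w0 mulr0 subr0.
  by have [_ _] := end_forms zf er (sub z pz); rewrite w0 h0 eqxx => -[].
(* [|omega| <= |W| / d] and [|h| <= |W| + |b||omega| <= K1 |W|]; the square of [K] dominates
   [2 / d^2 + K1^2]. *)
pose K1 := 1 + nc b * d^-1; pose K := 2 * d^-1 + K1.
have di0 : 0 <= d^-1 by rewrite invr_ge0 ltW.
have K10 : 0 <= K1 by rewrite addr_ge0 // mulr_ge0 // normc_ge0.
have K0 : 0 <= K by rewrite addr_ge0 // mulr_ge0.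
have lamK z : punc c rho z -> lift_factor f p z <= (K * nc (W z)) ^+ 2.
  move=> pz; rewrite /lift_factor -!/(height_form f p z) !normsqE.
  have n0 := normc_ge0 (W z); have h1 := w_le z pz.
  have h2 : nc (height_form f p z) <= K1 * nc (W z).
    have -> : height_form f p z = W z + b * omega f p z by rewrite /W subrK.
    apply: (le_trans (nc_leD _ _)); rewrite ncM /K1 mulrDl mul1r lerD2l -mulrA.
    by rewrite ler_wpM2l // normc_ge0.
  have h3 : nc (omega f p z) ^+ 2 <= (d^-1 * nc (W z)) ^+ 2.
    by rewrite lerXn2r // nnegrE ?normc_ge0 // mulr_ge0.
  have h4 : nc (height_form f p z) ^+ 2 <= (K1 * nc (W z)) ^+ 2.
    by rewrite lerXn2r // nnegrE ?normc_ge0 // mulr_ge0.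
  have -> : (K * nc (W z)) ^+ 2 = 4 * (d^-1 * nc (W z)) ^+ 2 +
      4 * ((d^-1 * nc (W z)) * (K1 * nc (W z))) + (K1 * nc (W z)) ^+ 2.
    by rewrite /K; ring.
  have h5 : 0 <= (d^-1 * nc (W z)) * (K1 * nc (W z)) by rewrite !mulr_ge0.
  have h6 := sqr_ge0 (d^-1 * nc (W z)).
  by move: h3 h4 h5 h6; clear -zf er; lra.
have WQ z : punc c rho z -> exists2 Q, holo Q z & \forall y \near z, 'D_1 Q y = W y.
  exact: slope_potential.
have hW z : punc c rho z -> holo W z.
  by move=> /WQ [Q hQ QW]; exact: near_eq_holo QW (holo_deriv hQ).
have cpl := slope_complete rhor K0 W0 lamK wc nDp.
have [M M0 hM] := flow_bounded W0 WQ cpl rho0.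
have near2 : \forall z \near c^', punc c (rho / 2) z.
  apply/nbhs_puncP; exists (rho / 2); first by rewrite divr_gt0.
  by move=> z z1 z2; apply/andP; rewrite nc_gt0 subr_eq0.
have half z : punc c (rho / 2) z -> punc c rho z.
  move=> /andP[h1 h2]; apply/andP; split => //; apply: (lt_trans h2).
  by move: rho0; clear -zf er; lra.
have [||v hv vE] := @holo_removable R (fun z => (W z)^-1) c M.
- apply: filterS near2 => z /half pz; apply: holo_derivable.
  by apply: holoV; [exact: W0|exact: hW].
- by apply: filterS near2 => z /hM.
have [d1 d10 h1] := (nbhs_puncP _ _).1 vE.
have vne z : 0 < nc (z - c) < Num.min d1 rho -> v z != 0.
  move=> /andP[z0]; rewrite lt_min => /andP[z1 z2].
  by rewrite -h1 // ?invr_eq0 ?W0 //; [apply/andP|rewrite -subr_eq0 -nc_gt0].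
(* The extension [v] equals [1 / W] off [c], so it cannot vanish identically and has a finite
   order. *)
case: (holo_zero_order hv) => [/nbhs_cP [d2 d20 h2]|[m [u [hu u0 /nbhs_cP [d2 d20 h2]]]]].
  pose s := Num.min (Num.min d1 rho) d2 / 2.
  have s0 : 0 < s by rewrite divr_gt0 // !lt_min d10 rho0.
  have sm : s < Num.min (Num.min d1 rho) d2.
    by rewrite /s ltr_pdivrMr // ltr_pMr ?ltr1n // !lt_min d10 rho0.
  have zs : nc (c + s%:C - c) = s by rewrite addrAC subrr add0r nc_real gtr0_norm.
  move: sm; rewrite lt_min => /andP[s1 s2].
  have := vne (c + s%:C); rewrite zs s0 s1 => /(_ isT).
  by rewrite h2 ?eqxx // zs.
have uc0 : 0 < nc (u c) / 2 by rewrite divr_gt0 // nc_gt0.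
have [d3 d30 h3] : exists2 d3, 0 < d3 & forall z, nc (z - c) < d3 -> nc (u c) / 2 <= nc (u z).
  have [d3 d30 h3] := (ccont_epsP _ _).1 (holo_ccont hu) _ uc0.
  exists d3 => // z /h3 h; have := nc_subl (u c) (u z); rewrite (normcB (u c)).
  by move: h; clear -zf er; lra.
pose rho1 := Num.min (Num.min d1 rho) (Num.min d2 d3).
exists m, (d^-1 * (2 / nc (u c))), rho1; split.
- by rewrite /rho1 !lt_min d10 rho0 d20 d30 /= !ge_min rhor' orbT.
- by rewrite mulr_ge0 // divr_ge0 // normc_ge0.
- move=> z /andP[z0]; rewrite !lt_min => /andP[/andP[z1 z2] /andP[z3 z4]].
  have pz : punc c rho z by apply/andP.
  have vz : v z != 0 by apply: vne; rewrite z0 lt_min z1 z2.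
  have zc : z != c by rewrite -subr_eq0 -nc_gt0.
  have uz : 0 < nc (u z) by exact: lt_le_trans uc0 (h3 z z4).
  have e1 : nc (W z) * nc (z - c) ^+ m = (nc (u z))^-1.
    have /(congr1 nc) := h1 z z1 zc; rewrite h2 // -[(W z)^-1]div1r nc_div nc1 div1r ncM ncX => e.
    have zm : nc (z - c) ^+ m != 0 by rewrite expf_neq0 // gt_eqF.
    rewrite -[nc (W z)]invrK e invfM mulrAC mulVf //.
    by rewrite mul1r.
  apply: (@le_trans _ _ (d^-1 * nc (W z) * nc (z - c) ^+ m)).
    by rewrite ler_wpM2r ?exprn_ge0 ?normc_ge0 // w_le.
  rewrite -mulrA e1 ler_wpM2l // -[2 / _]invrK invf_div lef_pV2 ?posrE //.
  exact: h3.
Qed.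

End Completeness.

(** * The order of omega at an end *)

Section Orders.
Context {R : realType}.
Local Notation C := R[i].
Local Notation nc := (@Normc.normc R).
Implicit Types (F G U : C -> C) (c z : C) (a m : int).

Lemma punctured_eq F G c : ccont F c -> ccont G c ->
  (\forall z \near c^', F z = G z) -> F c = G c.
Proof.
move=> cF cG /nbhs_puncP [d d0 hd].
apply: contrapT => /eqP ne; have e0 : 0 < nc (F c - G c) by rewrite nc_gt0 subr_eq0.
have [d1 d10 h1] := (ccont_epsP _ _).1 (ccontB cF cG) _ e0.
pose s := Num.min d d1 / 2.
have s0 : 0 < s by rewrite divr_gt0 // lt_min d0.
have sm : s < Num.min d d1 by rewrite /s ltr_pdivrMr // ltr_pMr ?ltr1n // lt_min d0.
have zs : nc (c + s%:C - c) = s by rewrite addrAC subrr add0r nc_real gtr0_norm.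
move: sm; rewrite lt_min => /andP[sd sd1].
have := h1 (c + s%:C); rewrite zs hd ?zs //; last first.
  by rewrite -subr_eq0 -nc_gt0 zs.
by rewrite subrr sub0r ncN ltxx => /(_ sd1).
Qed.

Lemma punctured_nonempty c (d : R) : 0 < d -> exists2 z, nc (z - c) < d & z != c.
Proof.
move=> d0; exists (c + (d / 2)%:C).
  rewrite addrAC subrr add0r nc_real gtr0_norm ?divr_gt0 //.
  by rewrite ltr_pdivrMr // ltr_pMr ?ltr1n.
by rewrite -subr_eq0 -nc_gt0 addrAC subrr add0r nc_real gtr0_norm divr_gt0.
Qed.

Lemma cder_exprz z c a : z != c ->
  cder (fun y => (y - c) ^ a) z (a%:~R * (z - c) ^ (a - 1)).
Proof.
rewrite -subr_eq0 => zc.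
have dX (n : nat) : cder (fun y => (y - c) ^+ n.+1) z (n.+1%:R * (z - c) ^+ n).
  apply: cder_eq (cderX n.+1 (cderB (cder_id z) (cder_cst c z))) _.
  by rewrite subr0 mulr1.
case: a => [[|n]|n].
- by apply: cder_eq (cder_cst 1 z) _; rewrite mul0r.
- by apply: cder_eq (dX n) _; rewrite intS addrAC subrr add0r.
- have zn : (z - c) ^+ n.+1 != 0 by rewrite expf_neq0.
  have h := @cderV R (fun y => (y - c) ^+ n.+1) z _ zn (dX n).
  apply: (cder_near _ (cder_eq h _)).
    by apply/nbhs_cP; exists 1; [exact: ltr01|].
  rewrite NegzE -opprD -PoszD addn1 -exprnN mulrNz.
  rewrite -exprM muln2 -addnn !mulNr; congr (- _); rewrite -mulrA; congr (_ * _).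
  apply: (mulIf (expf_neq0 (n.+1 + n.+1) zc)).
  rewrite divfK ?expf_neq0 //; have -> : (n.+1 + n.+1 = n.+2 + n)%N by rewrite !addSn !addnS.
  by rewrite exprD mulKf ?expf_neq0.
Qed.

Lemma has_order_uniq F c a m : has_order F c a -> has_order F c m -> a = m.
Proof.
have key b b' : has_order F c b -> has_order F c b' -> ~ b < b'.
  move=> [u [hu u0 uE]] [v [hv v0 vE]] bb.
  have [n nE] : exists n : nat, b' = b + n.+1%:Z.
    exists (`|b' - b| .-1)%N; rewrite prednK ?absz_gt0 ?subr_eq0 ?gt_eqF //.
    by rewrite gez0_abs ?subr_ge0 ?ltW //; ring.
  have := @punctured_eq u (fun z => (z - c) ^+ n.+1 * v z) c.
  rewrite subrr expr0n mul0r => /(_ (holo_ccont hu)) h.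
  case/eqP: u0; apply: h.
    apply: ccontM (holo_ccont hv).
    by apply: (cder_ccont (cderX n.+1 (cderB (cder_id c) (cder_cst c c)))).
  have [d d0 hd] := (nbhs_puncP _ _).1 uE; have [d' d'0 hd'] := (nbhs_puncP _ _).1 vE.
  apply/nbhs_puncP; exists (Num.min d d'); first by rewrite lt_min d0.
  move=> z; rewrite lt_min => /andP[z1 z2] zc.
  have zc0 : z - c != 0 by rewrite subr_eq0.
  have := hd z z1 zc; rewrite hd' // nE expfzDr // -mulrA.
  by move=> /(mulfI (expfz_neq0 b zc0)) <-.
move=> h1 h2; case: (ltrgtP a m) => //.
- by move=> h; case: (key _ _ h1 h2 h).
- by move=> h; case: (key _ _ h2 h1 h).
Qed.

(** For [a > 0] the constant [k] is the limit at [c]; for [a < 0] it could be absorbed into [U], and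
    [pole_normal_form] takes 0. Excluding [a = 0] makes the order of the derivative [a - 1]. *)
Definition normal_form F c (k : C) a U : Prop :=
  [/\ a != 0, holo U c, U c != 0 & \forall z \near c^', F z = k + (z - c) ^ a * U z].

Lemma holo_normal_form F G c : holo G c -> (\forall z \near c^', F z = G z) ->
  ~ (exists k, \forall z \near c^', F z = k) ->
  exists k a U, normal_form F c k a U /\ 0 < a.
Proof.
move=> hG FG ncst.
case: (holo_zero_order (holoB hG (holo_cst (G c) c))) => [z0|[m [U [hU U0 UE]]]].
  case: ncst; exists (G c); apply: filterS2 FG (nbhs_dnbhs z0) => z -> /eqP.
  by rewrite subr_eq0 => /eqP.
case: m UE => [|m] UE.
  by have := nbhs_singleton UE; rewrite subrr expr0 mul1r => e; rewrite -e eqxx in U0.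
exists (G c), m.+1, U; split => //; split => //.
by apply: filterS2 FG (nbhs_dnbhs UE) => z -> <-; rewrite addrC subrK.
Qed.

Lemma pole_normal_form F G c (j : nat) : holo G c ->
  (\forall z \near c^', (z - c) ^+ j * F z = G z) ->
  ~ (exists k, \forall z \near c^', F z = k) ->
  exists k a U, normal_form F c k a U.
Proof.
move=> hG FG ncst; have [d d0 hd] := (nbhs_puncP _ _).1 FG.
case: (holo_zero_order hG) => [z0|[m [U [hU U0 UE]]]].
  case: ncst; exists 0; have [d1 d10 hd1] := (nbhs_cP _ _).1 z0.
  apply/nbhs_puncP; exists (Num.min d d1); first by rewrite lt_min d0.
  move=> z; rewrite lt_min => /andP[z1 z2] zc; have := hd z z1 zc; rewrite hd1 //.
  by move=> /eqP; rewrite mulf_eq0 expf_eq0 subr_eq0 (negPf zc) andbF /= => /eqP.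
have [d1 d10 hd1] := (nbhs_cP _ _).1 UE.
have FE z : nc (z - c) < Num.min d d1 -> z != c -> (z - c) ^+ j * F z = (z - c) ^+ m * U z.
  by rewrite lt_min => /andP[z1 z2] zc; rewrite hd // hd1.
have dm : 0 < Num.min d d1 by rewrite lt_min d0.
have [jm|mj] := leqP j m.
  have hG' : holo (fun z => (z - c) ^+ (m - j) * U z) c.
    have h1 : holo (fun z => (z - c) ^+ (m - j)) c.
      by apply: holoX; exact: holoB (holo_id c) (holo_cst c c).
    exact: (holoM h1 hU).
  have FG' : \forall z \near c^', F z = (z - c) ^+ (m - j) * U z.
    apply/nbhs_puncP; exists (Num.min d d1) => // z z1 zc.
    have zj : (z - c) ^+ j != 0 by rewrite expf_neq0 // subr_eq0.
    by apply: (mulfI zj); rewrite FE // mulrA -exprD subnKC.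
  by have [k [a [V [h _]]]] := holo_normal_form hG' FG' ncst; exists k, a, V.
exists 0, (- (j - m)%:Z), U; split => //.
  by rewrite oppr_eq0 -lt0n subn_gt0.
apply/nbhs_puncP; exists (Num.min d d1) => // z z1 zc.
have zj : (z - c) ^+ j != 0 by rewrite expf_neq0 // subr_eq0.
have zjm : (z - c) ^+ (j - m) != 0 by rewrite expf_neq0 // subr_eq0.
apply: (mulfI zj); rewrite FE // add0r -exprnN mulrA; congr (_ * _).
by rewrite -[in LHS](mulfK zjm ((z - c) ^+ m)) -exprD subnKC // ltnW.
Qed.

(** The new cofactor is [a U + (z - c) U'], whose value [a U(c)] at [c] is nonzero because [a]
    is. *)
Lemma normal_form_deriv F c k a U : normal_form F c k a U ->
  exists2 V, holo V c /\ V c != 0 &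
    \forall z \near c^', cder F z ((z - c) ^ (a - 1) * V z).
Proof.
move=> [a0 hU U0 FE].
exists (fun z => a%:~R * U z + (z - c) * 'D_1 U z).
  split.
    apply: holoD; first exact: holoM (holo_cst _ c) hU.
    by apply: holoM (holo_deriv hU); exact: holoB (holo_id c) (holo_cst c c).
  by rewrite subrr mul0r addr0 mulf_neq0 // intr_eq0.
have [d d0 hd] := (nbhs_puncP _ _).1 FE; have [d1 d10 hd1] := (nbhs_cP _ _).1 (holo_near hU).
apply/nbhs_puncP; exists (Num.min d d1); first by rewrite lt_min d0.
move=> z; rewrite lt_min => /andP[z1 z2] zc; have zc0 : z - c != 0 by rewrite subr_eq0.
have h := cderD (cder_cst k z) (cderM (cder_exprz a zc) (holo_cder (hd1 z z2))).
apply: (cder_near _ (cder_eq h _)); last first.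
  rewrite add0r mulrDr -!mulrA; congr (_ + _); first by rewrite mulrCA.
  rewrite [RHS]mulrA; congr (_ * _).
  by rewrite -[X in _ * X]expr1z -expfzDr // subrK.
have n1 := disc_near z1; have n2 : \forall y \near z, y - c != 0.
  by apply: near_neq0 => //; apply: (cder_ccont (cderB (cder_id z) (cder_cst c z))).
by apply: filterS2 n1 n2 => y y1 y2; rewrite hd // -subr_eq0.
Qed.

End Orders.

(** * Normal form of the planar part *)

Section EndOrder.
Context {R : realType}.
Local Notation C := R[i].
Local Notation nc := (@Normc.normc R).
Local Notation I3 := (isotropic_space R).
Variables (S : riemann_surface R) (D : set S) (f : S -> I3).

Definition planar (q : S) : C := crd1 (f q) +i* crd2 (f q).

Lemma local_data_planar x z G P : local_data f x z G P ->
  \forall w \near z, planar (chart_inv x w) = P w.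
Proof.
by move=> [_ _ _ _]; apply: filterS => w; rewrite /planar /crd1 /crd2 => ->; case: (P w).
Qed.

Lemma local_data_cder_planar x z G P : local_data f x z G P ->
  cder (planar \o chart_inv x) z (omega f x z).
Proof.
move=> ld; have [hG hP _ _ eqf] := ld.
have [e1 _] := nbhs_singleton (potential_forms hG hP eqf).
rewrite e1; apply: cder_near (holo_cder hP).
by apply: filterS (local_data_planar ld) => w.
Qed.

Variables (p : S) (r : R).
Hypothesis zf : zmc_face D f.
Hypothesis er : end_disc D p r.
Local Notation c := (chart p p).
Local Notation P := (planar \o chart_inv p).

Lemma cder_planar z : punc c r z -> cder P z (omega f p z).
Proof.
move=> pz; have [G [Q ld]] := end_local_data zf er pz; exact: local_data_cder_planar ld.
Qed.

Lemma planar_nonconstant : ~ (exists k, \forall z \near c^', P z = k).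
Proof.
move=> [k /nbhs_puncP [d d0 hd]]; have [r0 _] := er.
have m0 : 0 < Num.min d r by rewrite lt_min d0.
have [z] := punctured_nonempty c m0; rewrite lt_min => /andP[z1 z2] zc.
have pz : punc c r z by apply/andP; rewrite nc_gt0 subr_eq0.
have [G [Q ld]] := end_local_data zf er pz; have [hG hQ im ncst eqf] := ld; apply: ncst.
have QE : \forall w \near z, Q w = k.
  have zc0 : z - c != 0 by rewrite subr_eq0.
  have n1 := disc_near z1; have n2 : \forall y \near z, y - c != 0.
    by apply: near_neq0 => //; apply: (cder_ccont (cderB (cder_id z) (cder_cst c z))).
  apply: filterS3 n1 n2 (local_data_planar ld) => w w1 w2 <-.
  by apply: hd => //; rewrite -subr_eq0.
apply: filterS (near_join QE) => w Qk; apply: cder_val.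
by apply: cder_near (cder_cst k w); apply: filterS Qk => y ->.
Qed.

Hypothesis wc : weakly_complete D f.
Hypothesis ft : finite_type D f.
Hypothesis nDp : ~ D p.

(** The bound on [omega] is integrated along the radius from [z] out to a fixed circle, on which [P]
    is bounded; along it [|z - c|] only increases. *)
Lemma planar_growth : exists (j : nat) (M rho : R), 0 < rho <= r /\
  forall z, punc c rho z -> nc (P z) * nc (z - c) ^+ j <= M.
Proof.
have [j [M [rho0 [/andP[rho00 rhor] M0 hM]]]] := end_omega_growth zf er wc ft nDp.
pose rho := rho0 / 2.
have rho1 : 0 < rho by rewrite divr_gt0.
have rho2 : rho < rho0 by rewrite /rho ltr_pdivrMr // ltr_pMr ?ltr1n.
have pr z : punc c rho0 z -> punc c r z.
  by move=> /andP[h1 h2]; apply/andP; split => //; exact: lt_le_trans rhor.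
(* The upper bound is written as [e^-1] because [disc_uniform] produces small constants. *)
have [e e0 he] : exists2 e, 0 < e & forall z, nc (z - c) <= rho -> rho <= nc (z - c) ->
    nc (P z) <= e^-1.
  apply: (disc_uniform (P := fun z e => rho <= nc (z - c) -> nc (P z) <= e^-1)).
    move=> y e e' h /andP[e'0 ee'] /h /le_trans; apply.
    by rewrite lef_pV2 ?posrE // (lt_le_trans e'0).
  move=> y ys; have [h|h] := leP rho (nc (y - c)); last first.
    exists 1; first exact: ltr01.
    by apply: filterS (disc_near h) => y' hy' h'; move: hy'; rewrite ltNge h'.
  have py : punc c r y.
    by apply: pr; apply/andP; split; [exact: lt_le_trans h|exact: le_lt_trans rho2].
  have k0 : 0 < nc (P y) + 1 by rewrite ltr_wpDl ?normc_ge0.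
  exists (nc (P y) + 1)^-1; first by rewrite invr_gt0.
  have : \forall y' \near y, nc (P y' - P y) < 1.
    apply: (ccont_near (cder_ccont (cder_planar py)) (P := fun v => nc (v - P y) < 1)).
    by apply: disc_near; rewrite subrr nc0.
  apply: filterS => y' h' _; rewrite invrK.
  have := nc_leD (P y' - P y) (P y); rewrite subrK => h2.
  by rewrite (le_trans h2) // addrC lerD2l ltW.
exists j, (e^-1 * rho ^+ j + 2 * M * rho), rho; split.
  by rewrite rho1 (le_trans (ltW rho2)).
move=> z /andP[z0 z1].
pose s := rho / nc (z - c).
have s1 : 1 <= s by rewrite ler_pdivlMr // mul1r ltW.
(* The radial projection of [z] to the circle of radius [rho]. *)
pose z' := c + s%:C * (z - c).
have z'E : nc (z' - c) = rho.
  by rewrite /z' addrAC subrr add0r ncM nc_real ger0_norm ?(le_trans ler01) // divfK ?gt_eqF.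
pose gam (t : R) := z + t%:C * (z' - z).
have gamE t : gam t - c = (1 + t * (s - 1))%:C * (z - c).
  by rewrite /gam /z' !(rmorphD, rmorphM, rmorphN, rmorph1) /=; ring.
have gam_ge t : 0 <= t <= 1 -> nc (z - c) <= nc (gam t - c) <= rho.
  move=> /andP[t0 t1]; have h1 : 1 <= 1 + t * (s - 1) by rewrite lerDl mulr_ge0 // subr_ge0.
  have h2 : 1 + t * (s - 1) <= s.
    by rewrite -lerBrDl ler_piMl // subr_ge0.
  rewrite gamE ncM nc_real ger0_norm ?(le_trans ler01) //.
  rewrite ler_peMl ?normc_ge0 //=.
  by rewrite -ler_pdivlMr.
have gamp t : 0 <= t <= 1 -> punc c rho0 (gam t).
  move=> /gam_ge /andP[h1 h2]; apply/andP; split; first exact: lt_le_trans h1.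
  exact: le_lt_trans rho2.
have zj : 0 < nc (z - c) ^+ j by rewrite exprn_gt0.
have dP (t : R) : 0 <= t <= 1 -> rder (fun t => P (gam t)) t (omega f p (gam t) * (z' - z)).
  by move=> /gamp /pr h; exact: seg_rder (cder_planar h).
have bnd (t : R) : 0 <= t <= 1 -> nc (omega f p (gam t) * (z' - z)) <= M / nc (z - c) ^+ j * rho.
  move=> t01; rewrite ncM; apply: ler_pM; [exact: normc_ge0|exact: normc_ge0| |].
    rewrite ler_pdivlMr //; apply: le_trans (hM _ (gamp t t01)).
    rewrite ler_wpM2l ?normc_ge0 // lerXn2r ?nnegrE ?normc_ge0 //.
    by have /andP[] := gam_ge t t01.
  have -> : z' - z = (s - 1)%:C * (z - c) by rewrite /z' !(rmorphD, rmorphN, rmorph1) /=; ring.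
  rewrite ncM nc_real ger0_norm ?subr_ge0 // mulrBl mul1r /s divfK ?gt_eqF //.
  by rewrite gerBl normc_ge0.
have := rder_mvi ler01 dP bnd.
have -> : gam 1 = z' by rewrite /gam mul1r addrC subrK.
have -> : gam 0 = z by rewrite /gam mul0r addr0.
rewrite subr0 mulr1 => h.
have h' : nc (P z') <= e^-1 by apply: he; rewrite z'E.
have h2 : nc (P z) <= e^-1 + 2 * (M / nc (z - c) ^+ j * rho).
  have := nc_leD (P z') (P z - P z'); rewrite addrC subrK => /le_trans; apply.
  by rewrite lerD // normcB.
apply: (@le_trans _ _ ((e^-1 + 2 * (M / nc (z - c) ^+ j * rho)) * nc (z - c) ^+ j)).
  by rewrite ler_wpM2r // ltW.
rewrite mulrDl; apply: lerD.
  rewrite ler_wpM2l ?invr_ge0 ?(ltW e0) //.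
  by rewrite lerXn2r ?nnegrE ?normc_ge0 ?(ltW rho1) // ltW.
have -> : 2 * (M / nc (z - c) ^+ j * rho) * nc (z - c) ^+ j =
    2 * M * rho * (nc (z - c) ^+ j / nc (z - c) ^+ j) by ring.
by rewrite divff ?gt_eqF // mulr1.
Qed.

Lemma end_normal_form : exists k a U, normal_form P c k a U.
Proof.
have [j [M [rho [/andP[rho0 rhor] hM]]]] := planar_growth.
have near_rho : \forall z \near c^', punc c rho z.
  by apply/nbhs_puncP; exists rho => // z z1 z2; apply/andP; rewrite nc_gt0 subr_eq0.
have pr z : punc c rho z -> punc c r z.
  by move=> /andP[h1 h2]; apply/andP; split => //; exact: lt_le_trans rhor.
have d1 : \forall z \near c^', derivable (fun z => (z - c) ^+ j * P z) z 1.
  apply: filterS near_rho => z /pr pz.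
  exact: cder_derivable (cderM (cderX j (cderB (cder_id z) (cder_cst c z))) (cder_planar pz)).
have d2 : \forall z \near c^', nc ((z - c) ^+ j * P z) <= M.
  by apply: filterS near_rho => z /hM; rewrite ncM ncX mulrC.
have [G hG GE] := holo_removable d1 d2.
exact: pole_normal_form hG GE planar_nonconstant.
Qed.

End EndOrder.

Section OrdOmega.
Context {R : realType}.
Local Notation C := R[i].
Variables (S : riemann_surface R) (D : set S) (f : S -> isotropic_space R) (p : S) (r : R).
Hypothesis zf : zmc_face D f.
Hypothesis er : end_disc D p r.

Lemma ord_omega_normal_form (k : C) (a : int) U :
  normal_form (planar f \o chart_inv p) (chart p p) k a U -> ord_omega f p = a - 1.
Proof.
move=> nf; have [V [hV V0] dV] := normal_form_deriv nf.
have ho : has_order (omega f p) (chart p p) (a - 1).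
  exists V; split => //; have [r0 _] := er.
  have near_r : \forall z \near (chart p p)^', punc (chart p p) r z.
    by apply/nbhs_puncP; exists r => // z z1 z2; apply/andP; rewrite nc_gt0 subr_eq0.
  apply: filterS2 near_r dV => z pz h.
  exact: cder_uniq (cder_planar zf er pz) h.
rewrite /ord_omega; apply: xget_unique => // m hm.
by apply: has_order_uniq hm ho.
Qed.

End OrdOmega.

(** * Expanding ends *)

Section Minorant.
Context {R : realType}.
Local Notation mu := (@lebesgue_measure R).

(** The supremum of the points reachable from [a] is itself reachable, and can be passed unless it
    is [b], by the local hypothesis at it. *)
Lemma interval_induction (Q : R -> R -> Prop) (a b : R) : a <= b ->
  (forall x m y, x <= m -> m <= y -> Q x m -> Q m y -> Q x y) ->
  (forall t, a <= t <= b -> exists2 d, 0 < d & forall x y, a <= x -> x <= y -> y <= b ->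
    `|x - t| < d -> `|y - t| < d -> Q x y) ->
  Q a b.
Proof.
move=> ab cat loc.
have Qaa : Q a a.
  have [|d d0 hd] := loc a; first by rewrite lexx ab.
  by apply: hd; rewrite ?lexx // subrr normr0.
pose A := [set x | a <= x <= b /\ Q a x].
have Aa : A a by split => //; rewrite lexx ab.
have hs : has_sup A by split; [exists a|exists b => x [/andP[]]].
have ub x : A x -> x <= sup A by move=> Ax; apply: ub_le_sup => //; case: hs.
have sb : sup A <= b by apply: ge_sup; [exists a|move=> x [/andP[]]].
have [|d d0 hd] := loc (sup A); first by rewrite ub.
have [x [/andP[ax xb] Qx] xs] := sup_adherent d0 hs.
have xsup : x <= sup A by apply: ub; split => //; rewrite ax.
pose y := Num.min b (sup A + d / 2).
have sy : sup A <= y by rewrite le_min sb lerDl divr_ge0 // ltW.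
have yb : y <= b by rewrite ge_min lexx.
have ys : y <= sup A + d / 2 by rewrite ge_min lexx orbT.
have xy : x <= y by exact: le_trans sy.
have Qy : Q a y.
  apply: (cat a x y) => //; apply: hd => //.
    by rewrite ler0_norm ?subr_le0 //; move: xs; clear; lra.
  by rewrite ger0_norm ?subr_ge0 //; move: ys d0; clear; lra.
have ay : A y by split => //; rewrite yb (le_trans ax).
have := ub y ay; rewrite {1}/y ge_min => /orP[bs|]; last by rewrite leNgt ltrDl divr_gt0.
suff <- : y = b by [].
by rewrite /y (min_idPl _) //; apply: (le_trans bs); rewrite lerDl divr_ge0 // ltW.
Qed.

(* [g] need not be measurable: the bound [|N b - N a| <= int g] is witnessed by
   a measurable minorant of [g]. *)
Definition minorant (g N : R -> R) (a b : R) : Prop :=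
  exists h : R -> R, [/\ measurable_fun (setT : set (measurableTypeR R)) (h : measurableTypeR R -> R),
    forall t, 0 <= h t, forall t, a < t < b -> h t <= g t,
    forall t, ~~ (a < t < b) -> h t = 0 &
    (`|N b - N a|%:E <= \int[mu]_t (h t)%:E)%E].

Lemma minorant_cat g N a m b : (forall t, 0 <= g t) -> a <= m -> m <= b ->
  minorant g N a m -> minorant g N m b -> minorant g N a b.
Proof.
move=> g0 am mb [h1 [m1 p1 l1 z1 i1]] [h2 [m2 p2 l2 z2 i2]].
exists (fun t => h1 t + h2 t); split.
- exact: measurable_funD.
- by move=> t; rewrite addr_ge0.
- move=> t /andP[at' tb]; have [tm|mt] := ltP t m.
    by rewrite z2 ?addr0 ?l1 ?at' // negb_and -leNgt (ltW tm).
  rewrite z1 ?add0r; last by rewrite negb_and -!leNgt mt orbT.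
  have [mt'|tm] := ltP m t; first by rewrite l2 // mt'.
  by rewrite z2 // negb_and -!leNgt tm.
- move=> t tab; rewrite z1 ?z2 ?addr0 //; move: tab; rewrite !negb_and -!leNgt.
    by case/orP => h; rewrite ?(le_trans h am) ?h ?orbT.
  by case/orP => h; rewrite ?h ?(le_trans mb h) ?orbT.
- under eq_integral do rewrite EFinD.
  rewrite ge0_integralD //; last 4 first.
  + by move=> t _; rewrite lee_fin.
  + exact/measurable_EFinP.
  + by move=> t _; rewrite lee_fin.
  + exact/measurable_EFinP.
  apply: le_trans (leeD i1 i2); rewrite -EFinD lee_fin.
  have -> : N b - N a = (N m - N a) + (N b - N m) by ring.
  exact: ler_normD.
Qed.

Lemma minorant_integral g N a b (J : set R) : minorant g N a b ->
  (forall t, 0 <= g t) -> (forall t, a < t < b -> J t) ->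
  (`|N b - N a|%:E <= \int[mu]_(t in J) (g t)%:E)%E.
Proof.
move=> [h [mh p l z i]] g0 abJ; apply: (le_trans i).
rewrite [leRHS]integral_mkcond; apply: ge0_le_integral_nomeas => t _.
  by rewrite lee_fin.
rewrite /patch; case: ifPn => tJ.
  by rewrite lee_fin; have [/l //|/z ->] := boolP (a < t < b).
rewrite lee_fin z //; apply/negP => /abJ; rewrite -inE; exact/negP.
Qed.

(** Where [N] agrees with a C^1 function [u], the minorant is [|u'|], and the bound is the
    fundamental theorem. *)
Lemma minorant_C1 (g N u n : R -> R) (a b t : R) : a <= t <= b ->
  (\forall s \near t, is_derive (s : R) 1 u (n s) /\ {for s, continuous n}) ->
  (\forall s \near t, a <= s <= b -> N s = u s) ->
  (\forall s \near t, a < s < b -> `|n s| <= g s) ->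
  exists2 d, 0 < d & forall x y, a <= x -> x <= y -> y <= b ->
    `|x - t| < d -> `|y - t| < d -> minorant g N x y.
Proof.
move=> tab hu hN hg.
have /nbhs_rP [d d0 hd] : \forall s \near t, [/\ is_derive (s : R) 1 u (n s) /\ {for s, continuous n},
    a <= s <= b -> N s = u s & a < s < b -> `|n s| <= g s].
  by apply: filterS3 hu hN hg => s.
exists d => // x y ax xy yb xt yt.
have [->|xney] := eqVneq x y.
  exists (fun=> 0); split => //.
  - by move=> s /andP[h1 h2]; have := lt_trans h1 h2; rewrite ltxx.
  - by rewrite subrr normr0 integral0.
have xly : x < y by rewrite lt_neqAle xney.
have ins s : x <= s <= y -> `|s - t| < d.
  move=> /andP[s1 s2]; move: xt yt => /ltr_normlP [h1 h2] /ltr_normlP [h3 h4].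
  by apply/ltr_normlP; split; move: s1 s2 h1 h2 h3 h4; clear; lra.
have cn : {within `[x, y], continuous n}.
  apply: continuous_in_subspaceT => s; rewrite inE /= in_itv /= => /ins /hd [[_ cs] _ _].
  exact: cs.
have mn : measurable_fun (`[x, y]%classic : set (measurableTypeR R)) (n : measurableTypeR R -> R).
  by apply: subspace_continuous_measurable_fun; [exact: measurable_itv|exact: cn].
have mo : measurable (`]x, y[%classic : set (measurableTypeR R)) by exact: measurable_itv.
have mc : measurable (`[x, y]%classic : set (measurableTypeR R)) by exact: measurable_itv.
have mno : measurable_fun (`]x, y[%classic : set (measurableTypeR R)) (n : measurableTypeR R -> R).
  by apply: measurable_funS mn => //; exact: subset_itv_oo_cc.
(* The open interval is used since the speed is controlled only at interior times: at an endpoint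
   the path agrees with its C^1 model on one side only. *)
exists ((fun s => `|n s|) \_ `]x, y[); split.
- apply/(measurable_restrictT _ mo); exact: measurableT_comp.
- by move=> s; rewrite /patch; case: ifP.
- move=> s /andP[s1 s2]; have sin : s \in `]x, y[%classic by rewrite inE /= in_itv /= s1 s2.
  rewrite /patch sin.
  have [|_ _ h] := hd s; first by apply: ins; rewrite !ltW.
  by apply: h; rewrite (le_lt_trans ax) ?(lt_le_trans s2).
- by move=> s hs; rewrite /patch ifF //; apply/negP; rewrite inE /= in_itv /=; exact/negP.
- have FTC : (\int[mu]_(s in `[x, y]) (n s)%:E = (u y)%:E - (u x)%:E)%E.
    have du s : x <= s <= y -> is_derive s 1 u (n s) by move=> /ins /hd [[]].
    have cu s : x <= s <= y -> {for s, continuous u}.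
      by move=> /du [h _]; apply: differentiable_continuous; apply/derivable1_diffP.
    apply: continuous_FTC2 => //.
      split.
      + by move=> s; rewrite in_itv /= => /andP[s1 s2]; have [|] := du s; rewrite ?ltW.
      + by apply: cvg_at_right_filter; apply: cu; rewrite lexx ltW.
      + by apply: cvg_at_left_filter; apply: cu; rewrite lexx ltW.
    move=> s; rewrite in_itv /= => /andP[s1 s2]; rewrite derive1E.
    by have [|_ h] := du s; rewrite ?ltW.
  have NE : `|N y - N x|%:E = `|\int[mu]_(s in `[x, y]) (n s)%:E|%E.
    have axb : a <= x <= b by rewrite ax (le_trans xy).
    have ayb : a <= y <= b by rewrite yb (le_trans ax).
    have [//|_ Nx _] := hd x; have [//|_ Ny _] := hd y.
    by rewrite FTC Nx // Ny.
  rewrite NE.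
  have -> : (\int[mu]_t (((fun s => `|n s|) \_ `]x, y[) t)%:E =
             \int[mu]_(t in `]x, y[) `|(n t)%:E|)%E.
    rewrite [RHS]integral_mkcond; apply: eq_integral => s _.
    by rewrite /patch; case: ifP.
  rewrite integral_itv_obnd_cbnd; last by apply/measurable_EFinP; exact: measurableT_comp.
  rewrite integral_itv_bndo_bndc.
    by apply: le_abse_integral => //; exact/measurable_EFinP.
  apply/measurable_EFinP; apply: measurableT_comp => //.
  by apply: measurable_funS mn => //; exact: subset_itv_co_cc.
Qed.

End Minorant.

Lemma is_derive_derive1 (R : realType) (u : R -> R) (s : R) :
  derivable u s 1 -> is_derive s 1 u (derive1 u s).
Proof. by move=> h; rewrite derive1E; exact: derivableP. Qed.

(** * Length of a path and variation of the planar part *)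

Section PathMinorant.
Context {R : realType}.
Local Notation C := R[i].
Local Notation nc := (@Normc.normc R).
Local Notation mu := (@lebesgue_measure R).
Local Notation I3 := (isotropic_space R).
Variables (S : riemann_surface R) (D : set S) (f : S -> I3).
Hypothesis zf : zmc_face D f.

Definition speed (c : R -> S) (t : R) : R :=
  Num.sqrt (first_fundamental_form f (c t) (velocity c t)).

Lemma velocity_near (c c' : R -> S) t : (\forall s \near t, c s = c' s) ->
  velocity c t = velocity c' t.
Proof.
move=> h; have e := nbhs_singleton h; rewrite /velocity e !derive1E.
by congr (_ +i* _); apply: near_eq_derive; apply: filterS h => s ->.
Qed.

Lemma continuous_complex (x y : R -> R) (t : R) :
  {for t, continuous x} -> {for t, continuous y} ->
  {for t, continuous (fun s => x s +i* y s : C)}.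
Proof.
move=> cx cy; apply/rcontP => e e0; have e20 : 0 < e / 2 by rewrite divr_gt0.
have near_half (g : R -> R) : {for t, continuous g} ->
    exists2 d, 0 < d & forall s, `|s - t| < d -> `|g s - g t| < e / 2.
  move=> cg; have : nbhs (g t) [set v : R | `|v - g t| < e / 2].
    by apply/nbhs_rP; exists (e / 2).
  by move=> /cg /nbhs_rP.
have [d1 d10 h1] := near_half x cx; have [d2 d20 h2] := near_half y cy.
exists (Num.min d1 d2); first by rewrite lt_min d10.
move=> s; rewrite lt_min => /andP[/h1 k1 /h2 k2].
apply: (le_lt_trans (nc_ReIm _)); rewrite ReD ImD ReN ImN /= (splitr e).
exact: ltrD.
Qed.

(** Along the path the planar part is [Q] composed with the C^1 model of the path, where
    [Q' = omega]; the modulus of its derivative is the speed for the first fundamental form. *)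
Lemma C1_path_minorant c a b : a <= b -> C1_path c a b ->
  (forall t, a <= t <= b -> D (c t)) ->
  minorant (speed c) (fun t => complex.Re (planar f (c t))) a b /\
  minorant (speed c) (fun t => complex.Im (planar f (c t))) a b.
Proof.
move=> ab [_ hc] Dc.
have speed0 t : 0 <= speed c t by exact: sqrtr_ge0.
suff loc (t : R) : a <= t <= b -> exists2 m : R -> C, exists u : R -> C,
    [/\ \forall s \near t, rder u s (m s) /\ {for s, continuous m},
     \forall s \near t, a <= s <= b -> planar f (c s) = u s &
     \forall s \near t, a < s < b -> nc (m s) <= speed c s] & True.
  have Re_c (m : R -> C) (s : R) : {for s, continuous m} ->
      {for s, continuous (fun s => complex.Re (m s))}.
    by move=> cm; apply: (continuous_comp cm); exact: Re_continuous.
  have Im_c (m : R -> C) (s : R) : {for s, continuous m} ->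
      {for s, continuous (fun s => complex.Im (m s))}.
    by move=> cm; apply: (continuous_comp cm); exact: Im_continuous.
  split; apply: interval_induction => //.
  - by move=> x m y xm my; exact: minorant_cat.
  - move=> t tab; have [m [u [h1 h2 h3]] _] := loc t tab.
    apply: (@minorant_C1 R _ _ (fun s => complex.Re (u s)) (fun s => complex.Re (m s))) => //.
    + by apply: filterS h1 => s [/rderP [k1 k2] k3]; split; [exact: k1|exact: Re_c].
    + by apply: filterS h2 => s h /h ->.
    + by apply: filterS h3 => s h /h; apply: le_trans; exact: nc_Re.
  - by move=> x m y xm my; exact: minorant_cat.
  - move=> t tab; have [m [u [h1 h2 h3]] _] := loc t tab.
    apply: (@minorant_C1 R _ _ (fun s => complex.Im (u s)) (fun s => complex.Im (m s))) => //.
    + by apply: filterS h1 => s [/rderP [k1 k2] k3]; split; [exact: k2|exact: Im_c].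
    + by apply: filterS h2 => s h /h ->.
    + by apply: filterS h3 => s h /h; apply: le_trans; exact: nc_Im.
move=> tab; have [d [hd1 hd2]] := hc t tab; set q := c t in hd2 *.
have [_ dt] := nbhs_singleton hd2 tab; rewrite -/q in dt.
have cd := chart_dom_center q.
have Dq : D q by exact: Dc.
have [G [Q ld]] := zmc_local_data zf Dq cd; have [hG hQ im ncst eqf] := ld.
pose d' (s : R) : C := derive1 (@complex.Re R \o d) s +i* derive1 (@complex.Im R \o d) s.
have dd : \forall s \near t, rder d s (d' s) /\ {for s, continuous d'}.
  apply: filterS hd1 => s [k1 k2 k3 k4]; split; last exact: continuous_complex.
  by apply/rderP; split; [exact: (is_derive_derive1 k1)|exact: (is_derive_derive1 k2)].
have [rdt _] := nbhs_singleton dd.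
rewrite dt in hQ ld hG.
have nearQ : \forall w \near d t, [/\ holo Q w, planar f (chart_inv q w) = Q w &
    omega f q w = 'D_1 Q w].
  rewrite dt in eqf.
  apply: filterS3 (holo_near hQ) (local_data_planar ld) (potential_forms hG hQ eqf) => w k1 k2.
  by move=> [k3 _].
have nearQt := rder_near_point rdt nearQ.
exists (fun s => 'D_1 Q (d s) * d' s) => //; exists (fun s => Q (d s)); split.
- apply: filterS2 dd nearQt => s [k1 k2] [k3 _ _].
  split; first exact: (rder_comp (F := Q) k1 (holo_cder k3)).
  have c1 := rder_cont (rder_comp (F := fun z => 'D_1 Q z) k1 (holo_cder (holo_deriv k3))).
  by exact: cvgM c1 k2.
- apply: filterS2 hd2 nearQt => s k1 [_ k2 _] sab.
  by have [k3 k4] := k1 sab; rewrite -k2 -k4 chartK.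
(* At an interior time the path coincides with its model on both sides, so the two velocities
   agree. *)
- apply: filterS3 (near_join hd2) dd nearQt => s k1 [k2 _] [_ _ k3] sab.
  have nab : \forall s' \near s, a <= s' <= b.
    have /andP[sa sb] := sab.
    by apply: filterS2 (lt_nbhsr sa) (lt_nbhsl sb) => s' /ltW -> /ltW ->.
  have cE : \forall s' \near s, c s' = chart_inv q (d s').
    by apply: filterS2 k1 nab => s' h /h [k4 <-]; rewrite chartK.
  have [k4 k5] := nbhs_singleton k1 (nbhs_singleton nab).
  have cs := nbhs_singleton cE.
  rewrite /speed (velocity_near cE) cs.
  rewrite (first_fundamental_form_velocity zf _ _ _ k2) -?cs //; last exact: Dc (nbhs_singleton nab).
  by rewrite -normsqM normsqE sqrtr_sqr k3 ger0_norm ?normc_ge0.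
Qed.

Lemma piecewise_C1_le (c : R -> S) a b : piecewise_C1 c a b -> a <= b.
Proof. by elim=> // {a b} a m b _ am _ mb; exact: le_trans mb. Qed.

Lemma piecewise_C1_minorant (c : R -> S) a b : piecewise_C1 c a b ->
  (forall t, a <= t <= b -> D (c t)) ->
  minorant (speed c) (fun t => complex.Re (planar f (c t))) a b /\
  minorant (speed c) (fun t => complex.Im (planar f (c t))) a b.
Proof.
have speed0 t : 0 <= speed c t by exact: sqrtr_ge0.
elim=> {a b} [a b ab hc Dc|a m b /piecewise_C1_le am IH1 /piecewise_C1_le mb IH2 Dc].
  exact: C1_path_minorant.
have [|h1 h2] := IH1; first by move=> t /andP[at' tm]; apply: Dc; rewrite at' (le_trans tm).
have [|h3 h4] := IH2; first by move=> t /andP[mt tb]; apply: Dc; rewrite tb (le_trans am).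
by split; apply: minorant_cat am mb _ _.
Qed.

End PathMinorant.

(** * Expanding ends and the exponent *)

Section Expanding.
Context {R : realType}.
Local Notation C := R[i].
Local Notation nc := (@Normc.normc R).
Local Notation mu := (@lebesgue_measure R).
Local Notation I3 := (isotropic_space R).
Variables (S : riemann_surface R) (D : set S) (f : S -> I3) (p : S) (r : R).
Hypothesis zf : zmc_face D f.
Hypothesis er : end_disc D p r.
Hypothesis nDp : ~ D p.
Local Notation c := (chart p p).
Local Notation P := (planar f \o chart_inv p).

(** A path of finite length [L] keeps the planar part within [2 L] of its initial value, [L] for
    each of the two coordinates, whereas it tends to infinity at [p]. *)
Lemma expanding_of_unbounded :
  (forall B : R, \forall z \near c^', B < nc (P z)) -> expanding_end D f p.
Proof.
move=> unb cc Dc pc cp; apply: contrapT => fin.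
have L0 : (0 <= path_length (first_fundamental_form f) cc `[0%R, 1%R[)%E.
  by apply: integral_ge0 => t _; rewrite lee_fin sqrtr_ge0.
pose L := fine (path_length (first_fundamental_form f) cc `[0%R, 1%R[).
have LE : path_length (first_fundamental_form f) cc `[0%R, 1%R[ = L%:E.
  by rewrite fineK // ge0_fin_numE // ltey; apply/eqP.
have bnd b : 0 < b < 1 -> nc (planar f (cc b)) <= 2 * L + nc (planar f (cc 0)).
  move=> b01; have /andP[b0 b1] := b01.
  have [|h1 h2] := @piecewise_C1_minorant R S D f zf cc 0 b (pc b b01).
    by move=> t /andP[t0 tb]; apply: Dc; rewrite t0 (le_lt_trans tb).
  have J t : 0 < t < b -> `[0%R, 1%R[%classic t.
    by move=> /andP[t0 tb]; rewrite /= in_itv /= ltW //= (lt_trans tb).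
  have speed0 t : 0 <= speed f cc t by exact: sqrtr_ge0.
  have := minorant_integral h1 speed0 J; have := minorant_integral h2 speed0 J.
  rewrite -/(path_length (first_fundamental_form f) cc `[0%R, 1%R[) LE !lee_fin => k2 k1.
  have := nc_leD (planar f (cc b) - planar f (cc 0)) (planar f (cc 0)); rewrite subrK.
  move=> /le_trans; apply; rewrite lerD2r; apply: (le_trans (nc_ReIm _)).
  by rewrite ReD ImD ReN ImN mulr_natl mulr2n lerD.
have [d d0 hd] := (nbhs_puncP _ _).1 (unb (2 * L + nc (planar f (cc 0)))).
have cd := chart_dom_center p.
have near_p : \forall q \near p, chart_dom p q /\ nc (chart p q - c) < d.
  have : \forall q \near p, nc (chart p q - c) < d.
    apply: (chart_near (V := [set z | nc (z - c) < d]) cd).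
    by apply: disc_near; rewrite subrr nc0.
  by apply: filterS2 (chart_dom_near cd).
have near1 : \forall t \near (1 : R)^'-, chart_dom p (cc t) /\ nc (chart p (cc t) - c) < d.
  exact: cp near_p.
have /nbhs_rP [d1 d10 hd1] : \forall t \near (1 : R), t < 1 ->
    chart_dom p (cc t) /\ nc (chart p (cc t) - c) < d by exact: near1.
pose u := Num.min d1 1 / 2; pose t := 1 - u.
have m0 : 0 < Num.min d1 1 by rewrite lt_min d10 ltr01.
have u0 : 0 < u by rewrite divr_gt0.
have : u < Num.min d1 1 by rewrite /u ltr_pdivrMr // ltr_pMr ?ltr1n.
rewrite lt_min => /andP[ud u1].
have t01 : 0 < t < 1 by rewrite subr_gt0 u1 gtrBl.
have [||dt tc] := hd1 t; [|by case/andP: t01|].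
  by rewrite /t addrAC subrr add0r normrN gtr0_norm.
have /andP[t0 t1] := t01.
have Dt : D (cc t) by apply: Dc; rewrite ltW.
have := hd (chart p (cc t)) tc; rewrite /= chartK // ltNge bnd // => h.
have tcc : chart p (cc t) = c by apply: contrapT => /eqP /h.
by apply: nDp; rewrite -(chartK cd) -tcc chartK.
Qed.

(** The radial segment that reaches [c] at time 1 has length at most [M * s]. *)
Lemma shrinking_of_bounded (M : R) : (\forall z \near c^', nc (omega f p z) <= M) ->
  shrinking_end D f p.
Proof.
move=> /nbhs_puncP [d d0 hd] ex; have [r0 _] := er.
pose s := Num.min d r / 2.
have dr : 0 < Num.min d r by rewrite lt_min d0.
have s0 : 0 < s by rewrite divr_gt0.
have sm : s < Num.min d r by rewrite /s ltr_pdivrMr // ltr_pMr ?ltr1n.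
move: (sm); rewrite lt_min => /andP[sd sr].
pose gam (t : R) := (c + s%:C) + t%:C * (- s%:C).
have gamE t : gam t - c = ((1 - t) * s)%:C.
  by rewrite /gam !(rmorphD, rmorphM, rmorphN, rmorph1) /=; ring.
have ncE t : t <= 1 -> nc (gam t - c) = (1 - t) * s.
  by move=> t1; rewrite gamE nc_real ger0_norm // mulr_ge0 ?subr_ge0 // ltW.
have ncl t : 0 <= t <= 1 -> nc (gam t - c) <= s.
  by move=> /andP[t0 t1]; rewrite ncE // ler_piMl ?(ltW s0) // gerBl.
have pg t : 0 <= t < 1 -> punc c r (gam t).
  move=> /andP[t0 t1]; apply/andP; split.
    by rewrite ncE ?ltW // mulr_gt0 // subr_gt0.
  by apply: le_lt_trans sr; apply: ncl; rewrite t0 ltW.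
have dg (t : R) : rder gam t (- s%:C) by exact: rder_line.
have : path_length (first_fundamental_form f) (chart_inv p \o gam) `[0%R, 1%R[ = +oo%E.
  apply: ex.
- by move=> t /pg /(end_disc_punc er) [].
- move=> b /andP[b0 b1]; apply: piecewise_C1_one; first exact: ltW.
  apply: (chart_path_C1 (gam' := fun=> - s%:C)).
    move=> t /andP[t0 tb]; have pt : punc c r (gam t) by apply: pg; rewrite t0 (le_lt_trans tb).
    by have [] := end_disc_punc er pt.
  move=> t _; apply/nbhs_rP; exists 1; first exact: ltr01.
  by move=> t' _; split; [exact: dg|exact: cst_continuous].
- have cg : {for (1 : R), continuous gam} by exact: rder_cont (dg 1).
  have g1 : gam 1 = c by rewrite /gam mul1r addrK.
  apply: (cvg_comp (G := nbhs c) gam (chart_inv p)).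
    by rewrite -g1; exact: cvg_at_left_filter cg.
  move=> A pA; exact: chart_inv_near (chart_dom_center p) pA.
move=> /eqP; apply/negP; rewrite lt_eqF //.
apply: (@le_lt_trans _ _ (\int[mu]_(t in `[0%R, 1%R[) (M * s)%:E)%E).
  apply: (path_length_le (q := first_fundamental_form f)) => t t01.
  have {}t01 : 0 <= t < 1 by have : t \in `[0, 1[%R := t01; rewrite in_itv.
  have [h1 h2 h3] := end_disc_punc er (pg t t01).
  rewrite (first_fundamental_form_velocity zf h3 h1 h2 (dg t)) -normsqM normsqE sqrtr_sqr.
  rewrite ger0_norm ?normc_ge0 // ncM ncN nc_real gtr0_norm // ler_wpM2r ?(ltW s0) //.
  have /andP[k1 k2] := pg t t01; apply: hd; last by rewrite -subr_eq0 -nc_gt0.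
  by apply: le_lt_trans sd; apply: ncl; case/andP: t01 => -> /ltW.
rewrite integral_cst; last exact: measurable_itv.
rewrite [X in (_ * X)%E](_ : _ = 1%E) ?mule1 ?ltry //.
have e : mu `[0, 1[ = 1%E by rewrite lebesgue_measure_itv /= lte01 oppr0 adde0.
exact: e.
Qed.

Variables (k : C) (a : int) (U : C -> C).
Hypothesis nf : normal_form P c k a U.

(** For [a > 0] the form has order [a - 1 >= 0] and is bounded, which makes the end shrinking; for
    [a < 0] the planar part is unbounded. *)
Lemma expanding_normal_form : expanding_end D f p <-> a < 0.
Proof.
have [a0 hU U0 PE] := nf.
have uc0 : 0 < nc (U c) / 2 by rewrite divr_gt0 // nc_gt0.
split=> [ex|aneg].
  rewrite ltNge; apply/negP => age; have {age a0} apos : 0 < a by rewrite lt_neqAle eq_sym a0.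
  have [V [hV V0] dV] := normal_form_deriv nf.
  have [r0 _] := er.
  have near_r : \forall z \near c^', punc c r z.
    by apply/nbhs_puncP; exists r => // z z1 z2; apply/andP; rewrite nc_gt0 subr_eq0.
  have [n nE] : exists n : nat, a - 1 = n%:Z.
    by exists `|a - 1|%N; rewrite gez0_abs // subr_ge0.
  have hX : ccont (fun z => (z - c) ^+ n * V z) c.
    apply: ccontM (holo_ccont hV).
    by apply: (cder_ccont (cderX n (cderB (cder_id c) (cder_cst c c)))).
  have : \forall z \near c, nc ((z - c) ^+ n * V z - (c - c) ^+ n * V c) < 1.
    apply: (ccont_near hX (P := fun v => nc (v - (c - c) ^+ n * V c) < 1)).
    by apply: disc_near; rewrite subrr nc0.
  move=> /nbhs_dnbhs near_b; apply: (@shrinking_of_bounded (1 + nc ((c - c) ^+ n * V c))) ex.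
  apply: filterS3 near_r dV near_b => z pz h hb.
  rewrite (cder_uniq (cder_planar zf er pz) h) nE.
  have := nc_leD ((z - c) ^+ n * V z - (c - c) ^+ n * V c) ((c - c) ^+ n * V c).
  by rewrite subrK => /le_trans; apply; rewrite lerD2r ltW.
apply: expanding_of_unbounded => B.
have [n nE] : exists n : nat, a = Negz n by case: (a) aneg => // n; exists n.
have [d1 d10 hd1] := (nbhs_puncP _ _).1 PE.
have [d2 d20 hd2] := (ccont_epsP _ _).1 (holo_ccont hU) _ uc0.
have B0 : 0 < `|B| + nc k + 1 by rewrite ltr_wpDl // addr_ge0 ?normc_ge0.
apply/nbhs_puncP.
exists (Num.min (Num.min d1 d2) (Num.min 1 (nc (U c) / 2 / (`|B| + nc k + 1)))).
  by rewrite !lt_min d10 d20 ltr01 divr_gt0.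
move=> z; rewrite !lt_min => /andP[/andP[z1 z2] /andP[z3 z4]] zc.
have zc0 : 0 < nc (z - c) by rewrite nc_gt0 subr_eq0.
rewrite hd1 // nE.
have Uz : nc (U c) / 2 <= nc (U z).
  have := nc_subl (U c) (U z); rewrite (normcB (U c)); have := hd2 z z2.
  by clear -zf er nDp nf; lra.
have e1 : nc ((z - c) ^ Negz n * U z) = nc (U z) / nc (z - c) ^+ n.+1.
  rewrite NegzE -exprnN ncM mulrC; congr (_ * _).
  by rewrite -[X in nc X]div1r nc_div nc1 div1r ncX.
have e2 : `|B| + nc k + 1 < nc (U z) / nc (z - c) ^+ n.+1.
  rewrite ltr_pdivlMr ?exprn_gt0 //; apply: lt_le_trans Uz.
  apply: (@le_lt_trans _ _ ((`|B| + nc k + 1) * nc (z - c))).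
    by rewrite ler_wpM2l ?(ltW B0) // exprS ler_piMr ?normc_ge0 // exprn_ile1 ?normc_ge0 // ltW.
  by rewrite mulrC -ltr_pdivlMr.
have := nc_subl ((z - c) ^ Negz n * U z) (- k); rewrite opprK ncN e1 addrC => e3.
apply: (le_lt_trans (ler_norm B)); rewrite addrC in e3; rewrite addrC.
apply: lt_le_trans e3; rewrite ltrBrDr; apply: lt_trans e2.
by rewrite ltrDl ltr01.
Qed.

End Expanding.

(** * Embedded ends *)

(** The differences [u t - u (t + d)] at [t = 0, d, ..., (m - 1) d] telescope to 0, so they cannot
    all have the same strict sign, and the intermediate value theorem applies. *)
Lemma shift_fixed_value (R : realType) (u : R -> R) (d : R) (m : nat) : (0 < m)%N ->
  continuous u -> u (m%:R * d) = u 0 -> exists t, u t = u (t + d).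
Proof.
move=> m0 cu um; pose g t := u t - u (t + d).
have cg : continuous g.
  move=> t; apply: cvgB; first exact: cu.
  apply: (continuous_comp (f := fun t => t + d)); last exact: cu.
  move=> A /nbhs_rP [e e0 eA]; apply/nbhs_rP; exists e => // s st; apply: eA.
  by rewrite opprD addrACA subrr addr0.
have sg : \sum_(i < m) g (i%:R * d) = 0.
  rewrite -(big_mkord xpredT (fun i => g (i%:R * d))).
  have -> : \sum_(0 <= i < m) g (i%:R * d) =
      - \sum_(0 <= i < m) (u (i.+1%:R * d) - u (i%:R * d)).
    rewrite -sumrN; apply: eq_bigr => i _; rewrite /g opprB.
    by rewrite -natr1 mulrDl mul1r.
  by rewrite telescope_sumr // mul0r um subrr oppr0.
have [i hi] : exists i : 'I_m, g (i%:R * d) <= 0.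
  apply: contrapT => no; have pos (i : 'I_m) : 0 < g (i%:R * d).
    by rewrite ltNge; apply/negP => h; apply: no; exists i.
  have : 0 < \sum_(i < m) g (i%:R * d).
    rewrite (bigD1 (Ordinal m0) isT); apply: (ltr_pwDl (pos (Ordinal m0))).
    by apply: sumr_ge0 => i _; exact: ltW.
  by rewrite sg ltxx.
have [j hj] : exists j : 'I_m, 0 <= g (j%:R * d).
  apply: contrapT => no; have neg (j : 'I_m) : 0 < - g (j%:R * d).
    by rewrite oppr_gt0 ltNge; apply/negP => h; apply: no; exists j.
  have : 0 < \sum_(i < m) - g (i%:R * d).
    rewrite (bigD1 (Ordinal m0) isT); apply: (ltr_pwDl (neg (Ordinal m0))).
    by apply: sumr_ge0 => l _; exact: ltW.
  by rewrite sumrN sg oppr0 ltxx.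
suff [t gt] : exists t, g t = 0 by exists t; apply/eqP; rewrite -subr_eq0; apply/eqP.
have cw x y : {within `[x, y], continuous g} by exact: continuous_subspaceT.
have [ij|ji] := leP (i%:R * d) (j%:R * d).
  have [|t _ gt] := @IVT R g _ _ 0 ij (cw _ _); last by exists t.
  by rewrite ge_min hi le_max hj orbT.
have [|t _ gt] := @IVT R g _ _ 0 (ltW ji) (cw _ _); last by exists t.
by rewrite ge_min hi orbT le_max hj.
Qed.

Lemma continuous_pair (T U V : topologicalType) (f : T -> U) (g : T -> V) (t : T) :
  {for t, continuous f} -> {for t, continuous g} ->
  {for t, continuous (fun x => (f x, g x))}.
Proof.
move=> cf cg A [[B1 B2] [/= h1 h2] sub].
have n1 : \forall s \near t, B1 (f s) := cf _ h1.
have n2 : \forall s \near t, B2 (g s) := cg _ h2.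
by apply: filterS2 n1 n2 => s k1 k2; exact: (sub (f s, g s)).
Qed.

Section Embedded.
Context {R : realType}.
Local Notation C := R[i].
Local Notation nc := (@Normc.normc R).
Local Notation I3 := (isotropic_space R).
Variables (S : riemann_surface R) (D : set S) (f : S -> I3) (p : S) (r : R).
Hypothesis zf : zmc_face D f.
Hypothesis er : end_disc D p r.
Local Notation c := (chart p p).
Local Notation P := (planar f \o chart_inv p).

Lemma eq_planar q q' : crd0 (f q) = crd0 (f q') -> planar f q = planar f q' -> f q = f q'.
Proof.
rewrite /planar /crd0 /crd1 /crd2 => + [].
by case: (f q) => [[x y] z]; case: (f q') => [[x' y'] z'] /= -> -> ->.
Qed.

Lemma height_continuous z : punc c r z ->
  {for z, continuous (fun w => crd0 (f (chart_inv p w)))}.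
Proof.
move=> pz; have [G [Q [hG hQ im ncst eqf]]] := end_local_data zf er pz.
have cG : {for z, continuous (fun w => complex.Re (G w))}.
  by apply: (continuous_comp (f := G)); [exact/ccontE/holo_ccont|exact: Re_continuous].
have e0 : \forall w \near z, complex.Re (G w) = crd0 (f (chart_inv p w)).
  by apply: filterS eqf => w ->.
rewrite /prop_for /continuous_at -(nbhs_singleton e0).
by apply: cvg_trans cG; exact: (near_eq_cvg e0).
Qed.

(* In the coordinate [y] with [(P - k)^(+-1) = y^m], the height is a continuous
   function on a small circle, so it takes the same value at some [y] and
   [cis (2 * pi / m) * y], where [P] agrees as well. *)
Lemma not_embedded (k : C) (m : nat) (u0 : C -> C) (a : int) : (1 < m)%N -> `|a|%N = m ->
  holo u0 c -> u0 c != 0 ->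
  (\forall z \near c^', P z = k + ((z - c) ^+ m * u0 z) ^ (Num.sg a)) ->
  ~ embedded_end D f p.
Proof.
move=> m1 am hu u00 PE [V [oV Vp VD [_ _ inj _]]].
have m0 : (0 < m)%N by exact: ltnW.
have [Z [hZ Z0 [r1 r10 Zinj] ZE]] := power_coordinate hu u00 m0.
have [d d0 hd] := (nbhs_puncP _ _).1 PE.
have [rr0 _] := er.
have nearV : \forall z \near c, nc (z - c) < Num.min r d /\ V (chart_inv p z).
  have n1 : \forall z \near c, nc (z - c) < Num.min r d.
    by apply: disc_near; rewrite subrr nc0 lt_min rr0.
  have n2 : \forall z \near c, V (chart_inv p z).
    by apply: (chart_inv_near (chart_dom_center p)); exact: open_nbhs_nbhs.
  by apply: filterS2 n1 n2.
rewrite -{1}Z0 in nearV.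
have near0 := ccont_near (holo_ccont hZ) nearV.
have n4 := holo_near hZ.
have /nbhs_cP [d1 d10 hd1] : \forall y \near 0, [/\
    nc (Z y - c) < Num.min r d /\ V (chart_inv p (Z y)),
    (Z y - c) ^+ m * u0 (Z y) = y ^+ m & holo Z y].
  by apply: filterS3 near0 ZE n4.
pose s := Num.min r1 d1 / 2.
have mm : 0 < Num.min r1 d1 by rewrite lt_min r10.
have s0 : 0 < s by rewrite divr_gt0.
have : s < Num.min r1 d1 by rewrite /s ltr_pdivrMr // ltr_pMr ?ltr1n.
rewrite lt_min => /andP[sr1 sd1].
pose y (t : R) : C := s%:C * cis t.
have ny t : nc (y t) = s by rewrite /y ncM nc_cis nc_real mulr1 gtr0_norm.
have y0 t : y t != 0 by rewrite -nc_gt0 ny.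
have data t : [/\ nc (Z (y t) - c) < Num.min r d /\ V (chart_inv p (Z (y t))),
    (Z (y t) - c) ^+ m * u0 (Z (y t)) = y t ^+ m & holo Z (y t)].
  by apply: hd1; rewrite subr0 ny.
have Zc t : Z (y t) != c.
  apply/eqP => e; have : Z (y t) = Z 0 by rewrite Z0.
  by move=> /Zinj; rewrite ny nc0 => /(_ sr1 r10) /eqP; apply/negP.
have pZ t : punc c r (Z (y t)).
  have [[h _] _ _] := data t; move: h; rewrite lt_min => /andP[h _].
  by apply/andP; rewrite nc_gt0 subr_eq0.
have PZ t : P (Z (y t)) = k + (y t ^+ m) ^ (Num.sg a).
  have [[h _] e _] := data t; move: h; rewrite lt_min => /andP[_ h].
  by rewrite hd // e.
pose u t := crd0 (f (chart_inv p (Z (y t)))).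
have cu : continuous u.
  move=> t; apply: (continuous_comp (f := fun t => Z (y t)) (g := fun w => crd0 (f (chart_inv p w)))).
    have [_ _ hz] := data t.
    exact: rder_cont (rder_comp (F := Z) (rderM (rder_cst s%:C t) (rder_cis t)) (holo_cder hz)).
  exact: height_continuous.
pose dl : R := 2 * pi / m%:R.
have mdl : m%:R * dl = 2 * pi by rewrite /dl mulrC divfK // pnatr_eq0 -lt0n.
have [|t ut] := @shift_fixed_value R u dl m m0 cu.
  by rewrite mdl /u /y cis2pi cis0.
pose zeta := cis dl.
have yE : y (t + dl) = y t * zeta by rewrite /y cisD mulrA.
have q_in s' : (V `\ p) (chart_inv p (Z (y s'))).
  have [[_ h] _ _] := data s'; split => // e.
  have [_ e2 _] := end_disc_punc er (pZ s').
  by move: (Zc s'); rewrite -e2 e eqxx.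
have eqq : chart_inv p (Z (y t)) = chart_inv p (Z (y (t + dl))).
  apply: inj; [exact: q_in|exact: q_in|].
  apply: eq_planar; first exact: ut.
  have := PZ t; have := PZ (t + dl); rewrite /= => -> ->.
  have zm : zeta ^+ m = 1 by exact: cis_root_pow.
  by rewrite yE [(y t * zeta) ^+ m]exprMn zm mulr1.
have : Z (y t) = Z (y (t + dl)).
  have [_ e1 _] := end_disc_punc er (pZ t); have [_ e2 _] := end_disc_punc er (pZ (t + dl)).
  by rewrite -e1 eqq e2.
move=> /Zinj; rewrite !ny => /(_ sr1 sr1); rewrite yE => /eqP.
rewrite -subr_eq0 -{1}[y t]mulr1 -mulrBr mulf_eq0 (negPf (y0 t)) /= subr_eq0 eq_sym.
by apply/negP; exact: cis_root_neq1.
Qed.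

Lemma continuous_planar_coord : continuous (fun v : R * R * R => v.1.2 +i* v.2 : C).
Proof.
move=> v; apply: (@continuous_comp _ _ _ (fun v : R * R * R => (v.1.2, v.2))
  (fun w : R * R => w.1 +i* w.2 : C)); last exact: cplx_continuous.
apply: continuous_pair; last exact: cvg_snd.
by apply: (@continuous_comp _ _ _ (fun v : R * R * R => v.1) (fun w : R * R => w.2)); [exact: cvg_fst|exact: cvg_snd].
Qed.

(** The coordinate [Phi], bilipschitz from below, is a continuous function of the planar part. Thus
    the planar part alone yields injectivity and the continuous inverse, and [omega != 0] yields the
    immersion; the height only has to be continuous. *)
Lemma embedded_of_bilipschitz (Phi e : C -> C) (rho L : R) : 0 < rho <= r -> 0 < L ->
  (forall z w, nc (z - c) < rho -> nc (w - c) < rho ->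
    L * nc (z - w) <= 2 * nc (Phi z - Phi w)) ->
  (forall z, punc c rho z -> [/\ Phi z = e (P z), ccont e (P z) & omega f p z != 0]) ->
  embedded_end D f p.
Proof.
move=> /andP[rho0 rhor] L0 lip hP.
have cd := chart_dom_center p.
pose V := [set q | chart_dom p q /\ nc (chart p q - c) < rho].
have VA q : (V `\ p) q -> [/\ chart_dom p q, punc c rho (chart p q) & D q].
  move=> [[d1 d2] qp].
  have qc : chart p q != c.
    by apply/eqP => e1; apply: qp; rewrite /= -(chartK d1) e1 chartK.
  have pq : punc c rho (chart p q) by apply/andP; rewrite nc_gt0 subr_eq0.
  split => //; have [_ /(_ (chart p q)) h] := er.
  by have [|_ _] := h; [exact: lt_le_trans rhor|rewrite chartK //; exact].
have pr z : punc c rho z -> punc c r z.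
  by move=> /andP[h1 h2]; apply/andP; split => //; exact: lt_le_trans rhor.
exists V; split.
- rewrite openE => q [d1 d2]; rewrite /interior.
  have n1 : \forall q' \near q, nc (chart p q' - c) < rho.
    apply: (chart_near (V := [set z | nc (z - c) < rho]) d1); exact: disc_near.
  by apply: filterS2 (chart_dom_near d1) n1.
- by split => //; rewrite subrr nc0.
- by move=> q /VA [].
split.
- move=> q v /VA [dq pq Dq] dv.
  have [_ _ w0] := hP _ pq.
  have [e1 _] := forms_chart zf Dq dq.
  have wq : omega f q (chart q q) != 0.
    by apply: contraNneq w0 => w0; rewrite e1 w0 mul0r.
  have := first_fundamental_formE zf Dq v.
  rewrite /first_fundamental_form dv /isotropic_dot /crd1 /crd2 /= !mul0r addr0.
  move=> /esym /eqP; rewrite -normsqM normsqE sqrf_eq0 nc_eq0 mulf_eq0 (negPf wq) /=.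
  by move/eqP.
- apply: continuous_in_subspaceT => q; rewrite inE => /VA [dq pq Dq].
  have [G [Q [hG hQ im ncst eqf]]] := zmc_local_data zf Dq dq.
  have cc := chart_continuous dq.
  have fE : \forall q' \near q, (complex.Re (G (chart p q')), complex.Re (Q (chart p q')),
      complex.Im (Q (chart p q'))) = f q' :> R * R * R.
    by apply: filterS2 (chart_dom_near dq) (chart_near dq eqf) => q' dq'; rewrite chartK.
  have comp (g : C -> C) : holo g (chart p q) -> g (chart p q') @[q' --> q] --> g (chart p q).
    by move=> hg; apply: cvg_comp cc _; apply/ccontE/holo_ccont.
  rewrite /prop_for /continuous_at -(nbhs_singleton fE).
  apply: cvg_trans (near_eq_cvg fE) _.
  have cr (g : C -> C) : holo g (chart p q) -> {for q, continuous (fun q' => complex.Re (g (chart p q')))}.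
    by move=> hg; apply: (continuous_comp (comp g hg)); exact: Re_continuous.
  have ci (g : C -> C) : holo g (chart p q) -> {for q, continuous (fun q' => complex.Im (g (chart p q')))}.
    by move=> hg; apply: (continuous_comp (comp g hg)); exact: Im_continuous.
  exact: (continuous_pair (continuous_pair (cr G hG) (cr Q hQ)) (ci Q hQ)).
- move=> q q' /VA [dq pq Dq] /VA [dq' pq' Dq'] ff.
  have [h1 _ _] := hP _ pq; have [h2 _ _] := hP _ pq'.
  have /andP[_ k1] := pq; have /andP[_ k2] := pq'.
  have := lip _ _ k1 k2; rewrite h1 h2 /= !chartK // /planar ff subrr nc0 mulr0.
  rewrite pmulr_rle0 // => k3.
  have : chart p q - chart p q' = 0 by apply/eqP; rewrite -nc_eq0 eq_le k3 normc_ge0.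
  by move=> /subr0_eq k4; rewrite -(chartK dq) k4 chartK.
- move=> q V' /VA [dq pq Dq] qV'.
  have [h1 he _] := hP _ pq; have /andP[_ k1] := pq.
  have qV : nbhs (chart_inv p (chart p q)) V' by rewrite chartK.
  have := chart_inv_near dq qV'; move=> /nbhs_cP [ep ep0 hep].
  have Lep : 0 < L * ep / 2 by rewrite divr_gt0 // mulr_gt0.
  have [eta eta0 heta] := (ccont_epsP _ _).1 he _ Lep.
  exists [set v : R * R * R | nc ((v.1.2 +i* v.2) - planar f q) < eta].
    apply: (@continuous_planar_coord (f q : R * R * R) [set v | nc (v - planar f q) < eta]).
    by apply: disc_near; rewrite /planar subrr nc0.
  move=> q' /VA [dq' pq' Dq'] /= hq'.
  have [h2 _ _] := hP _ pq'; have /andP[_ k2] := pq'.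
  rewrite -(chartK dq'); apply: hep.
  have := lip _ _ k2 k1; rewrite h1 h2 => k3.
  have k4 : nc (e (P (chart p q')) - e (P (chart p q))) < L * ep / 2.
    by apply: heta; rewrite /= !chartK.
  rewrite -(ltr_pM2l L0); apply: (le_lt_trans k3).
  by move: k4; clear -zf er; lra.
Qed.

Variables (k : C) (a : int) (U : C -> C).
Hypothesis nf : normal_form P c k a U.

(** Raising [P - k] to the power [sg a] turns poles into zeros, so both signs of [a] reduce to the
    zero [(z - c) ^+ |a| * u0]. For [|a| = 1] this is a local coordinate. *)
Lemma embedded_normal_form : embedded_end D f p <-> `|a|%N = 1%N.
Proof.
have [a0 hU U0 PE] := nf.
have [V [hV V0] dV] := normal_form_deriv nf.
pose u0 z := if 0 < a then U z else (U z)^-1.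
have u0E : u0 = U \/ u0 = (fun z => (U z)^-1).
  by rewrite /u0; case: (0 < a); [left|right].
have hu0 : holo u0 c by case: u0E => ->; [exact: hU|exact: holoV].
have u00 : u0 c != 0 by case: u0E => ->; rewrite ?invr_eq0.
have PE' : \forall z \near c^', P z = k + ((z - c) ^+ `|a|%N * u0 z) ^ (Num.sg a).
  apply: filterS PE => z ->; congr (_ + _); rewrite /u0.
  have [apos|aneg|/eqP] := ltrgt0P a; last by rewrite (negPf a0).
    by rewrite gtr0_sg // expr1z -[in LHS](gtz0_abs apos).
  rewrite ltr0_sg // exprN1 invfM invrK; congr (_ * _).
  by rewrite exprnN ltz0_abs // opprK.
split=> [emb|a1].
  apply/eqP; rewrite eqn_leq absz_gt0 a0 andbT leqNgt; apply/negP => a2.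
  exact: (not_embedded a2 (erefl _) hu0 u00 PE') emb.
have [r0 _] := er.
pose Phi z := (z - c) * u0 z.
have hPhi : holo Phi c by apply: holoM hu0; exact: holoB (holo_id c) (holo_cst c c).
have dPhi : 'D_1 Phi c = u0 c.
  have := cderM (cderB (cder_id c) (cder_cst c c)) (holo_cder hu0).
  by move=> /cder_val ->; rewrite subr0 mul1r subrr mul0r addr0.
have dPhi0 : 'D_1 Phi c != 0 by rewrite dPhi.
have [r2 r20 [_ _ lip]] := holo_bilipschitz hPhi dPhi0.
have near_r : \forall z \near c^', punc c r z.
  by apply/nbhs_puncP; exists r => // z z1 z2; apply/andP; rewrite nc_gt0 subr_eq0.
have w0 : \forall z \near c^', omega f p z != 0.
  have nV : \forall z \near c^', V z != 0.
    by apply: nbhs_dnbhs; apply: near_neq0 V0; exact: holo_ccont.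
  have zc : \forall z \near c^', z != c by apply/nbhs_puncP; exists 1; [exact: ltr01|].
  apply: filterS3 (filterI near_r zc) dV nV => z [pz zc'] h Vz.
  rewrite (cder_uniq (cder_planar zf er pz) h) mulf_neq0 // expfz_neq0 // subr_eq0 //.
have [d d0 hd] := (nbhs_puncP _ _).1 (filterI PE' w0).
(* [P - k = Phi ^ (sg a)] with [sg a] equal to 1 or -1, so the same power recovers [Phi] from
   [P]. *)
pose e v : C := (v - k) ^ (Num.sg a).
have L0 : 0 < nc ('D_1 Phi c) by rewrite nc_gt0.
apply: (@embedded_of_bilipschitz Phi e (Num.min (Num.min r r2) d) (nc ('D_1 Phi c))) => //.
- by rewrite !lt_min r0 r20 d0 /= !ge_min lexx.
- by move=> z w; rewrite !lt_min => /andP[/andP[_ z1] _] /andP[/andP[_ w1] _]; exact: lip.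
move=> z /andP[z0]; rewrite !lt_min => /andP[/andP[z1 z2] z3].
have zc : z != c by rewrite -subr_eq0 -nc_gt0.
have [PzE wz] := hd z z3 zc; rewrite a1 expr1 -/(Phi z) in PzE.
have Phi0 : Phi z != 0.
  have := lip z c z2; rewrite subrr nc0 => /(_ r20).
  have -> : Phi c = 0 by rewrite /Phi subrr mul0r.
  by rewrite subr0 -nc_gt0 => h; move: (lt_le_trans (mulr_gt0 L0 z0) h); rewrite pmulr_rgt0.
have vk : P z - k = Phi z ^ (Num.sg a) by rewrite PzE addrC addKr.
split => //.
- rewrite /e vk exprz_exp; have [apos|aneg|/eqP] := ltrgt0P a; last by rewrite (negPf a0).
    by rewrite gtr0_sg // mulr1 expr1z.
  by rewrite ltr0_sg // mulrNN mulr1 expr1z.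
- have cB : ccont (fun v => v - k) (P z) by exact: (cder_ccont (cderB (cder_id _) (cder_cst k _))).
  have [apos|aneg|/eqP] := ltrgt0P a; last by rewrite (negPf a0).
    by rewrite /e gtr0_sg.
  rewrite /e ltr0_sg //; apply: (ccontV _ cB).
  by rewrite vk expfz_neq0.
Qed.

End Embedded.

(** * Summation over the ends *)

Section OrderFormula.
Context {R : realType}.
Local Notation I3 := (isotropic_space R).
Variables (S : riemann_surface R) (n : nat) (p : 'I_n -> S) (k : nat) (f : S -> I3).
Hypothesis cf : complete_finite_type_face p k f.

Lemma end_exponent j : exists a : int, [/\ a != 0, ord_omega f (p j) = a - 1,
  expanding_end (punctured p) f (p j) <-> a < 0 &
  embedded_end (punctured p) f (p j) <-> `|a|%N = 1%N].
Proof.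
have [_ _ zf wc ft _ _ _] := cf.
have [r er] := exists_end_disc p j.
have nD : ~ punctured p (p j) by move=> /(_ j).
have [c [a [U nf]]] := end_normal_form zf er wc ft nD.
exists a; split.
- by have [] := nf.
- have h := ord_omega_normal_form zf er nf. exact: h.
- have h := expanding_normal_form zf er nD nf. exact: h.
- have h := embedded_normal_form zf er nf. exact: h.
Qed.

Lemma end_order_sum_ge : 2 * k%:Z <= end_order_sum p k f /\
  (end_order_sum p k f = 2 * k%:Z <->
   forall j : 'I_n, embedded_end (punctured p) f (p j)).
Proof.
have [_ _ _ _ _ kn exp_ shr] := cf.
have [a ha] := choice end_exponent.
(* The excess of an end over its minimal contribution: [-(a - 1) - 2] if expanding, [a - 1] if
   shrinking. Given the sign of [a] it is nonnegative, and it is zero exactly when [|a| = 1]. *)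
pose t (j : 'I_n) : int := if (j < k)%N then - a j - 1 else a j - 1.
have t0 j : 0 <= t j.
  have [a0 _ ex _] := ha j; rewrite /t; case: (ltnP j k) => jk.
    by have := ex.1 (exp_ j jk); lia.
  have : ~ (a j < 0) by move=> /ex.2; exact: shr.
  by move: a0; lia.
have t0E j : t j = 0 <-> embedded_end (punctured p) f (p j).
  have [a0 _ ex em] := ha j; rewrite em /t; case: (ltnP j k) => jk.
    by have := ex.1 (exp_ j jk); lia.
  have : ~ (a j < 0) by move=> /ex.2; exact: shr.
  by move: a0; lia.
have sumE : end_order_sum p k f = 2 * k%:Z + \sum_(j < n) t j.
  rewrite /end_order_sum [in RHS](bigID (fun j : 'I_n => (j < k)%N)) /=.
  have -> : \sum_(j < n | (j < k)%N) t j =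
      - (\sum_(j < n | (j < k)%N) ord_omega f (p j)) - 2 * k%:Z.
    have -> : 2 * k%:Z = \sum_(j < n | (j < k)%N) (2 : int).
      rewrite (big_ord_narrow kn) sumr_const card_ord.
      by rewrite -[RHS]mulr_natr [k%:R]natz.
    rewrite -sumrN -sumrB; apply: eq_bigr => j jk.
    by have [_ -> _ _] := ha j; rewrite /t jk; ring.
  have -> : \sum_(j < n | ~~ (j < k)%N) t j = \sum_(j < n | (k <= j)%N) ord_omega f (p j).
    apply: eq_big => j; first by rewrite -leqNgt.
    by move=> jk; have [_ -> _ _] := ha j; rewrite /t (negPf jk).
  by ring.
have s0 : 0 <= \sum_(j < n) t j by apply: sumr_ge0 => j _; exact: t0.
split; first by rewrite sumE lerDl.
rewrite sumE; split=> [/eqP|emb].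
  rewrite addrC -subr_eq0 addrK psumr_eq0; last by move=> j _; exact: t0.
  by move=> /allP h j; apply/t0E/eqP; apply: h; rewrite mem_index_enum.
by rewrite big1 ?addr0 // => j _; apply/t0E.
Qed.

End OrderFormula.

(** * Entire graphs of harmonic polynomials *)

Section Wirtinger.
Context {R : realType}.
Local Notation C := R[i].
Local Notation nc := (@Normc.normc R).
Implicit Types (u v a b : C -> C) (z w : C).

(* Caratheodory's form of real differentiability: [a] and [b] are the Wirtinger
   derivatives of [u] at [z]. *)
Definition wirtinger u z (a b : C) : Prop := exists A B : C -> C,
  [/\ ccont A z, ccont B z, A z = a, B z = b &
      forall w, u w - u z = A w * (w - z) + B w * conjc (w - z)].

Lemma nc_conj z : nc (conjc z) = nc z.
Proof. by case: z => x y; rewrite /= sqrrN. Qed.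

Lemma conjc_i : conjc 'i%C = - 'i%C :> C.
Proof. by apply/eqP; rewrite eq_complex /= oppr0 !eqxx. Qed.

Lemma ccont_conj z : ccont conjc z.
Proof.
by apply/ccont_epsP => e e0; exists e => // w; rewrite -rmorphB nc_conj.
Qed.

Lemma wirtinger_ccont u z (a b : C) : wirtinger u z a b -> ccont u z.
Proof.
move=> [A [B [cA cB _ _ uE]]].
have -> : u = (fun w => u z + (A w * (w - z) + B w * conjc (w - z))).
  by apply/funext => w; rewrite -uE addrC subrK.
have cid : ccont (fun w => w - z) z by exact: ccontB (ccont_id z) (ccont_cst z z).
apply: ccontD (ccont_cst _ z) _; apply: ccontD (ccontM cA cid) _.
by apply: ccontM cB _; apply: (ccont_comp cid); exact: ccont_conj.
Qed.

Lemma wirtinger_eq u z (a b a' b' : C) : wirtinger u z a b -> a = a' -> b = b' ->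
  wirtinger u z a' b'.
Proof. by move=> h <- <-. Qed.

Lemma wirtinger_linear (p q k z : C) : wirtinger (fun w => p * w + q * conjc w + k) z p q.
Proof.
exists (fun=> p), (fun=> q); split; [exact: ccont_cst|exact: ccont_cst|by []|by []|].
by move=> w; rewrite rmorphB; ring.
Qed.

Lemma wirtingerD u v z (a b a' b' : C) : wirtinger u z a b -> wirtinger v z a' b' ->
  wirtinger (fun w => u w + v w) z (a + a') (b + b').
Proof.
move=> [A [B [cA cB <- <- uE]]] [A' [B' [cA' cB' <- <- vE]]].
exists (fun w => A w + A' w), (fun w => B w + B' w); split => //.
- exact: ccontD.
- exact: ccontD.
- by move=> w; rewrite opprD addrACA uE vE; ring.
Qed.

Lemma wirtingerM u v z (a b a' b' : C) : wirtinger u z a b -> wirtinger v z a' b' ->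
  wirtinger (fun w => u w * v w) z (u z * a' + a * v z) (u z * b' + b * v z).
Proof.
move=> hu hv; have cu := wirtinger_ccont hu.
move: hu hv => [A [B [cA cB <- <- uE]]] [A' [B' [cA' cB' <- <- vE]]].
exists (fun w => u w * A' w + A w * v z), (fun w => u w * B' w + B w * v z); split => //.
- by apply: ccontD; [exact: ccontM|apply: ccontM cA _; exact: ccont_cst].
- by apply: ccontD; [exact: ccontM|apply: ccontM cB _; exact: ccont_cst].
- move=> w; have -> : u w * v w - u z * v z = u w * (v w - v z) + (u w - u z) * v z.
    by ring.
  by rewrite uE vE; ring.
Qed.

Lemma wirtinger_conj u z (a b : C) : wirtinger u z a b ->
  wirtinger (fun w => conjc (u w)) z (conjc b) (conjc a).
Proof.
move=> [A [B [cA cB <- <- uE]]].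
exists (fun w => conjc (B w)), (fun w => conjc (A w)); split => //.
- by apply: (ccont_comp cB); exact: ccont_conj.
- by apply: (ccont_comp cA); exact: ccont_conj.
- by move=> w; rewrite -rmorphB uE rmorphD !rmorphM /= conjcK addrC.
Qed.

Lemma cder_wirtinger u z l : cder u z l -> wirtinger u z l 0.
Proof.
move=> h; exists (fun w => if w == z then l else (u w - u z) / (w - z)), (fun=> 0); split => //.
- exact: diff_quotient_ccont.
- exact: ccont_cst.
- by rewrite eqxx.
- move=> w; rewrite mul0r addr0; have [->|wz] := eqVneq w z; first by rewrite !subrr mulr0.
  by rewrite divfK // subr_eq0.
Qed.

Lemma wirtinger_cder u z l : wirtinger u z l 0 -> cder u z l.
Proof.
move=> [A [B [/ccont_epsP cA /ccont_epsP cB <- B0 uE]]] e e0.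
have e2 : 0 < e / 2 by rewrite divr_gt0.
have [d d0 hd] := cA _ e2; have [d' d'0 hd'] := cB _ e2.
exists (Num.min d d'); first by rewrite lt_min d0.
move=> w; rewrite lt_min => /andP[/hd w1 /hd' w2]; rewrite uE.
have -> : A w * (w - z) + B w * conjc (w - z) - A z * (w - z) =
    (A w - A z) * (w - z) + (B w - B z) * conjc (w - z) by rewrite B0; ring.
apply: (le_trans (nc_leD _ _)); rewrite !ncM nc_conj -mulrDl.
by apply: ler_wpM2r; [exact: normc_ge0|move: w1 w2; clear; lra].
Qed.

Lemma wirtinger_line u z (a b v : C) : nc v = 1 -> wirtinger u z a b ->
  rder (fun t : R => u (z + t%:C * v)) 0 (a * v + b * conjc v).
Proof.
move=> v1 [A [B [/ccont_epsP cA /ccont_epsP cB <- <- uE]]] e e0.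
have e2 : 0 < e / 2 by rewrite divr_gt0.
have [d d0 hd] := cA _ e2; have [d' d'0 hd'] := cB _ e2.
exists (Num.min d d'); first by rewrite lt_min d0.
move=> s; rewrite subr0 lt_min => /andP[sd sd'].
have wz : z + s%:C * v - z = s%:C * v by rewrite addrC addKr.
have nw : nc (z + s%:C * v - z) = `|s| by rewrite wz ncM nc_real v1 mulr1.
have s1 := hd (z + s%:C * v); rewrite nw in s1.
have s2 := hd' (z + s%:C * v); rewrite nw in s2.
have cs : conjc (s%:C * v) = s%:C * conjc v.
  by rewrite rmorphM; congr (_ * _); exact: conjc_real.
rewrite mul0r addr0 uE wz cs.
have -> : forall p q p' q' x y y' : C, p * (x * y) + q * (x * y') - x * (p' * y + q' * y') =
    x * ((p - p') * y + (q - q') * y') by move=> *; ring.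
rewrite ncM nc_real mulrC; apply: ler_wpM2r; first exact: normr_ge0.
apply: (le_trans (nc_leD _ _)); rewrite !ncM nc_conj v1 !mulr1.
by have := s1 sd; have := s2 sd'; clear; lra.
Qed.

Definition growth u : Prop := exists (N : nat) (K : R),
  0 <= K /\ forall z, nc (u z) <= K * (1 + nc z) ^+ N.

Lemma growthD u v : growth u -> growth v -> growth (fun w => u w + v w).
Proof.
move=> [N [K [K0 hu]]] [M [L [L0 hv]]]; exists (maxn N M), (K + L).
split; first exact: addr_ge0.
move=> z; apply: (le_trans (nc_leD _ _)); rewrite mulrDl.
have z1 : 1 <= 1 + nc z by rewrite lerDl normc_ge0.
apply: lerD; [apply: (le_trans (hu z))|apply: (le_trans (hv z))]; apply: ler_wpM2l => //.
  by rewrite ler_weXn2l // leq_maxl.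
by rewrite ler_weXn2l // leq_maxr.
Qed.

Lemma growthM u v : growth u -> growth v -> growth (fun w => u w * v w).
Proof.
move=> [N [K [K0 hu]]] [M [L [L0 hv]]]; exists (N + M)%N, (K * L).
split; first exact: mulr_ge0.
move=> z; rewrite ncM exprD mulrACA.
by apply: ler_pM; rewrite ?normc_ge0 ?hu ?hv.
Qed.

Lemma growth_linear (p q k : C) : growth (fun w => p * w + q * conjc w + k).
Proof.
exists 1%N, (nc p + nc q + nc k); split; first by rewrite !addr_ge0 ?normc_ge0.
move=> z; rewrite expr1; apply: (le_trans (nc_leD _ _)).
have h : nc (p * z + q * conjc z) <= (nc p + nc q) * nc z.
  by apply: (le_trans (nc_leD _ _)); rewrite !ncM nc_conj mulrDl.
have k0 := normc_ge0 k; have p0 := normc_ge0 p; have q0 := normc_ge0 q.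
have z0 := normc_ge0 z; have kz := mulr_ge0 k0 z0.
by move: h k0 p0 q0 kz; clear; rewrite !mulrDr !mulrDl !mulr1; lra.
Qed.

(* [a], [b] are the Wirtinger derivatives of [u] and [ab] the common mixed
   second derivative, that is a quarter of the Laplacian. *)
Definition smooth2 u : Prop := growth u /\ exists a b aa ab bb : C -> C,
  growth a /\ forall z, [/\ wirtinger u z (a z) (b z),
    wirtinger a z (aa z) (ab z) & wirtinger b z (ab z) (bb z)].

Lemma smooth2_linear (p q k : C) : smooth2 (fun w => p * w + q * conjc w + k).
Proof.
split; first exact: growth_linear.
have wc (m z : C) : wirtinger (fun=> m) z 0 0.
  exact: cder_wirtinger (cder_cst m z).
exists (fun=> p), (fun=> q), (fun=> 0), (fun=> 0), (fun=> 0); split.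
  exists 0%N, (nc p); split; first exact: normc_ge0.
  by move=> z; rewrite expr0 mulr1.
by move=> z; split; [exact: wirtinger_linear|exact: wc|exact: wc].
Qed.

Lemma smooth2D u v : smooth2 u -> smooth2 v -> smooth2 (fun w => u w + v w).
Proof.
move=> [gu [a [b [aa [ab [bb [ga ha]]]]]]] [gv [a' [b' [aa' [ab' [bb' [ga' ha']]]]]]].
split; first exact: growthD.
exists (fun z => a z + a' z), (fun z => b z + b' z), (fun z => aa z + aa' z),
  (fun z => ab z + ab' z), (fun z => bb z + bb' z); split; first exact: growthD.
by move=> z; have [h1 h2 h3] := ha z; have [h4 h5 h6] := ha' z; split; exact: wirtingerD.
Qed.

Lemma smooth2M u v : smooth2 u -> smooth2 v -> smooth2 (fun w => u w * v w).
Proof.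
move=> [gu [a [b [aa [ab [bb [ga ha]]]]]]] [gv [a' [b' [aa' [ab' [bb' [ga' ha']]]]]]].
split; first exact: growthM.
exists (fun z => u z * a' z + a z * v z), (fun z => u z * b' z + b z * v z),
  (fun z => (u z * aa' z + a z * a' z) + (a z * a' z + aa z * v z)),
  (fun z => (u z * ab' z + b z * a' z) + (a z * b' z + ab z * v z)),
  (fun z => (u z * bb' z + b z * b' z) + (b z * b' z + bb z * v z)); split.
  by apply: growthD; exact: growthM.
move=> z; have [h1 h2 h3] := ha z; have [h4 h5 h6] := ha' z; split.
- exact: wirtingerM.
- exact: wirtingerD (wirtingerM h1 h5) (wirtingerM h2 h4).
- apply: wirtinger_eq (wirtingerD (wirtingerM h1 h6) (wirtingerM h3 h4)) _ (erefl _).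
  by ring.
Qed.

(** Induction on both variables, from [x = (z + conj z) / 2] and [y = - i (z - conj z) / 2]. *)
Lemma smooth2_poly (phi : {poly {poly R}}) :
  smooth2 (fun z => (phi.[complex.Re z, complex.Im z])%:C).
Proof.
have sx : smooth2 (fun z => (complex.Re z)%:C).
  have -> : (fun z => (complex.Re z)%:C) = (fun z : C => 2^-1 * z + 2^-1 * conjc z + 0).
    apply/funext => z; rewrite addr0 -mulrDr; case: z => x y.
    by apply: (mulfI (_ : 2 != 0 :> C)); rewrite ?pnatr_eq0 // mulVKf ?pnatr_eq0 //;
      apply/eqP; rewrite eq_complex /=; apply/andP; split; apply/eqP; ring.
  exact: smooth2_linear.
have sy : smooth2 (fun z => (complex.Im z)%:C).
  have -> : (fun z => (complex.Im z)%:C) =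
      (fun z : C => (- 'i%C / 2) * z + ('i%C / 2) * conjc z + 0).
    apply/funext => z; rewrite addr0 !(mulrAC _ 2^-1) -mulrDl; case: z => x y.
    apply: (mulIf (_ : 2 != 0 :> C)); rewrite ?pnatr_eq0 // divfK ?pnatr_eq0 //.
    by apply/eqP; rewrite eq_complex /=; apply/andP; split; apply/eqP; ring.
  exact: smooth2_linear.
have s0 (k : R) : smooth2 (fun=> k%:C).
  have -> : (fun=> k%:C) = (fun z : C => 0 * z + 0 * conjc z + k%:C).
    by apply/funext => z; rewrite !mul0r !add0r.
  exact: smooth2_linear.
have s1 (p : {poly R}) : smooth2 (fun z => (p.[complex.Im z])%:C).
  elim/poly_ind: p => [|p k ih].
    by under eq_fun do rewrite horner0; exact: s0.
  have -> : (fun z => ((p * 'X + k%:P).[complex.Im z])%:C) =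
      (fun z : C => (p.[complex.Im z])%:C * (complex.Im z)%:C + k%:C).
    by apply/funext => z; rewrite hornerMXaddC rmorphD rmorphM.
  by apply: smooth2D (s0 k); exact: smooth2M.
elim/poly_ind: phi => [|p k ih].
  by under eq_fun do rewrite !horner0; exact: s0.
have -> : (fun z => ((p * 'X + k%:P).[complex.Re z, complex.Im z])%:C) =
    (fun z : C => (p.[complex.Re z, complex.Im z])%:C * (complex.Re z)%:C +
      (k.[complex.Im z])%:C).
  by apply/funext => z; rewrite hornerMXaddC hornerD hornerM hornerC rmorphD rmorphM.
by apply: smooth2D (s1 k); exact: smooth2M.
Qed.

Lemma wirtinger_dir_deriv (u : C -> R) z (a b v : C) : nc v = 1 ->
  wirtinger (fun w => (u w)%:C) z a b ->
  (dir_deriv v u z)%:C = a * v + b * conjc v.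
Proof.
move=> v1 h; have /rderP[h1 h2] := wirtinger_line v1 h.
rewrite [RHS]complex_eta (dir_deriv_val h1).
have <- := (@dir_deriv_val R v (fun=> 0) z _ h2).
by rewrite /dir_deriv derive1_cst.
Qed.

(** [h = 2 a = phi_x - i phi_y], with [a] the first Wirtinger derivative. Harmonicity says that the
    other Wirtinger derivative of [a] vanishes, which is complex differentiability. *)
Lemma harmonic_gradient (phi : {poly {poly R}}) : harmonic_poly phi ->
  exists h : C -> C, [/\ forall z, derivable h z 1, growth h &
    forall z, wirtinger (fun w => (phi.[complex.Re w, complex.Im w])%:C) z
      (h z / 2) (conjc (h z) / 2)].
Proof.
move=> harm; have [_ [a [b [aa [ab [bb [ga ha]]]]]]] := smooth2_poly phi.
set u := fun w : C => phi.[complex.Re w, complex.Im w].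
have i1 : nc 'i%C = 1 by exact: nci.
have ux z : (dir_deriv 1 u z)%:C = a z + b z.
  by have [h _ _] := ha z; rewrite (wirtinger_dir_deriv nc1 h) rmorph1 !mulr1.
have uy z : (dir_deriv 'i%C u z)%:C = 'i%C * (a z - b z).
  have [h _ _] := ha z; rewrite (wirtinger_dir_deriv i1 h).
  rewrite conjc_i.
  by ring.
(* Because [phi] is real, both directional derivatives are real, and comparing imaginary parts
   identifies [b]. *)
have bE z : b z = conjc (a z).
  have := ux z; have := uy z; case: (a z) => p q; case: (b z) => r s /=.
  move=> /eqP; rewrite eq_complex /= => /andP[_ /eqP e1].
  move=> /eqP; rewrite eq_complex /= => /andP[_ /eqP e2].
  by congr (_ +i* _); move: e1 e2; clear; lra.
have uxx z : (dir_deriv 1 (dir_deriv 1 u) z)%:C = aa z + ab z + (ab z + bb z).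
  have [_ h1 h2] := ha z; have h := wirtingerD h1 h2.
  rewrite (_ : (fun w => a w + b w) = (fun w => (dir_deriv 1 u w)%:C)) in h; last first.
    by apply/funext => w; rewrite ux.
  by rewrite (wirtinger_dir_deriv nc1 h) rmorph1 !mulr1 addrACA.
have uyy z : (dir_deriv 'i%C (dir_deriv 'i%C u) z)%:C = - (aa z - ab z - (ab z - bb z)).
  have [_ h1 h2] := ha z.
  have hc : wirtinger (fun w : C => -1 * w + 0 * conjc w + 0) (b z) (-1) 0.
    exact: wirtinger_linear.
  have m1 (k y : C) : wirtinger (fun=> k) y 0 0 by exact: cder_wirtinger (cder_cst k y).
  have h := wirtingerM (m1 'i%C z) (wirtingerD h1 (wirtingerM (m1 (-1) z) h2)).
  rewrite (_ : (fun w => _) = (fun w => (dir_deriv 'i%C u w)%:C)) in h; last first.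
    by apply/funext => w; rewrite uy; ring.
  rewrite (wirtinger_dir_deriv i1 h).
  rewrite conjc_i.
  by ring : (@sqr_i R).
(* In the sum of the two second derivatives [aa] and [bb] cancel, leaving [4 ab] for the
   Laplacian. *)
have ab0 z : ab z = 0.
  have e : aa z + ab z + (ab z + bb z) - (aa z - ab z - (ab z - bb z)) = 0.
    by rewrite -uxx -uyy -rmorphD -laplacianE; exact: congr1 (harm z).
  have : 4 * ab z = 0.
    by move: (aa z) (ab z) (bb z) e => p q r e; rewrite -[RHS]e; clear; ring.
  by move=> /eqP; rewrite mulf_eq0 pnatr_eq0 /= => /eqP.
exists (fun z => 2 * a z); split.
- move=> z; have [_ h _] := ha z; rewrite ab0 in h.
  exact: cder_derivable (cderZ 2 (wirtinger_cder h)).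
- apply: growthM ga; exists 0%N, (nc 2); split; first exact: normc_ge0.
  by move=> z; rewrite expr0 mulr1.
- move=> z; have [h _ _] := ha z; apply: (wirtinger_eq h).
    by rewrite mulrAC divff ?mul1r // pnatr_eq0.
  by rewrite bE rmorphM rmorph_nat mulrAC divff ?mul1r // pnatr_eq0.
Qed.

End Wirtinger.

(** * Entire potentials and the plane as universal cover *)

Section Plane.
Context {R : realType}.
Local Notation C := R[i].
Local Notation nc := (@Normc.normc R).

(** Primitives on growing squares, normalised at 0, agree where both are defined; at each point one
    with a sufficiently large index is taken. *)
Lemma exists_entire_primitive (h : C -> C) (k : C) : (forall z, derivable h z 1) ->
  exists2 F : C -> C, F 0 = k & forall z, cder F z (h z).
Proof.
move=> dh; have ch z : ccont h z by exact: cder_ccont (derivable_cder (dh z)).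
have prim (n : nat) : exists F : C -> C, F 0 = k /\
    forall z, nc z < n%:R -> cder F z (h z).
  have [//|F hF] := @box_primitive R h 0 0 n%:R ch.
  exists (fun z => F z - (F 0 - k)); split; first by ring.
  move=> z zn; apply: cder_eq (cderB (hF z _ _) (cder_cst _ z)) (subr0 _).
    by rewrite subr0; apply: le_lt_trans zn; exact: nc_Re.
  by rewrite subr0; apply: le_lt_trans zn; exact: nc_Im.
have [F hF] := choice prim.
pose N (z : C) : nat := Num.bound (nc z).
have zN z : nc z < (N z)%:R by exact: archi_boundP (normc_ge0 z).
have agree n m z : nc z < n%:R -> (n <= m)%N -> F n z = F m z.
  move=> zn nm; have [Fn0 dFn] := hF n; have [Fm0 dFm] := hF m.
  have n0 : 0 < n%:R :> R by exact: le_lt_trans (normc_ge0 z) zn.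
  have d0 w : nc (w - 0) < n%:R -> cder (fun w => F n w - F m w) w 0.
    rewrite subr0 => wn; apply: cder_eq (cderB (dFn w wn) (dFm w _)) (subrr _).
    by apply: lt_le_trans wn _; rewrite ler_nat.
  have z1 : nc (z - 0) < n%:R by rewrite subr0.
  have z2 : nc (0 - 0 : C) < n%:R by rewrite subr0 nc0.
  have /eqP := @convex_deriv0 R _ _ (@convex_disc R 0 n%:R) d0 z 0 z1 z2.
  rewrite Fn0 Fm0 subrr.
  by rewrite subr_eq0 => /eqP.
exists (fun z => F (N z) z); first by have [] := hF (N 0).
move=> z; pose m : nat := Num.bound (nc z + 1).
have zm : nc z + 1 < m%:R by apply: archi_boundP; rewrite addr_ge0 ?normc_ge0.
have {}zm : nc z < m%:R by apply: lt_trans zm; rewrite ltrDl.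
have [_ dF] := hF m; apply: cder_near _ (dF z zm).
apply/nbhs_cP; exists (m%:R - nc z); first by rewrite subr_gt0.
move=> w wz; have wm : nc w < m%:R.
  by have := nc_leD (w - z) z; rewrite subrK; move: wz; clear; lra.
have [le|/ltnW le] := leqP m (N w); first exact: agree.
by rewrite (agree _ _ _ (zN w) le).
Qed.

(** Both Wirtinger derivatives of [(F + conj F) / 2 - phi] vanish, so it is constant, and it is 0 at
    the origin by the choice of [F 0]. *)
Lemma entire_potential (phi : {poly {poly R}}) (h : C -> C) :
  (forall z, derivable h z 1) ->
  (forall z, wirtinger (fun w => (phi.[complex.Re w, complex.Im w])%:C) z
      (h z / 2) (conjc (h z) / 2)) ->
  exists2 F : C -> C, forall z, cder F z (h z) &
    forall z, complex.Re (F z) = phi.[complex.Re z, complex.Im z].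
Proof.
move=> dh hphi.
set u := fun w : C => (phi.[complex.Re w, complex.Im w])%:C.
have [F F0 dF] := exists_entire_primitive (u 0) dh; exists F => //.
have d0 z : cder (fun w => (F w + conjc (F w)) * 2^-1 + (-1) * u w) z 0.
  apply: wirtinger_cder.
  have w1 (k : C) : wirtinger (fun=> k) z 0 0 by exact: cder_wirtinger (cder_cst k z).
  have h1 := cder_wirtinger (dF z).
  apply: wirtinger_eq (wirtingerD (wirtingerM (wirtingerD h1 (wirtinger_conj h1))
    (w1 2^-1)) (wirtingerM (w1 (-1)) (hphi z))) _ _.
    by rewrite rmorph0; ring.
  by ring.
move=> z; have := @convex_deriv0 R setT _ (fun _ _ _ _ _ _ => I) (fun z _ => d0 z) z 0 I I.
have re w : (F w + conjc (F w)) * 2^-1 = (complex.Re (F w))%:C.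
  apply: (mulIf (_ : 2 != 0 :> C)); rewrite ?pnatr_eq0 // divfK ?pnatr_eq0 //.
  by case: (F w) => x y; apply/eqP; rewrite eq_complex /=; apply/andP; split; apply/eqP; ring.
rewrite !re F0 /u !mulN1r /= subrr => /eqP; rewrite subr_eq0 => /eqP e.
exact: complexI e.
Qed.

Lemma plane_img_open (x : C) : open (id @` [set: C]).
Proof. by rewrite image_id; exact: openT. Qed.

Lemma plane_chart_holomorphic (x y q : C) : setT q -> setT q ->
  derivable ((fun z : C => z) \o (fun z : C => z)) q 1.
Proof. by move=> _ _; exact: derivable_id. Qed.

Definition complex_plane : riemann_surface R :=
  @RiemannSurface R C (fun _ z => z) (fun=> setT) (fun _ z => z)
    (fun=> openT) (fun=> I) plane_img_open (fun _ _ _ => erefl)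
    (fun _ _ _ => @cvg_id _ _) (fun _ _ _ => @cvg_id _ _)
    plane_chart_holomorphic (@norm_hausdorff _ _) connected_complex.

Lemma simply_connected_plane : simply_connected (R := R) C.
Proof.
have rc (a b : C) : continuous (fun t : R => a + t%:C * b).
  by move=> t; exact: rder_cont (rder_line a b t).
split=> [x y|c cc c01].
  exists (fun t => x + t%:C * (y - x)); split.
  - exact: continuous_subspaceT (rc _ _).
  - by rewrite mul0r addr0.
  - by rewrite mul1r addrC subrK.
(* The loop is continuous only within [[0, 1]]; composing it with the projection of the line to
   [[0, 1]] makes the straight-line homotopy continuous on the whole plane. *)
pose cl (t : R) : R := Num.max 0 (Num.min 1 t).
have cl01 t : 0 <= cl t <= 1.
  by rewrite /cl le_max lexx /= ge_max ler01 ge_min lexx.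
have clid t : 0 <= t <= 1 -> cl t = t.
  by move=> /andP[t0 t1]; rewrite /cl (min_idPr t1) (max_idPr t0).
have cll (t s : R) : `|cl t - cl s| <= `|t - s|.
  have clE x : (x <= 0 /\ cl x = 0) \/ (0 <= x <= 1 /\ cl x = x) \/ (1 <= x /\ cl x = 1).
    have [x0|x0] := leP x 0; [left|right].
      split=> //; apply/max_idPl; rewrite ge_min x0 orbT //.
    have [x1|x1] := leP x 1; [left|right].
      by split; [rewrite ltW|apply: clid; rewrite ltW].
    by split; [exact: ltW|rewrite /cl (min_idPl (ltW x1)) (max_idPr _) // ler01].
  have n1 := ler_norm (t - s); have n2 := ler_norm (s - t); rewrite distrC in n2.
  rewrite ler_norml; move: (clE t) (clE s) n1 n2; clear.
  by move=> [[? ->]|[[/andP[? ?] ->]|[? ->]]] [[? ->]|[[/andP[? ?] ->]|[? ->]]] ? ?;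
    apply/andP; split; lra.
have ccl : continuous (c \o cl).
  move=> t; have tI : `[0, 1]%classic (cl t) by rewrite /= in_itv /= cl01.
  have /subspace_continuousP /(_ _ tI) h := cc.
  move=> A /h [e e0 he]; apply/nbhs_rP; exists e => // s st.
  apply: he; last by rewrite /= in_itv /= cl01.
  by rewrite /ball /=; apply: le_lt_trans st; rewrite distrC.
exists (fun q : R * R => (1 - q.1)%:C * c (cl q.2) + q.1%:C * c 0); split.
  apply: continuous_subspaceT => q.
  have c1 : {for q, continuous (fun q : R * R => (c \o cl) q.2)}.
    by apply: (@continuous_comp _ _ _ snd (c \o cl)); [exact: cvg_snd|exact: ccl].
  have real (g : R * R -> R) : {for q, continuous g} ->
      {for q, continuous (fun q => (g q)%:C : C)}.
    move=> cg; apply: (@continuous_comp _ _ _ g (fun t : R => t%:C : C) q cg).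
    exact: rder_cont (rder_id _).
  have h1 : {for q, continuous (fun q : R * R => q.1%:C : C)} by apply: real; exact: cvg_fst.
  have h2 : {for q, continuous (fun q : R * R => (1 - q.1)%:C : C)}.
    by apply: real; apply: cvgB; [exact: cvg_cst|exact: cvg_fst].
  apply: (@cvgD C C); first exact: (@cvgM C _ _ _ _ _ _ _ h2 c1).
  by apply: (@cvgM C _ _ _ _ _ _ _ h1); exact: cvg_cst.
have c00 : cl 0 = 0 by apply: clid; rewrite lexx ler01.
have cl1 : cl 1 = 1 by apply: clid; rewrite lexx ler01.
move=> t t01; rewrite /= c00 cl1 (clid _ t01) -c01; split.
- by rewrite subr0 mul1r mul0r addr0.
- by rewrite subrr mul0r mul1r add0r.
- by rewrite -mulrDl -rmorphD subrK mul1r.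
- by rewrite -mulrDl -rmorphD subrK mul1r.
Qed.

Lemma punctured_infinity (q : @riemann_sphere R) : punctured infinity_end q <-> q <> None.
Proof. by split=> [/(_ ord0)|h j]. Qed.

Lemma plane_cover : universal_cover (punctured infinity_end)
  (Some : complex_plane -> @riemann_sphere R).
Proof.
have cS : continuous (Some : complex_plane -> @riemann_sphere R).
  exact: one_point_compactification_some_continuous.
split; last exact: simply_connected_plane.
- split => //.
    apply/seteqP; split=> [q [z _ <-]|[z|]]; first exact/punctured_infinity.
      by exists z.
    by move=> /punctured_infinity.
  move=> [y|/punctured_infinity //] _.
  exists [set q | q <> None]; split => //.
  + exact: (@sphere_dom_open R (Some 0)).
  + by move=> q ?; exact/punctured_infinity.
  exists unit, (fun=> setT), (fun _ q => odflt 0 q); split.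
  + by move=> _; exact: openT.
  + by move=> [] [].
  + by apply/seteqP; split=> [z _|z _] //; exists tt.
  + move=> _; split=> [//|[v|] //|v v0].
    exact: (@sphere_chart_continuous R (Some 0) v).
- split=> // x; exact: (@derivable_id _ _ _ _).
Qed.

Lemma entire_graph_zmc (phi : {poly {poly R}}) (F : C -> C) :
  (forall z, derivable F z 1) ->
  (forall z, complex.Re (F z) = phi.[complex.Re z, complex.Im z]) ->
  zmc_face (punctured infinity_end) (entire_graph phi).
Proof.
move=> dF FE.
have d1 (z : C) : cder (fun w => w) z 1 := cder_id z.
have d2 (z : C) : cder (fun w => - 'i%C * w) z (- 'i%C).
  by apply: cder_eq (cderZ _ (cder_id z)) (mulr1 _).
pose L (z : complex_plane) : C * C * C := (F z, z, - 'i%C * z).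
have D1 x : dcoef (crd1 \o L) x = 1 by exact: cder_val (d1 x).
have D2 x : dcoef (crd2 \o L) x = - 'i%C by exact: cder_val (d2 x).
exists complex_plane, Some, L; split; last first.
  by move=> x; rewrite D1 D2 mulrN opprK -expr2 sqr_i subrr.
split.
- exact: plane_cover.
- split=> x; first exact: dF.
    exact: cder_derivable (d1 x).
  exact: cder_derivable (d2 x).
- by move=> x [_ + _]; rewrite D1 => /eqP; rewrite oner_eq0.
- by move=> x; rewrite D1 D2 sqrrN sqr_i expr1n subrr.
- by exists (0 : C), (1 : C); apply/eqP; rewrite eq_sym oner_eq0.
- move=> z; rewrite /re3 /L /= FE; congr (_, _, _).
  by rewrite cReM /= oppr0 mul0r sub0r mulN1r opprK.
Qed.

End Plane.

(** * The lift-distance dominates planar coordinates *)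

Section LiftDistance.
Context {R : realType}.
Local Notation C := R[i].
Local Notation nc := (@Normc.normc R).
Local Notation I3 := (isotropic_space R).
Variables (S : riemann_surface R) (D : set S) (f : S -> I3).
Hypothesis zf : zmc_face D f.

Lemma first_fundamental_form_le q v : D q ->
  first_fundamental_form f q v <= lift_metric f q v.
Proof.
move=> Dq; rewrite (first_fundamental_formE zf Dq) /lift_metric /lift_factor.
have n0 (w : C) : 0 <= normsq w by rewrite addr_ge0 ?sqr_ge0.
apply: ler_wpM2r; first exact: n0.
have := n0 (omega f q (chart q q)); have := n0 (2 * del (crd0 \o f) q (chart q q)).
by clear; lra.
Qed.

(** The first fundamental form is at most the lift-metric, so the path minorants bound the
    coordinate increments by the lift-length of every admissible path. *)
Lemma planar_le_dist x y :
  (`|complex.Re (planar f y) - complex.Re (planar f x)|%:E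
     <= riemannian_dist D (lift_metric f) x y)%E /\
  (`|complex.Im (planar f y) - complex.Im (planar f x)|%:E
     <= riemannian_dist D (lift_metric f) x y)%E.
Proof.
have main (c : R -> S) : piecewise_C1 c 0 1 -> (forall t, 0 <= t <= 1 -> D (c t)) ->
    (`|complex.Re (planar f (c 1)) - complex.Re (planar f (c 0))|%:E
      <= path_length (lift_metric f) c `[0%R, 1%R])%E /\
    (`|complex.Im (planar f (c 1)) - complex.Im (planar f (c 0))|%:E
      <= path_length (lift_metric f) c `[0%R, 1%R])%E.
  move=> pc Dc; have [h1 h2] := piecewise_C1_minorant zf pc Dc.
  have J (t : R) : 0 < t < 1 -> `[0%R, 1%R]%classic t.
    by move=> /andP[t0 t1]; rewrite /= in_itv /= !ltW.
  have s0 t : 0 <= speed f c t by exact: sqrtr_ge0.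
  have le : (path_length (first_fundamental_form f) c `[0%R, 1%R]
      <= path_length (lift_metric f) c `[0%R, 1%R])%E.
    apply: ge0_le_integral_nomeas => t; first by move=> _; rewrite lee_fin sqrtr_ge0.
    rewrite /= in_itv /= => t01; rewrite lee_fin ler_wsqrtr //.
    exact: first_fundamental_form_le (Dc t t01).
  split.
    exact: (le_trans (minorant_integral h1 s0 J) le).
  exact: (le_trans (minorant_integral h2 s0 J) le).
split; apply: le_ereal_inf_tmp => _ [c [pc <- <- Dc ->]]; have [h1 h2] := main c pc Dc.
  exact: h1.
exact: h2.
Qed.

End LiftDistance.

Lemma cauchy_real_cvg (R : realType) (u : nat -> R) :
  (forall e : R, 0 < e -> exists N : nat, forall m n : nat,
    (N <= m)%N -> (N <= n)%N -> `|u m - u n| < e) ->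
  exists l : R, forall e : R, 0 < e -> exists N : nat, forall n : nat,
    (N <= n)%N -> `|u n - l| < e.
Proof.
move=> cu; have : cvg (u @ \oo).
  apply/cauchy_cvgP; apply/cauchy_ballP => e e0; rewrite !near_map2.
  have [N hN] := cu e e0.
  exists ([set n | (N <= n)%N], [set n | (N <= n)%N]); first by split; exists N.
  by move=> [m n] [/= Nm Nn]; exact: hN.
move=> cvu; exists (lim (u @ \oo)) => e e0.
have [N _ hN] : \forall n \near \oo, `|lim (u @ \oo) - u n| < e.
  by have /cvgrPdist_lt := cvu; apply.
by exists N => n Nn; rewrite distrC; exact: hN.
Qed.

(** * Completeness and the end of an entire graph *)

Section GraphEnds.
Context {R : realType}.
Local Notation C := R[i].
Local Notation nc := (@Normc.normc R).
Variable phi : {poly {poly R}}.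
Local Notation f := (entire_graph phi).
Local Notation D := (punctured (@infinity_end R)).
Hypothesis zf : zmc_face D f.

Lemma planar_entire_graph (z : C) : planar f (Some z) = z.
Proof. by case: z. Qed.

(** Since the planar part is the coordinate [z] itself, a Cauchy sequence for the lift-metric has
    Cauchy coordinates and converges at a finite point. *)
Lemma entire_graph_weakly_complete : weakly_complete D f.
Proof.
move=> u Du cu.
have [z hz] : exists z : nat -> C, forall n, u n = Some (z n).
  exists (fun n => if u n is Some z then z else 0) => n.
  by have /punctured_infinity := Du n; case: (u n).
have dist m n : (`|complex.Re (z m) - complex.Re (z n)|%:E
     <= riemannian_dist D (lift_metric f) (u n) (u m))%E /\
  (`|complex.Im (z m) - complex.Im (z n)|%:E
     <= riemannian_dist D (lift_metric f) (u n) (u m))%E.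
  by have := planar_le_dist zf (u n) (u m); rewrite !hz !planar_entire_graph.
have [a ha] : exists l : R, forall e : R, 0 < e -> exists N : nat, forall n : nat,
    (N <= n)%N -> `|complex.Re (z n) - l| < e.
  apply: cauchy_real_cvg => e /cu [N hN]; exists N => m n Nm Nn.
  have [h _] := dist m n; rewrite -lte_fin; apply: le_lt_trans h _; exact: hN.
have [b hb] : exists l : R, forall e : R, 0 < e -> exists N : nat, forall n : nat,
    (N <= n)%N -> `|complex.Im (z n) - l| < e.
  apply: cauchy_real_cvg => e /cu [N hN]; exists N => m n Nm Nn.
  have [_ h] := dist m n; rewrite -lte_fin; apply: le_lt_trans h _; exact: hN.
exists (Some (a +i* b)); first exact/punctured_infinity.
move=> A /sphere_nbhs_some /nbhs_cP [e e0 he].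
have e2 : 0 < e / 2 by rewrite divr_gt0.
have [N1 h1] := ha _ e2; have [N2 h2] := hb _ e2.
exists (maxn N1 N2) => // n /=; rewrite geq_max => /andP[n1 n2]; rewrite hz; apply: he.
apply: (le_lt_trans (nc_ReIm _)); rewrite ReD ImD ReN ImN /=.
by have := h1 n n1; have := h2 n n2; clear; lra.
Qed.

Lemma entire_graph_normal_form :
  normal_form (planar f \o chart_inv (None : @riemann_sphere R))
    (chart (None : @riemann_sphere R) None) 0 (-1) (fun=> 1).
Proof.
split => //; first exact: holo_cst.
- apply/nbhs_puncP; exists 1; first exact: ltr01.
  move=> z _; rewrite [chart _ _]/= => z0.
  by rewrite /= (negPf z0) planar_entire_graph subr0 add0r mulr1 exprN1.
Qed.

Lemma entire_graph_expanding : expanding_end D f None.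
Proof.
have [r er] := exists_end_disc (@infinity_end R) ord0.
have nD : ~ D None by move=> /(_ ord0).
have h := expanding_normal_form zf er nD entire_graph_normal_form.
by apply/h.
Qed.

Lemma ord_omega_entire_graph : ord_omega f None = - 2.
Proof.
have [r er] := exists_end_disc (@infinity_end R) ord0.
have h := ord_omega_normal_form zf er entire_graph_normal_form.
exact: h.
Qed.

Lemma end_order_sum_entire_graph : end_order_sum (@infinity_end R) 1 f = 2 * 1%:Z.
Proof.
rewrite /end_order_sum [X in - X](big_pred1 ord0); last by move=> j; rewrite !ord1.
rewrite [X in _ + X]big_pred0; last by move=> j; rewrite ord1.
have -> : @infinity_end R ord0 = None by [].
by rewrite ord_omega_entire_graph.
Qed.

End GraphEnds.

(** * The spherical derivative of the gradient *)

Section SphericalDerivative.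
Context {R : realType}.
Local Notation C := R[i].
Local Notation nc := (@Normc.normc R).
Variable h : C -> C.
Hypothesis dh : forall z, derivable h z 1.
Hypothesis gh : growth h.

Lemma cder_inversion (z : C) : z != 0 ->
  cder (fun w => h w^-1) z ('D_1 h z^-1 * (- 1 / z ^+ 2)).
Proof.
move=> z0; have e := @cder_comp R h (fun w => w^-1) z _ _ (cderV z0 (cder_id z)) (derivable_cder (@dh z^-1)).
exact: e.
Qed.

(** Polynomial growth puts [h(1/z)] in normal form at 0. For a positive exponent its derivative is
    bounded; for a negative one the squared modulus in the denominator of the spherical derivative
    has a pole of at least the order of the derivative. *)
Lemma spherical_bound_infinity : exists (rho K : R), [/\ 0 < rho <= 1, 0 <= K &
  forall z : C, 0 < nc z < rho ->
    nc ('D_1 h z^-1 * (- 1 / z ^+ 2)) <= K * (2 + nc (h z^-1) ^+ 2)].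
Proof.
(* A constant has no normal form, since exponent 0 is excluded; its derivative is 0. *)
have [[k hk]|ncst] := pselect (exists k, \forall z \near (0 : C)^', h z^-1 = k).
  have [d d0 hd] := (nbhs_puncP _ _).1 hk.
  exists (Num.min d 1), 0; split => //.
    by rewrite lt_min d0 ltr01 ge_min lexx orbT.
  move=> z /andP[z0]; rewrite lt_min => /andP[zd _].
  have zn : z != 0 by rewrite -nc_gt0.
  have near_k : \forall w \near z, h w^-1 = k.
    apply/nbhs_cP; exists (Num.min (d - nc z) (nc z)); first by rewrite lt_min subr_gt0 zd.
    move=> w; rewrite lt_min => /andP[w1 w2]; apply: hd.
      by rewrite subr0; have := nc_leD (w - z) z; rewrite subrK; move: w1; clear -dh gh; lra.
    by apply: contraTneq w2 => ->; rewrite sub0r ncN -leNgt.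
  have near_k' : \forall w \near z, k = h w^-1 by apply: filterS near_k.
  rewrite (cder_uniq (cder_inversion zn) (cder_near near_k' (cder_cst k z))) nc0 mul0r.
  exact: lexx.
have [N [K [K0 hK]]] := gh.
have d1 : \forall z \near (0 : C)^', derivable (fun z : C => (z - 0) ^+ N * h z^-1) z 1.
  apply/nbhs_puncP; exists 1 => // z _ z0.
  exact: cder_derivable (cderM (cderX N (cderB (cder_id z) (cder_cst 0 z))) (cder_inversion z0)).
have d2 : \forall z \near (0 : C)^', nc ((z - 0) ^+ N * h z^-1) <= K * 2 ^+ N.
  apply/nbhs_puncP; exists 1 => // z; rewrite subr0 => z1 z0.
  have zp : 0 < nc z by rewrite nc_gt0.
  rewrite ncM ncX mulrC; apply: (@le_trans _ _ (K * (1 + nc z^-1) ^+ N * nc z ^+ N)).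
    by apply: ler_wpM2r; [rewrite exprn_ge0 // normc_ge0|exact: hK].
  rewrite -mulrA -exprMn; apply: ler_wpM2l => //.
  rewrite normcV mulrDl mul1r mulVf ?gt_eqF //.
  by rewrite lerXn2r ?nnegrE ?addr_ge0 ?normc_ge0 //; move: z1; clear -dh gh; lra.
have [G hG GE] := holo_removable d1 d2.
have [k [a [U nf]]] := pole_normal_form hG GE ncst.
have [V [hV V0] dV] := normal_form_deriv nf.
have [a0 hU U0 PE] := nf.
have U1 : 0 < nc (U 0) / 2 by rewrite divr_gt0 ?nc_gt0.
have n1 : \forall z \near (0 : C)^', nc (V z) <= nc (V 0) + 1.
  apply: nbhs_dnbhs; have [d d0 hd] := (ccont_epsP _ _).1 (holo_ccont hV) _ (@ltr01 R).
  apply/nbhs_cP; exists d => // z /hd; have := nc_leD (V z - V 0) (V 0); rewrite subrK.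
  by clear -dh gh; lra.
have n2 : \forall z \near (0 : C)^', nc (U 0) / 2 <= nc (U z).
  apply: nbhs_dnbhs; have [d d0 hd] := (ccont_epsP _ _).1 (holo_ccont hU) _ U1.
  apply/nbhs_cP; exists d => // z /hd; have := nc_subl (U 0) (U z); rewrite (normcB (U 0)).
  by clear -dh gh; lra.
have [d d0 hd] := (nbhs_puncP _ _).1 (filterI (filterI n1 n2) (filterI dV PE)).
pose m := nc (U 0) / 2; pose M := nc (V 0) + 1.
have M0 : 0 <= M by rewrite addr_ge0 ?normc_ge0.
have Mm : 0 <= M / m ^+ 2 by rewrite divr_ge0 ?sqr_ge0.
have k2 : 0 <= 2 + nc k ^+ 2 by rewrite addr_ge0 ?ler0n ?sqr_ge0.
exists (Num.min d 1), (M + M / m ^+ 2 * (2 + nc k ^+ 2)); split.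
- by rewrite lt_min d0 ltr01 ge_min lexx orbT.
- by apply: addr_ge0 => //; exact: mulr_ge0.
move=> z /andP[z0]; rewrite lt_min => /andP[zd z1].
have zn : z != 0 by rewrite -nc_gt0.
have [|[Vz Uz] [dz gz]] := hd z _ zn; first by rewrite subr0.
rewrite subr0 in dz gz.
rewrite (cder_uniq (cder_inversion zn) dz) ncM.
set H := nc (h z^-1); set q := nc z.
have B0 : 0 <= M / m ^+ 2 * (2 + nc k ^+ 2).
  exact: mulr_ge0.
have H0 : 0 <= H ^+ 2 := sqr_ge0 _.
case: a a0 gz {nf PE dz hd dV} => [[//|n]|n] a0 gz.
  have -> : Posz n.+1 - 1 = Posz n by rewrite -addn1 PoszD addrK.
  rewrite -exprnP ncX -/q.
  have q1 : q ^+ n <= 1 by apply: exprn_ile1; [exact: normc_ge0|exact: ltW].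
  have : q ^+ n * nc (V z) <= M.
    by rewrite -[leRHS]mul1r; apply: ler_pM; rewrite ?exprn_ge0 ?normc_ge0.
  move=> /le_trans; apply; rewrite -[leLHS]mulr1; apply: ler_pM => //.
    by rewrite lerDl.
  by move: H0; clear -dh gh; lra.
have e1 : nc (z ^ (Negz n - 1)) = (q ^+ n.+2)^-1.
  have -> : Negz n - 1 = Negz n.+1 by rewrite !NegzE -opprD -PoszD addn1.
  by rewrite NegzE -exprnN -[X in nc X]div1r nc_div nc1 div1r ncX.
have e2 : nc (z ^ Negz n) = (q ^+ n.+1)^-1.
  by rewrite NegzE -exprnN -[X in nc X]div1r nc_div nc1 div1r ncX.
pose t := (q ^+ n.+1)^-1.
have t0 : 0 < t by rewrite invr_gt0 exprn_gt0.
have mp : 0 < m by exact: U1.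
(* With a pole of order [n + 1], the derivative has a pole of order [n + 2], and
   [n + 2 <= 2 (n + 1)]. *)
have le1 : (q ^+ n.+2)^-1 <= t ^+ 2.
  rewrite /t exprVn -exprM lef_pV2 ?posrE ?exprn_gt0 //.
  have nn : (n.+2 <= n.+1 * 2)%N by rewrite mulSn -addn2 addnC leq_add2l leq_pmulr.
  exact: ler_wiXn2l (normc_ge0 z) (ltW z1) _ _ nn.
have le2 : m * t <= H + nc k.
  have -> : H = nc (k + z ^ Negz n * U z) by rewrite -gz.
  have := nc_leB (k + z ^ Negz n * U z) k; rewrite addrC addKr ncM e2 -/t.
  have : m * t <= t * nc (U z) by rewrite mulrC; apply: ler_wpM2l Uz; exact: ltW.
  by clear -dh gh; lra.
have le3 : (m * t) ^+ 2 <= 2 * H ^+ 2 + 2 * nc k ^+ 2.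
  apply: (@le_trans _ _ ((H + nc k) ^+ 2)).
    have mt0 : 0 <= m * t by exact: mulr_ge0 (ltW mp) (ltW t0).
    have Hk0 : 0 <= H + nc k by exact: addr_ge0 (normc_ge0 _) (normc_ge0 _).
    by rewrite lerXn2r ?nnegrE.
  by have := sqr_ge0 (H - nc k); clear -dh gh; nra.
rewrite e1; apply: (@le_trans _ _ (t ^+ 2 * M)).
  by apply: ler_pM; rewrite ?invr_ge0 ?exprn_ge0 ?normc_ge0.
apply: (@le_trans _ _ (M / m ^+ 2 * (2 * H ^+ 2 + 2 * nc k ^+ 2))).
  rewrite mulrC -mulrA; apply: ler_wpM2l => //.
  by rewrite mulrC ler_pdivlMr ?exprn_gt0 // -exprMn mulrC.
apply: (@le_trans _ _ (M / m ^+ 2 * (2 + nc k ^+ 2) * (2 + H ^+ 2))).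
  rewrite -[leRHS]mulrA; apply: ler_wpM2l => //.
  by have := mulr_ge0 (sqr_ge0 (nc k)) H0; move: (sqr_ge0 (nc k)) H0; clear -dh gh; lra.
by rewrite [leRHS]mulrDl lerDr mulr_ge0 // addr_ge0.
Qed.

(** This says that [h] has bounded derivative for the round metrics on source and target: by
    compactness for [|z| <= 1 / rho], and by inversion beyond. *)
Lemma spherical_bound : exists2 K : R, 0 <= K & forall z : C,
  nc ('D_1 h z) * (1 + nc z ^+ 2) <= K * (2 + nc (h z) ^+ 2).
Proof.
have [rho [K1 [/andP[rho0 rho1] K10 hK1]]] := spherical_bound_infinity.
have hh z : holo h z by apply/holoP; exists 1; [exact: ltr01|move=> w _; exact: dh].
have [M hM] := @ccont_bounded R (fun z => 'D_1 h z) 0 rho^-1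
  (fun z _ => holo_ccont (holo_deriv (hh z))).
have M0 : 0 <= M.
  apply: le_trans (hM 0 _); first exact: normc_ge0.
  by rewrite subr0 nc0 invr_ge0 ltW.
have r2 : 0 <= 1 + rho^-1 ^+ 2 by rewrite addr_ge0 ?sqr_ge0.
(* Beyond the disc [|z| >= 1], so [1 + |z|^2 <= 2 |z|^2], whence [2 * K1]; the other term bounds the
   left-hand side on the disc. *)
exists (2 * K1 + M * (1 + rho^-1 ^+ 2)).
  by rewrite addr_ge0 ?mulr_ge0.
move=> z; have H0 : 0 <= nc (h z) ^+ 2 := sqr_ge0 _.
rewrite mulrDl; have A0 := mulr_ge0 (mulr_ge0 M0 r2) H0.
have B0 := mulr_ge0 K10 H0; have C0 := mulr_ge0 M0 r2.
have [zr|zr] := leP (nc z) rho^-1.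
  have : nc ('D_1 h z) * (1 + nc z ^+ 2) <= M * (1 + rho^-1 ^+ 2).
    apply: ler_pM; rewrite ?normc_ge0 ?addr_ge0 ?sqr_ge0 //.
      by apply: hM; rewrite subr0.
    by rewrite lerD2l lerXn2r ?nnegrE ?normc_ge0 // invr_ge0 ltW.
  by move: A0 B0 C0 K10; clear -dh gh; rewrite !mulrDr; lra.
have zp : 0 < nc z by apply: lt_trans zr; rewrite invr_gt0.
have z0 : z != 0 by rewrite -nc_gt0.
have : 0 < nc z^-1 < rho.
  rewrite normcV invr_gt0 zp /=; rewrite -[rho]invrK ltf_pV2 ?posrE //.
  by rewrite invr_gt0.
move=> /(hK1 z^-1) h1. rewrite (invrK z) exprVn invrK in h1.
have {}h1 : nc ('D_1 h z) * nc z ^+ 2 <= K1 * (2 + nc (h z) ^+ 2).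
  by move: h1; rewrite mulN1r ncM ncN ncX.
have z1 : 1 <= nc z ^+ 2.
  apply: exprn_ege1; apply: (le_trans _ (ltW zr)).
  by rewrite invf_ge1.
have := ler_wpM2l (normc_ge0 ('D_1 h z)) z1; rewrite mulr1 mulrDr mulr1.
by move: h1 A0 B0 C0 K10; clear -dh gh; rewrite !mulrDr; lra.
Qed.

End SphericalDerivative.

(** * An integrable majorant on the plane *)

Section PlaneIntegral.
Context {R : realType}.
Local Notation mu := (@lebesgue_measure R).
Local Notation R1 := (measurableTypeR R).
Local Notation mu2 := (mu \x mu)%E.

(** A product of one-variable kernels, integrable by Tonelli, that dominates [C (1 + |z|^2)^-2]
    because of [oneDsqr_mul_le]. *)
Definition bell (C : R) (ab : R1 * R1) : R :=
  C * ((oneDsqr (ab.1 : R))^-1 * (oneDsqr (ab.2 : R))^-1).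

Lemma bell_ge0 (C : R) ab : 0 <= C -> 0 <= bell C ab.
Proof. by move=> C0; rewrite /bell !mulr_ge0 ?invr_ge0 // addr_ge0 ?sqr_ge0. Qed.

Lemma measurable_bell (C : R) : measurable_fun setT (EFin \o bell C).
Proof.
have m1 : measurable_fun setT ((fun x : R => (oneDsqr x)^-1) : R1 -> R1).
  by apply: continuous_measurable_fun => x; exact: continuous_oneDsqrV.
apply/measurable_EFinP; apply: measurable_funM; first exact: measurable_cst.
apply: measurable_funM.
  exact: (measurableT_comp m1 (@measurable_fst _ _ R1 R1)).
exact: (measurableT_comp m1 (@measurable_snd _ _ R1 R1)).
Qed.

Lemma integral_oneDsqrV : (\int[mu]_x ((oneDsqr x)^-1)%:E = (pi : R)%:E)%E.
Proof.
rewrite ge0_symfun_integralT; first last.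
- by move=> x; rewrite /= /oneDsqr sqrrN.
- exact: continuous_oneDsqrV.
- by move=> x; rewrite invr_ge0 addr_ge0 ?sqr_ge0.
by rewrite -set_itvcy integral0y_oneDsqr -EFinM mulrC divfK.
Qed.

Lemma integral_bell (C : R) : 0 <= C ->
  (\int[mu2]_ab (bell C ab)%:E = (C * pi * pi)%:E)%E.
Proof.
move=> C0; rewrite fubini_tonelli1; last 2 first.
- exact: measurable_bell.
- by move=> x; rewrite lee_fin bell_ge0.
have m1 : measurable_fun (setT : set R1) (fun x : R1 => ((oneDsqr (x : R))^-1)%:E).
  apply/measurable_EFinP; apply: continuous_measurable_fun => x.
  exact: continuous_oneDsqrV.
have p0 (x : R) : 0 <= (oneDsqr x)^-1 by rewrite invr_ge0 addr_ge0 ?sqr_ge0.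
have -> : fubini_F mu (fun ab : R1 * R1 => (bell C ab)%:E) =
    (fun x : R1 => (C * pi)%:E * ((oneDsqr (x : R))^-1)%:E)%E.
  apply/funext => x; rewrite /fubini_F.
  transitivity (\int[mu]_y ((C * (oneDsqr (x : R))^-1)%:E * ((oneDsqr (y : R))^-1)%:E))%E.
    by apply: eq_integral => y _; rewrite -EFinM /bell /= mulrA.
  rewrite ge0_integralZl //; last by rewrite lee_fin mulr_ge0.
  by rewrite integral_oneDsqrV -!EFinM mulrAC.
rewrite ge0_integralZl //; last by rewrite lee_fin mulr_ge0 ?pi_ge0.
by rewrite integral_oneDsqrV -EFinM.
Qed.

Lemma disjoint_integrals_le (N : nat) (E : 'I_N -> set (R1 * R1)) (P : pred 'I_N)
    (g : 'I_N -> R1 * R1 -> \bar R) (C : R) : 0 <= C ->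
  (forall i, measurable (E i)) ->
  (forall i j ab, P i -> P j -> E i ab -> E j ab -> i = j) ->
  (forall i ab, P i -> E i ab -> (0 <= g i ab <= (bell C ab)%:E)%E) ->
  (\sum_(i < N | P i) \int[mu2]_(ab in E i) g i ab <= (C * pi * pi)%:E)%E.
Proof.
move=> C0 mE dE gE; rewrite -(integral_bell C0).
apply: (@le_trans _ _ (\sum_(i < N | P i) \int[mu2]_(ab in E i) (bell C ab)%:E)%E).
  apply: lee_sum => i Pi; apply: ge0_le_integral_nomeas => ab /(gE i ab Pi) /andP[h1 h2].
    exact: h1.
  exact: h2.
have b0 ab : (0 <= (bell C ab)%:E)%E by rewrite lee_fin bell_ge0.
rewrite -big_filter -ge0_integral_bigsetU //.
- apply: ge0_subset_integral => //.
  + by apply: bigsetU_measurable => i _; exact: mE.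
  + exact: measurable_bell.
- exact/filter_uniq/index_enum_uniq.
- move=> i j; rewrite /= !mem_filter => /andP[Pi _] /andP[Pj _] [ab [h1 h2]].
  exact: dE Pi Pj h1 h2.
- apply: measurable_funS (measurable_bell C) => //.
Qed.

End PlaneIntegral.

Lemma oneDsqr_mul_le (R : realType) (a b : R) :
  oneDsqr a * oneDsqr b <= (1 + (a ^+ 2 + b ^+ 2)) ^+ 2.
Proof.
rewrite /oneDsqr; move: (sqr_ge0 a) (sqr_ge0 b).
by move: (a ^+ 2) (b ^+ 2) => x y x0 y0; have := mulr_ge0 x0 y0; nra.
Qed.

(** * Finite total curvature of entire graphs *)

Section FiniteType.
Context {R : realType}.
Local Notation C := R[i].
Local Notation nc := (@Normc.normc R).
Local Notation mu := (@lebesgue_measure R).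
Variables (phi : {poly {poly R}}) (h F : C -> C).
Local Notation f := (entire_graph phi).
Local Notation D := (punctured (@infinity_end R)).
Hypothesis dh : forall z : C, derivable h z 1.
Hypothesis gh : growth h.
Hypothesis dF : forall z : C, cder F z (h z).
Hypothesis FE : forall z : C, complex.Re (F z) = phi.[complex.Re z, complex.Im z].

Let hF z : holo F z.
Proof. by apply/holoP; exists 1; [exact: ltr01|move=> w _; exact: cder_derivable (dF w)]. Qed.

Let hh z : holo h z.
Proof. by apply/holoP; exists 1; [exact: ltr01|move=> w _; exact: dh]. Qed.

Let hD : (fun z => 'D_1 F z) = h.
Proof. by apply/funext => z; exact: cder_val (dF z). Qed.

Lemma graph_density_plane (y z : C) :
  `|gauss_curvature (lift_factor f (Some y)) z| * lift_factor f (Some y) z =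
  4 * nc ('D_1 h z) ^+ 2 / (2 + nc (h z) ^+ 2) ^+ 2.
Proof.
have d1 : (fun z : C => 'D_1 (fun w : C => w) z) = (fun=> 1).
  by apply/funext => w; exact: cder_val (cder_id w).
have ld : local_data f (Some y) z F (fun w => w).
  split; [exact: hF|exact: holo_id| | |].
  - by left; have := congr1 (@^~ z) d1 => /= ->; exact: oner_neq0.
  - move=> /nbhs_singleton; rewrite (cder_val (cder_id z)) => /eqP.
    by rewrite oner_eq0.
  - by apply/nbhs_cP; exists 1; [exact: ltr01|move=> w _; rewrite FE].
have e : curv_density (fun w => 'D_1 (fun w : C => w) w) (fun w => 'D_1 F w) z =
    curv_density (fun=> 1) h z := congr2 (fun p q => curv_density p q z) d1 hD.
apply: (etrans (ld_curvature ld)); apply: (etrans e).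
(* [curv_density_quotient] is stated on a punctured disc; here nothing is singular, and the disc
   around [z - 1] is simply one whose puncture is not [z]. *)
have pz : punc (z - 1) 2 z.
  by rewrite /punc /= opprB addrCA subrr addr0 nc1 ltr01 ltr1n.
rewrite (@curv_density_quotient R (fun=> 1) h (z - 1) 2) //.
- have -> : (fun y : C => h y / 1) = h by apply/funext => w; rewrite divr1.
  by rewrite divr1.
- by move=> w _; exact: holo_cst.
Qed.

Lemma graph_density_infinity (z : C) : z != 0 ->
  `|gauss_curvature (lift_factor f None) z| * lift_factor f None z =
  4 * nc ('D_1 h z^-1 * (- 1 / z ^+ 2)) ^+ 2 / (2 + nc (h z^-1) ^+ 2) ^+ 2.
Proof.
move=> z0; pose P (w : C) : C := w^-1; pose G (w : C) : C := F w^-1.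
have dP w : w != 0 -> cder P w (- 1 / w ^+ 2) by move=> w0; exact: cderV w0 (cder_id w).
have dG w : w != 0 -> cder G w (h w^-1 * (- 1 / w ^+ 2)).
  by move=> w0; have e := @cder_comp R F P w _ _ (dP w w0) (dF w^-1); exact: e.
have dP0 w : w != 0 -> 'D_1 P w != 0.
  move=> w0; rewrite (cder_val (dP w w0)) mulf_neq0 ?invr_eq0 ?expf_neq0 //.
have hP w : w != 0 -> holo P w by move=> w0; exact: holoV w0 (holo_id w).
have hG w : w != 0 -> holo G w.
  by move=> w0; have e := @holo_comp R F P w (hP w w0) (hF w^-1); exact: e.
have ld : local_data f None z G P.
  split; [exact: hG|exact: hP| | |].
  - by left; exact: dP0.
  - by move=> /nbhs_singleton /eqP; apply/negP; exact: dP0.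
  - by apply: filterS (near_complex_neq0 z0) => w w0; rewrite /= (negPf w0) /= FE.
apply: (etrans (ld_curvature ld)).
have pun (w : C) (r : R) : punc 0 r w -> w != 0 by move=> /andP[+ _]; rewrite subr0 nc_gt0.
have pz : punc 0 (nc z + 1) z.
  by rewrite /punc /= subr0 nc_gt0 z0 ltrDl ltr01.
rewrite (@curv_density_quotient R (fun w => 'D_1 P w) (fun w => 'D_1 G w) 0 (nc z + 1)) //.
- have q w : w != 0 -> 'D_1 G w / 'D_1 P w = h w^-1.
    by move=> w0; rewrite (cder_val (dG w w0)) (cder_val (dP w w0)) mulfK // -(cder_val (dP w w0)) dP0.
  have near_q : \forall w \near z, h w^-1 = 'D_1 G w / 'D_1 P w.
    by apply: filterS (near_complex_neq0 z0) => w w0; rewrite q.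
  have dq := cder_val (cder_near near_q (cder_inversion dh z0)).
  exact: (congr2 (fun a b : C => 4 * nc a ^+ 2 / (2 + nc b ^+ 2) ^+ 2) dq (q z z0)).
- by move=> w /pun w0; exact: holo_deriv (hP w w0).
- by move=> w /pun w0; exact: holo_deriv (hG w w0).
- exact: dP0.
Qed.

(** The density is the square of a spherical derivative, and [|dz| / (1 + |z|^2)] is invariant under
    inversion, so one bound serves both kinds of chart. *)
Lemma graph_density_le : exists2 K : R, 0 <= K & forall x q, D q -> chart_dom x q ->
  0 <= `|gauss_curvature (lift_factor f x) (chart x q)| * lift_factor f x (chart x q)
    <= K / (1 + nc (chart x q) ^+ 2) ^+ 2.
Proof.
have [K K0 hK] := spherical_bound dh gh.
have main (A H t : R) : 0 <= A -> 0 <= H -> 0 <= t -> A * (1 + t) <= K * (2 + H) ->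
    0 <= 4 * A ^+ 2 / (2 + H) ^+ 2 <= 4 * K ^+ 2 / (1 + t) ^+ 2.
  move=> A0 H0 t0 le; have H2 : 0 < 2 + H by rewrite ltr_pwDl.
  have t1 : 0 < 1 + t by rewrite ltr_pwDl.
  have A2 : 0 <= 4 * A ^+ 2 by rewrite mulr_ge0 ?sqr_ge0.
  rewrite (divr_ge0 A2 (sqr_ge0 _)) /=.
  rewrite ler_pdivrMr ?exprn_gt0 // mulrAC ler_pdivlMr ?exprn_gt0 //.
  have -> : 4 * A ^+ 2 * (1 + t) ^+ 2 = 4 * (A * (1 + t)) ^+ 2 by ring.
  have -> : 4 * K ^+ 2 * (2 + H) ^+ 2 = 4 * (K * (2 + H)) ^+ 2 by ring.
  apply: (ler_wpM2l (ler0n _ 4)).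
  by rewrite lerXn2r ?nnegrE //; apply: mulr_ge0 => //; exact: ltW.
exists (4 * K ^+ 2); first by rewrite mulr_ge0 ?sqr_ge0.
move=> [y|] [v|] Dq dq.
- rewrite [chart _ _]/= graph_density_plane; apply: main; [exact: normc_ge0|exact: sqr_ge0|exact: sqr_ge0|exact: hK].
- by case/punctured_infinity: Dq.
- have v0 : v != 0 by apply/eqP => v0; apply: dq; rewrite v0.
  rewrite [chart _ _]/= graph_density_infinity ?invr_eq0 // invrK.
  apply: main; rewrite ?normc_ge0 ?sqr_ge0 //.
  have e : nc ('D_1 h v * (-1 / v^-1 ^+ 2)) = nc ('D_1 h v) * nc v ^+ 2.
    by rewrite exprVn invrK mulN1r ncM ncN ncX.
  rewrite e normcV -mulrA mulrDr mulr1 exprVn mulfV ?expf_neq0 ?gt_eqF ?nc_gt0 // addrC.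
  exact: hK.
- by case/punctured_infinity: Dq.
Qed.

Lemma entire_graph_finite_type : finite_type D f.
Proof.
have [K K0 hK] := graph_density_le.
apply: (@le_lt_trans _ _ ((K * pi * pi)%:E + (K * pi * pi)%:E)%E); last first.
  by rewrite -EFinD ltry.
apply: ge_ereal_sup => _ [N [x [A [AD tA mA ->]]]].
set E := fun i => [set ab : R * R | exists2 q, A i q & chart (x i) q = ab.1 +i* ab.2].
(* The family is split by kind of chart: all finite charts share the coordinate [z], so within each
   kind disjoint sets have disjoint images, and each kind contributes at most the integral of
   [bell K]. *)
pose P i := if x i is Some _ then true else false.
rewrite (bigID P) /=.
have bound i ab : E i ab -> (0 <=
    (`|gauss_curvature (lift_factor f (x i)) (ab.1 +i* ab.2)|
               * lift_factor f (x i) (ab.1 +i* ab.2))%:E <= (bell K ab)%:E)%E.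
  move=> [q Aq e]; have [Dq dq] := AD i q Aq.
  have := hK (x i) q Dq dq; rewrite e !lee_fin => /andP[-> h1] /=.
  apply: (le_trans h1); rewrite /bell; apply: ler_wpM2l => //.
  rewrite nc_sqr /= -invfM lef_pV2 ?posrE.
  - exact: oneDsqr_mul_le.
  - by rewrite exprn_gt0 // ltr_pwDl // addr_ge0 ?sqr_ge0.
  - by rewrite mulr_gt0 // ltr_pwDl ?sqr_ge0.
have inj i j ab : P i = P j -> E i ab -> E j ab -> i = j.
  move=> Pij [q Aq e] [q' Aq' e'].
  have [_ dq] := AD i q Aq; have [_ dq'] := AD j q' Aq'.
  have qq : q = q'.
    rewrite -(chartK dq) -(chartK dq') e e'.
    by move: Pij; rewrite /P; case: (x i); case: (x j).
  by apply: (tA i j I I); exists q; split => //; rewrite qq.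
apply: leeD; apply: disjoint_integrals_le => //.
- by move=> i j ab Pi Pj; apply: inj; rewrite Pi Pj.
- by move=> i ab _; exact: bound.
- by move=> i j ab /negPf Pi /negPf Pj; apply: inj; rewrite Pi Pj.
- by move=> i ab _; exact: bound.
Qed.

End FiniteType.

Lemma entire_graph_face (R : realType) (phi : {poly {poly R}}) : harmonic_poly phi ->
  complete_finite_type_face infinity_end 1 (entire_graph phi) /\
  end_order_sum infinity_end 1 (entire_graph phi) = 2 * 1%:Z.
Proof.
move=> harm; have [h [dh gh hphi]] := harmonic_gradient harm.
have [F dF FE] := entire_potential dh hphi.
have zf := entire_graph_zmc (fun z => cder_derivable (dF z)) FE.
split; last exact: end_order_sum_entire_graph zf.
split.
- exact: one_point_compactification_compact.
- by move=> i j _; rewrite !ord1.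
- exact: zf.
- exact: entire_graph_weakly_complete zf.
- exact: (entire_graph_finite_type dh gh dF FE).
- by [].
- by move=> j _; exact: entire_graph_expanding zf.
- by move=> j; rewrite ord1.
Qed.

Theorem theorem4p10 (R : realType) :
  (forall (S : riemann_surface R) (n : nat) (p : 'I_n -> S) (k : nat)
      (f : S -> isotropic_space R),
    complete_finite_type_face p k f ->
    2 * k%:Z <= end_order_sum p k f /\
    (end_order_sum p k f = 2 * k%:Z <->
     forall j : 'I_n, embedded_end (punctured p) f (p j)))
  /\
  (forall phi : {poly {poly R}}, harmonic_poly phi ->
    complete_finite_type_face infinity_end 1 (entire_graph phi) /\
    end_order_sum infinity_end 1 (entire_graph phi) = 2 * 1%:Z).
Proof.
split=> [S n p k f cf|phi harm]; first exact: end_order_sum_ge cf.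
exact: entire_graph_face harm.
Qed.
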